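(* Consider the closed-loop system consisting of the plant $$\partial_tu=-\lambda\partial_xu+\sigma u+\omega v,\quad\partial_tv=\mu\partial_xv+\theta u,\quad u(0,t)=qv(0,t),\quad v(1,t)=\hat U(t),$$ the observer $$\begin{aligned}\partial_t\hat u&=-\lambda\partial_x\hat u+\sigma\hat u+\omega\hat v+\hat m_1(x,0)\mu(0)(v(0,t)-\hat v(0,t)),\\ \partial_t\hat v&=\mu\partial_x\hat v+\theta\hat u+\hat m_2(x,0)\mu(0)(v(0,t)-\hat v(0,t)),\end{aligned}\qquad\hat u(0,t)=qv(0,t),\quad\hat v(1,t)=\hat U(t),$$ and the neural operator approximation $\hat U(t)=\hat{\mathcal U}(\lambda,\mu,\sigma,\omega,\theta,q,\hat u(t),\hat v(t))$ of the feedback law $\int_0^1\hat k_1(1,\xi)\hat u(\xi,t)d\xi+\int_0^1\hat k_2(1,\xi)\hat v(\xi,t)d\xi$, with approximation accuracy $\epsilon$. There are positive constants $\vartheta_3(\epsilon),\vartheta_4(\epsilon),\vartheta_5$ such that, for any $\epsilon<\epsilon^*$, where $$\epsilon^*:=\frac{\sqrt{B_u^2+B_v^2+B_{\hat u}^2+B_{\hat v}^2}}{\sqrt{S_2(\epsilon)\vartheta_5}}>0,$$ and any initial data with $\|u(0)\|^2+\|v(0)\|^2+\|\hat u(0)\|^2+\|\hat v(0)\|^2\le\zeta$, where $$\zeta:=\frac{S_1(\epsilon)}{S_2(\epsilon)\vartheta_4(\epsilon)}\Big((B_u^2+B_v^2+B_{\hat u}^2+B_{\hat v}^2)-S_2(\epsilon)\vartheta_5\epsilon^2\Big)>0,$$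 the closed-loop system satisfies the semi-global practical exponential stability estimate $$\Phi_2(t)\le\frac{S_2(\epsilon)}{S_1(\epsilon)}\vartheta_4(\epsilon)e^{-\vartheta_3(\epsilon)t}\Phi_2(0)+S_2(\epsilon)\vartheta_5\epsilon^2,\qquad\forall t\ge0,$$ where $\Phi_2(t)=\|u(t)\|^2+\|v(t)\|^2+\|\hat u(t)\|^2+\|\hat v(t)\|^2$ and $$\begin{aligned}S_1(\epsilon)&=20+8(N_1e^{M_1}+\epsilon)e^{N_1e^{M_1}+\epsilon}+8(N_2e^{M_2}+\epsilon)e^{N_2e^{M_2}+\epsilon}+3(N_1e^{M_1}+N_2e^{M_2}+2\epsilon),\\S_2(\epsilon)&=20+9(N_1e^{M_1}+N_2e^{M_2}+2\epsilon)e^{N_2e^{M_2}+\epsilon}+4N_1e^{M_1}+4N_2e^{M_2}+8\epsilon.\end{aligned}$$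
   Context: Here $x\in[0,1]$, $t\ge0$, $\epsilon>0$; $\|\cdot\|$ is the $L^2[0,1]$ norm, $\|\cdot\|_\infty$ the supremum norm, $\mathcal T=\{(x,\xi):0\le\xi\le x\le1\}$. Initial data are in $L^2[0,1]$. Coefficients: $\lambda,\mu\in C^1([0,1])$, $\sigma,\omega,\theta\in C^0([0,1])$, $q\in\mathbb R$, $\lambda,\mu>0$ on $[0,1]$, all bounded above and below, with positive lower bounds $\underline\lambda,\underline\mu$ for $\lambda,\mu$; the neural operators below are trained on Lipschitz coefficients with $\|\lambda\|_\infty\le B_\lambda$, $\|\mu\|_\infty\le B_\mu$, $\|\sigma\|_\infty\le B_\sigma$, $\|\omega\|_\infty\le B_\omega$, $\|\theta\|_\infty\le B_\theta$, $\|\lambda'\|_\infty\le B_{\lambda'}$, $\|\mu'\|_\infty\le B_{\mu'}$, the $B$'s being arbitrarily large positive constants. $B_u,B_v,B_{\hat u},B_{\hat v}>0$ are the (arbitrarily large) magnitude bounds for the samples of $u,v,\hat u,\hat v$. Exact kernels: $(k_1,k_2)$ and $(m_1,m_2)$ are the unique $C^1(\mathcal T)$ solutions of $\mu(x)\partial_xk_1-\lambda(\xi)\partial_\xi k_1=\lambda'(\xi)k_1+\sigma(\xi)k_1+\theta(\xi)k_2$, $\ \mu(x)\partial_xk_2+\mu(\xi)\partial_\xi k_2=-\mu'(\xi)k_2+\omega(\xi)k_1$, $\ k_1(x,x)=-\frac{\theta(x)}{\lambda(x)+\mu(x)}$, $\ \mu(0)k_2(x,0)=q\lambda(0)k_1(x,0)$;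 $\lambda(x)\partial_xm_1-\mu(\xi)\partial_\xi m_1=\mu'(\xi)m_1+\sigma(x)m_1+\omega(x)m_2$, $\ \mu(x)\partial_xm_2+\mu(\xi)\partial_\xi m_2=-\mu'(\xi)m_2-\theta(x)m_1$, $\ m_1(x,x)=\frac{\omega(x)}{\lambda(x)+\mu(x)}$, $\ m_2(1,\xi)=0$. $N_i,M_i>0$ are constants such that $|k_i|\le N_ie^{M_i}$ and $|m_i|\le N_ie^{M_i}$ on $\mathcal T$, $i=1,2$. Also $\kappa(x,\xi)=\omega(x)k_2(x,\xi)+\int_\xi^x\kappa(x,s)k_2(s,\xi)ds$, $c(x,\xi)=\omega(x)k_1(x,\xi)+\int_\xi^x\kappa(x,s)k_1(s,\xi)ds$, and $\hat\kappa,\hat c$ are given by the same formulas with $k_i,\kappa$ replaced by the approximate kernels $\hat k_i$ and $\hat\kappa$. Approximation accuracy $\epsilon$ means that, with $\tilde k_i=k_i-\hat k_i$, $\tilde m_i=m_i-\hat m_i$, one has $\|\tilde m_i\|_\infty<\epsilon$ ($i=1,2$) and, for all $(x,\xi)\in\mathcal T$ and all Lipschitz $\hat u,\hat v$ with $\|\hat u\|_\infty\le B_{\hat u}$, $\|\hat v\|_\infty\le B_{\hat v}$, $$\begin{aligned}&|\tilde k_1|+|\tilde k_2|+|c-\hat c|+|\kappa-\hat\kappa|+|(\lambda(x)+\mu(x))\tilde k_1(x,x)|+|\lambda(0)q\tilde k_1(x,0)-\mu(0)\tilde k_2(x,0)|\\&+|-\mu(x)\partial_x\tilde k_1+\lambda(\xi)\partial_\xi\tilde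 k_1+\lambda'(\xi)\tilde k_1+\sigma(\xi)\tilde k_1+\theta(\xi)\tilde k_2|+|-\mu(x)\partial_x\tilde k_2-\mu(\xi)\partial_\xi\tilde k_2-\mu'(\xi)\tilde k_2+\omega(\xi)\tilde k_1|\\&+|\lambda(x)\partial_x\tilde m_1-\mu(\xi)\partial_\xi\tilde m_1-\mu'(\xi)\tilde m_1-\sigma(x)\tilde m_1-\omega(x)\tilde m_2|+|\mu(x)\partial_x\tilde m_2+\mu(\xi)\partial_\xi\tilde m_2+\mu'(\xi)\tilde m_2+\theta(x)\tilde m_1|\\&+\Big|\int_0^1\hat k_1(1,\xi)\hat u(\xi)d\xi+\int_0^1\hat k_2(1,\xi)\hat v(\xi)d\xi-\hat{\mathcal U}(\lambda,\mu,\sigma,\omega,\theta,q,\hat u,\hat v)\Big|<\epsilon.\end{aligned}$$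
   Formalization: It is additionally assumed that, at every time when Φ₂(t) ≤ B_u²+B_v²+B_û²+B_v̂², the neural operator approximates the feedback law within ε at the observer state (û(t),v̂(t)); accuracy on Lipschitz bounded samples alone does not give this for L² data. *)

(* Defs.v *)
From HB Require Import structures.
From mathcomp Require Import all_boot all_order all_algebra.
From mathcomp Require Import all_classical all_reals all_analysis.
Set Implicit Arguments.
Unset Strict Implicit.
Unset Printing Implicit Defensive.
Import Order.TTheory GRing.Theory Num.Theory.
Import numFieldNormedType.Exports.
Local Open Scope classical_set_scope.
Local Open Scope ring_scope.

Definition I01 (R : realType) : set R := `[0, 1].

Definition triangle (R : realType) : set (R * R) :=
  [set z | 0 <= z.2 /\ z.2 <= z.1 /\ z.1 <= 1].

Definition L2 (R : realType) (A : set R) (f : R -> R) : Prop :=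
  f \_ A \in Lfun (@lebesgue_measure R) 2%:E.

Definition L2norm (R : realType) (A : set R) (f : R -> R) : R :=
  fine ('N[@lebesgue_measure R]_2%:E [EFin \o (f \_ A)])%E.

(* [sup] of an unbounded set is 0; only used for bounded functions. *)
Definition supnorm (R : realType) (f : R -> R) : R :=
  sup [set `|f x| | x in @I01 R].

Definition supnorm2 (R : realType) (f : R -> R -> R) : R :=
  sup [set `|f z.1 z.2| | z in @triangle R].

(* C^1([0,1]): a continuous function, differentiable inside, whose derivative
   extends continuously to [0,1]; [c1_der] is that extension. *)
Record C1I (R : realType) := MkC1I {
  c1_fun :> R -> R ;
  c1_der : R -> R ;
  c1_funC : {within @I01 R, continuous c1_fun} ;
  c1_derC : {within @I01 R, continuous c1_der} ;
  c1_derP : forall x : R, 0 < x < 1 -> is_derive x 1 c1_fun (c1_der x) }.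

(* C^1 of the closed triangle 0 <= xi <= x <= 1, in the same sense; [dx] and
   [dxi] are the continuous extensions of the partial derivatives. *)
Record C1T (R : realType) := MkC1T {
  c1t_fun :> R -> R -> R ;
  dx : R -> R -> R ;
  dxi : R -> R -> R ;
  c1t_funC : {within @triangle R, continuous (fun z => c1t_fun z.1 z.2)} ;
  c1t_dxC : {within @triangle R, continuous (fun z => dx z.1 z.2)} ;
  c1t_dxiC : {within @triangle R, continuous (fun z => dxi z.1 z.2)} ;
  c1t_dxP : forall x xi : R, 0 < xi < x -> x < 1 ->
    is_derive x 1 (fun y => c1t_fun y xi) (dx x xi) ;
  c1t_dxiP : forall x xi : R, 0 < xi < x -> x < 1 ->
    is_derive xi 1 (fun y => c1t_fun x y) (dxi x xi) }.

Record plant (R : realType) := Plant {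
  lam : C1I R ; mu : C1I R ;
  sig : R -> R ; om : R -> R ; th : R -> R ;
  q : R }.

Definition admissible (R : realType) (P : plant R) (lam_lo mu_lo : R) : Prop :=
  [/\ {within @I01 R, continuous (sig P)},
      {within @I01 R, continuous (om P)},
      {within @I01 R, continuous (th P)},
      0 < lam_lo /\ (forall x, @I01 R x -> lam_lo <= lam P x) &
      0 < mu_lo /\ (forall x, @I01 R x -> mu_lo <= mu P x)].

Record bounds (R : realType) := Bounds {
  B_lam : R ; B_mu : R ; B_sig : R ; B_om : R ; B_th : R ;
  B_lam' : R ; B_mu' : R ;
  B_u : R ; B_v : R ; B_uh : R ; B_vh : R }.

Definition bounds_pos (R : realType) (B : bounds R) : Prop :=
  [/\ [/\ 0 < B_lam B, 0 < B_mu B, 0 < B_sig B, 0 < B_om B & 0 < B_th B],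
      0 < B_lam' B /\ 0 < B_mu' B &
      [/\ 0 < B_u B, 0 < B_v B, 0 < B_uh B & 0 < B_vh B]].

Definition lip01 (R : realType) (f : R -> R) : Prop :=
  [lipschitz (f : R^o -> R^o) x | x in @I01 R].

Definition coef_sample (R : realType) (B : bounds R) (P : plant R) : Prop :=
  [/\ [/\ lip01 (lam P), lip01 (mu P), lip01 (sig P), lip01 (om P)
        & lip01 (th P)],
      [/\ supnorm (lam P) <= B_lam B, supnorm (mu P) <= B_mu B,
          supnorm (sig P) <= B_sig B, supnorm (om P) <= B_om B
        & supnorm (th P) <= B_th B],
      supnorm (c1_der (lam P)) <= B_lam' B
    & supnorm (c1_der (mu P)) <= B_mu' B].

Definition state_sample (R : realType) (B : bounds R) (uh vh : R -> R) : Prop :=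
  [/\ lip01 uh, lip01 vh, supnorm uh <= B_uh B & supnorm vh <= B_vh B].

Definition control_kernels (R : realType) (P : plant R) (k1 k2 : C1T R) : Prop :=
  [/\ forall x xi, @triangle R (x, xi) ->
        mu P x * dx k1 x xi - lam P xi * dxi k1 x xi
        = c1_der (lam P) xi * k1 x xi + sig P xi * k1 x xi
          + th P xi * k2 x xi,
      forall x xi, @triangle R (x, xi) ->
        mu P x * dx k2 x xi + mu P xi * dxi k2 x xi
        = - (c1_der (mu P) xi * k2 x xi) + om P xi * k1 x xi,
      forall x, @I01 R x -> k1 x x = - (th P x / (lam P x + mu P x)) &
      forall x, @I01 R x -> mu P 0 * k2 x 0 = q P * lam P 0 * k1 x 0].

Definition observer_kernels (R : realType) (P : plant R) (m1 m2 : C1T R) : Prop :=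
  [/\ forall x xi, @triangle R (x, xi) ->
        lam P x * dx m1 x xi - mu P xi * dxi m1 x xi
        = c1_der (mu P) xi * m1 x xi + sig P x * m1 x xi + om P x * m2 x xi,
      forall x xi, @triangle R (x, xi) ->
        mu P x * dx m2 x xi + mu P xi * dxi m2 x xi
        = - (c1_der (mu P) xi * m2 x xi) - th P x * m1 x xi,
      forall x, @I01 R x -> m1 x x = om P x / (lam P x + mu P x) &
      forall xi, @I01 R xi -> m2 1 xi = 0].

Definition kernel_bound (R : realType) (N M : R) (k : C1T R) : Prop :=
  forall x xi, @triangle R (x, xi) -> `|k x xi| <= N * expR M.

(* [kap] is the continuous solution of the Volterra equation with kernel k2. *)
Definition is_kappa (R : realType) (P : plant R) (k2 : C1T R)
    (kap : R -> R -> R) : Prop :=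
  {within @triangle R, continuous (fun z => kap z.1 z.2)} /\
  forall x xi, @triangle R (x, xi) ->
    kap x xi = om P x * k2 x xi
      + \int[@lebesgue_measure R]_(s in `[xi, x]) (kap x s * k2 s xi).

Definition ckernel (R : realType) (P : plant R) (k1 : C1T R)
    (kap : R -> R -> R) (x xi : R) : R :=
  om P x * k1 x xi
  + \int[@lebesgue_measure R]_(s in `[xi, x]) (kap x s * k1 s xi).

(* An operator (lambda, mu, sigma, omega, theta, q, uh, vh) |-> control. *)
Definition control_operator (R : realType) :=
  (R -> R) -> (R -> R) -> (R -> R) -> (R -> R) -> (R -> R) -> R ->
  (R -> R) -> (R -> R) -> R.

Definition control (R : realType) (P : plant R) (U : control_operator R)
    (uh vh : R -> R) : R :=
  U (lam P) (mu P) (sig P) (om P) (th P) (q P) uh vh.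

Definition feedback (R : realType) (k1h k2h : C1T R) (uh vh : R -> R) : R :=
  \int[@lebesgue_measure R]_(xi in `[0, 1]) (k1h 1 xi * uh xi)
  + \int[@lebesgue_measure R]_(xi in `[0, 1]) (k2h 1 xi * vh xi).

Definition control_error (R : realType) (P : plant R) (k1h k2h : C1T R)
    (U : control_operator R) (uh vh : R -> R) : R :=
  `|feedback k1h k2h uh vh - control P U uh vh|.

Definition kernel_error (R : realType) (P : plant R)
    (k1 k2 m1 m2 : C1T R) (kap : R -> R -> R)
    (k1h k2h m1h m2h : C1T R) (kaph : R -> R -> R) (x xi : R) : R :=
  let k1t y z := k1 y z - k1h y z in
  let k2t y z := k2 y z - k2h y z in
  let m1t y z := m1 y z - m1h y z in
  let m2t y z := m2 y z - m2h y z in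
  let k1t_x := dx k1 x xi - dx k1h x xi in
  let k1t_xi := dxi k1 x xi - dxi k1h x xi in
  let k2t_x := dx k2 x xi - dx k2h x xi in
  let k2t_xi := dxi k2 x xi - dxi k2h x xi in
  let m1t_x := dx m1 x xi - dx m1h x xi in
  let m1t_xi := dxi m1 x xi - dxi m1h x xi in
  let m2t_x := dx m2 x xi - dx m2h x xi in
  let m2t_xi := dxi m2 x xi - dxi m2h x xi in
  let lam' := c1_der (lam P) xi in
  let mu' := c1_der (mu P) xi in
  `|k1t x xi| + `|k2t x xi|
  + `|ckernel P k1 kap x xi - ckernel P k1h kaph x xi|
  + `|kap x xi - kaph x xi|
  + `|(lam P x + mu P x) * k1t x x|
  + `|lam P 0 * q P * k1t x 0 - mu P 0 * k2t x 0|
  + `|- (mu P x * k1t_x) + lam P xi * k1t_xi + lam' * k1t x xi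
      + sig P xi * k1t x xi + th P xi * k2t x xi|
  + `|- (mu P x * k2t_x) - mu P xi * k2t_xi - mu' * k2t x xi
      + om P xi * k1t x xi|
  + `|lam P x * m1t_x - mu P xi * m1t_xi - mu' * m1t x xi
      - sig P x * m1t x xi - om P x * m2t x xi|
  + `|mu P x * m2t_x + mu P xi * m2t_xi + mu' * m2t x xi
      + th P x * m1t x xi|.

Definition accuracy (R : realType) (B : bounds R) (P : plant R)
    (k1 k2 m1 m2 : C1T R) (kap : R -> R -> R)
    (k1h k2h m1h m2h : C1T R) (kaph : R -> R -> R)
    (U : control_operator R) (eps : R) : Prop :=
  [/\ supnorm2 (fun x xi => m1 x xi - m1h x xi) < eps,
      supnorm2 (fun x xi => m2 x xi - m2h x xi) < eps &
      forall x xi uh vh, @triangle R (x, xi) -> state_sample B uh vh ->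
        kernel_error P k1 k2 m1 m2 kap k1h k2h m1h m2h kaph x xi
        + control_error P k1h k2h U uh vh < eps].

(* C([0,oo); L^2[0,1]); states are functions of (t, x), in this order. *)
Definition CL2 (R : realType) (w : R -> R -> R) : Prop :=
  (forall t, 0 <= t -> L2 (@I01 R) (w t)) /\
  (forall t0, 0 <= t0 ->
    L2norm (@I01 R) (fun x => w t x - w t0 x)
      @[t --> within `[0, +oo[%classic (nbhs t0)] --> (0 : R)).

Definition L2loc (R : realType) (g : R -> R) : Prop :=
  forall T, 0 <= T -> L2 `[0, T]%classic g.

(* Weak form of  w_t = - a w_x + f,  w(t, 0) = g(t),  with initial value w 0.
   The test functions vanish at the outflow boundary x = 1. *)
Definition weak_rightward (R : realType) (a : C1I R) (w f : R -> R -> R)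
    (g : R -> R) : Prop :=
  forall (phi : C1I R) (t : R), phi 1 = 0 -> 0 <= t ->
    \int[@lebesgue_measure R]_(x in `[0, 1]) (w t x * phi x)
    = \int[@lebesgue_measure R]_(x in `[0, 1]) (w 0 x * phi x)
      + \int[@lebesgue_measure R]_(s in `[0, t])
          (a 0 * g s * phi 0
           + \int[@lebesgue_measure R]_(x in `[0, 1])
               (w s x * (c1_der a x * phi x + a x * c1_der phi x)
                + f s x * phi x)).

(* Weak form of  w_t = a w_x + f,  w(t, 1) = g(t),  with initial value w 0 and
   outflow trace y(t) = w(t, 0).  The test functions are free at both ends, so
   that y is determined by w, almost everywhere. *)
Definition weak_leftward (R : realType) (a : C1I R) (w f : R -> R -> R)
    (g y : R -> R) : Prop :=
  forall (psi : C1I R) (t : R), 0 <= t ->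
    \int[@lebesgue_measure R]_(x in `[0, 1]) (w t x * psi x)
    = \int[@lebesgue_measure R]_(x in `[0, 1]) (w 0 x * psi x)
      + \int[@lebesgue_measure R]_(s in `[0, t])
          (a 1 * g s * psi 1 - a 0 * y s * psi 0
           + \int[@lebesgue_measure R]_(x in `[0, 1])
               (- (w s x * (c1_der a x * psi x + a x * c1_der psi x))
                + f s x * psi x)).

(* Weak L^2 solutions of the closed loop; y and yh are the traces v(., 0) and
   vh(., 0), and Uh is the control signal. *)
Definition closed_loop (R : realType) (P : plant R) (m1h m2h : C1T R)
    (U : control_operator R) (u v uh vh : R -> R -> R) : Prop :=
  let Uh t := control P U (uh t) (vh t) in
  [/\ CL2 u, CL2 v, CL2 uh & CL2 vh] /\
  exists y yh : R -> R,
    [/\ L2loc y, L2loc yh & L2loc Uh] /\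
    [/\ weak_rightward (lam P) u
          (fun t x => sig P x * u t x + om P x * v t x)
          (fun t => q P * y t),
        weak_leftward (mu P) v
          (fun t x => th P x * u t x)
          Uh y,
        weak_rightward (lam P) uh
          (fun t x => sig P x * uh t x + om P x * vh t x
             + m1h x 0 * mu P 0 * (y t - yh t))
          (fun t => q P * y t) &
        weak_leftward (mu P) vh
          (fun t x => th P x * uh t x + m2h x 0 * mu P 0 * (y t - yh t))
          Uh yh].

Definition Phi2 (R : realType) (u v uh vh : R -> R -> R) (t : R) : R :=
  L2norm (@I01 R) (u t) ^+ 2 + L2norm (@I01 R) (v t) ^+ 2
  + L2norm (@I01 R) (uh t) ^+ 2 + L2norm (@I01 R) (vh t) ^+ 2.

Definition range2 (R : realType) (B : bounds R) : R :=
  B_u B ^+ 2 + B_v B ^+ 2 + B_uh B ^+ 2 + B_vh B ^+ 2.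

(* [accuracy] controls the operator only at Lipschitz states that are bounded
   in sup norm, which no L^2 bound on the state can guarantee.  This says that
   the accuracy eps is available at the observer states met by the trajectory
   within the L^2 range of the samples; given [accuracy], it holds as soon as
   these observer states satisfy [state_sample]. *)
Definition accurate_in_range (R : realType) (B : bounds R) (P : plant R)
    (k1h k2h : C1T R) (U : control_operator R) (eps : R)
    (u v uh vh : R -> R -> R) : Prop :=
  forall t, 0 <= t -> Phi2 u v uh vh t <= range2 B ->
    control_error P k1h k2h U (uh t) (vh t) < eps.

Definition S1 (R : realType) (N1 N2 M1 M2 eps : R) : R :=
  let a1 := N1 * expR M1 in
  let a2 := N2 * expR M2 in
  20 + 8 * (a1 + eps) * expR (a1 + eps) + 8 * (a2 + eps) * expR (a2 + eps)
  + 3 * (a1 + a2 + 2 * eps).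

Definition S2 (R : realType) (N1 N2 M1 M2 eps : R) : R :=
  let a1 := N1 * expR M1 in
  let a2 := N2 * expR M2 in
  20 + 9 * (a1 + a2 + 2 * eps) * expR (a2 + eps) + 4 * a1 + 4 * a2 + 8 * eps.

Definition eps_star (R : realType) (B : bounds R) (s2 th5 : R) : R :=
  Num.sqrt (range2 B) / Num.sqrt (s2 * th5).

Definition zeta (R : realType) (B : bounds R) (s1 s2 th4 th5 eps : R) : R :=
  s1 / (s2 * th4) * (range2 B - s2 * th5 * eps ^+ 2).

(* Main.v *)
Require Import Defs.
From HB Require Import structures.
From mathcomp Require Import all_boot all_order all_algebra.
From mathcomp Require Import all_classical all_reals all_analysis.
From mathcomp Require Import measurable_realfun lebesgue_integral_differentiation.
From mathcomp Require Import ring lra.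
Set Implicit Arguments.
Unset Strict Implicit.
Unset Printing Implicit Defensive.
Import Order.TTheory GRing.Theory Num.Theory.
Import numFieldNormedType.Exports.
Local Open Scope classical_set_scope.
Local Open Scope ring_scope.

(** Why the estimate holds.

    The constant theta5 is free.  Since S2 >= 20, taking theta5 above
    range2 / eps0^2 makes eps < eps_star imply eps <= eps0, for any eps0 that
    depends on the plant and on the exact kernels only: small eps suffice.
    With theta4 = 2 K S1 / S2, zeta becomes
    (range2 - S2 theta5 eps^2) / (2 K), and what remains is
      Phi2 T <= K e^(-c T) Phi2 0 + D eps^2                         [decay]
    as long as Phi2 stays below range2 on [0, T]; by that same inequality the
    continuous function Phi2 cannot leave this range [stays_below].

    To prove [decay], the state is transformed by the exact kernels, the
    approximate ones being small perturbations.  With the Volterra operators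
    V k f (x) = int_0^x k(x, s) f(s) ds, put
      z = v - V k1 u - V k2 v,
      beta + V m2 beta = v - vh,       alpha = u - uh - V m1 beta.
    The kernel equations turn the closed loop into four transport equations:
    z moves leftward without source, with the control mismatch
    g = Uh - int k1(1, .) u - int k2(1, .) v as inflow and y = v(., 0) as
    outflow trace [target_weak]; u moves rightward with inflow q y; beta moves
    leftward and alpha rightward, without inflow, their sources being bounded
    by alpha and by eps times the trace y - yh of beta
    [beta_weak, alpha_weak].  For weak solutions this is an identity on test
    functions: they are transformed by the adjoint operators Vs, and the kernel
    equations say which transport operator acts on the result.

    Each transport equation has an energy E(w) = int e^(gam h) w^2 / a, where h
    is the travel time to the outflow boundary.  It decreases at any
    prescribed rate, up to inflow and source, and moreover releases the square
    of the outflow trace [energy].  An L^2 solution cannot be multiplied by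
    itself, so the inequality is obtained by duality: the
    functions chi (h(x) + t) / a solve the adjoint equation, testing against
    them gives an identity that needs no derivative of chi [identity], and chi
    is then taken close to the best one, by density [short].  The resulting
    inequality is exact to first order in the length of the time interval, and
    it is integrated by a straddle argument [local_to_global].

    The Lyapunov functional is E_u + A1 E_z + A2 (E_beta + B E_alpha).  The
    trace y^2 released by z pays for the inflow q y of u, the one released by
    beta pays for the terms in eps (y - yh), and a large rate for the rightward
    equations absorbs the couplings of order zero.  This is not circular,
    because the weights of the rightward equations are nonincreasing in x up to
    a factor that ignores the rate, so that Volterra operators are bounded
    uniformly in the rate [Wn_volterra, weights_comparable].  Last, g is bounded
    by eps, by eps times the state and by alpha and beta [inflow_bound]; A2 is
    chosen after A1 to absorb the latter [lyapunov_rate]. *)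

(** * Integrals on segments *)

Notation leb := (@lebesgue_measure _).
Notation Int a b f := (Rintegral (@lebesgue_measure _) `[a, b]%classic f).

Definition itg (R : realType) (a b : R) (f : R -> R) : Prop :=
  (@lebesgue_measure R).-integrable `[a, b] (EFin \o f).

Section interval_integral.
Variable R : realType.
Implicit Types (a b c k : R) (f g : R -> R).

Lemma itgP a b f : itg a b f -> measurable_fun `[a, b] f.
Proof. by case/integrableP => /measurable_EFinP. Qed.

Lemma itg_within a b f : {within `[a, b], continuous f} -> itg a b f.
Proof.
by move=> cf; apply: continuous_compact_integrable => //; exact: segment_compact.
Qed.

Lemma itg_cont a b f : continuous f -> itg a b f.
Proof. by move=> cf; apply: itg_within; exact: continuous_subspaceT. Qed.

Lemma itg_eq a b f g : (forall x, a <= x <= b -> f x = g x) ->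
  itg a b f -> itg a b g.
Proof.
move=> fg; apply: eq_integrable => // x; rewrite inE/= in_itv/= => xab.
by rewrite /= fg.
Qed.

Lemma itgD a b f g : itg a b f -> itg a b g -> itg a b (fun x => f x + g x).
Proof. by move=> fi gi; exact: (integrableD _ fi gi). Qed.

Lemma itgB a b f g : itg a b f -> itg a b g -> itg a b (fun x => f x - g x).
Proof. by move=> fi gi; exact: (integrableB _ fi gi). Qed.

Lemma itgZ a b k f : itg a b f -> itg a b (fun x => k * f x).
Proof. by move=> fi; exact: (integrableZl _ k fi). Qed.

Lemma itgZr a b k f : itg a b f -> itg a b (fun x => f x * k).
Proof. by move=> /(itgZ k); apply: itg_eq => x _; rewrite mulrC. Qed.

Lemma itgN a b f : itg a b f -> itg a b (fun x => - f x).
Proof. by move=> /(itgZ (-1)); apply: itg_eq => x _; rewrite mulN1r. Qed.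

Lemma itg_norm a b f : itg a b f -> itg a b (fun x => `|f x|).
Proof. by move=> fi; exact: (integrable_norm fi). Qed.

Lemma itg_cst a b k : itg a b (fun=> k).
Proof. by apply: itg_cont => x; exact: cvg_cst. Qed.

Lemma itg_le a b f g : measurable_fun `[a, b] f -> itg a b g ->
  (forall x, a <= x <= b -> `|f x| <= g x) -> itg a b f.
Proof.
move=> mf gi fg; apply: le_integrable gi => //; first exact/measurable_EFinP.
move=> x /=; rewrite in_itv/= => xab; rewrite lee_fin.
by rewrite (le_trans (fg _ xab))// ler_norm.
Qed.

Lemma itg_sub a b c d f : a <= c -> d <= b -> itg a b f -> itg c d f.
Proof.
by move=> ac db; apply: integrableS => //; apply: subset_itv; rewrite bnd_simp.
Qed.

Lemma eq_Int a b f g : (forall x, a <= x <= b -> f x = g x) ->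
  Int a b f = Int a b g.
Proof.
by move=> fg; apply: eq_Rintegral => x; rewrite inE/= in_itv/= => /fg.
Qed.

Lemma IntD a b f g : itg a b f -> itg a b g ->
  Int a b (fun x => f x + g x) = Int a b f + Int a b g.
Proof. by move=> fi gi; apply: RintegralD. Qed.

Lemma IntB a b f g : itg a b f -> itg a b g ->
  Int a b (fun x => f x - g x) = Int a b f - Int a b g.
Proof. by move=> fi gi; apply: RintegralB. Qed.

Lemma IntZ a b k f : itg a b f -> Int a b (fun x => k * f x) = k * Int a b f.
Proof. by move=> fi; apply: RintegralZl. Qed.

Lemma IntZr a b k f : itg a b f -> Int a b (fun x => f x * k) = Int a b f * k.
Proof. by move=> fi; apply: RintegralZr. Qed.

Lemma IntN a b f : itg a b f -> Int a b (fun x => - f x) = - Int a b f.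
Proof.
move=> fi; rewrite -mulN1r -IntZ//; apply: eq_Int => x _.
by rewrite mulN1r.
Qed.

Lemma Int_le a b f g : itg a b f -> itg a b g ->
  (forall x, a <= x <= b -> f x <= g x) -> Int a b f <= Int a b g.
Proof.
by move=> fi gi fg; apply: le_Rintegral => // x; rewrite /= in_itv/= => /fg.
Qed.

Lemma Int_ge0 a b f : (forall x, a <= x <= b -> 0 <= f x) -> 0 <= Int a b f.
Proof. by move=> f0; apply: Rintegral_ge0 => x /=; rewrite in_itv/= => /f0. Qed.

Lemma Int_norm a b f : itg a b f -> `|Int a b f| <= Int a b (fun x => `|f x|).
Proof. by move=> fi; apply: le_normr_Rintegral. Qed.

Lemma Int_cst a b k : a <= b -> Int a b (fun=> k) = k * (b - a).
Proof.
move=> ab; rewrite Rintegral_cst//= lebesgue_measure_itv/= lte_fin.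
by move: ab; rewrite le_eqVlt => /predU1P[->|->//]; rewrite ltxx subrr.
Qed.

Lemma Int_empty a b f : b < a -> Int a b f = 0.
Proof. by move=> ba; rewrite set_itv_ge ?Rintegral_set0// bnd_simp -ltNge. Qed.

Lemma Int_point a f : Int a a f = 0.
Proof. by rewrite set_itv1 Rintegral_set1. Qed.

Lemma Int_cat a b c f : a <= b -> b <= c -> itg a c f ->
  Int a c f = Int a b f + Int b c f.
Proof.
move=> ab bc fi; apply/eqP; rewrite addrC -subr_eq; apply/eqP.
rewrite (@Rintegral_itvB _ f (BLeft a) (BRight c) b) ?bnd_simp//.
apply: Rintegral_itv_obnd_cbnd.
by apply: integrableS fi => //; apply: subset_itv; rewrite bnd_simp.
Qed.

Lemma Int_bound a b f k : a <= b -> itg a b f ->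
  (forall x, a <= x <= b -> `|f x| <= k) -> `|Int a b f| <= k * (b - a).
Proof.
move=> ab fi fk; rewrite (le_trans (Int_norm fi))// -Int_cst//.
by apply: Int_le => //; [exact: itg_norm|exact: itg_cst].
Qed.

Lemma Int_le_set a b c d f : a <= c -> c <= d -> d <= b -> itg a b f ->
  (forall x, a <= x <= b -> 0 <= f x) -> Int c d f <= Int a b f.
Proof.
move=> ac cd db fi f0.
rewrite (@Int_cat a c b)// ?(le_trans cd)// (@Int_cat c d b)//; last first.
  exact: itg_sub fi.
have h1 : 0 <= Int a c f.
  by apply: Int_ge0 => x /andP[ax xc]; apply: f0; rewrite ax; lra.
have h2 : 0 <= Int d b f.
  by apply: Int_ge0 => x /andP[ax xc]; apply: f0; rewrite xc andbT; lra.
lra.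
Qed.

End interval_integral.

(** * Square integrable functions on a segment *)

Definition sqi (R : realType) (a b : R) (f : R -> R) : Prop :=
  measurable_fun `[a, b] f /\ itg a b (fun x => f x ^+ 2).

Section square_integrable.
Variable R : realType.
Implicit Types (a b c k : R) (f g : R -> R).

Lemma within_bounded a b f : {within `[a, b], continuous f} ->
  exists2 C, 0 <= C & forall x, a <= x <= b -> `|f x| <= C.
Proof.
move=> cf; have /compact_bounded[M [_ Mf]] :=
  continuous_compact cf (@segment_compact _ a b).
exists (`|M| + 1) => [|x xab]; first by rewrite addr_ge0.
apply: (Mf (`|M| + 1)); first by rewrite ltr_pwDr// ler_norm.
by exists x.
Qed.

Lemma within_measurable a b f :
  {within `[a, b], continuous f} -> measurable_fun `[a, b] f.
Proof. by move=> /itg_within/itgP. Qed.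

Lemma sqi_sub a b c d f : a <= c -> d <= b -> sqi a b f -> sqi c d f.
Proof.
move=> ac db [mf fi]; split; last exact: itg_sub fi.
by apply: measurable_funS mf => //; apply: subset_itv; rewrite bnd_simp.
Qed.

Lemma sqi_eq a b f g : (forall x, a <= x <= b -> f x = g x) ->
  sqi a b f -> sqi a b g.
Proof.
move=> fg [mf fi]; split; last by apply: itg_eq fi => x /fg ->.
apply: eq_measurable_fun mf => x; rewrite inE/= in_itv/=; exact: fg.
Qed.

Lemma sqi_mul a b f g : sqi a b f -> sqi a b g -> itg a b (fun x => f x * g x).
Proof.
move=> [mf fi] [mg gi].
apply: (@itg_le _ _ _ _ (fun x => f x ^+ 2 + g x ^+ 2)).
- exact: measurable_funM.
- exact: itgD.
move=> x _; rewrite normrM -(real_normK (num_real (f x))) -(real_normK (num_real (g x))).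
nra.
Qed.

Lemma sqi_cont a b f : {within `[a, b], continuous f} -> sqi a b f.
Proof.
move=> cf; split; first exact: within_measurable.
apply: itg_within => x; apply: (@continuousM _ (subspace _)); exact: cf.
Qed.

Lemma sqi_itg a b f : sqi a b f -> itg a b f.
Proof.
move=> fi; have /(sqi_mul fi) : sqi a b (cst 1).
  by apply: sqi_cont => x; exact: cvg_cst.
by apply: itg_eq => x _ /=; rewrite mulr1.
Qed.

Lemma sqiZ a b k f : sqi a b f -> sqi a b (fun x => k * f x).
Proof.
move=> [mf fi]; split; first exact: measurable_funM.
by apply: itg_eq (itgZ (k ^+ 2) fi) => x _; rewrite exprMn.
Qed.

Lemma sqiD a b f g : sqi a b f -> sqi a b g -> sqi a b (fun x => f x + g x).
Proof.
move=> fs gs; have fg := sqi_mul fs gs; case: fs gs => [mf fi] [mg gi].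
split; first exact: measurable_funD.
apply: itg_eq (itgD (itgD fi (itgZ 2 fg)) gi) => x _.
by rewrite sqrrD mulr_natl.
Qed.

Lemma sqiN a b f : sqi a b f -> sqi a b (fun x => - f x).
Proof. by move=> /(sqiZ (-1)); apply: sqi_eq => x _; rewrite mulN1r. Qed.

Lemma sqiB a b f g : sqi a b f -> sqi a b g -> sqi a b (fun x => f x - g x).
Proof. by move=> fs /sqiN; exact: sqiD. Qed.

Lemma sqi_bM a b f g k : measurable_fun `[a, b] g ->
  (forall x, a <= x <= b -> `|g x| <= k) ->
  sqi a b f -> sqi a b (fun x => g x * f x).
Proof.
move=> mg gk [mf fi]; split; first exact: measurable_funM.
apply: itg_le (itgZ (k ^+ 2) fi) _.
  by apply: measurable_funX; exact: measurable_funM.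
move=> x xab; rewrite normrX normrM exprMn (real_normK (num_real (f x))).
by rewrite ler_wpM2r ?sqr_ge0// lerXn2r ?nnegrE ?gk// (le_trans _ (gk _ xab)).
Qed.

Lemma sqi_cM a b f g : {within `[a, b], continuous g} ->
  sqi a b f -> sqi a b (fun x => g x * f x).
Proof.
move=> cg; have [C _ gC] := within_bounded cg.
by apply: sqi_bM gC; exact: within_measurable.
Qed.

Lemma sqi_norm a b f : sqi a b f -> sqi a b (fun x => `|f x|).
Proof.
move=> [mf fi]; split; first exact: measurableT_comp.
by apply: itg_eq fi => x _; rewrite real_normK ?num_real.
Qed.

Lemma itg_cM a b f g : {within `[a, b], continuous g} ->
  itg a b f -> itg a b (fun x => g x * f x).
Proof.
move=> cg fi; have [C _ gC] := within_bounded cg.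
apply: (@itg_le _ _ _ _ (fun x => C * `|f x|)).
- apply: measurable_funM; [exact: within_measurable|exact: itgP].
- exact/itgZ/itg_norm.
- by move=> x xab; rewrite normrM ler_wpM2r// gC.
Qed.

Lemma itg_cMr a b f g : {within `[a, b], continuous g} ->
  itg a b f -> itg a b (fun x => f x * g x).
Proof. by move=> cg /(itg_cM cg); apply: itg_eq => x _; rewrite mulrC. Qed.

(** The discriminant of a nonnegative quadratic: the common core of the two
    forms of the Cauchy-Schwarz inequality. *)
Lemma discr_le (A B C : R) : 0 <= C ->
  (forall s, 0 <= A + 2 * s * B + s ^+ 2 * C) -> B ^+ 2 <= A * C.
Proof.
rewrite le_eqVlt => /predU1P[<-|C0] H.
  rewrite mulr0; have [->|B0] := eqVneq B 0; first by rewrite expr0n.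
  have := H (- (A + 1) / (2 * B)); rewrite mulr0 addr0.
  have -> : 2 * (- (A + 1) / (2 * B)) * B = - (A + 1) by field.
  lra.
have := H (- B / C).
have -> : A + 2 * (- B / C) * B + (- B / C) ^+ 2 * C = (A * C - B ^+ 2) / C.
  by field; rewrite gt_eqF.
by rewrite pmulr_lge0 ?invr_gt0// subr_ge0.
Qed.

Lemma cauchy_schwarz a b f g : sqi a b f -> sqi a b g ->
  Int a b (fun x => f x * g x) ^+ 2 <=
  Int a b (fun x => f x ^+ 2) * Int a b (fun x => g x ^+ 2).
Proof.
move=> fs gs; apply: discr_le => [|s]; first by apply: Int_ge0 => x _; exact: sqr_ge0.
have fg := sqi_mul fs gs; case: fs gs => [_ fi] [_ gi].
have fg2 := itgZ (2 * s) fg; have gi2 := itgZ (s ^+ 2) gi.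
rewrite -!IntZ// -!IntD//; last exact: itgD.
apply: Int_ge0 => x _.
have -> : f x ^+ 2 + 2 * s * (f x * g x) + s ^+ 2 * g x ^+ 2 = (f x + s * g x) ^+ 2 by ring.
exact: sqr_ge0.
Qed.

Lemma sqi_restrict a b f : sqi a b f <->
  measurable_fun setT (f \_ `[a, b]) /\
  leb.-integrable setT (EFin \o (fun x => (f \_ `[a, b]) x ^+ 2)).
Proof.
have E : EFin \o (fun x => (f \_ `[a, b]) x ^+ 2) =
    (EFin \o (fun x => f x ^+ 2)) \_ `[a, b].
  by apply/funext => x /=; rewrite /patch; case: ifP => //= _; rewrite expr0n.
rewrite E /sqi /itg; split=> -[H1 H2]; split.
- by apply/(measurable_restrictT _ _).1.
- by apply/(integrable_mkcond _ _).1.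
- by apply/(measurable_restrictT _ _).2.
- by apply/(integrable_mkcond _ _).2.
Qed.

Lemma L2_sqi a b f : L2 `[a, b] f <-> sqi a b f.
Proof.
rewrite sqi_restrict /L2; split=> [fL|[mf fi]].
  split; last exact: Lfun2_integrable_sqr.
  by move: fL; rewrite inE/= => /andP[]; rewrite inE.
rewrite inE/=; apply/andP; rewrite !inE/=; split=> //.
rewrite /finite_norm unlock /= poweR_lty//.
case/integrableP: fi => _; apply: le_lt_trans.
apply: ge0_le_integral => //.
- by apply/measurable_EFinP; apply: (@measurableT_comp _ _ _ _ _ _ (fun x => x `^ 2)) => //; exact: measurableT_comp.
- do 2 apply: measurableT_comp => //; apply: measurable_funX; exact: mf.
by move=> x _; rewrite lee_fin powR_mulrn// normrX.
Qed.

Lemma L2norm_sqi a b f : L2norm `[a, b] f ^+ 2 = Int a b (fun x => f x ^+ 2).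
Proof.
rewrite /L2norm unlock.
have -> : (\int[leb]_x `|(EFin \o (f \_ `[a, b])) x| `^ 2 = \int[leb]_(x in `[a, b]) (f x ^+ 2)%:E)%E.
  rewrite [RHS]integral_mkcond; apply: eq_integral => x _.
  rewrite /= /patch; case: ifP => _ /=; last by rewrite normr0 powR0.
  by rewrite powR_mulrn// real_normK// num_real.
rewrite /Rintegral; set X := integral _ _ _.
have X0 : (0 <= X)%E by apply: integral_ge0 => x _; rewrite lee_fin sqr_ge0.
case: X X0 => [r| |] //=; rewrite ?lee_fin => r0.
  by rewrite -powR_mulrn ?powR_ge0// -powRrM mulVf// powRr1.
by rewrite invr_eq0 pnatr_eq0/= expr0n.
Qed.

End square_integrable.

(** * Integration of local inequalities, continuous curves *)

Section straddle.
Variable R : realType.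
Implicit Types (F G V X : R -> R) (a b c e k s t r : R).

(** Otherwise the supremum of the times up to which the inequality between
    increments holds could be passed.  Only intervals that straddle a point are
    required, because a first order expansion at t0 controls
    nothing on intervals that avoid t0. *)
Lemma local_to_global (Psi M : R -> R) (a b : R) : a <= b ->
  (forall t0, a <= t0 <= b -> exists2 tau, 0 < tau &
    forall s t, a <= s <= t0 -> t0 <= t <= b -> t0 - tau < s -> t < t0 + tau ->
      Psi t - Psi s <= M t - M s) ->
  Psi b - Psi a <= M b - M a.
Proof.
move=> ab loc.
pose S := [set t | a <= t <= b /\ Psi t - Psi a <= M t - M a].
have Sa : S a by split; [rewrite lexx|rewrite !subrr].
have hS : has_sup S.
  by split; [exists a|exists b => t [/andP[_ tb] _]].
have sab : a <= sup S <= b.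
  apply/andP; split; first by apply: (sup_upper_bound hS) => //; exact: hS.
  by apply: ge_sup; [exists a|move=> t [/andP[_ tb] _]].
have [tau tau0 H] := loc _ sab.
have Ssup : S (sup S).
  split=> //.
  have [s [sab' Ps] st] := sup_adherent tau0 hS.
  have ssup : s <= sup S by apply: (sup_upper_bound hS); split.
  have := H s (sup S).
  move: sab' sab => /andP[-> sb] /andP[aS ->]; rewrite ssup lexx st ltrDl tau0.
  by move=> /(_ erefl erefl erefl erefl); lra.
have [supb|bsup] := ltP (sup S) b; last first.
  have -> : b = sup S by apply/eqP; rewrite eq_le bsup; case/andP: sab => _ ->.
  by case: Ssup.
exfalso.
pose t := Num.min b (sup S + tau / 2).
have tsup : sup S < t by rewrite lt_min supb ltrDl divr_gt0.
have tb : t <= b by rewrite ge_min lexx.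
have tt : t < sup S + tau by rewrite gt_min ltrD2l; apply/orP; right; lra.
suff St : S t by have := sup_upper_bound hS St; lra.
split; first by case/andP: sab => aS _; rewrite tb andbT; lra.
have := H (sup S) t; case/andP: sab => -> _; rewrite lexx tb (ltW tsup) tt.
rewrite ltrBlDr ltrDl tau0 => /(_ erefl erefl erefl erefl).
by case: Ssup => _; lra.
Qed.

Lemma near_window (t0 d d' s t r : R) : d <= d' -> 0 <= s -> t0 - d < s ->
  t < t0 + d -> s <= r <= t -> 0 <= r /\ `|r - t0| < d'.
Proof.
move=> dd s0 h1 h2 /andP[sr rt]; split; first exact: le_trans sr.
by rewrite ltr_norml; apply/andP; split; lra.
Qed.

Lemma narrow_window (t0 d d' s t r r' : R) : d <= d' / 2 -> t0 - d < s ->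
  t < t0 + d -> s <= r <= t -> s <= r' <= t -> `|r - r'| < d'.
Proof.
move=> dd h1 h2 /andP[? ?] /andP[? ?].
by rewrite ltr_norml; apply/andP; split; lra.
Qed.

(** Continuity on [0, +oo[, spelled with moduli because the functions of time
    are meaningless on negative times. *)
Definition cont0 (F : R -> R) : Prop :=
  forall t0, 0 <= t0 -> forall e, 0 < e ->
  exists2 d, 0 < d & forall t, 0 <= t -> `|t - t0| < d -> `|F t - F t0| < e.

Lemma cont0_max (F : R -> R) : cont0 F <-> continuous (fun t : R => F (Num.max 0 t)).
Proof.
split=> [cF t0|cF t0 t00 e e0].
  apply/cvgrPdist_lt => e e0.
  have [d d0 dP] := cF (Num.max 0 t0) (ltac:(by rewrite le_max lexx)) e e0.
  near=> t; rewrite distrC; apply: dP; first by rewrite le_max lexx.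
  have td : `|t0 - t| < d by near: t; exact: cvgr_dist_lt.
  apply: le_lt_trans td.
  rewrite distrC.
  case: (leP 0 t0) => h1; case: (leP 0 t) => h2.
  - by [].
  - by rewrite ?subr0 ?sub0r ?normrN ger0_norm// ler_normr; apply/orP; first [left; lra|right; lra].
  - by rewrite ?subr0 ?sub0r ?normrN ger0_norm// ler_normr; apply/orP; first [left; lra|right; lra].
  - by rewrite subrr normr0.
have /cvgrPdist_lt/(_ e e0) := cF t0.
case=> d /= d0 dP; exists d => // t t0' td.
have := dP t; rewrite /= distrC => /(_ td).
by rewrite !max_r// distrC.
Unshelve. all: by end_near. Qed.

Lemma within_eq F G a b : (forall x, a <= x <= b -> F x = G x) ->
  {within `[a, b], continuous F} -> {within `[a, b], continuous G}.
Proof.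
move=> FG cF; apply: (subspace_eq_continuous _ cF) => x.
by rewrite inE/= in_itv/= => /FG.
Qed.

Lemma cont0_within (F : R -> R) a b : 0 <= a -> cont0 F ->
  {within `[a, b], continuous F}.
Proof.
move=> a0 /cont0_max cF.
apply: (@within_eq (fun t : R => F (Num.max 0 t))).
  by move=> t /andP[a_t _]; rewrite max_r// (le_trans a0).
exact: continuous_subspaceT.
Qed.

Lemma cont0_itg (F : R -> R) a b : 0 <= a -> cont0 F -> itg a b F.
Proof. by move=> a0 cF; apply/itg_within/cont0_within. Qed.

Lemma cont0D F G : cont0 F -> cont0 G -> cont0 (fun t => F t + G t).
Proof.
rewrite !cont0_max => cF cG t; apply: (@cvgD _ R^o); [exact: cF|exact: cG].
Qed.

Lemma cont0M F G : cont0 F -> cont0 G -> cont0 (fun t => F t * G t).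
Proof. by rewrite !cont0_max => cF cG t; apply: cvgM; [exact: cF|exact: cG]. Qed.

Lemma cont0_cst k : cont0 (fun=> k).
Proof. by rewrite cont0_max => t; exact: cvg_cst. Qed.

Lemma cont0Z k F : cont0 F -> cont0 (fun t => k * F t).
Proof. by apply: cont0M; exact: cont0_cst. Qed.

Lemma Int_near_cst (F : R -> R) s t k e : s <= t -> itg s t F ->
  (forall r, s <= r <= t -> `|F r - k| <= e) ->
  `|Int s t F - k * (t - s)| <= e * (t - s).
Proof.
move=> st Fi Fk; rewrite -(Int_cst k st) -IntB//; last exact: itg_cst.
by apply: Int_bound => //; apply: itgB => //; exact: itg_cst.
Qed.

(** A and B are the values of e^(c t) at the end points of an interval of length
    tau, on which X stays within e1 of X0 and I is its integral. *)
Lemma discounted_increment (c A B tau I Xs Xt X0 e1 eT : R) :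
  0 <= c -> 0 <= tau -> 0 <= A -> 0 <= e1 ->
  c * tau * B <= A - B -> A - B <= c * tau * A ->
  (X0 - e1) * tau <= I -> Xt - Xs <= - (c * I) -> X0 - e1 <= Xs -> Xs <= X0 + e1 ->
  c * A * e1 * 2 <= eT / 2 -> c ^+ 2 * tau * A * (`|X0| + e1) <= eT / 2 ->
  A * Xt - B * Xs <= eT * tau.
Proof.
move=> c0 tau0 A0 e10 h1 h2 HI HX Xs1 Xs2 small1 small2.
have cd : 0 <= c * tau by exact: mulr_ge0.
have cA : 0 <= c * A by exact: mulr_ge0.
have step1 : A * Xt - B * Xs <=
    - (c * A * X0 * tau) + c * A * e1 * tau + (A - B) * Xs.
  have := ler_wpM2l A0 HX; have := ler_wpM2l cA HI; lra.
pose r := c * tau * A - (A - B).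
have r0 : 0 <= r by rewrite subr_ge0.
have r1 : r <= (c * tau) ^+ 2 * A by rewrite /r expr2; have := ler_wpM2l cd h2; lra.
have X00 : 0 <= `|X0| + e1 by rewrite addr_ge0.
have Xsn : - Xs <= `|X0| + e1 by have := ler_norm (- X0); rewrite normrN; lra.
have step2 : (A - B) * Xs <=
    c * tau * A * (X0 + e1) + (c * tau) ^+ 2 * A * (`|X0| + e1).
  have -> : (A - B) * Xs = c * tau * A * Xs + r * (- Xs) by rewrite /r; ring.
  apply: lerD; first by rewrite ler_wpM2l// mulr_ge0.
  by apply: le_trans (ler_wpM2l r0 Xsn) _; rewrite ler_wpM2r.
have := ler_wpM2l tau0 (lerD small1 small2).
rewrite -splitr [tau * eT]mulrC; apply: le_trans.
apply: (le_trans step1); apply: le_trans (lerD (lexx _) step2) _.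
by rewrite -subr_ge0 (_ : _ - _ = 0)//; ring.
Qed.

(** The hypothesis is V' <= D - c V in the integrated form in which energy
    inequalities are obtained. *)
Lemma gronwall (V : R -> R) (c D T : R) : 0 < c -> 0 <= D -> 0 <= T ->
  cont0 V ->
  (forall s t, 0 <= s -> s <= t -> t <= T ->
     V t - V s <= Int s t (fun r => D - c * V r)) ->
  V T <= expR (- c * T) * V 0 + D / c.
Proof.
move=> c0 D0 T0 cV H.
have c00 := lt0r_neq0 c0.
pose X t := V t - D / c.
have cX : cont0 X by apply: cont0D => //; exact: cont0_cst.
have HX s t : 0 <= s -> s <= t -> t <= T -> X t - X s <= - (c * Int s t X).
  move=> s0 st tT; have := H s t s0 st tT.
  have Xi : itg s t X by exact: cont0_itg.
  rewrite -IntZ// -IntN; last exact: itgZ.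
  rewrite (_ : X t - X s = V t - V s) /X; last by ring.
  move=> /le_trans; apply; rewrite le_eqVlt; apply/orP; left; apply/eqP.
  by apply: eq_Int => r _; field.
have eqT : expR (- c * T) * expR (c * T) = 1 by rewrite -expRD mulNr addNr expR0.
(* It suffices to bound e^(c t) X t; its increments are compared with eT times
   the length of the interval, for an arbitrarily small slope eT. *)
suff Psi : expR (c * T) * X T <= X 0.
  have -> : V T = X T + D / c by rewrite /X; ring.
  rewrite lerD2r; apply: (@le_trans _ _ (expR (- c * T) * X 0)).
    by rewrite -[X T]mul1r -eqT -mulrA ler_wpM2l ?expR_ge0.
  by rewrite ler_wpM2l ?expR_ge0// /X gerBl divr_ge0// ltW.
pose K := expR (c * T).
have K0 : 0 < K by exact: expR_gt0.
apply/ler_addgt0Pr => eta eta0.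
have -> : expR (c * T) * X T = expR (c * T) * X T - X 0 + X 0 by ring.
rewrite [leRHS]addrC lerD2r.
rewrite (_ : _ - _ = expR (c * T) * X T - expR (c * 0) * X 0); last first.
  by rewrite mulr0 expR0 mul1r.
pose eT := eta / (T + 1).
have eT0 : 0 < eT by rewrite divr_gt0// ltr_wpDl.
apply: (@le_trans _ _ (eT * T - eT * 0)); last first.
  rewrite mulr0 subr0 /eT -mulrA ler_piMr ?(ltW eta0)//.
  by rewrite mulrC ler_pdivrMr ?ltr_wpDl// mul1r lerDl.
apply: (@local_to_global (fun t => expR (c * t) * X t) (fun t => eT * t)) => //.
move=> t0 /andP[t00 t0T].
pose e1 := eT / (4 * c * K).
have e10 : 0 < e1 by rewrite divr_gt0// !mulr_gt0.
have [tau1 tau10 Htau1] := cX t0 t00 e1 e10.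
pose tau2 := eT / (4 * c ^+ 2 * K * (`|X t0| + e1)).
have X10 : 0 < `|X t0| + e1 by rewrite ltr_wpDl.
have tau20 : 0 < tau2 by rewrite divr_gt0// !mulr_gt0// exprn_gt0.
exists (Num.min tau1 tau2); first by rewrite lt_min tau10.
move=> s t /andP[s0 st0] /andP[t0t tT] sgt tlt.
have st : s <= t by exact: le_trans t0t.
have m1 : Num.min tau1 tau2 <= tau1 by rewrite ge_min lexx.
have m2 : Num.min tau1 tau2 <= tau2 * 2 / 2 by rewrite mulfK// ge_min lexx orbT.
have Xr r : s <= r <= t -> `|X r - X t0| <= e1.
  by move=> /(near_window m1 s0 sgt tlt)[r0 rt]; exact/ltW/Htau1.
have Xi : itg s t X by exact: cont0_itg.
have := Int_near_cst st Xi Xr; rewrite ler_norml => /andP[HI _].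
have := HX s t s0 st tT.
have sgt2 : t - s <= 2 * tau2.
  rewrite mulrC (le_trans (ler_norm _))// ltW//.
  by apply: (narrow_window m2 sgt tlt); rewrite ?lexx ?st.
set I := Int s t X in HI * => HXst.
set A := expR (c * t); set B := expR (c * s).
have A0 : 0 < A by exact: expR_gt0.
have AK : A <= K by rewrite ler_expR ler_pM2l.
have AB : A = expR (c * (t - s)) * B by rewrite -expRD; congr expR; ring.
have BA : B = expR (- (c * (t - s))) * A by rewrite -expRD; congr expR; ring.
have h1 : c * (t - s) * B <= A - B.
  by rewrite AB lerBrDl -{1}[B]mul1r -mulrDl ler_wpM2r ?expR_ge0// expR_ge1Dx.
have h2 : A - B <= c * (t - s) * A.
  rewrite lerBlDl -lerBlDr -{1}[A]mul1r -mulrBl [leRHS]BA ler_wpM2r ?(ltW A0)//.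
  exact: expR_ge1Dx.
have := Xr s; rewrite lexx st => /(_ erefl); rewrite ler_distl => /andP[Xs1 Xs2].
have d0 : 0 <= t - s by rewrite subr_ge0.
have step3 : c * A * e1 * 2 <= eT / 2.
  apply: (@le_trans _ _ (c * K * e1 * 2)).
    by rewrite ler_wpM2r// ler_wpM2r ?(ltW e10)// ler_wpM2l// ltW.
  by rewrite le_eqVlt; apply/orP; left; apply/eqP; rewrite /e1; field; rewrite ?gt_eqF.
have step4 : c ^+ 2 * (t - s) * A * (`|X t0| + e1) <= eT / 2.
  apply: (@le_trans _ _ (c ^+ 2 * (2 * tau2) * K * (`|X t0| + e1))).
    rewrite ler_wpM2r ?(ltW X10)//; apply: ler_pM => //; try exact: ltW.
      by rewrite mulr_ge0// exprn_ge0// ltW.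
    by rewrite ler_wpM2l ?exprn_ge0 ?(ltW c0).
  rewrite le_eqVlt; apply/orP; left; apply/eqP; rewrite /tau2.
  by field; rewrite ?gt_eqF.
rewrite -mulrBr; rewrite lerBrDl -mulrBl in HI.
exact: (discounted_increment (ltW c0) d0 (ltW A0) (ltW e10) h1 h2 HI HXst Xs1 Xs2 step3 step4).
Qed.

Implicit Types (f g p : R -> R) (w : R -> R -> R).
(** The continuous curves in L^2[0,1], with the squared norm written as an
    integral. *)
Definition cl2 (w : R -> R -> R) : Prop :=
  (forall t, 0 <= t -> sqi 0 1 (w t)) /\
  (forall t0, 0 <= t0 -> forall e, 0 < e -> exists2 d, 0 < d &
     forall t, 0 <= t -> `|t - t0| < d ->
       Int 0 1 (fun x => (w t x - w t0 x) ^+ 2) < e).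

Lemma cl2_sqi w t : cl2 w -> 0 <= t -> sqi 0 1 (w t).
Proof. by move=> [+ _]; exact. Qed.

Lemma CL2_cl2 w : CL2 w -> cl2 w.
Proof.
move=> [wL wc]; split=> [t /wL|t0 t00 e e0]; first exact: (L2_sqi 0 1 _).1.
have /cvgrPdist_lt/(_ _ (ltac:(rewrite sqrtr_gt0; exact: e0) : 0 < Num.sqrt e)) := wc t0 t00.
rewrite near_withinE => -[d /= d0 dP]; exists d => // t t0' td.
have := dP t; rewrite /= distrC => /(_ td); rewrite in_itv/= andbT => /(_ t0').
rewrite sub0r normrN => h.
rewrite -(L2norm_sqi 0 1 (fun x => w t x - w t0 x)) -(sqr_sqrtr (ltW e0)).
by rewrite -real_normK ?num_real// ltrXn2r// ?nnegrE// sqrtr_ge0.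
Qed.

Lemma cl2_cst f : sqi 0 1 f -> cl2 (fun=> f).
Proof.
move=> fs; split=> // t0 _ e e0; exists 1 => // t _ _.
rewrite (eq_Int (g := fun=> 0)) ?Int_cst ?mul0r// => x _.
by rewrite subrr expr0n.
Qed.

Lemma Int_sqrD a b f g : sqi a b f -> sqi a b g ->
  Int a b (fun x => (f x + g x) ^+ 2) <=
  2 * Int a b (fun x => f x ^+ 2) + 2 * Int a b (fun x => g x ^+ 2).
Proof.
move=> fs gs; have [_ fgi] := sqiD fs gs; case: fs gs => [_ fi] [_ gi].
rewrite -!IntZ// -IntD; [|exact: itgZ|exact: itgZ].
apply: Int_le => // [|x _]; first by apply: itgD; exact: itgZ.
by have := sqr_ge0 (f x - g x); rewrite !expr2; lra.
Qed.

(** Two curves, so as to cover sums as well as operators. *)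
Lemma cl2_lip w w1 w2 k : cl2 w1 -> cl2 w2 ->
  (forall t, 0 <= t -> sqi 0 1 (w t)) ->
  (forall s t, 0 <= s -> 0 <= t ->
     Int 0 1 (fun x => (w t x - w s x) ^+ 2) <=
     k * (Int 0 1 (fun x => (w1 t x - w1 s x) ^+ 2) +
          Int 0 1 (fun x => (w2 t x - w2 s x) ^+ 2))) ->
  cl2 w.
Proof.
move=> [_ c1] [_ c2] ws H; split=> // t0 t00 e e0.
pose e' := e / (2 * (`|k| + 1)).
have e'0 : 0 < e' by rewrite divr_gt0// mulr_gt0// ltr_wpDl.
have [d1 d10 D1] := c1 t0 t00 e' e'0; have [d2 d20 D2] := c2 t0 t00 e' e'0.
exists (Num.min d1 d2) => [|t t0']; first by rewrite lt_min d10.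
rewrite lt_min => /andP[td1 td2].
apply: le_lt_trans (H _ _ t00 t0') _.
have := D1 t t0' td1; have := D2 t t0' td2.
set a1 := Int _ _ _; set a2 := Int _ _ _ => h1 h2.
have a10 : 0 <= a1 by apply: Int_ge0 => x _; exact: sqr_ge0.
have a20 : 0 <= a2 by apply: Int_ge0 => x _; exact: sqr_ge0.
have -> : e = (`|k| + 1) * (e' + e') by rewrite /e'; field; rewrite gt_eqF// ltr_wpDl.
apply: (@le_lt_trans _ _ (`|k| * (a2 + a1))).
  by rewrite ler_wpM2r ?addr_ge0// ler_norm.
apply: (@le_lt_trans _ _ (`|k| * (e' + e'))); first by rewrite ler_wpM2l//; lra.
by rewrite mulrDl mul1r ltrDl addr_gt0.
Qed.

Lemma cl2D w1 w2 : cl2 w1 -> cl2 w2 -> cl2 (fun t x => w1 t x + w2 t x).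
Proof.
move=> c1 c2; apply: (@cl2_lip _ w1 w2 2) => // [t t0|s t s0 t0].
  by apply: sqiD; exact: cl2_sqi.
rewrite mulrDr (eq_Int (g := fun x => ((w1 t x - w1 s x) + (w2 t x - w2 s x)) ^+ 2)).
  by apply: Int_sqrD; apply: sqiB; exact: cl2_sqi.
by move=> x _; congr (_ ^+ 2); ring.
Qed.

Lemma cl2_cM w p : {within `[0, 1], continuous p} -> cl2 w ->
  cl2 (fun t x => p x * w t x).
Proof.
move=> cp cw; have [C C0 pC] := within_bounded cp.
apply: (@cl2_lip _ w w (C ^+ 2)) => // [t t0|s t s0 t0].
  by apply: sqi_cM => //; exact: cl2_sqi.
have [_ di] : sqi 0 1 (fun x => w t x - w s x) by apply: sqiB; exact: cl2_sqi.
apply: (@le_trans _ _ (C ^+ 2 * Int 0 1 (fun x => (w t x - w s x) ^+ 2))).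
  rewrite -IntZ//; apply: Int_le; last 1 first.
  - move=> x xab; rewrite -mulrBr exprMn ler_wpM2r ?sqr_ge0//.
    by rewrite -(real_normK (num_real (p x))) lerXn2r ?nnegrE ?pC.
  - by have [_] : sqi 0 1 (fun x => p x * w t x - p x * w s x);
      [apply: sqiB; apply: sqi_cM => //; exact: cl2_sqi|].
  - exact: itgZ.
rewrite ler_wpM2l ?exprn_ge0// lerDl.
by apply: Int_ge0 => x _; exact: sqr_ge0.
Qed.

Lemma cl2N w : cl2 w -> cl2 (fun t x => - w t x).
Proof.
move=> /(@cl2_cM _ (fun=> -1)) [].
  by apply: continuous_subspaceT => x; exact: cvg_cst.
move=> h1 h2; split=> [t /h1|t0 t00 e e0].
  by apply: sqi_eq => x _; rewrite mulN1r.
have [d d0 dP] := h2 t0 t00 e e0; exists d => // t t0' td.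
rewrite (eq_Int (g := fun x => (-1 * w t x - -1 * w t0 x) ^+ 2)) ?dP// => x _.
by rewrite !mulN1r.
Qed.

Lemma cl2B w1 w2 : cl2 w1 -> cl2 w2 -> cl2 (fun t x => w1 t x - w2 t x).
Proof. by move=> c1 /cl2N; exact: cl2D. Qed.

Lemma cauchy_schwarz_sqrt a b f g : sqi a b f -> sqi a b g ->
  `|Int a b (fun x => f x * g x)| <=
  Num.sqrt (Int a b (fun x => f x ^+ 2)) * Num.sqrt (Int a b (fun x => g x ^+ 2)).
Proof.
move=> fs gs; rewrite -sqrtrM; last by apply: Int_ge0 => x _; exact: sqr_ge0.
by rewrite -sqrtr_sqr ler_wsqrtr// cauchy_schwarz.
Qed.

Lemma small_products (x1 x2 n1 n2 d e : R) : 0 < e -> d <= 1 ->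
  d * (n1 + n2 + 1) <= e / 2 -> 0 <= n1 -> 0 <= n2 ->
  0 <= x1 -> 0 <= x2 -> x1 <= d -> x2 <= d -> x1 * x2 + (x1 * n2 + n1 * x2) < e.
Proof.
move=> e0 d1 de n10 n20 x10 x20 h1 h2.
have : x1 * x2 <= d * 1 by apply: ler_pM => //; exact: le_trans d1.
have := ler_wpM2r n20 h1; have := ler_wpM2l n10 h2; lra.
Qed.

Lemma cl2_pair w1 w2 : cl2 w1 -> cl2 w2 ->
  cont0 (fun t => Int 0 1 (fun x => w1 t x * w2 t x)).
Proof.
move=> c1 c2 t0 t00 e e0.
pose n1 := Num.sqrt (Int 0 1 (fun x => w1 t0 x ^+ 2)).
pose n2 := Num.sqrt (Int 0 1 (fun x => w2 t0 x ^+ 2)).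
have n10 : 0 <= n1 by exact: sqrtr_ge0.
have n20 : 0 <= n2 by exact: sqrtr_ge0.
pose e' := Num.min 1 (e / (2 * (n1 + n2 + 1))).
have p0 : 0 < n1 + n2 + 1 by rewrite ltr_wpDl// addr_ge0.
have e'0 : 0 < e' by rewrite lt_min ltr01/= divr_gt0// mulr_gt0.
have e'2 : 0 < e' ^+ 2 by rewrite exprn_gt0.
have [d1 d10 D1] := c1.2 t0 t00 _ e'2; have [d2 d20 D2] := c2.2 t0 t00 _ e'2.
exists (Num.min d1 d2) => [|t t0']; first by rewrite lt_min d10.
rewrite lt_min => /andP[td1 td2].
have s1 := cl2_sqi c1 t0'; have s2 := cl2_sqi c2 t0'.
have s10 := cl2_sqi c1 t00; have s20 := cl2_sqi c2 t00.
have ds1 := sqiB s1 s10; have ds2 := sqiB s2 s20.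
rewrite -IntB; [|exact: sqi_mul|exact: sqi_mul].
rewrite (eq_Int (g := fun x => (w1 t x - w1 t0 x) * (w2 t x - w2 t0 x) +
   ((w1 t x - w1 t0 x) * w2 t0 x + w1 t0 x * (w2 t x - w2 t0 x)))); last first.
  by move=> x _; ring.
rewrite !IntD; try exact: sqi_mul; last by apply: itgD; exact: sqi_mul.
have m1 : Num.sqrt (Int 0 1 (fun x => (w1 t x - w1 t0 x) ^+ 2)) <= e'.
  by rewrite -[leRHS]ger0_norm ?(ltW e'0)// -sqrtr_sqr ler_wsqrtr// ltW// D1.
have m2 : Num.sqrt (Int 0 1 (fun x => (w2 t x - w2 t0 x) ^+ 2)) <= e'.
  by rewrite -[leRHS]ger0_norm ?(ltW e'0)// -sqrtr_sqr ler_wsqrtr// ltW// D2.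
have b1 := cauchy_schwarz_sqrt ds1 ds2.
have b2 := cauchy_schwarz_sqrt ds1 s20.
have b3 := cauchy_schwarz_sqrt s10 ds2.
apply: le_lt_trans (ler_normD _ _) _.
apply: le_lt_trans (lerD (lexx _) (ler_normD _ _)) _.
apply: le_lt_trans (lerD b1 (lerD b2 b3)) _.
rewrite -/n1 -/n2.
move: m1 m2 (sqrtr_ge0 (Int 0 1 (fun x => (w1 t x - w1 t0 x) ^+ 2)))
  (sqrtr_ge0 (Int 0 1 (fun x => (w2 t x - w2 t0 x) ^+ 2))).
set x1 := Num.sqrt _; set x2 := Num.sqrt _ => h1 h2 h3 h4.
have e'1 : e' <= 1 by rewrite ge_min lexx.
have e'e : e' * (n1 + n2 + 1) <= e / 2.
  rewrite -ler_pdivlMr// ge_min; apply/orP; right.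
  by rewrite le_eqVlt; apply/orP; left; apply/eqP; field; rewrite ?gt_eqF.
exact: (small_products e0 e'1 e'e).
Qed.

End straddle.

(** * Calculus on segments *)

Section calculus.
Variable R : realType.
Implicit Types (f g p F G : R -> R) (a b c e k s t x y : R).

Lemma heine (T : pseudoMetricType R) (f : T -> R) (K : set T) e :
  compact K -> continuous f -> 0 < e ->
  exists2 d, 0 < d & forall z z', K z -> ball z d z' -> `|f z - f z'| < e.
Proof.
move=> /compact_near_coveringP cK cf e0.
have [|d [/= d0 dP]] := cK R (0^'+) (fun d z => forall z', ball z d z' -> `|f z - f z'| < e) _.
  move=> z Kz.
  have : \forall y \near z, `|f z - f y| < e / 2.
    by have /cvgrPdist_lt := cf z; apply; rewrite divr_gt0.
  move=> /nbhs_ballP[r /= r0 rP].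
  exists (ball z (r / 2), [set d | d < r / 2]) => /=.
    split; first by apply: nbhsx_ballx; rewrite divr_gt0.
    by apply: nbhs_right_lt; rewrite divr_gt0.
  move=> [y d] /= [zy dr] z' yz'.
  have h1 : `|f z - f y| < e / 2 by apply: rP; apply: le_ball zy; lra.
  have h2 : `|f z - f z'| < e / 2.
    apply: rP; rewrite (splitr r); apply: ball_triangle zy _.
    exact: le_ball (ltW dr) _ yz'.
  rewrite (_ : f y - f z' = (f z - f z') - (f z - f y)); last by ring.
  by rewrite (le_lt_trans (ler_normB _ _))//; lra.
exists (d / 2); first by rewrite divr_gt0.
move=> z z' Kz; have := dP (d / 2); apply => //=; rewrite ?divr_gt0//.
by rewrite sub0r normrN ger0_norm ?divr_ge0 ?ltW//; lra.
Qed.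

Lemma heineR f a b e : continuous f -> 0 < e ->
  exists2 d, 0 < d & forall x y, a <= x <= b -> `|x - y| < d -> `|f x - f y| < e.
Proof.
move=> cf e0; have [d d0 dP] := heine (@segment_compact _ a b) cf e0.
by exists d => // x y xab xy; apply: dP.
Qed.

Lemma Int_derive F f a b : a <= b ->
  (forall x, a < x < b -> is_derive x 1 F (f x)) ->
  {within `[a, b], continuous F} -> {within `[a, b], continuous f} ->
  Int a b f = F b - F a.
Proof.
rewrite le_eqVlt => /predU1P[<-|ab] dF cF cf; first by rewrite Int_point subrr.
rewrite /Rintegral (@continuous_FTC2 _ f F)//.
- move/(continuous_within_itvP _ ab) : cF => [_ ca cb]; split => // x.
  by rewrite in_itv/= => /dF [].
- by move=> x; rewrite in_itv/= => /dF dFx; rewrite derive1E derive_val.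
Qed.

Lemma prim_derive f c x : continuous f -> c < x ->
  is_derive x 1 (fun y => Int c y f) (f x).
Proof.
move=> cf cx.
have xu : x < x + 1 by rewrite ltrDl.
have [|h1 h2] := @continuous_FTC1_closed _ f c x (x + 1) xu _ cx (cf x).
  exact: itg_cont.
by apply: DeriveDef; [exact: h1|rewrite -derive1E; exact: h2].
Qed.

Lemma derive_continuous F x k : is_derive x 1 F k -> {for x, continuous F}.
Proof. by move=> [/derivable1_diffP/differentiable_continuous]. Qed.

Lemma is_derive_add F G x k c : is_derive x 1 F k -> is_derive x 1 G c ->
  is_derive x 1 (fun y => F y + G y) (k + c).
Proof. exact: is_deriveD. Qed.

Lemma is_derive_sub F G x k c : is_derive x 1 F k -> is_derive x 1 G c ->
  is_derive x 1 (fun y => F y - G y) (k - c).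
Proof. exact: is_deriveB. Qed.

Lemma is_derive_scale F x k c : is_derive x 1 F k ->
  is_derive x 1 (fun y => c * F y) (c * k).
Proof. exact: is_deriveZ. Qed.

Lemma is_derive_mul F G x k c : is_derive x 1 F k -> is_derive x 1 G c ->
  is_derive x 1 (fun y => F y * G y) (F x * c + G x * k).
Proof. exact: is_deriveM. Qed.

Lemma is_derive_compo F G x k c : is_derive (G x) 1 F k -> is_derive x 1 G c ->
  is_derive x 1 (fun y => F (G y)) (k * c).
Proof. exact: is_derive1_comp. Qed.

Lemma is_derive_translate F c x k : is_derive (x + c) 1 F k ->
  is_derive x 1 (fun y => F (y + c)) k.
Proof.
move=> dF.
have d1 : is_derive x 1 (fun y : R => y + c) 1.
  have := is_derive_add (is_derive_id x (1:R)) (is_derive_cst c x (1:R)).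
  by move=> /is_derive_eq; apply; rewrite addr0.
by have /is_derive_eq := @is_derive_compo F (fun y => y + c) x k 1 dF d1; apply; rewrite mulr1.
Qed.

Lemma prim_cont f c : continuous f -> continuous (fun x => Int c x f).
Proof.
move=> cf x; apply/cvgrPdist_lt => e e0.
have [C C0 fC] := @within_bounded _ c (Num.max c x + 1) f (continuous_subspaceT cf).
have H a b : c <= a -> a <= b -> b <= Num.max c x + 1 ->
    `|Int c b f - Int c a f| <= C * (b - a).
  move=> ca ab bx; rewrite (@Int_cat _ c a b)//; last exact: itg_cont.
  rewrite addrAC subrr add0r; apply: Int_bound => //; first exact: itg_cont.
  by move=> r rab; apply: fC; lra.
have max0 z : Int c z f = Int c (Num.max c z) f.
  by have [//|zc] := leP c z; rewrite Int_point Int_empty.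
have m0 : 0 < Num.min 1 (e / (C + 1)).
  by rewrite lt_min ltr01 divr_gt0// ltr_wpDl.
near=> z.
have zx : `|x - z| < Num.min 1 (e / (C + 1)).
  by near: z; exact: cvgr_dist_lt.
have [zx1 zx2] : `|x - z| < 1 /\ `|x - z| < e / (C + 1).
  by move: zx; rewrite lt_min => /andP.
have Ce : C * `|x - z| < e.
  apply: (@le_lt_trans _ _ ((C + 1) * `|x - z|)).
    by rewrite ler_wpM2r// lerDl.
  by rewrite mulrC -ltr_pdivlMr// ltr_wpDl.
rewrite (max0 x) (max0 z); apply: le_lt_trans Ce.
have dmax : `|Num.max c x - Num.max c z| <= `|x - z|.
  case: (leP c x) => h1; case: (leP c z) => h2; rewrite ?subrr ?normr0//.
  - by rewrite ger0_norm; [rewrite ler_normr; apply/orP; left|]; lra.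
  - by rewrite ler0_norm; [rewrite ler_normr; apply/orP; right|]; lra.
have xm : c <= Num.max c x by rewrite le_max lexx.
have zm : c <= Num.max c z by rewrite le_max lexx.
have [xz|/ltW xz] := leP (Num.max c x) (Num.max c z).
  rewrite distrC (le_trans (H _ _ _ xz _))//.
    by move: (le_lt_trans dmax zx1); rewrite ltr_norml => /andP[]; lra.
  by rewrite ler_wpM2l// (le_trans _ dmax)// distrC ler_norm.
rewrite (le_trans (H _ _ _ xz _))//; first by lra.
by rewrite ler_wpM2l// (le_trans _ dmax)// ler_norm.
Unshelve. all: by end_near. Qed.

(** Differentiability is only asked for -1 < x: primitives based at a finite
    point are constant, not differentiable, to the left of it. *)
Definition C1p F f := (forall x, -1 < x -> is_derive x 1 F (f x)) /\ continuous f.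

(** Smoothing by the average over [x - n, x].  Averaging to the left of x keeps
    f = 0 on ]-oo, s] true for the approximation, and so preserves the test
    functions that vanish at the outflow boundary. *)
Lemma C1p_approx f T e : continuous f -> 0 < e ->
  exists F F', [/\ C1p F F', continuous F,
     forall x, 0 <= x <= T -> `|F x - f x| <= e &
     forall s, 0 <= s -> (forall x, x <= s -> f x = 0) -> forall x, -1 < x -> x <= s -> F x = 0].
Proof.
move=> cf e0; have [d d0 dP] := heineR 0 T cf e0.
pose n := (Num.min d 1) / 2.
have n0 : 0 < n by rewrite divr_gt0// lt_min d0 ltr01.
have nd : n < d.
  rewrite /n ltr_pdivrMr//; have : Num.min d 1 <= d by rewrite ge_min lexx.
  lra.
have n1 : n < 1.
  rewrite /n ltr_pdivrMr//; have : Num.min d 1 <= 1 by rewrite ge_min lexx orbT.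
  lra.
pose P x := Int (-3) x f.
pose F x := n^-1 * (P x - P (x - n)).
have FE x : -1 < x -> F x = n^-1 * Int (x - n) x f.
  move=> x1; rewrite /F /P (@Int_cat _ (-3) (x - n) x); [|lra|lra|exact: itg_cont].
  by rewrite addrAC subrr add0r.
exists F, (fun x => n^-1 * (f x - f (x - n))); split.
- split.
    move=> x x1; apply: is_derive_scale; apply: is_derive_sub; first by apply: prim_derive => //; lra.
    by apply: is_derive_translate; apply: prim_derive => //; lra.
  move=> x; apply: cvgM; first exact: cvg_cst.
  apply: cvgB; first exact: cf.
  apply: (@continuous_comp _ _ _ (fun x => x - n) f); last exact: cf.
  by apply: cvgB; [exact: cvg_id|exact: cvg_cst].
- move=> x; apply: cvgM; first exact: cvg_cst.
  apply: cvgB; first exact: prim_cont.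
  apply: (@continuous_comp _ _ _ (fun x => x - n) P); last exact: prim_cont.
  by apply: cvgB; [exact: cvg_id|exact: cvg_cst].
- move=> x xT; rewrite FE; last by lra.
  have h : `|Int (x - n) x f - f x * (x - (x - n))| <= e * (x - (x - n)).
    apply: Int_near_cst; [lra|exact: itg_cont|].
    move=> r rx; rewrite distrC ltW// dP// ger0_norm; lra.
  rewrite (_ : _ - _ = n^-1 * (Int (x - n) x f - f x * (x - (x - n)))); last first.
    by field; rewrite gt_eqF.
  rewrite normrM gtr0_norm ?invr_gt0// ler_pdivrMl//.
  by move: h; rewrite (_ : x - (x - n) = n) ?(mulrC e)//; ring.
- move=> s s0 fs x x1 xs; rewrite FE// (eq_Int (g := fun=> 0)).
    by rewrite Int_cst ?mul0r ?mulr0//; lra.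
  by move=> y /andP[_ yx]; apply: fs; lra.
Qed.

Lemma Int_shift f c a b : a <= b -> continuous f ->
  Int a b (fun x => f (x + c)) = Int (a + c) (b + c) f.
Proof.
move=> ab cf; pose P x := Int (a + c - 1) x f.
have dP x : a + c - 1 < x -> is_derive x 1 P (f x) by exact: prim_derive.
have cPc : continuous (fun x => f (x + c)).
  move=> x; apply: (@continuous_comp _ _ _ (fun x => x + c) f); last exact: cf.
  by apply: cvgD; [exact: cvg_id|exact: cvg_cst].
transitivity (P (b + c) - P (a + c)); last symmetry; [|apply: Int_derive].
- apply: (@Int_derive (fun x => P (x + c)) _ a b) => //.
  + by move=> x xab; apply: is_derive_translate; apply: dP; lra.
  + apply: continuous_in_subspaceT => x; rewrite inE/= in_itv/= => xab.
    by apply: derive_continuous; apply: is_derive_translate; apply: dP; lra.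
  + exact: continuous_subspaceT.
- by rewrite lerD2r.
- by move=> x xab; apply: dP; lra.
- apply: continuous_in_subspaceT => x; rewrite inE/= in_itv/= => xab.
  by apply: derive_continuous; apply: dP; lra.
- exact: continuous_subspaceT.
Qed.

(** Typically A = W f^2, B = f g and C = g^2 / W for a weight W. *)
Lemma CSgen a b (A B C : R -> R) : itg a b A -> itg a b B -> itg a b C ->
  (forall x, a <= x <= b -> [/\ 0 <= A x, 0 <= C x & B x ^+ 2 <= A x * C x]) ->
  Int a b B ^+ 2 <= Int a b A * Int a b C.
Proof.
move=> Ai Bi Ci H; apply: discr_le => [|s]; first by apply: Int_ge0 => x /H[].
have B2 := itgZ (2 * s) Bi; have C2 := itgZ (s ^+ 2) Ci.
rewrite -!IntZ// -!IntD//; last exact: itgD.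
apply: Int_ge0 => x /H[A0 C0 BAC].
have [Ax|Ax] := eqVneq (A x) 0.
  have B0 : B x = 0.
    by apply/eqP; rewrite -sqrf_eq0 eq_le sqr_ge0 andbT (le_trans BAC)// Ax mul0r.
  by rewrite Ax B0 mulr0 addr0 add0r mulr_ge0// sqr_ge0.
have Ap : 0 < A x by rewrite lt_neqAle eq_sym Ax.
rewrite -(pmulr_rge0 _ Ap).
have -> : A x * (A x + 2 * s * B x + s ^+ 2 * C x) =
  (A x + s * B x) ^+ 2 + s ^+ 2 * (A x * C x - B x ^+ 2) by ring.
by rewrite addr_ge0 ?sqr_ge0// mulr_ge0 ?sqr_ge0// subr_ge0.
Qed.

Lemma within_compo f F a b : continuous F -> {within `[a, b], continuous f} ->
  {within `[a, b], continuous (fun x => F (f x))}.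
Proof. by move=> cF cf; apply: within_continuous_comp => // x _; exact: cF. Qed.

Lemma withinM f F a b : {within `[a, b], continuous f} -> {within `[a, b], continuous F} ->
  {within `[a, b], continuous (fun x => f x * F x)}.
Proof. by move=> cf cF x; apply: (@continuousM _ (subspace _)); [exact: cf|exact: cF]. Qed.

Lemma withinD f F a b : {within `[a, b], continuous f} -> {within `[a, b], continuous F} ->
  {within `[a, b], continuous (fun x => f x + F x)}.
Proof. by move=> cf cF x; apply: (@continuousD _ _ (subspace _)); [exact: cf|exact: cF]. Qed.

Lemma contDr f c : continuous f -> continuous (fun x => f (x + c)).
Proof.
move=> cf x; apply: (@continuous_comp _ _ _ (fun x => x + c) f); last exact: cf.
by apply: cvgD; [exact: cvg_id|exact: cvg_cst].
Qed.

Lemma withinB f F a b : {within `[a, b], continuous f} -> {within `[a, b], continuous F} ->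
  {within `[a, b], continuous (fun x => f x - F x)}.
Proof. by move=> cf cF x; apply: (@continuousB _ _ (subspace _)); [exact: cf|exact: cF]. Qed.

Lemma within_cst a b c : {within `[a, b], continuous (fun=> c)}.
Proof. by apply: continuous_subspaceT => x; exact: cvg_cst. Qed.

End calculus.

(** * Density of continuous functions in L^2 *)

Section density.
Variable R : realType.
Implicit Types (f g : R -> R) (a b c e k s t x y : R).

Definition trunc (n : R) (x : R) : R := Num.max (- n) (Num.min n x).

Lemma trunc_id n x : `|x| <= n -> trunc n x = x.
Proof. by rewrite ler_norml => /andP[nx xn]; rewrite /trunc min_r// max_r. Qed.

Lemma trunc_bound n x : 0 <= n -> `|trunc n x| <= n.
Proof.
move=> n0; rewrite ler_norml /trunc le_max lexx/= ge_max; apply/andP; split; first by lra.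
by rewrite ge_min lexx.
Qed.

Lemma trunc_lip n x y : 0 <= n -> `|trunc n x - trunc n y| <= `|x - y|.
Proof.
move=> n0; have H z w : z <= w -> 0 <= trunc n w - trunc n z <= w - z.
  move=> zw; rewrite /trunc.
  have nn : - n <= n by lra.
  case: (leP n z) => h1; case: (leP n w) => h2; rewrite ?(max_r nn).
  - lra.
  - lra.
  - by case: (leP (- n) z) => h3; lra.
  - by case: (leP (- n) z) => h3; case: (leP (- n) w) => h4; lra.
have [xy|/ltW yx] := leP x y.
  have /andP[h1 h2] := H _ _ xy.
  by rewrite distrC (distrC x) !ger0_norm//; lra.
by have /andP[h1 h2] := H _ _ yx; rewrite !ger0_norm//; lra.
Qed.

Lemma trunc_cont n : continuous (trunc n).
Proof.
move=> x; apply: (@continuous_max _ _ (fun=> - n) (fun x : R => Num.min n x)); first exact: cvg_cst.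
by apply: (@continuous_min _ _ (fun=> n) (fun x : R => x)); [exact: cvg_cst|exact: cvg_id].
Qed.

Lemma trunc_near a b f e : sqi a b f -> 0 < e ->
  exists2 n, 0 < n & Int a b (fun x => (f x - trunc n (f x)) ^+ 2) <= e.
Proof.
move=> [mf fi] e0.
pose u (n : nat) x := (f x - trunc n.+1%:R (f x)) ^+ 2.
have mu n : measurable_fun `[a, b] (u n).
  apply: measurable_funX; apply: measurable_funB => //.
  by apply: measurableT_comp => //; apply: continuous_measurable_fun; exact: trunc_cont.
have uf n x : 0 <= u n x <= f x ^+ 2.
  rewrite sqr_ge0/= /u -real_normK ?num_real// -(real_normK (num_real (f x))).
  rewrite lerXn2r ?nnegrE//.
  have t0 : trunc n.+1%:R (0:R) = 0 by rewrite trunc_id// normr0.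
  have H z w : 0 <= n.+1%:R :> R by [].
  have n0 : (0:R) <= n.+1%:R by [].
  rewrite /trunc; case: (leP n.+1%:R (f x)) => h1.
    rewrite max_r; last by lra.
    by rewrite !ger0_norm; lra.
  case: (leP (- n.+1%:R) (f x)) => h2; first by rewrite subrr normr0.
  by rewrite !ler0_norm; lra.
have ucvg x : (u n x)%:E @[n --> \oo] --> (0:R)%:E.
  apply: cvg_near_cst.
  exists (Num.truncn `|f x|) => // n /= nf; congr (_%:E); rewrite /u trunc_id ?subrr ?expr0n//.
  rewrite (le_trans (ltW (truncnS_gt _)))// ler_nat ltnS//.
have /fine_cvgP[_ /cvgrPdist_le/(_ _ e0)[N _ NP]] :
    (fun n => \int[leb]_(x in `[a, b]) (u n x)%:E)%E @ \oo --> 0%:E.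
  rewrite (_ : 0%:E = \int[leb]_(x in `[a, b]) 0%:E)%E; last by rewrite integral0.
  apply: (@dominated_cvg _ _ R leb `[a, b] (measurable_itv _)
    (fun n x => (u n x)%:E) (fun=> 0%:E) (fun x => (f x ^+ 2)%:E)) => //.
  - by move=> n; apply/measurable_EFinP; exact: mu.
  - by move=> n x _; have /andP[h1 h2] := uf n x; rewrite lee_fin ger0_norm.
exists N.+1%:R => //.
have := NP N (leqnn N); rewrite sub0r normrN ger0_norm//.
by apply: Int_ge0 => x _; exact: sqr_ge0.
Qed.

Lemma cutoff_small a b c d : a <= b -> 0 < d ->
  Int a b (fun x => Num.max 0 (1 - `|x - c| / d) ^+ 2) <= 2 * d.
Proof.
move=> ab d0; set k := (X in Int _ _ X).
have kc : continuous k.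
  move=> x; apply: cvgM; apply: (@continuous_max _ _ (fun=> 0) (fun x : R => 1 - `|x - c| / d)); try exact: cvg_cst.
  - apply: cvgB; first exact: cvg_cst.
    apply: cvgM; last exact: cvg_cst.
    by apply: cvg_norm; apply: cvgB; [exact: cvg_id|exact: cvg_cst].
  - apply: cvgB; first exact: cvg_cst.
    apply: cvgM; last exact: cvg_cst.
    by apply: cvg_norm; apply: cvgB; [exact: cvg_id|exact: cvg_cst].
have k0 x : 0 <= k x by exact: sqr_ge0.
pose A := Num.min a (c - d); pose B := Num.max b (c + d).
have Aa : A <= a by rewrite ge_min lexx.
have Ac : A <= c - d by rewrite ge_min lexx orbT.
have bB : b <= B by rewrite le_max lexx.
have cB : c + d <= B by rewrite le_max lexx orbT.
have koff x : d <= `|x - c| -> k x = 0.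
  move=> xd; rewrite /k max_l ?expr0n// subr_le0 ler_pdivlMr// mul1r//.
apply: (@le_trans _ _ (Int A B k)).
  by apply: Int_le_set => //; exact: itg_cont.
rewrite (@Int_cat _ A (c - d) B)//; [|lra|exact: itg_cont].
rewrite (@Int_cat _ (c - d) (c + d) B)//; [|lra|exact: itg_cont].
rewrite (@eq_Int _ A (c - d) k (fun=> 0)); last first.
  by move=> x xA; apply: koff; rewrite ler_normr; apply/orP; right; lra.
rewrite (@eq_Int _ (c + d) B k (fun=> 0)); last first.
  by move=> x xA; apply: koff; rewrite ler_normr; apply/orP; left; lra.
rewrite !Int_cst// !mul0r add0r addr0.
apply: (@le_trans _ _ (Int (c - d) (c + d) (fun=> 1))); last by rewrite Int_cst; lra.
apply: Int_le; [exact: itg_cont|exact: itg_cst|move=> x _].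
have h1 : 0 <= Num.max 0 (1 - `|x - c| / d) by rewrite le_max lexx.
have h2 : Num.max 0 (1 - `|x - c| / d) <= 1.
  by rewrite ge_max ler01 gerBl divr_ge0// ltW.
by rewrite /k expr2 (le_trans (ler_pM h1 h1 h2 h2))// mul1r.
Qed.

(** The value of phi at one point is prescribed, which a cutoff achieves at a
    small cost in L^2; test functions are built by gluing phi at that point.  The
    density in L^1 of the continuous functions is used after a truncation, on
    bounded functions, where it gives density in L^2. *)
Lemma dense_cont a b f c e : a <= b -> sqi a b f -> 0 < e ->
  exists phi, [/\ continuous phi, phi c = 0 & Int a b (fun x => (f x - phi x) ^+ 2) <= e].
Proof.
move=> ab fs e0.
have e40 : 0 < e / 4 by rewrite divr_gt0.
have [n n0 fn] := trunc_near fs e40.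
have tm : measurable_fun `[a, b] (fun x => trunc n (f x)).
  by apply: measurableT_comp; [apply: continuous_measurable_fun; exact: trunc_cont|case: fs].
have ti : itg a b (fun x => trunc n (f x)).
  apply: (itg_le tm (itg_cst a b n)) => x _; apply: trunc_bound; exact: ltW.
have [g_ [gc gi gcvg]] : exists g_ : (R -> R)^nat,
    [/\ forall n, continuous (g_ n),
        forall n, leb.-integrable `[a, b] (EFin \o g_ n) &
        (fun j : nat => \int[leb]_(z in `[a, b]) `|(trunc n (f z) - g_ j z)%:E|)%E @ \oo --> 0%E].
  apply: approximation_continuous_integrable => //.
  by rewrite /= lebesgue_measure_itv/=; case: ifP => // _; rewrite ltry.
have e80 : 0 < e / (32 * n) by rewrite divr_gt0// mulr_gt0.
move/fine_cvgP : gcvg => [_ /cvgrPdist_le/(_ _ e80)[N _ NP]].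
have := NP N (leqnn N); rewrite sub0r normrN => {}NP.
pose g x := trunc n (g_ N x).
have cg : continuous g by move=> x; apply: (@continuous_comp _ _ _ (g_ N) (trunc n)); [exact: gc|exact: trunc_cont].
have gn x : `|g x| <= n by apply: trunc_bound; exact: ltW.
have ts : sqi a b (fun x => trunc n (f x)).
  split=> //; apply: (itg_le _ (itg_cst a b (n ^+ 2))); first exact: measurable_funX.
  by move=> x _; rewrite normrX lerXn2r ?nnegrE ?(ltW n0)// trunc_bound// ltW.
have gs : sqi a b g by apply: sqi_cont; exact: continuous_subspaceT.
have tg : Int a b (fun x => (trunc n (f x) - g x) ^+ 2) <= e / 16.
  have di : itg a b (fun x => `|trunc n (f x) - g_ N x|).
    by apply: itg_norm; apply: itgB => //; exact: gi.
  apply: (@le_trans _ _ (2 * n * Int a b (fun x => `|trunc n (f x) - g_ N x|))).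
    rewrite -IntZ//; apply: Int_le; [by case: (sqiB ts gs)|exact: itgZ|move=> x _].
    rewrite -real_normK ?num_real// expr2; apply: ler_pM => //.
      by rewrite (le_trans (ler_normB _ _))// mulr2n mulrDl mul1r lerD// trunc_bound// ltW.
    rewrite /g -{1}(trunc_id (trunc_bound (f x) (ltW n0))); apply: trunc_lip; exact: ltW.
  have : Int a b (fun x => `|trunc n (f x) - g_ N x|) <= e / (32 * n).
    by apply: le_trans NP; exact: ler_norm.
  move=> h; apply: (@le_trans _ _ (2 * n * (e / (32 * n)))).
    by rewrite ler_wpM2l// mulr_ge0// ltW.
  by rewrite le_eqVlt; apply/orP; left; apply/eqP; field; rewrite gt_eqF.
pose d := e / (32 * n ^+ 2).
have d0 : 0 < d by rewrite divr_gt0// mulr_gt0// exprn_gt0.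
pose psi x := Num.max 0 (1 - `|x - c| / d).
have psic : continuous psi.
  move=> x; apply: (@continuous_max _ _ (fun=> 0) (fun x : R => 1 - `|x - c| / d)); first exact: cvg_cst.
  apply: cvgB; first exact: cvg_cst.
  apply: cvgM; last exact: cvg_cst.
  by apply: cvg_norm; apply: cvgB; [exact: cvg_id|exact: cvg_cst].
pose phi x := g x * (1 - psi x).
have phic : continuous phi.
  move=> x; apply: cvgM; first exact: cg.
  by apply: cvgB; [exact: cvg_cst|exact: psic].
have phis : sqi a b phi by apply: sqi_cont; exact: continuous_subspaceT.
exists phi; split=> //.
  by rewrite /phi /psi subrr normr0 mul0r subr0 max_r// subrr mulr0.
have gp : Int a b (fun x => (g x - phi x) ^+ 2) <= e / 16.
  apply: (@le_trans _ _ (n ^+ 2 * Int a b (fun x => psi x ^+ 2))).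
    have ps : itg a b (fun x => psi x ^+ 2).
      by apply: itg_cont => x; apply: cvgM; exact: psic.
    rewrite -IntZ//; apply: Int_le; [by case: (sqiB gs phis)|exact: itgZ|move=> x _].
    rewrite (_ : g x - phi x = g x * psi x); last by rewrite /phi; ring.
    rewrite exprMn ler_wpM2r ?sqr_ge0// -real_normK ?num_real// lerXn2r ?nnegrE ?(ltW n0)//.
  apply: (@le_trans _ _ (n ^+ 2 * (2 * d))).
    by rewrite ler_wpM2l ?sqr_ge0// cutoff_small.
  by rewrite le_eqVlt; apply/orP; left; apply/eqP; rewrite /d; field; rewrite gt_eqF.
have h1 := Int_sqrD (sqiB fs ts) (sqiB ts phis).
have h2 := Int_sqrD (sqiB ts gs) (sqiB gs phis).
rewrite (eq_Int (g := fun x => (f x - trunc n (f x) + (trunc n (f x) - phi x)) ^+ 2)); last first.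
  by move=> x _; congr (_ ^+ 2); ring.
rewrite (@eq_Int _ a b (fun x => (trunc n (f x) - g x + (g x - phi x)) ^+ 2) (fun x => (trunc n (f x) - phi x) ^+ 2)) in h2; last first.
  by move=> x _; congr (_ ^+ 2); ring.
lra.
Qed.

End density.

(** * Elementary inequalities of the energy estimate *)

Section algebra.
Variable R : realType.

Lemma amgm (x A D k : R) : 0 <= A -> 0 <= D -> 0 < k -> x ^+ 2 <= A * D ->
  2 * x <= k * A + D / k.
Proof.
move=> A0 D0 k0 xAD.
have kk : k * k^-1 = 1 by rewrite divff ?gt_eqF.
have xk : x ^+ 2 <= (k * A) * (D / k).
  have -> : k * A * (D / k) = A * D by field; rewrite gt_eqF.
  exact: xAD.
have kA : 0 <= k * A by rewrite mulr_ge0// ltW.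
have Dk : 0 <= D / k by rewrite divr_ge0// ltW.
set a := k * A in xk kA *; set b := D / k in xk Dk *.
have := sqr_ge0 (a - b) => ab.
have [x0|x0] := leP x 0; first by apply: le_trans (addr_ge0 kA Dk); lra.
have : (2 * x) ^+ 2 <= (a + b) ^+ 2.
  by move: ab; rewrite !expr2 in xk *; lra.
by rewrite ler_pXn2r ?nnegrE ?addr_ge0//; lra.
Qed.

Lemma shift_itv (c H t : R) : 0 <= c <= H -> 0 <= t -> 0 <= c + t <= H + t.
Proof. by move=> /andP[? ?] ?; rewrite addr_ge0//= lerD2r. Qed.

Lemma summands_le (a b c d e : R) : 0 <= a -> 0 <= b -> 0 <= c -> 0 <= d ->
  a + b + c + d <= e -> [/\ a <= e, b <= e, c <= e & d <= e].
Proof. by move=> *; split; lra. Qed.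

Lemma difference_quotient_bound (D I P L n W X e e' tau : R) : 0 <= tau ->
  e' * (2 * (W + X)) <= e ->
  `|I - L * tau| <= e' * (W + X) * tau -> `|D - P * tau| <= e' * tau * n ->
  e' * tau * n <= e' * tau * W ->
  `|P * tau - L * tau| <= e' * X * tau -> `|D - I| <= e * tau.
Proof.
move=> tau0 e'e hI hD hn hP.
have -> : D - I = D - P * tau + (P * tau - L * tau) - (I - L * tau) by ring.
apply: (le_trans (ler_normB _ _)); apply: (@le_trans _ _ (e' * (2 * (W + X)) * tau)).
  have := ler_normD (D - P * tau) (P * tau - L * tau); lra.
by rewrite ler_wpM2r.
Qed.

Lemma complete_squares (e C C' E Y P Q U V RHS : R) :
  E - (2 * P - U) <= C * e -> Y - (2 * Q - V) <= C' * e ->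
  2 * (P + Q) - (V + U) <= RHS -> E + Y <= RHS + e * (C + C').
Proof. by move=> *; lra. Qed.

Lemma duality_balance (d P A G S W1 W2 : R) : 0 < d ->
  2 * P <= (1 + d) * A + W1 / (1 + d) -> 2 * G <= (1 + d) * S + W2 / (1 + d) ->
  forall Q F, 2 * Q <= (1 + d^-1) * F + (W1 + W2) / (1 + d^-1) ->
  2 * (P + G + Q) - (W1 + W2) <= (1 + d) * (A + S) + (1 + d^-1) * F.
Proof.
move=> d0 a1 a2 Q F a3.
have e1 : (W1 + W2) / (1 + d) + (W1 + W2) / (1 + d^-1) = W1 + W2.
  by field; rewrite ?gt_eqF//; lra.
rewrite mulrDl in e1; lra.
Qed.

(** The last hypothesis is the energy inequality on a short interval, in which
    rho tau separates the source from the rest.  Expanded to first order in the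
    length tau, it yields the infinitesimal inequality up to an error of order
    e, provided that the energy stays within e1 of E0. *)
Lemma energy_step (gam rho G tau e e1 E0 Es Et IE Y X Z YY FF : R) :
  0 <= gam -> 0 < rho -> 0 <= G -> 0 < tau -> tau <= 1 ->
  tau * (gam + 1 + rho * G + 2 * (gam ^+ 2 + rho * gam ^+ 2 + rho * gam) * (E0 + 1)) <= e ->
  `|rho - gam| * (2 * e1) <= e / 2 -> e1 <= 1 ->
  `|IE - E0 * tau| <= e1 * tau -> `|Es - E0| <= e1 -> 0 <= Es -> 0 <= E0 ->
  0 <= Y -> 0 <= X -> 0 <= Z -> (1 - gam * tau) * Y <= YY -> FF <= tau * Z ->
  Et + YY <= (1 + rho * tau) * (expR (- (gam * tau)) * Es + G * X) +
             (1 + (rho * tau)^-1) * FF ->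
  Et - Es - ((rho - gam) * IE + G * X + rho^-1 * Z - Y) <= e * (tau + Y + X + Z).
Proof.
move=> gam0 rho0 G0 taup taud taue e1e e11 IEb Esb Es0 E00 Y0 X0 Z0 yl Fc Hs.
have tau0 := ltW taup.
have rt0 : 0 < rho * tau by rewrite mulr_gt0.
pose c1 := `|rho - gam|.
have c10 : 0 <= c1 by exact: normr_ge0.
pose c2 := gam ^+ 2 + rho * gam ^+ 2 + rho * gam.
have c20 : 0 <= c2 by rewrite /c2 !addr_ge0 ?mulr_ge0 ?sqr_ge0// ltW.
have Fc' : (1 + (rho * tau)^-1) * FF <= (tau + rho^-1) * Z.
  apply: (@le_trans _ _ ((1 + (rho * tau)^-1) * (tau * Z))).
    by rewrite ler_wpM2l// addr_ge0// invr_ge0 ltW.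
  rewrite le_eqVlt; apply/orP; left; apply/eqP; field.
  by rewrite !gt_eqF.
pose x := gam * tau.
have x0 : 0 <= x by rewrite mulr_ge0.
have ex : expR (- x) <= 1 - x + x ^+ 2.
  rewrite expRN -[leLHS]mul1r ler_pdivrMr ?expR_gt0//.
  apply: (@le_trans _ _ ((1 - x + x ^+ 2) * (1 + x))).
    rewrite (_ : (1 - x + x ^+ 2) * (1 + x) = 1 + x ^+ 3); last by ring.
    by rewrite lerDl exprn_ge0.
  rewrite ler_wpM2l ?expR_ge1Dx//.
  have := sqr_ge0 (x - 2^-1); rewrite !expr2; lra.
have h1 : (1 + rho * tau) * (expR (- x) * Es) <=
   Es + (rho - gam) * tau * Es + c2 * tau * tau * (E0 + 1).
  apply: (@le_trans _ _ ((1 + rho * tau) * ((1 - x + x ^+ 2) * Es))).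
    rewrite ler_wpM2l; [by []|by rewrite addr_ge0// ltW|].
    by rewrite ler_wpM2r.
  have -> : (1 + rho * tau) * ((1 - x + x ^+ 2) * Es) =
     Es + (rho - gam) * tau * Es +
     (gam ^+ 2 - rho * gam + rho * gam ^+ 2 * tau) * (tau * tau * Es).
    by rewrite /x; ring.
  rewrite lerD2l -[c2 * tau * tau]mulrA -[leRHS]mulrA.
  have ES : Es <= E0 + 1 by move: Esb; rewrite ler_norml => /andP[]; lra.
  have TT : 0 <= tau * tau by rewrite mulr_ge0.
  apply: (@le_trans _ _ (c2 * (tau * tau * Es))).
    rewrite ler_wpM2r ?mulr_ge0// /c2.
    have : 0 <= rho * gam by rewrite mulr_ge0// ltW.
    have : rho * gam ^+ 2 * tau <= rho * gam ^+ 2 by rewrite ler_piMr// mulr_ge0 ?sqr_ge0// ltW.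
    by lra.
  by rewrite ler_wpM2l// ler_wpM2l.
have h2 : (rho - gam) * tau * Es - (rho - gam) * IE <= c1 * (2 * e1) * tau.
  rewrite -mulrA -mulrBr -[leRHS]mulrA.
  apply: (le_trans (ler_norm _)); rewrite normrM ler_wpM2l//.
  rewrite (_ : _ - _ = tau * (Es - E0) - (IE - E0 * tau)); last by ring.
  rewrite (le_trans (ler_normB _ _))// normrM (ger0_norm tau0).
  have : tau * `|Es - E0| <= tau * e1 by rewrite ler_wpM2l.
  by lra.
have h3 : c1 * (2 * e1) * tau <= e / 2 * tau by rewrite ler_wpM2r.
have TN : tau * gam + tau + tau * (rho * G) + 2 * (tau * (c2 * (E0 + 1))) <= e.
  by move: taue; rewrite -/c2; lra.
have p1 : 0 <= tau * gam by rewrite mulr_ge0.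
have p2 : 0 <= tau * (rho * G) by rewrite !mulr_ge0// ltW.
have p3 : 0 <= tau * (c2 * (E0 + 1)) by rewrite !mulr_ge0// addr_ge0.
have [q1 q2 q3 q4] := summands_le p1 tau0 p2 (mulr_ge0 (ler0n _ 2) p3) TN.
have h4 : tau * (c2 * (E0 + 1)) * tau <= e / 2 * tau.
  by rewrite ler_wpM2r// ler_pdivlMr// mulrC.
have h5 : tau * gam * Y <= e * Y by rewrite ler_wpM2r.
have h6 : tau * (rho * G) * X <= e * X by rewrite ler_wpM2r.
have h7 : tau * Z <= e * Z by rewrite ler_wpM2r.
rewrite -/x in Hs.
have Hs' : Et + (1 - gam * tau) * Y <=
   Es + (rho - gam) * tau * Es + c2 * tau * tau * (E0 + 1) +
   (1 + rho * tau) * (G * X) + (tau + rho^-1) * Z.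
  apply: (le_trans (lerD (lexx _) yl)); apply: (le_trans Hs).
  by rewrite mulrDr; apply: lerD => //; rewrite lerD2r.
lra.
Qed.

End algebra.

(** * The energy inequality for transport equations, by duality *)

Section transport.
(** In the application p = 1 / a for the speed a, h is the travel time from x
    to the outflow boundary, hi its inverse and H the travel time across
    [0, 1]; hsub is the change of variables s = h x. *)
Variables (R : realType) (p h hi : R -> R) (H gam : R).
Hypothesis H0 : 0 <= H.
Hypothesis gam0 : 0 <= gam.
Hypothesis pc : {within `[0, 1], continuous p}.
Hypothesis p0 : forall x, 0 <= x <= 1 -> 0 < p x.
Hypothesis hc : {within `[0, 1], continuous h}.
Hypothesis h01 : forall x, 0 <= x <= 1 -> 0 <= h x <= H.
Hypothesis hic : continuous hi.
Hypothesis hiK : forall x, 0 <= x <= 1 -> hi (h x) = x.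
Hypothesis hsub : forall f : R -> R, continuous f ->
  Int 0 1 (fun x => f (h x) * p x) = Int 0 H f.

Implicit Types (w chi f g y F : R -> R) (a b c e k s t r x : R).

(** As s varies, the functions chi (h x + s) p x solve the adjoint transport
    equation. *)
Definition pair w chi s : R := Int 0 1 (fun x => w x * (chi (h x + s) * p x)).
Definition Ew w : R := Int 0 1 (fun x => expR (gam * h x) * p x * w x ^+ 2).
Definition n1 w : R := Int 0 1 (fun x => `|w x| * p x).

Lemma test_cont chi s : continuous chi ->
  {within `[0, 1], continuous (fun x => chi (h x + s) * p x)}.
Proof.
move=> cc; apply: withinM => //.
by apply: (@within_compo _ h (fun x => chi (x + s))) => //; exact: contDr.
Qed.

Lemma pair_itg w chi s : sqi 0 1 w -> continuous chi ->
  itg 0 1 (fun x => w x * (chi (h x + s) * p x)).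
Proof. by move=> ws cc; apply: itg_cMr; [exact: test_cont|exact: sqi_itg]. Qed.

Lemma n1_itg w : sqi 0 1 w -> itg 0 1 (fun x => `|w x| * p x).
Proof. by move=> ws; apply: itg_cMr => //; apply: itg_norm; exact: sqi_itg. Qed.

Lemma n1_ge0 w : 0 <= n1 w.
Proof. by apply: Int_ge0 => x xab; rewrite mulr_ge0// ltW// p0. Qed.

Lemma n1_bound w chi s e : sqi 0 1 w -> continuous chi ->
  (forall x, 0 <= x <= 1 -> `|chi (h x + s)| <= e) -> `|pair w chi s| <= e * n1 w.
Proof.
move=> ws cc ce; have pi := pair_itg s ws cc.
apply: (le_trans (Int_norm pi)); rewrite -IntZ; last exact: n1_itg.
apply: Int_le; [exact: itg_norm|apply: itgZ; exact: n1_itg|move=> x xab].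
rewrite !normrM (ger0_norm (ltW (p0 xab))) mulrCA.
by rewrite ler_wpM2r ?ce// mulr_ge0// ltW// p0.
Qed.

Lemma pairBl w1 w2 chi s : sqi 0 1 w1 -> sqi 0 1 w2 -> continuous chi ->
  pair w1 chi s - pair w2 chi s = pair (fun x => w1 x - w2 x) chi s.
Proof.
move=> s1 s2 cc; rewrite /pair -IntB; [|exact: pair_itg|exact: pair_itg].
by apply: eq_Int => x _; ring.
Qed.

Lemma pairBr w chi1 chi2 s1 s2 e : sqi 0 1 w -> continuous chi1 -> continuous chi2 ->
  (forall x, 0 <= x <= 1 -> `|chi1 (h x + s1) - chi2 (h x + s2)| <= e) ->
  `|pair w chi1 s1 - pair w chi2 s2| <= e * n1 w.
Proof.
move=> ws c1 c2 ce.
have -> : pair w chi1 s1 - pair w chi2 s2 =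
    pair w (fun r => chi1 (r + s1) - chi2 (r + s2)) 0.
  rewrite /pair -IntB; [|exact: pair_itg|exact: pair_itg].
  by apply: eq_Int => x _; rewrite addr0; ring.
apply: n1_bound => //.
  by move=> x; apply: (@cvgB _ R^o); exact: contDr.
by move=> x xab; rewrite addr0 ce.
Qed.

Lemma Int_p : Int 0 1 p = H.
Proof.
transitivity (Int 0 1 (fun x => (fun=> 1 : R) (h x) * p x)); last rewrite (hsub (f := fun=> 1)).
- by apply: eq_Int => x _; rewrite mul1r.
- by rewrite Int_cst ?mul1r ?subr0.
- by move=> x; exact: cvg_cst.
Qed.

Lemma Ewt_cont : {within `[0, 1], continuous (fun x => expR (gam * h x) * p x)}.
Proof.
apply: withinM => //; apply: (@within_compo _ h (fun x => expR (gam * x))) => // x.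
apply: continuous_comp; last exact: continuous_expR.
by apply: cvgM; [exact: cvg_cst|exact: cvg_id].
Qed.

Lemma Ew_itg w : sqi 0 1 w -> itg 0 1 (fun x => expR (gam * h x) * p x * w x ^+ 2).
Proof. by move=> [_ ?]; apply: itg_cM => //; exact: Ewt_cont. Qed.

Lemma wt_ge0 x : 0 <= x <= 1 -> 0 <= expR (gam * h x) * p x.
Proof. by move=> xab; rewrite mulr_ge0 ?expR_ge0// ltW// p0. Qed.

Lemma Ew_ge0 w : 0 <= Ew w.
Proof. by apply: Int_ge0 => x xab; rewrite mulr_ge0 ?sqr_ge0// wt_ge0. Qed.

(** Duality between Ew and the integral of chi^2 with the inverse weight: the
    window [s, s + H] slides along the values of chi as s grows. *)
Lemma pair_le w chi s : sqi 0 1 w -> continuous chi ->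
  pair w chi s ^+ 2 <= Ew w * Int s (s + H) (fun r => expR (gam * (s - r)) * chi r ^+ 2).
Proof.
move=> ws cc.
pose th r := expR (- (gam * r)) * chi (r + s) ^+ 2.
have cth : continuous th.
  move=> r; apply: cvgM.
    apply: continuous_comp; last exact: continuous_expR.
    by apply: cvgN; apply: cvgM; [exact: cvg_cst|exact: cvg_id].
  by apply: cvgM; exact: contDr.
have -> : Int s (s + H) (fun r => expR (gam * (s - r)) * chi r ^+ 2) =
    Int 0 1 (fun x => th (h x) * p x).
  rewrite hsub//.
  transitivity (Int (0 + s) (H + s) (fun r => expR (gam * (s - r)) * chi r ^+ 2)).
    by rewrite add0r addrC.
  transitivity (Int 0 H (fun r => expR (gam * (s - (r + s))) * chi (r + s) ^+ 2)); last first.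
    by apply: eq_Int => r _; rewrite /th; congr (expR _ * _); ring.
  symmetry; apply: (@Int_shift _ (fun r => expR (gam * (s - r)) * chi r ^+ 2) s 0 H) => //.
  move=> r; apply: cvgM; last by apply: cvgM; exact: cc.
  apply: continuous_comp; last exact: continuous_expR.
  apply: cvgM; first exact: cvg_cst.
  by apply: cvgB; [exact: cvg_cst|exact: cvg_id].
apply: CSgen.
- exact: Ew_itg.
- exact: pair_itg.
- apply: itg_within; apply: withinM => //; exact: within_compo.
move=> x xab; have px := p0 xab; split.
- by rewrite mulr_ge0 ?sqr_ge0// wt_ge0.
- by rewrite /th mulr_ge0 ?(ltW px)// mulr_ge0 ?expR_ge0 ?sqr_ge0.
- rewrite /th; have E1 : expR (gam * h x) * expR (- (gam * h x)) = 1.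
    by rewrite -expRD subrr expR0.
  rewrite -subr_ge0.
  rewrite (_ : _ - _ = (expR (gam * h x) * expR (- (gam * h x)) - 1) * (p x ^+ 2 * w x ^+ 2 * chi (h x + s) ^+ 2)); last by ring.
  by rewrite E1 subrr mul0r.
Qed.

Lemma n1_le w : sqi 0 1 w -> n1 w ^+ 2 <= Ew w * H.
Proof.
move=> ws; rewrite -Int_p; apply: CSgen.
- exact: Ew_itg.
- exact: n1_itg.
- exact: itg_within.
move=> x xab; have px := p0 xab; split.
- by rewrite mulr_ge0 ?sqr_ge0// wt_ge0.
- exact: ltW.
rewrite exprMn real_normK ?num_real//.
rewrite (_ : _ * p x * _ * p x = expR (gam * h x) * (w x ^+ 2 * p x ^+ 2)); last by ring.
rewrite ler_peMl//; first by rewrite mulr_ge0 ?sqr_ge0.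
have : 0 <= gam * h x by rewrite mulr_ge0//; case/andP: (h01 xab).
by have := expR_ge1Dx (gam * h x); lra.
Qed.

(** Sources are bounded in energy only; this is what makes them harmless when
    tested against small functions. *)
Lemma n1_sqrt w (F : R) : sqi 0 1 w -> 0 <= F -> Ew w <= F ^+ 2 -> n1 w <= Num.sqrt H * F.
Proof.
move=> ws F0 EF; rewrite -(ger0_norm (n1_ge0 w)) -sqrtr_sqr.
rewrite -[X in _ * X](ger0_norm F0) -(sqrtr_sqr F) -sqrtrM// ler_wsqrtr//.
by rewrite (le_trans (n1_le ws))// mulrC ler_wpM2l.
Qed.

Lemma chi_cl2 chi : continuous chi -> cl2 (fun r x => chi (h x + r) * p x).
Proof.
move=> cc; split=> [t _|t0 t00 e e0].
  by apply: sqi_cont; exact: test_cont.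
have [C C0 pC] := within_bounded pc.
pose e' := Num.min 1 (e / (C ^+ 2 + 1)).
have C1 : 0 < C ^+ 2 + 1 by rewrite ltr_wpDl// sqr_ge0.
have e'0 : 0 < e' by rewrite lt_min ltr01 divr_gt0.
have e'1 : e' <= 1 by rewrite ge_min lexx.
have [d d0 dP] := heineR t0 (H + t0) cc e'0.
exists d => // t _ td.
have cD : {within `[0, 1], continuous (fun x => chi (h x + t) * p x - chi (h x + t0) * p x)}.
  by apply: withinB; exact: test_cont.
apply: (@le_lt_trans _ _ (Int 0 1 (fun=> e' * C ^+ 2))).
  apply: Int_le; [|exact: itg_cst|].
    by have [] := sqi_cont cD.
  move=> x xab; rewrite -mulrBl exprMn -(real_normK (num_real (p x))).
  apply: ler_pM; rewrite ?sqr_ge0//; last by rewrite lerXn2r ?nnegrE ?pC.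
  rewrite -real_normK ?num_real// distrC.
  have : `|chi (h x + t0) - chi (h x + t)| < e'.
    apply: dP; first by have := h01 xab; lra.
    by rewrite (_ : _ - _ = t0 - t) 1?distrC//; ring.
  by move=> he; rewrite expr2 (le_trans (ler_pM _ _ (ltW he) (ltW he)))// ger_pMl.
rewrite Int_cst// subr0 mulr1.
apply: (@le_lt_trans _ _ (e / (C ^+ 2 + 1) * C ^+ 2)).
  by rewrite ler_wpM2r ?sqr_ge0// ge_min lexx orbT.
by rewrite mulrAC ltr_pdivrMr// ltr_pM2l// ltrDl.
Qed.

(** Sources need not be continuous in time, as they contain boundary traces;
    they are only tested against continuous curves.  F bounds their energy norm
    and is square integrable in time. *)
Record source (f : R -> R -> R) (F : R -> R) : Prop := Source {
  source_sqi : forall r, 0 <= r -> sqi 0 1 (f r);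
  source_itg : forall phi s t, cl2 phi -> 0 <= s -> s <= t ->
     itg s t (fun r => Int 0 1 (fun x => f r x * phi r x));
  source_tl2 : forall t, 0 <= t -> sqi 0 t F;
  source_ge0 : forall r, 0 <= r -> 0 <= F r;
  source_le : forall r, 0 <= r -> Ew (f r) <= F r ^+ 2 }.

Definition tl2 (g : R -> R) : Prop := forall t, 0 <= t -> sqi 0 t g.

Lemma tl2_sqi g s t : 0 <= s -> s <= t -> tl2 g -> sqi s t g.
Proof. by move=> s0 st /(_ t (le_trans s0 st)); exact: sqi_sub. Qed.

Section identity.
Variables (w f : R -> R -> R) (F g y : R -> R) (full : bool).
Hypothesis wc : cl2 w.
Hypothesis fF : source f F.
Hypothesis g2 : tl2 g.
Hypothesis y2 : tl2 y.

(** The weak equation tested against chi (h x + s0) p x for a fixed s0; y is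
    the outflow trace.  When full fails, only test functions that vanish at the
    outflow boundary, where h = 0, are allowed. *)
Definition weak_transport : Prop := forall chi chi' : R -> R,
  C1p chi chi' -> continuous chi -> forall s0 s t, 0 <= s0 -> 0 <= s -> s <= t ->
  full \/ chi s0 = 0 ->
  pair (w t) chi s0 - pair (w s) chi s0 =
  Int s t (fun r => g r * chi (H + s0) - y r * chi s0 +
                    (pair (f r) chi s0 - pair (w r) chi' s0)).

Hypothesis weak : weak_transport.

Lemma n1_diff t0 e : 0 <= t0 -> 0 < e -> exists2 d, 0 < d &
  forall t, 0 <= t -> `|t - t0| < d -> n1 (fun x => w t x - w t0 x) <= e.
Proof.
move=> t00 e0; have [C C0 pC] := within_bounded pc.
have e'0 : 0 < e ^+ 2 / (C ^+ 2 + 1) by rewrite divr_gt0 ?exprn_gt0// ltr_wpDl// sqr_ge0.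
have [d d0 dP] := wc.2 t0 t00 _ e'0; exists d => // t t0' /(dP t t0') hd.
have ws : sqi 0 1 (fun x => w t x - w t0 x) by apply: sqiB; exact: cl2_sqi.
have : n1 (fun x => w t x - w t0 x) ^+ 2 <= e ^+ 2.
  have := cauchy_schwarz (sqi_norm ws) (sqi_cont pc).
  move=> /le_trans; apply.
  rewrite (eq_Int (g := fun x => (w t x - w t0 x) ^+ 2)); last first.
    by move=> x _; rewrite real_normK ?num_real.
  apply: (@le_trans _ _ (e ^+ 2 / (C ^+ 2 + 1) * C ^+ 2)).
    apply: ler_pM; [by apply: Int_ge0 => x _; exact: sqr_ge0|
      by apply: Int_ge0 => x _; exact: sqr_ge0|exact: ltW|].
    rewrite (_ : C ^+ 2 = C ^+ 2 * (1 - 0)); last by rewrite subr0 mulr1.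
    rewrite -Int_cst//; apply: Int_le; [by case: (sqi_cont pc)|exact: itg_cst|].
    by move=> x xab; rewrite -(real_normK (num_real (p x))) lerXn2r ?nnegrE ?pC.
  rewrite mulrAC ler_pdivrMr ?ltr_wpDl ?sqr_ge0// ler_wpM2l ?sqr_ge0// lerDl//.
by rewrite ler_pXn2r ?nnegrE ?n1_ge0 ?(ltW e0).
Qed.

Lemma source_pair_itg chi a b : continuous chi -> 0 <= a -> a <= b ->
  itg a b (fun r => pair (f r) chi r).
Proof. by move=> cc a0 ab; apply: (source_itg fF) => //; exact: chi_cl2. Qed.

Lemma source_pair_itg0 chi s a b : continuous chi -> 0 <= a -> a <= b ->
  itg a b (fun r => pair (f r) chi s).
Proof.
move=> cc a0 ab; apply: (source_itg fF (phi := fun _ x => chi (h x + s) * p x)) => //.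
by apply: cl2_cst; apply: sqi_cont; exact: test_cont.
Qed.

Lemma flux_itg chi a b : continuous chi -> 0 <= a -> a <= b ->
  itg a b (fun r => g r * chi (H + r) - y r * chi r + pair (f r) chi r).
Proof.
move=> cc a0 ab; apply: itgD; last exact: source_pair_itg.
apply: itgB; apply: itg_cMr.
- apply: continuous_subspaceT => x; apply: (@continuous_comp _ _ _ (fun x => H + x) chi); last exact: cc.
  by apply: cvgD; [exact: cvg_cst|exact: cvg_id].
- by apply: sqi_itg; exact: tl2_sqi.
- exact: continuous_subspaceT.
- by apply: sqi_itg; exact: tl2_sqi.
Qed.

(** To first order, moving the test function from s to t adds
    the pairing with its derivative, for which the weak equation at fixed s0 has the
    opposite term. *)
Lemma pair_step chi chi' t0 e : C1p chi chi' -> continuous chi -> 0 <= t0 -> 0 < e ->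
  exists2 d, 0 < d & forall s t, 0 <= s <= t0 -> t0 <= t -> t0 - d < s -> t < t0 + d ->
  `|pair (w t) chi t - pair (w t) chi s - Int s t (fun r => pair (w r) chi' s)| <=
  e * (t - s).
Proof.
move=> [dchi cchi'] cchi t00 e0.
pose W0 := n1 (w t0).
have W00 : 0 <= W0 by exact: n1_ge0.
have [X X0 HX] := @within_bounded _ 0 (H + t0) chi' (continuous_subspaceT cchi').
have Y0 : 0 < 2 * (W0 + 1 + X) by lra.
pose e' := Num.min 1 (e / (2 * (W0 + 1 + X))).
have e'0 : 0 < e' by rewrite lt_min ltr01 divr_gt0.
have e'1 : e' <= 1 by rewrite ge_min lexx.
have e'e : e' * (2 * (W0 + 1 + X)) <= e.
  by rewrite -ler_pdivlMr// ge_min lexx orbT.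
have [d1 d10 D1] := heineR 0 (H + t0) cchi' e'0.
have [d2 d20 D2] := n1_diff t00 e'0.
exists (Num.min d1 d2); first by rewrite lt_min d10.
move=> s t /andP[s0 st0] t0t sgt tlt.
have m1 : Num.min d1 d2 <= d1 by rewrite ge_min lexx.
have m2 : Num.min d1 d2 <= d2 by rewrite ge_min lexx orbT.
have st : s <= t by exact: le_trans t0t.
pose L := pair (w t0) chi' t0.
have near1 r : s <= r <= t -> 0 <= r /\ `|r - t0| < d1 by exact: near_window m1 s0 sgt tlt.
have nr r : s <= r <= t -> n1 (fun x => w r x - w t0 x) <= e'.
  by move=> /(near_window m2 s0 sgt tlt)[r0 rt]; exact: D2.
have nW r : s <= r <= t -> n1 (w r) <= W0 + 1.
  move=> srt; have [r0 _] := near1 r srt.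
  apply: (@le_trans _ _ (n1 (w t0) + n1 (fun x => w r x - w t0 x))).
    have s1 := cl2_sqi wc r0; have s2 := cl2_sqi wc t00.
    rewrite /n1 -IntD; [|exact: n1_itg|by apply: n1_itg; exact: sqiB].
    apply: Int_le; [exact: n1_itg|by apply: itgD; apply: n1_itg => //; exact: sqiB|].
    move=> x xab; rewrite -mulrDl ler_wpM2r ?(ltW (p0 xab))//.
    by rewrite {1}(_ : w r x = w t0 x + (w r x - w t0 x)) ?ler_normD//; ring.
  by rewrite lerD2l (le_trans (nr r srt)).
have Lr r : s <= r <= t -> forall s', s <= s' <= t -> `|pair (w r) chi' s' - L| <= e' * (W0 + 1 + X).
  move=> srt s' ss't; have [r0 _] := near1 r srt.
  have s1 := cl2_sqi wc r0; have s2 := cl2_sqi wc t00.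
  rewrite (_ : _ - L = (pair (w r) chi' s' - pair (w r) chi' t0) + (pair (w r) chi' t0 - L)); last by ring.
  rewrite (le_trans (ler_normD _ _))// mulrDr; apply: lerD.
    apply: (@le_trans _ _ (e' * n1 (w r))); last by rewrite ler_wpM2l ?nW// ltW.
    apply: pairBr => // x xab; rewrite distrC ltW// D1//; first exact/shift_itv/t00/h01.
    by rewrite opprD addrACA subrr add0r distrC; case: (near1 s' ss't).
  rewrite /L pairBl//; apply: (@le_trans _ _ (X * n1 (fun x => w r x - w t0 x))).
    by apply: n1_bound => //; [exact: sqiB|move=> x xab; apply: HX; exact/shift_itv/t00/h01].
  by rewrite mulrC ler_wpM2r// nr.
have I1 : `|Int s t (fun r => pair (w r) chi' s) - L * (t - s)| <= e' * (W0 + 1 + X) * (t - s).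
  apply: Int_near_cst => //.
    apply: cont0_itg => //; apply: cl2_pair => //; apply: cl2_cst.
    by apply: sqi_cont; exact: test_cont.
  by move=> r srt; apply: Lr => //; rewrite lexx.
have tt : 0 <= t by exact: le_trans t0t.
have I2 : `|pair (w t) chi t - pair (w t) chi s - pair (w t) chi' t0 * (t - s)| <= e' * (t - s) * n1 (w t).
  pose ch r := chi (r + t) - chi (r + s) - chi' (r + t0) * (t - s).
  have cch : continuous ch.
    move=> r; apply: (@cvgB _ R^o); first by apply: (@cvgB _ R^o); exact: contDr.
    by apply: cvgM; [exact: contDr|exact: cvg_cst].
  have -> : pair (w t) chi t - pair (w t) chi s - pair (w t) chi' t0 * (t - s) = pair (w t) ch 0.
    have ws := cl2_sqi wc tt.
    rewrite /pair -IntZr; last exact: pair_itg.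
    rewrite -!IntB; try exact: pair_itg; last 2 first.
    - by apply: itgB; exact: pair_itg.
    - by apply: itgZr; exact: pair_itg.
    by apply: eq_Int => x _; rewrite /ch !addr0; ring.
  apply: n1_bound => //; first exact: cl2_sqi.
  move=> x xab; rewrite addr0 /ch; have hx := h01 xab.
  have [||c] := @MVT_segment _ chi chi' (h x + s) (h x + t) _ _ (continuous_subspaceT cchi).
  - by rewrite lerD2l.
  - move=> r; rewrite in_itv/= => /andP[hr _]; apply: dchi.
    apply: (lt_le_trans (ltrN10 R)); apply: le_trans (ltW hr).
    by rewrite addr_ge0//; case/andP: hx.
  rewrite in_itv/= => cab ->.
  rewrite (_ : _ - _ = (chi' c - chi' (h x + t0)) * (t - s)); last by ring.
  rewrite normrM [X in _ * X]ger0_norm ?subr_ge0// ler_wpM2r ?subr_ge0// distrC ltW// D1//; first exact: shift_itv.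
  rewrite (_ : _ - c = t0 - (c - h x)) 1?distrC; last by ring.
  by case: (near1 (c - h x)) => //; rewrite lerBrDl lerBlDl.
have I3 : `|pair (w t) chi' t0 * (t - s) - L * (t - s)| <= e' * X * (t - s).
  rewrite -mulrBl normrM (ger0_norm (_ : 0 <= t - s)) ?subr_ge0// ler_wpM2r ?subr_ge0//.
  have s1 := cl2_sqi wc tt; have s2 := cl2_sqi wc t00.
  rewrite /L pairBl//; apply: (@le_trans _ _ (X * n1 (fun x => w t x - w t0 x))).
    by apply: n1_bound => //; [exact: sqiB|move=> x xab; apply: HX; exact/shift_itv/t00/h01].
  by rewrite mulrC ler_wpM2r// nr// lexx st.
have I2' : e' * (t - s) * n1 (w t) <= e' * (t - s) * (W0 + 1).
  by rewrite ler_wpM2l ?mulr_ge0 ?subr_ge0 ?(ltW e'0)// nW// lexx st.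
by apply: (difference_quotient_bound _ e'e I1 I2 I2' I3); rewrite subr_ge0.
Qed.

(** Hence the weak equation for the moving test function, up to e times a fixed
    integrable density. *)
Lemma identity_local chi chi' t0 e : C1p chi chi' -> continuous chi -> 0 <= t0 -> 0 < e ->
  exists2 d, 0 < d & forall s t, 0 <= s <= t0 -> t0 <= t -> t0 - d < s -> t < t0 + d ->
  full \/ chi s = 0 ->
  `|pair (w t) chi t - pair (w s) chi s -
     Int s t (fun r => g r * chi (H + r) - y r * chi r + pair (f r) chi r)| <=
  e * Int s t (fun r => 1 + `|g r| + `|y r| + Num.sqrt H * F r).
Proof.
move=> dchi cchi t00 e0.
have [d1 d10 D1] := heineR 0 (H + t0) cchi e0.
have [d2 d20 D2] := pair_step dchi cchi t00 e0.
exists (Num.min (d1 / 2) d2); first by rewrite lt_min d20 divr_gt0.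
move=> s t /andP[s0 st0] t0t sgt tlt fs.
have m1 : Num.min (d1 / 2) d2 <= d1 / 2 by rewrite ge_min lexx.
have m2 : Num.min (d1 / 2) d2 <= d2 by rewrite ge_min lexx orbT.
have st : s <= t by exact: le_trans t0t.
have := D2 s t; rewrite s0 st0 => /(_ isT t0t).
have -> : t0 - d2 < s by lra.
have -> : t < t0 + d2 by lra.
move=> /(_ isT isT) H2.
have gi : itg s t g by apply: sqi_itg; exact: tl2_sqi.
have yi : itg s t y by apply: sqi_itg; exact: tl2_sqi.
have Fi : itg s t F by apply: sqi_itg; exact: tl2_sqi (source_tl2 fF).
have fi1 : itg s t (fun r => pair (f r) chi s) by exact: source_pair_itg0.
have Gi := flux_itg cchi s0 st.
have wi : itg s t (fun r => pair (w r) (chi') s).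
  apply: cont0_itg => //; apply: cl2_pair => //; apply: cl2_cst.
  by apply: sqi_cont; apply: test_cont; case: dchi.
have Gi1 : itg s t (fun r => g r * chi (H + s) - y r * chi s + pair (f r) chi s).
  by apply: itgD => //; apply: itgB; exact: itgZr.
have := weak dchi cchi s0 s0 st fs.
rewrite (eq_Int (g := fun r => (g r * chi (H + s) - y r * chi s + pair (f r) chi s) - pair (w r) chi' s)); last first.
  by move=> r _; ring.
rewrite IntB// => Hw.
have Hd : `|Int s t (fun r => g r * chi (H + s) - y r * chi s + pair (f r) chi s) -
    Int s t (fun r => g r * chi (H + r) - y r * chi r + pair (f r) chi r)| <=
    e * Int s t (fun r => `|g r| + `|y r| + Num.sqrt H * F r).
  rewrite -IntB//; apply: (le_trans (Int_norm (itgB Gi1 Gi))).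
  have Ki : itg s t (fun r => `|g r| + `|y r| + Num.sqrt H * F r).
    by apply: itgD; [apply: itgD; exact: itg_norm|exact: itgZ].
  rewrite -IntZ//.
  apply: Int_le; [by apply: itg_norm; exact: itgB|exact: itgZ|move=> r /andP[sr rt]].
  have r0 : 0 <= r by exact: le_trans sr.
  have near1 c : 0 <= c <= H -> `|chi (c + s) - chi (c + r)| <= e.
    move=> cH; apply/ltW/D1.
      by have /andP[-> cs] := shift_itv cH s0; rewrite (le_trans cs)// lerD2l.
    rewrite (_ : _ - _ = s - r); last by ring.
    by apply: (narrow_window m1 sgt tlt); rewrite ?lexx ?sr.
  rewrite (_ : _ - _ = g r * (chi (H + s) - chi (H + r)) - y r * (chi (0 + s) - chi (0 + r))
     + (pair (f r) chi s - pair (f r) chi r)); last by rewrite !add0r; ring.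
  rewrite (le_trans (ler_normD _ _))// [leRHS]mulrDr; apply: lerD.
    rewrite (le_trans (ler_normB _ _))// !normrM [leRHS]mulrDr ![e * _]mulrC.
    by apply: lerD; apply: ler_wpM2l => //; apply: near1; rewrite ?lexx ?H0.
  have fs' := source_sqi fF r0.
  apply: (@le_trans _ _ (e * n1 (f r))).
    by apply: pairBr => // x xab; apply: near1; exact: h01.
  rewrite ler_wpM2l ?(ltW e0)//; apply: n1_sqrt => //; first exact: (source_ge0 fF).
  exact: (source_le fF).
have -> : Int s t (fun r => 1 + `|g r| + `|y r| + Num.sqrt H * F r) =
   (t - s) + Int s t (fun r => `|g r| + `|y r| + Num.sqrt H * F r).
  rewrite -[t - s]mul1r -Int_cst// -IntD; last 2 first.
  - exact: itg_cst.
  - by apply: itgD; [apply: itgD; exact: itg_norm|exact: itgZ].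
  by apply: eq_Int => r _; rewrite !addrA.
rewrite mulrDr.
move: Hw H2 Hd; set A := pair _ _ _; set B := pair _ _ _; set C := pair _ _ _.
set I1 := Int _ _ _; set I2 := Int _ _ _; set I3 := Int _ _ _; set I4 := Int _ _ _.
move=> Hw H2 Hd.
have -> : C - B - I3 = (C - A - I2) + (I1 - I3) by rewrite -(subKr A B) Hw; ring.
by rewrite (le_trans (ler_normD _ _))// lerD.
Qed.

Lemma Int_diff f0 a b c : a <= b -> b <= c -> itg a c f0 ->
  Int a c f0 - Int a b f0 = Int b c f0.
Proof. by move=> ab bc fi; rewrite (Int_cat ab bc fi) addrAC subrr add0r. Qed.

Lemma rate_itg s t : 0 <= s -> s <= t ->
  itg s t (fun r => 1 + `|g r| + `|y r| + Num.sqrt H * F r).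
Proof.
move=> s0 st.
apply: itgD; last by apply: itgZ; apply: sqi_itg; exact: tl2_sqi (source_tl2 fF).
apply: itgD; last by apply: itg_norm; apply: sqi_itg; exact: tl2_sqi.
by apply: itgD; [exact: itg_cst|apply: itg_norm; apply: sqi_itg; exact: tl2_sqi].
Qed.

Lemma identity_C1 chi chi' t1 t2 : C1p chi chi' -> continuous chi -> 0 <= t1 -> t1 <= t2 ->
  (forall s, t1 <= s <= t2 -> full \/ chi s = 0) ->
  pair (w t2) chi t2 - pair (w t1) chi t1 =
  Int t1 t2 (fun r => g r * chi (H + r) - y r * chi r + pair (f r) chi r).
Proof.
move=> dchi cchi t10 t12 fs.
pose G r := g r * chi (H + r) - y r * chi r + pair (f r) chi r.
pose K r := 1 + `|g r| + `|y r| + Num.sqrt H * F r.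
pose Psi t := pair (w t) chi t - Int t1 t G.
have Gi s t : 0 <= s -> s <= t -> itg s t G by exact: flux_itg.
have Ki s t : 0 <= s -> s <= t -> itg s t K by exact: rate_itg.
have loc e t0 : 0 < e -> t1 <= t0 <= t2 -> exists2 d, 0 < d &
   forall s t, t1 <= s <= t0 -> t0 <= t <= t2 -> t0 - d < s -> t < t0 + d ->
     `|Psi t - Psi s| <= e * Int t1 t K - e * Int t1 s K.
  move=> e0 t0t; have t00 : 0 <= t0 by lra.
  have [d d0 D] := identity_local dchi cchi t00 e0.
  exists d => // s t /andP[t1s st0] /andP[t0t' tt2] sgt tlt.
  have s0 : 0 <= s by lra.
  have st : s <= t by lra.
  rewrite -mulrBr (Int_diff t1s st); last by apply: Ki => //; lra.
  have -> : Psi t - Psi s = pair (w t) chi t - pair (w s) chi s - Int s t G.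
    rewrite -(Int_diff t1s st); last by apply: Gi => //; lra.
    by rewrite /Psi; ring.
  by apply: D => //; [rewrite s0|apply: fs; lra].
have key e : 0 < e -> `|Psi t2 - Psi t1| <= e * Int t1 t2 K.
  move=> e0.
  have -> : e * Int t1 t2 K = e * Int t1 t2 K - e * Int t1 t1 K by rewrite Int_point mulr0 subr0.
  rewrite ler_norml; apply/andP; split.
    rewrite lerNl.
    have -> : - (Psi t2 - Psi t1) = - Psi t2 - - Psi t1 by ring.
    apply: (@local_to_global _ (fun t => - Psi t) (fun t => e * Int t1 t K)) => // t0 t0t.
    have [d d0 D] := loc e t0 e0 t0t; exists d => // s t h1 h2 h3 h4.
    have -> : - Psi t - - Psi s = - (Psi t - Psi s) by ring.
    by apply: le_trans (D s t h1 h2 h3 h4); rewrite -normrN ler_norm.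
  apply: (@local_to_global _ Psi (fun t => e * Int t1 t K)) => // t0 t0t.
  have [d d0 D] := loc e t0 e0 t0t; exists d => // s t h1 h2 h3 h4.
  exact: le_trans (ler_norm _) (D s t h1 h2 h3 h4).
have K0 : 0 <= Int t1 t2 K.
  apply: Int_ge0 => r /andP[r1 _]; rewrite /K !addr_ge0//.
  by rewrite mulr_ge0 ?sqrtr_ge0// (source_ge0 fF)//; lra.
suff : Psi t2 - Psi t1 = 0.
  by move=> /eqP; rewrite /Psi Int_point subr0 addrAC subr_eq0 => /eqP.
apply/eqP; rewrite -normr_le0; apply/ler_addgt0Pr => e e0; rewrite add0r.
have e'0 : 0 < e / (Int t1 t2 K + 1) by rewrite divr_gt0// ltr_wpDl.
apply: (le_trans (key _ e'0)).
by rewrite mulrAC ler_pdivrMr ?ltr_wpDl// ler_pM2l// lerDl.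
Qed.

(** No derivative of chi is left in the identity, which therefore extends from
    C^1 to continuous functions. *)
Lemma identity chi t1 t2 : continuous chi -> 0 <= t1 -> t1 <= t2 ->
  full \/ (forall s, s <= t2 -> chi s = 0) ->
  pair (w t2) chi t2 - pair (w t1) chi t1 =
  Int t1 t2 (fun r => g r * chi (H + r) - y r * chi r + pair (f r) chi r).
Proof.
move=> cc t10 t12 fs; have t20 : 0 <= t2 by lra.
set LHS := _ - pair (w t1) chi t1; set RHS := Int _ _ _.
pose K := n1 (w t2) + n1 (w t1) + Int t1 t2 (fun r => 1 + `|g r| + `|y r| + Num.sqrt H * F r).
have Ki := rate_itg t10 t12.
have K0 : 0 <= K.
  rewrite /K !addr_ge0 ?n1_ge0//.
  apply: Int_ge0 => r /andP[r1 _]; rewrite !addr_ge0//.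
  by rewrite mulr_ge0 ?sqrtr_ge0// (source_ge0 fF)//; lra.
have key e : 0 < e -> `|LHS - RHS| <= e * K.
  move=> e0; have [c1 [c1' [dc cc1 near1 van]]] := C1p_approx (H + t2) cc e0.
  have fs1 s : t1 <= s <= t2 -> full \/ c1 s = 0.
    move=> /andP[s1 s2]; case: fs => [->|fs]; first by left.
    by right; apply: (van t2) => //; lra.
  have Hid := identity_C1 dc cc1 t10 t12 fs1.
  have b1 t : 0 <= t -> t <= t2 -> `|pair (w t) chi t - pair (w t) c1 t| <= e * n1 (w t).
    move=> t0 tt2; apply: pairBr => //; first exact: cl2_sqi.
    by move=> x xab; rewrite distrC near1//; have := h01 xab; lra.
  have b2 : `|Int t1 t2 (fun r => g r * c1 (H + r) - y r * c1 r + pair (f r) c1 r) - RHS| <=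
      e * Int t1 t2 (fun r => 1 + `|g r| + `|y r| + Num.sqrt H * F r).
    rewrite /RHS -IntB; [|exact: flux_itg|exact: flux_itg].
    apply: (le_trans (Int_norm (itgB (flux_itg cc1 t10 t12) (flux_itg cc t10 t12)))).
    rewrite -IntZ//; apply: Int_le; [|exact: itgZ|move=> r /andP[r1 r2]].
      by apply: itg_norm; apply: itgB; exact: flux_itg.
    have r0 : 0 <= r by lra.
    rewrite (_ : _ - _ = g r * (c1 (H + r) - chi (H + r)) - y r * (c1 r - chi r)
       + (pair (f r) c1 r - pair (f r) chi r)); last by ring.
    rewrite (le_trans (ler_normD _ _))// [leRHS]mulrDr; apply: lerD.
      rewrite (le_trans (ler_normB _ _))// !normrM -[1 + _ + _]addrA [leRHS]mulrDr mulr1 -[leLHS]add0r.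
      apply: lerD; first exact: ltW.
      rewrite [leRHS]mulrDr ![e * _]mulrC.
      by apply: lerD; apply: ler_wpM2l => //; apply: near1; have := H0; lra.
    have fs' := source_sqi fF r0.
    apply: (@le_trans _ _ (e * n1 (f r))).
      by apply: pairBr => // x xab; apply: near1; have := h01 xab; lra.
    rewrite ler_wpM2l ?(ltW e0)//; apply: n1_sqrt => //; first exact: (source_ge0 fF).
    exact: (source_le fF).
  move: b2; rewrite -Hid => b2.
  have := b1 t2 t20 (lexx _); have := b1 t1 t10 t12.
  rewrite /LHS /K; set A := pair (w t1) chi t1; set A' := pair (w t1) c1 t1.
  set B := pair (w t2) chi t2; set B' := pair (w t2) c1 t2 => h1 h2.
  rewrite (_ : _ - RHS = (B - B') - (A - A') + (B' - A' - RHS)); last by ring.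
  rewrite (le_trans (ler_normD _ _))// 2!mulrDr lerD//.
  by rewrite (le_trans (ler_normB _ _))// lerD.
apply/eqP; rewrite -subr_eq0 -normr_le0; apply/ler_addgt0Pr => e e0; rewrite add0r.
have e'0 : 0 < e / (K + 1) by rewrite divr_gt0// ltr_wpDl.
apply: (le_trans (key _ e'0)).
by rewrite mulrAC ler_pdivrMr ?ltr_wpDl// ler_pM2l// lerDl.
Qed.

Lemma expw_cont t2 a b : {within `[a, b], continuous (fun r => expR (gam * (t2 - r)))}.
Proof.
apply: continuous_subspaceT => r.
apply: continuous_comp; last exact: continuous_expR.
apply: cvgM; first exact: cvg_cst.
by apply: cvgB; [exact: cvg_cst|exact: cvg_id].
Qed.

(** The identity at t2 involves chi on [t2, t2 + H] through w, and on [t1, t2]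
    through y, whereas the initial value and the inflow pair with chi on
    [t1, t1 + H] and [t1 + H, t2 + H].  Both are partitions of [t1, t2 + H]:
    Cauchy-Schwarz with the weight e^(gam (t2 - r)) loses nothing to first order
    in t2 - t1, apart from the factors 1 + d and 1 + 1 / d that separate the
    source. *)
Lemma short_chi chi t1 t2 d : continuous chi -> 0 <= t1 -> t1 <= t2 -> 0 < d ->
  full \/ (forall s, s <= t2 -> chi s = 0) ->
  2 * (pair (w t2) chi t2 + Int t1 t2 (fun r => y r * chi r))
    - Int t1 (t2 + H) (fun r => expR (gam * (t2 - r)) * chi r ^+ 2) <=
  (1 + d) * (expR (- (gam * (t2 - t1))) * Ew (w t1) +
             expR (gam * H) * Int t1 t2 (fun r => g r ^+ 2)) +
  (1 + d^-1) * Int t1 t2 F ^+ 2.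
Proof.
move=> cc t10 t12 d0 fs; have t20 : 0 <= t2 by lra.
pose W a b := Int a b (fun r => expR (gam * (t2 - r)) * chi r ^+ 2).
have Wc : continuous (fun r => expR (gam * (t2 - r)) * chi r ^+ 2).
  move=> r; apply: cvgM; last by apply: cvgM; exact: cc.
  apply: continuous_comp; last exact: continuous_expR.
  apply: cvgM; first exact: cvg_cst.
  by apply: cvgB; [exact: cvg_cst|exact: cvg_id].
have Wi a b : itg a b (fun r => expR (gam * (t2 - r)) * chi r ^+ 2) by exact: itg_cont.
have Wp r : 0 <= expR (gam * (t2 - r)) * chi r ^+ 2 by rewrite mulr_ge0 ?expR_ge0 ?sqr_ge0.
have W0 a b : 0 <= W a b by apply: Int_ge0.
have gi : itg t1 t2 g by apply: sqi_itg; exact: tl2_sqi.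
have yi : itg t1 t2 y by apply: sqi_itg; exact: tl2_sqi.
have Fs := tl2_sqi t10 t12 (source_tl2 fF).
have Fi := sqi_itg Fs.
have cH : continuous (fun r => chi (H + r)).
  move=> x; apply: (@continuous_comp _ _ _ (fun x => H + x) chi); last exact: cc.
  by apply: cvgD; [exact: cvg_cst|exact: cvg_id].
have i1 : itg t1 t2 (fun r => g r * chi (H + r)) by apply: itg_cMr => //; exact: continuous_subspaceT.
have i2 : itg t1 t2 (fun r => y r * chi r) by apply: itg_cMr => //; exact: continuous_subspaceT.
have i3 : itg t1 t2 (fun r => pair (f r) chi r) by exact: source_pair_itg.
have Hid : pair (w t2) chi t2 + Int t1 t2 (fun r => y r * chi r) =
    pair (w t1) chi t1 + Int t1 t2 (fun r => g r * chi (H + r)) + Int t1 t2 (fun r => pair (f r) chi r).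
  have := identity cc t10 t12 fs; rewrite IntD// ?IntB//; last exact: itgB.
  by move=> ?; lra.
rewrite Hid -/(W t1 (t2 + H)).
have x1 : pair (w t1) chi t1 ^+ 2 <= (expR (- (gam * (t2 - t1))) * Ew (w t1)) * W t1 (t1 + H).
  apply: (le_trans (pair_le t1 (cl2_sqi wc t10) cc)).
  rewrite mulrAC mulrC ler_wpM2r ?Ew_ge0//.
  rewrite /W -IntZ// le_eqVlt; apply/orP; left; apply/eqP; apply: eq_Int => r _.
  by rewrite mulrA -expRD; congr (expR _ * _); ring.
have x2 : Int t1 t2 (fun r => g r * chi (H + r)) ^+ 2 <=
    (expR (gam * H) * Int t1 t2 (fun r => g r ^+ 2)) * W (t1 + H) (t2 + H).
  have gs := tl2_sqi t10 t12 g2.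
  have -> : W (t1 + H) (t2 + H) = Int t1 t2 (fun r => expR (gam * (t2 - (r + H))) * chi (r + H) ^+ 2).
    symmetry; apply: (@Int_shift _ (fun r => expR (gam * (t2 - r)) * chi r ^+ 2)) => //.
  rewrite -(IntZ (expR (gam * H)) gs.2).
  apply: CSgen => //.
  - by apply: itgZ; case: gs.
  - apply: itg_cont => r; exact: (@contDr _ (fun r => expR (gam * (t2 - r)) * chi r ^+ 2)).
  move=> r /andP[r1 r2]; split; [by rewrite mulr_ge0 ?expR_ge0 ?sqr_ge0|exact: Wp|].
  rewrite exprMn [leRHS]mulrACA -expRD [r + H]addrC ler_peMl//; first by rewrite mulr_ge0 ?sqr_ge0.
  have := expR_ge1Dx (gam * H + gam * (t2 - (H + r))).
  have : 0 <= gam * (t2 - r) by rewrite mulr_ge0//; lra.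
  by lra.
have D12 : W t1 (t1 + H) + W (t1 + H) (t2 + H) = W t1 (t2 + H).
  by rewrite /W -Int_cat//; [rewrite lerDl|rewrite lerD2r].
have x3 : Int t1 t2 (fun r => pair (f r) chi r) ^+ 2 <= Int t1 t2 F ^+ 2 * W t1 (t2 + H).
  have F0 r : t1 <= r <= t2 -> 0 <= F r by move=> /andP[r1 _]; apply/(source_ge0 fF)/le_trans/r1.
  have : `|Int t1 t2 (fun r => pair (f r) chi r)| <= Num.sqrt (W t1 (t2 + H)) * Int t1 t2 F.
    apply: (le_trans (Int_norm i3)); rewrite -IntZ//.
    apply: Int_le; [exact: itg_norm|exact: itgZ|move=> r r12].
    have /andP[r1 r2] := r12; have r0 : 0 <= r by exact: le_trans r1.
    have hs : Int r (r + H) (fun r0 => expR (gam * (r - r0)) * chi r0 ^+ 2) <= W t1 (t2 + H).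
      apply: (@le_trans _ _ (W r (r + H))).
        apply: Int_le => //.
          apply: itg_cont => z; apply: cvgM; last by apply: cvgM; exact: cc.
          apply: continuous_comp; last exact: continuous_expR.
          apply: cvgM; first exact: cvg_cst.
          by apply: cvgB; [exact: cvg_cst|exact: cvg_id].
        move=> z _; rewrite ler_wpM2r ?sqr_ge0// ler_expR ler_wpM2l// lerD2r//.
      by apply: Int_le_set => //; rewrite ?lerDl ?lerD2r//.
    rewrite -[X in _ * X](ger0_norm (F0 _ r12)) -sqrtr_sqr -[X in _ * X]sqrtr_sqr -sqrtrM//.
    rewrite ler_wsqrtr// (le_trans (pair_le r (source_sqi fF r0) cc))// mulrC.
    apply: ler_pM; [|exact: Ew_ge0|exact: hs|exact: (source_le fF)].
    by apply: Int_ge0 => z _; rewrite mulr_ge0 ?expR_ge0 ?sqr_ge0.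
  move=> hn; rewrite -real_normK ?num_real// -(sqr_sqrtr (W0 t1 (t2 + H))) -exprMn mulrC.
  by rewrite lerXn2r ?nnegrE// mulr_ge0 ?sqrtr_ge0// Int_ge0.
have d1 : 0 < 1 + d by rewrite addr_gt0.
have d2 : 0 < 1 + d^-1 by rewrite addr_gt0// invr_gt0.
have g20 : 0 <= Int t1 t2 (fun r => g r ^+ 2) by apply: Int_ge0 => r _; exact: sqr_ge0.
have a1 := amgm (mulr_ge0 (expR_ge0 _) (Ew_ge0 _)) (W0 _ _) d1 x1.
have a2 := amgm (mulr_ge0 (expR_ge0 _) g20) (W0 _ _) d1 x2.
have a3 := amgm (sqr_ge0 _) (W0 _ _) d2 x3.
by move: a3; rewrite -D12; exact: duality_balance.
Qed.

Hypothesis yfull : full \/ (forall r, y r = 0).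

(** The left-hand side of [short_chi] is maximal for chi equal to the weighted
    w(t2) on [t2, t2 + H], in the variable h, and to the weighted y on
    [t1, t2].  Continuous functions approach it in L^2; both pieces are made to
    vanish at the junction t2, so that they glue. *)
Lemma short t1 t2 d : 0 <= t1 -> t1 <= t2 -> 0 < d ->
  Ew (w t2) + Int t1 t2 (fun r => expR (- (gam * (t2 - r))) * y r ^+ 2) <=
  (1 + d) * (expR (- (gam * (t2 - t1))) * Ew (w t1) +
             expR (gam * H) * Int t1 t2 (fun r => g r ^+ 2)) +
  (1 + d^-1) * Int t1 t2 F ^+ 2.
Proof.
move=> t10 t12 d0; set RHS := (X in _ <= X).
have t20 : 0 <= t2 by lra.
have ws := cl2_sqi wc t20.
have ys := tl2_sqi t10 t12 y2.
have cwn : {within `[0, 1], continuous (fun x => expR (- (gam * h x)) * p x)}.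
  apply: withinM => //; apply: (@within_compo _ h (fun x => expR (- (gam * x)))) => // x.
  apply: continuous_comp; last exact: continuous_expR.
  by apply: cvgN; apply: cvgM; [exact: cvg_cst|exact: cvg_id].
have [C C0 CP] := within_bounded cwn.
have [C' C'0 CP'] := within_bounded (@expw_cont t2 t1 t2).
pose a x := expR (gam * h x) * w t2 x.
have sa : sqi 0 1 a.
  apply: sqi_cM => //; apply: (@within_compo _ h (fun x => expR (gam * x))) => // x.
  apply: continuous_comp; last exact: continuous_expR.
  by apply: cvgM; [exact: cvg_cst|exact: cvg_id].
pose yw r := expR (- (gam * (t2 - r))) * y r.
have cyw : {within `[t1, t2], continuous (fun r => expR (- (gam * (t2 - r))))}.
  apply: continuous_subspaceT => r.
  apply: continuous_comp; last exact: continuous_expR.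
  apply: cvgN; apply: cvgM; first exact: cvg_cst.
  by apply: cvgB; [exact: cvg_cst|exact: cvg_id].
have syw : sqi t1 t2 yw by exact: sqi_cM.
suff key e : 0 < e -> Ew (w t2) + Int t1 t2 (fun r => expR (- (gam * (t2 - r))) * y r ^+ 2) <=
    RHS + e * (C + C').
  apply/ler_addgt0Pr => e e0.
  have e'0 : 0 < e / (C + C' + 1) by rewrite divr_gt0//; lra.
  apply: (le_trans (key _ e'0)); rewrite lerD2l mulrAC ler_pdivrMr; last by lra.
  by rewrite ler_pM2l//; lra.
move=> e0.
have [phi [cphi phi0 phie]] := dense_cont (hi 0) (ler01 : (0:R) <= 1) sa e0.
have [eta [ceta eta0 etae etaf]] : exists eta, [/\ continuous eta, eta t2 = 0,
    Int t1 t2 (fun x => (yw x - eta x) ^+ 2) <= e & full \/ forall r, eta r = 0].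
  have [ff|y0] := yfull.
    have [eta [h1 h2 h3]] := dense_cont t2 t12 syw e0.
    by exists eta; split=> //; left.
  exists (fun=> 0); split=> //; [by move=> x; exact: cvg_cst| |by right].
  rewrite (eq_Int (g := fun=> 0)) ?Int_cst ?mul0r ?(ltW e0)// => r _.
  by rewrite /yw y0 mulr0 subr0 expr0n.
(* chi is eta to the left of t2 and phi, read along h, to the right. *)
pose chi r := eta (Num.min r t2) + phi (hi (Num.max (r - t2) 0)).
have chi_le r : r <= t2 -> chi r = eta r.
  by move=> rt; rewrite /chi min_l// max_r ?subr_le0// phi0 addr0.
have chi_ge r : 0 <= r -> chi (r + t2) = phi (hi r).
  by move=> r0; rewrite /chi min_r ?lerDr// eta0 add0r addrK max_l.
have cc : continuous chi.
  move=> r; apply: cvgD.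
    apply: (@continuous_comp _ _ _ (fun r => Num.min r t2) eta); last exact: ceta.
    by apply: (@continuous_min _ _ (fun x : R => x) (fun=> t2)); [exact: cvg_id|exact: cvg_cst].
  apply: (@continuous_comp _ _ _ (fun r => hi (Num.max (r - t2) 0)) phi); last exact: cphi.
  apply: (@continuous_comp _ _ _ (fun r => (Num.max (r - t2) 0)) hi); last exact: hic.
  apply: (@continuous_max _ _ (fun x : R => x - t2) (fun=> 0)); last exact: cvg_cst.
  by apply: cvgB; [exact: cvg_id|exact: cvg_cst].
have fs : full \/ forall s, s <= t2 -> chi s = 0.
  by case: etaf => [->|he]; [left|right => s st; rewrite chi_le].
have := short_chi cc t10 t12 d0 fs; rewrite -/RHS => Hs.
have Wi a' b' : itg a' b' (fun r => expR (gam * (t2 - r)) * chi r ^+ 2).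
  apply: itg_within; apply: withinM; first exact: expw_cont.
  by apply: continuous_subspaceT => r; apply: cvgM; exact: cc.
have X1 : pair (w t2) chi t2 = Int 0 1 (fun x => w t2 x * (phi x * p x)).
  apply: eq_Int => x xab; rewrite chi_ge ?hiK//.
  by case/andP: (h01 xab).
have X2 : Int t1 t2 (fun r => y r * chi r) = Int t1 t2 (fun r => y r * eta r).
  by apply: eq_Int => r /andP[_ r2]; rewrite chi_le.
have Dcat : Int t1 (t2 + H) (fun r => expR (gam * (t2 - r)) * chi r ^+ 2) =
  Int t1 t2 (fun r => expR (gam * (t2 - r)) * eta r ^+ 2) +
  Int 0 1 (fun x => expR (- (gam * h x)) * p x * phi x ^+ 2).
  have tH : t2 <= t2 + H by rewrite lerDl.
  rewrite (Int_cat t12 tH (Wi _ _)).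
  congr (_ + _); first by apply: eq_Int => r /andP[_ r2]; rewrite chi_le.
  transitivity (Int 0 H (fun s => expR (- (gam * s)) * phi (hi s) ^+ 2)).
    transitivity (Int (0 + t2) (H + t2) (fun r => expR (gam * (t2 - r)) * chi r ^+ 2)).
      by rewrite add0r addrC.
    rewrite -(@Int_shift _ (fun r => expR (gam * (t2 - r)) * chi r ^+ 2) t2 0 H)//.
      apply: eq_Int => r /andP[r0 _]; rewrite chi_ge//; congr (expR _ * _); ring.
    move=> r; apply: cvgM; last by apply: cvgM; exact: cc.
    apply: continuous_comp; last exact: continuous_expR.
    apply: cvgM; first exact: cvg_cst.
    by apply: cvgB; [exact: cvg_cst|exact: cvg_id].
  rewrite -(hsub (f := fun s => expR (- (gam * s)) * phi (hi s) ^+ 2)).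
    by apply: eq_Int => x xab; rewrite hiK//; ring.
  move=> r; apply: cvgM.
    apply: continuous_comp; last exact: continuous_expR.
    by apply: cvgN; apply: cvgM; [exact: cvg_cst|exact: cvg_id].
  by apply: cvgM; apply: (@continuous_comp _ _ _ hi phi); [exact: hic|exact: cphi|exact: hic|exact: cphi].
have ps : sqi 0 1 phi by apply: sqi_cont; exact: continuous_subspaceT.
have es : sqi t1 t2 eta by apply: sqi_cont; exact: continuous_subspaceT.
have sq1 : Ew (w t2) - (2 * Int 0 1 (fun x => w t2 x * (phi x * p x)) -
    Int 0 1 (fun x => expR (- (gam * h x)) * p x * phi x ^+ 2)) <= C * e.
  apply: (@le_trans _ _ (C * Int 0 1 (fun x => (a x - phi x) ^+ 2))); last by rewrite ler_wpM2l.
  have i1 : itg 0 1 (fun x => w t2 x * (phi x * p x)).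
    apply: itg_cMr; last exact: sqi_itg.
    by apply: withinM => //; exact: continuous_subspaceT.
  have i2 : itg 0 1 (fun x => expR (- (gam * h x)) * p x * phi x ^+ 2).
    by apply: itg_cM => //; case: ps.
  have [_ i3] := sqiB sa ps.
  have i4 := itgZ 2 i1.
  rewrite -(IntZ _ i3) -(IntZ _ i1) -(IntB i4 i2) -IntB; [|exact: Ew_itg|exact: itgB].
  apply: Int_le; [by apply: itgB; [exact: Ew_itg|exact: itgB]|exact: itgZ|].
  move=> x xab.
  apply: (@le_trans _ _ (expR (- (gam * h x)) * p x * (a x - phi x) ^+ 2)).
    rewrite /a; have E1 : expR (- (gam * h x)) * expR (gam * h x) = 1.
      by rewrite -expRD addNr expR0.
    rewrite le_eqVlt; apply/orP; left; apply/eqP.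
    set q := expR (gam * h x) in E1 *; set q' := expR (- _) in E1 *.
    rewrite (_ : q' * p x * (q * w t2 x - phi x) ^+ 2 = (q' * q) * q * p x * w t2 x ^+ 2
      - 2 * (q' * q) * (w t2 x * (phi x * p x)) + q' * p x * phi x ^+ 2); last by ring.
    by rewrite E1; ring.
  by rewrite ler_wpM2r ?sqr_ge0// (le_trans (ler_norm _))// CP.
have sq2 : Int t1 t2 (fun r => expR (- (gam * (t2 - r))) * y r ^+ 2) -
    (2 * Int t1 t2 (fun r => y r * eta r) -
     Int t1 t2 (fun r => expR (gam * (t2 - r)) * eta r ^+ 2)) <= C' * e.
  apply: (@le_trans _ _ (C' * Int t1 t2 (fun x => (yw x - eta x) ^+ 2))); last by rewrite ler_wpM2l.
  have i0 : itg t1 t2 (fun r => expR (- (gam * (t2 - r))) * y r ^+ 2).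
    by apply: itg_cM => //; case: ys.
  have i1 : itg t1 t2 (fun r => y r * eta r) by exact: sqi_mul.
  have i2 : itg t1 t2 (fun r => expR (gam * (t2 - r)) * eta r ^+ 2).
    by apply: itg_cM; [exact: expw_cont|case: es].
  have [_ i3] := sqiB syw es.
  have i4 := itgZ 2 i1.
  rewrite -(IntZ _ i3) -(IntZ _ i1) -(IntB i4 i2) -IntB//; last exact: itgB.
  apply: Int_le; [by apply: itgB => //; exact: itgB|exact: itgZ|].
  move=> r rab.
  apply: (@le_trans _ _ (expR (gam * (t2 - r)) * (yw r - eta r) ^+ 2)).
    rewrite /yw; have E1 : expR (gam * (t2 - r)) * expR (- (gam * (t2 - r))) = 1.
      by rewrite -expRD subrr expR0.
    rewrite le_eqVlt; apply/orP; left; apply/eqP.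
    set q := expR (- _) in E1 *; set q' := expR (gam * _) in E1 *.
    rewrite (_ : q' * (q * y r - eta r) ^+ 2 = (q' * q) * q * y r ^+ 2
      - 2 * (q' * q) * (y r * eta r) + q' * eta r ^+ 2); last by ring.
    by rewrite E1; ring.
  by rewrite ler_wpM2r ?sqr_ge0// (le_trans (ler_norm _))// CP'.
by move: Hs; rewrite X1 X2 Dcat; exact: complete_squares sq1 sq2.
Qed.

Lemma Ew_cont0 : cont0 (fun t => Ew (w t)).
Proof.
have := cl2_pair wc (cl2_cM Ewt_cont wc).
have -> // : (fun t => Int 0 1 (fun x => w t x * (expR (gam * h x) * p x * w t x))) =
   (fun t => Ew (w t)).
by apply/funext => t; apply: eq_Int => x _; ring.
Qed.

(** Apply [short] with d = rho (t - s) on short intervals and sum up. *)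
Lemma energy t1 t2 rho : 0 <= t1 -> t1 <= t2 -> 0 < rho ->
  Ew (w t2) - Ew (w t1) <= Int t1 t2 (fun r => - (gam - rho) * Ew (w r) +
    expR (gam * H) * g r ^+ 2 + rho^-1 * F r ^+ 2 - y r ^+ 2).
Proof.
move=> t10 t12 rho0.
pose G := expR (gam * H).
pose Q r := - (gam - rho) * Ew (w r) + G * g r ^+ 2 + rho^-1 * F r ^+ 2 - y r ^+ 2.
pose K r := 1 + y r ^+ 2 + g r ^+ 2 + F r ^+ 2.
have cE := Ew_cont0.
have [gi yi Fi] : [/\ forall s t, 0 <= s -> s <= t -> itg s t (fun r => g r ^+ 2),
   forall s t, 0 <= s -> s <= t -> itg s t (fun r => y r ^+ 2) &
   forall s t, 0 <= s -> s <= t -> itg s t (fun r => F r ^+ 2)].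
  by split=> s t s0 st; [case: (tl2_sqi s0 st g2)|case: (tl2_sqi s0 st y2)|
     case: (tl2_sqi s0 st (source_tl2 fF))].
have Ei s t : 0 <= s -> itg s t (fun r => Ew (w r)) by move=> s0; exact: cont0_itg.
have Qi s t : 0 <= s -> s <= t -> itg s t Q.
  move=> s0 st; apply: itgB; last exact: yi.
  by apply: itgD; [apply: itgD|]; apply: itgZ; [exact: Ei|exact: gi|exact: Fi].
have Ki s t : 0 <= s -> s <= t -> itg s t K.
  move=> s0 st; apply: itgD; last exact: Fi.
  by apply: itgD; [apply: itgD; [exact: itg_cst|exact: yi]|exact: gi].
pose Psi t := Ew (w t) - Int t1 t Q.
have K0 : 0 <= Int t1 t2 K.
  by apply: Int_ge0 => r _; rewrite /K !addr_ge0 ?sqr_ge0.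
have G0 : 0 < G by exact: expR_gt0.
have loc e t0 : 0 < e -> t1 <= t0 <= t2 -> exists2 d, 0 < d &
   forall s t, t1 <= s <= t0 -> t0 <= t <= t2 -> t0 - d < s -> t < t0 + d ->
     Psi t - Psi s <= e * Int t1 t K - e * Int t1 s K.
  move=> e0 t0t; have t00 : 0 <= t0 by lra.
  pose c1 := `|rho - gam|.
  have c10 : 0 <= c1 by exact: normr_ge0.
  pose E0 := Ew (w t0).
  have E00 : 0 <= E0 by exact: Ew_ge0.
  pose e1 := Num.min 1 (e / (4 * (c1 + 1))).
  have e10 : 0 < e1 by rewrite lt_min ltr01 divr_gt0//; lra.
  have e11 : e1 <= 1 by rewrite ge_min lexx.
  have e1e : c1 * (2 * e1) <= e / 2.
    have : e1 <= e / (4 * (c1 + 1)) by rewrite ge_min lexx orbT.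
    rewrite ler_pdivlMr; last by lra.
    by rewrite mulrDr mulr1 mulrDr => ?; lra.
  pose c2 := gam ^+ 2 + rho * gam ^+ 2 + rho * gam.
  have c20 : 0 <= c2 by rewrite /c2 !addr_ge0 ?mulr_ge0 ?sqr_ge0// ltW.
  pose N := gam + 1 + rho * G + 2 * c2 * (E0 + 1).
  have N0 : 0 < N.
    rewrite /N; apply: ltr_wpDr; first by rewrite !mulr_ge0//; lra.
    apply: ltr_wpDr; first by rewrite mulr_ge0// ltW.
    by have := gam0; lra.
  pose d2 := Num.min 1 (e / N).
  have d20 : 0 < d2 by rewrite lt_min ltr01 divr_gt0.
  have [d1 d10 D1] := cE t0 t00 e1 e10.
  exists (Num.min d1 (d2 / 2)); first by rewrite lt_min d10 divr_gt0.
  move=> s t /andP[t1s st0] /andP[t0t' tt2] sgt tlt.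
  have m1 : Num.min d1 (d2 / 2) <= d1 by rewrite ge_min lexx.
  have m2 : Num.min d1 (d2 / 2) <= d2 / 2 by rewrite ge_min lexx orbT.
  have s0 : 0 <= s by exact: le_trans t1s.
  have st : s <= t by exact: le_trans t0t'.
  pose tau := t - s.
  have tau0 : 0 <= tau by rewrite subr_ge0.
  have [taud taue] : tau <= 1 /\ tau * N <= e.
    have tau2 : tau <= d2.
      rewrite -(ger0_norm tau0) ltW//.
      by apply: (narrow_window m2 sgt tlt); rewrite lexx ?st.
    split; first by rewrite (le_trans tau2)// ge_min lexx.
    by rewrite -ler_pdivlMr// (le_trans tau2)// ge_min lexx orbT.
  rewrite -mulrBr (Int_diff t1s st); last exact/Ki/(le_trans t1s).
  have -> : Psi t - Psi s = Ew (w t) - Ew (w s) - Int s t Q.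
    rewrite -(Int_diff t1s st); last exact/Qi/(le_trans t1s).
    by rewrite /Psi; ring.
  have [tz|tnz] := eqVneq tau 0.
    have -> : t = s by apply/eqP; rewrite -subr_eq0; apply/eqP.
    by rewrite !Int_point mulr0 subrr subr0.
  have taup : 0 < tau by rewrite lt_neqAle eq_sym tnz.
  have En r : s <= r <= t -> `|Ew (w r) - E0| <= e1.
    by move=> /(near_window m1 s0 sgt tlt)[r0 rd]; exact/ltW/D1.
  pose Y := Int s t (fun r => y r ^+ 2).
  pose X := Int s t (fun r => g r ^+ 2).
  pose Z := Int s t (fun r => F r ^+ 2).
  pose IE := Int s t (fun r => Ew (w r)).
  have Y0 : 0 <= Y by apply: Int_ge0 => r _; exact: sqr_ge0.
  have X0 : 0 <= X by apply: Int_ge0 => r _; exact: sqr_ge0.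
  have Z0 : 0 <= Z by apply: Int_ge0 => r _; exact: sqr_ge0.
  have QE : Int s t Q = (rho - gam) * IE + G * X + rho^-1 * Z - Y.
    have a1 := itgZ (- (gam - rho)) (Ei s t s0).
    have a2 := itgZ G (gi _ _ s0 st).
    have a3 := itgZ rho^-1 (Fi _ _ s0 st).
    rewrite /Q IntB; [|by apply: itgD => //; exact: itgD|exact: yi].
    rewrite IntD//; last exact: itgD.
    rewrite IntD// (IntZ _ (Ei s t s0)) (IntZ _ (gi _ _ s0 st)) (IntZ _ (Fi _ _ s0 st)).
    by rewrite opprB.
  have KE : Int s t K = tau + Y + X + Z.
    rewrite /K IntD; [|by apply: itgD; [apply: itgD; [exact: itg_cst|exact: yi]|exact: gi]|exact: Fi].
    rewrite IntD; [|by apply: itgD; [exact: itg_cst|exact: yi]|exact: gi].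
    by rewrite IntD; [|exact: itg_cst|exact: yi]; rewrite Int_cst// mul1r.
  have IEb : `|IE - E0 * tau| <= e1 * tau by apply: Int_near_cst => //; exact: Ei.
  have Es : `|Ew (w s) - E0| <= e1 by apply: En; rewrite lexx.
  have rt0 : 0 < rho * tau by rewrite mulr_gt0.
  have := short s0 st rt0; rewrite -/G -/X -/tau => Hs.
  have yl : (1 - gam * tau) * Y <= Int s t (fun r => expR (- (gam * (t - r))) * y r ^+ 2).
    rewrite /Y -IntZ; last exact: yi.
    apply: Int_le; [by apply: itgZ; exact: yi| |].
      apply: itg_cM; last exact: yi.
      apply: continuous_subspaceT => r; apply: continuous_comp; last exact: continuous_expR.
      apply: cvgN; apply: cvgM; first exact: cvg_cst.
      by apply: cvgB; [exact: cvg_cst|exact: cvg_id].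
    move=> r /andP[sr rt]; rewrite ler_wpM2r ?sqr_ge0//.
    apply: le_trans (expR_ge1Dx _).
    by rewrite lerD2l lerN2 ler_wpM2l// lerD2l lerN2.
  have Fc : Int s t F ^+ 2 <= tau * Z.
    have := cauchy_schwarz (tl2_sqi s0 st (source_tl2 fF)) (sqi_cont (@within_cst R s t 1)).
    rewrite (eq_Int (g := F)); last by move=> r _; rewrite mulr1.
    by rewrite expr1n Int_cst// mul1r mulrC.
  rewrite QE KE.
  by apply: (energy_step gam0 rho0 (ltW G0) taup taud taue e1e e11 IEb Es (Ew_ge0 _) E00 Y0 X0 Z0 yl Fc Hs).
have key e : 0 < e -> Psi t2 - Psi t1 <= e * Int t1 t2 K.
  move=> e0.
  have -> : e * Int t1 t2 K = e * Int t1 t2 K - e * Int t1 t1 K by rewrite Int_point mulr0 subr0.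
  apply: (@local_to_global _ Psi (fun t => e * Int t1 t K)) => // t0 t0t.
  by have [d d0 D] := loc e t0 e0 t0t; exists d.
rewrite -/G -/Q -[leRHS]addr0 -lerBlDl.
have -> : Ew (w t2) - Ew (w t1) - Int t1 t2 Q = Psi t2 - Psi t1.
  by rewrite /Psi Int_point; ring.
apply/ler_addgt0Pr => e e0; rewrite add0r.
have e'0 : 0 < e / (Int t1 t2 K + 1) by rewrite divr_gt0// ltr_wpDl.
apply: (le_trans (key _ e'0)).
by rewrite mulrAC ler_pdivrMr ?ltr_wpDl// ler_pM2l// lerDl.
Qed.

End identity.

End transport.

(** * Characteristics of the two boundary value problems *)

Section extension.
Variable R : realType.
Implicit Types (x s t r lo : R).

(** Composing with this retraction extends a function that is continuous on
    [0, 1] to a continuous function on the line. *)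
Definition c01 (x : R) : R := Num.min 1 (Num.max 0 x).

Lemma c01_in x : 0 <= c01 x <= 1.
Proof. by rewrite /c01 le_min ler01 le_max lexx/= ge_min lexx. Qed.

Lemma c01_id x : 0 <= x <= 1 -> c01 x = x.
Proof. by move=> /andP[x0 x1]; rewrite /c01 max_r// min_r. Qed.

Lemma c01_cont : continuous c01.
Proof.
move=> x; apply: (@continuous_min _ _ (fun=> 1) (fun x : R => Num.max 0 x)).
  exact: cvg_cst.
by apply: (@continuous_max _ _ (fun=> 0) (fun x : R => x)); [exact: cvg_cst|exact: cvg_id].
Qed.

Lemma oo_cc x : 0 < x < 1 -> 0 <= x <= 1.
Proof. by case/andP=> /ltW -> /ltW ->. Qed.

Lemma retract_cont (T U : topologicalType) (A : set T) (r : T -> T) (f : T -> U) :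
  continuous r -> (forall z, A (r z)) -> {within A, continuous f} ->
  continuous (fun z => f (r z)).
Proof.
move=> cr Ar /subspace_continuousP cf x.
apply: (@cvg_comp _ _ _ r f _ (within A (nbhs (r x)))); last exact: cf.
move=> P /(cr x); rewrite /nbhs/= => h; apply: filterS h => y /= h; exact: h.
Qed.

Lemma ext01_cont (f : R -> R) : {within `[0, 1], continuous f} ->
  continuous (fun x => f (c01 x)).
Proof.
move=> cf; apply: (@retract_cont R R `[0, 1]%classic) => //; first exact: c01_cont.
by move=> x; rewrite /= in_itv/= c01_in.
Qed.

End extension.

Section travel.
Variables (R : realType) (a : C1I R) (lo : R).
Hypothesis lo0 : 0 < lo.
Hypothesis alo : forall x, @I01 R x -> lo <= a x.
Implicit Types (x s t r : R) (chi f : R -> R).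

(** hL and hR are the travel times from x to the left and to the right end, Ht
    the travel time across the segment. *)
Definition pa x : R := (a (c01 x))^-1.
Definition hL x : R := Int 0 x pa.
Definition Ht : R := hL 1.
Definition hR x : R := Ht - hL x.

Lemma a_gt0 x : 0 <= x <= 1 -> 0 < a x.
Proof. by move=> x01; apply: lt_le_trans lo0 (alo _); rewrite /I01/= in_itv/=. Qed.

Lemma pa_gt0 x : 0 < pa x.
Proof. by rewrite invr_gt0; apply: a_gt0; exact: c01_in. Qed.

Lemma pa_id x : 0 <= x <= 1 -> pa x = (a x)^-1.
Proof. by move=> /c01_id; rewrite /pa => ->. Qed.

Lemma apa x : 0 <= x <= 1 -> a x * pa x = 1.
Proof. by move=> x01; rewrite pa_id// divff// gt_eqF// a_gt0. Qed.

Lemma a_cont : {within `[0, 1], continuous a}.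
Proof. exact: c1_funC. Qed.

Lemma pa_cont : continuous pa.
Proof.
move=> x; apply: cvgV; first by rewrite gt_eqF// a_gt0// c01_in.
exact: (ext01_cont a_cont).
Qed.

Lemma hL_cont : continuous hL.
Proof. exact: (prim_cont pa_cont). Qed.

Lemma hL_derive x : 0 < x -> is_derive x 1 hL (pa x).
Proof. exact: (prim_derive pa_cont). Qed.

Lemma hL0 : hL 0 = 0.
Proof. by rewrite /hL Int_point. Qed.

Lemma hL_lt x y : 0 <= x -> x < y -> hL x < hL y.
Proof.
move=> x0 xy; rewrite /hL (@Int_cat _ 0 x y) ?(ltW xy)//; last by apply: itg_cont; exact: pa_cont.
rewrite ltrDl.
have [|m mxy mP] := @EVT_min _ pa x y (ltW xy); first exact: continuous_subspaceT pa_cont.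
apply: (@lt_le_trans _ _ (pa m * (y - x))); first by rewrite mulr_gt0 ?pa_gt0// subr_gt0.
rewrite -(Int_cst (pa m) (ltW xy)); apply: Int_le; [exact: itg_cst|apply: itg_cont; exact: pa_cont|].
by move=> z zxy; apply: mP; rewrite in_itv/=.
Qed.

Lemma hL_le x y : 0 <= x -> x <= y -> hL x <= hL y.
Proof. by move=> x0; rewrite le_eqVlt => /predU1P[->//|/(hL_lt x0)/ltW]. Qed.

Lemma hL01 x : 0 <= x <= 1 -> 0 <= hL x <= Ht.
Proof. by move=> /andP[x0 x1]; rewrite -{1}hL0 !hL_le. Qed.

Lemma hR01 x : 0 <= x <= 1 -> 0 <= hR x <= Ht.
Proof. by move=> /hL01; rewrite /hR; lra. Qed.

Lemma Ht_ge0 : 0 <= Ht.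
Proof. by have /andP[] := @hL01 1 (ltac:(by rewrite ler01 lexx)). Qed.

Lemma hL_inj : {in `[0, 1] &, injective hL}.
Proof.
move=> x y; rewrite !in_itv/= => /andP[x0 _] /andP[y0 _] hxy.
by have [/(hL_lt x0)|/(hL_lt y0)|//] := ltgtP x y; rewrite hxy ltxx.
Qed.

Lemma hL_inverse : exists2 hi : R -> R, continuous hi &
  forall x, 0 <= x <= 1 -> hi (hL x) = x.
Proof.
pose g s := xget 0 [set x | 0 <= x <= 1 /\ hL x = s].
have gK : {in `[0, 1], cancel hL g}.
  move=> x; rewrite in_itv/= => x01; rewrite /g; case: xgetP => [z _ [z01 hz]|/(_ x)[]//].
  by apply: hL_inj; rewrite ?in_itv.
have cg := segment_can_le_continuous ler01 (continuous_subspaceT hL_cont) gK.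
rewrite hL0 -/Ht in cg.
pose cl s := Num.min Ht (Num.max 0 s).
exists (fun s => g (cl s)); last first.
  move=> x x01; have /andP[h0 h1] := hL01 x01.
  by rewrite /cl max_r// min_r// gK// in_itv.
apply: (@retract_cont R R `[0, Ht]%classic) => //.
  move=> x; apply: (@continuous_min _ _ (fun=> Ht) (fun x : R => Num.max 0 x)).
    exact: cvg_cst.
  by apply: (@continuous_max _ _ (fun=> 0) (fun x : R => x)); [exact: cvg_cst|exact: cvg_id].
move=> x; rewrite /= in_itv/= /cl le_min Ht_ge0 le_max lexx/=.
by rewrite ge_min lexx.
Qed.

Lemma hR_inverse : exists2 hi : R -> R, continuous hi &
  forall x, 0 <= x <= 1 -> hi (hR x) = x.
Proof.
have [hi chi hiK] := hL_inverse; exists (fun s => hi (Ht - s)).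
  move=> x; apply: (@continuous_comp _ _ _ (fun s => Ht - s) hi); last exact: chi.
  by apply: cvgB; [exact: cvg_cst|exact: cvg_id].
by move=> x x01; rewrite /hR opprB addrC subrK hiK.
Qed.

Lemma hL_sub f : continuous f -> Int 0 1 (fun x => f (hL x) * pa x) = Int 0 Ht f.
Proof.
move=> cf; pose P x := Int (-1) x f.
have dP x : -1 < x -> is_derive x 1 P (f x) by exact: prim_derive.
have cP : continuous P by exact: prim_cont.
rewrite -(@Int_diff _ f (-1) 0 Ht) ?Ht_ge0 ?lerN10//; last exact: itg_cont.
rewrite -/(P Ht) -/(P 0) -{2}hL0 /Ht.
apply: (@Int_derive _ (fun x => P (hL x))) => //.
- move=> x /andP[x0 x1]; apply: is_derive_compo; last exact: hL_derive.
  apply: dP; have /andP[hx _] : 0 <= hL x <= Ht by apply: hL01; apply: oo_cc; rewrite x0.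
  by apply: lt_le_trans hx; rewrite ltrN10.
- apply: continuous_subspaceT => x; apply: (@continuous_comp _ _ _ hL P); [exact: hL_cont|exact: cP].
- apply: continuous_subspaceT => x; apply: cvgM; last exact: pa_cont.
  by apply: (@continuous_comp _ _ _ hL f); [exact: hL_cont|exact: cf].
Qed.

Lemma hR_sub f : continuous f -> Int 0 1 (fun x => f (hR x) * pa x) = Int 0 Ht f.
Proof.
move=> cf; pose F s := f (Ht - s).
have cF : continuous F.
  move=> x; apply: (@continuous_comp _ _ _ (fun s => Ht - s) f); last exact: cf.
  by apply: cvgB; [exact: cvg_cst|exact: cvg_id].
rewrite (hL_sub cF).
pose P x := Int (-1) x f.
have dP x : -1 < x -> is_derive x 1 P (f x) by exact: prim_derive.
have cP : continuous P by exact: prim_cont.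
rewrite -(@Int_diff _ f (-1) 0 Ht) ?Ht_ge0 ?lerN10//; last exact: itg_cont.
rewrite -/(P Ht) -/(P 0).
have -> : P Ht - P 0 = (fun s => - P (Ht - s)) Ht - (fun s => - P (Ht - s)) 0.
  by rewrite /= subrr subr0; ring.
have dN s x : is_derive x 1 (fun s => Ht - s) (-1).
  have := is_derive_sub (is_derive_cst Ht x (1:R)) (is_derive_id x (1:R)).
  by move=> /is_derive_eq; apply; rewrite sub0r.
apply: (@Int_derive _ (fun s => - P (Ht - s)) F 0 Ht); [exact: Ht_ge0| | |exact: continuous_subspaceT].
- move=> x /andP[x0 x1].
  have d1 : is_derive (Ht - x) 1 P (f (Ht - x)) by apply: dP; lra.
  have := is_derive_scale (-1) (@is_derive_compo _ P (fun s => Ht - s) x _ _ d1 (dN x x)).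
  rewrite (_ : -1 * (f (Ht - x) * -1) = F x); last by rewrite /F; ring.
  by rewrite (_ : (fun y => _) = (fun s => - P (Ht - s)))//; apply/funext => z; rewrite mulN1r.
- apply: continuous_subspaceT => x; apply: cvgN.
  apply: (@continuous_comp _ _ _ (fun s => Ht - s) P); last exact: cP.
  by apply: cvgB; [exact: cvg_cst|exact: cvg_id].
Qed.

(** The adjoint transport operator psi |-> (a psi)' acts on
    psi = chi (h x + s0) / a as the derivative of chi, because a h' = sg. *)
Lemma transported_test (h chi chi' : R -> R) (sg s0 : R) :
  {within `[0, 1], continuous h} -> (forall x, 0 <= x <= 1 -> 0 <= h x) ->
  (forall x, 0 < x < 1 -> is_derive x 1 h (sg * pa x)) ->
  C1p chi chi' -> continuous chi -> 0 <= s0 ->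
  exists psi : C1I R, (forall x, psi x = chi (h x + s0) * pa x) /\
    forall x, 0 <= x <= 1 ->
      c1_der a x * psi x + a x * c1_der psi x = sg * (chi' (h x + s0) * pa x).
Proof.
move=> ch h0 dh [dchi cchi'] cchi s00.
pose psi x := chi (h x + s0) * pa x.
pose psi' x := chi (h x + s0) * (- (c1_der a x * pa x ^+ 2)) +
               pa x * (chi' (h x + s0) * (sg * pa x)).
have wpa : {within `[0, 1], continuous pa} by apply: continuous_subspaceT; exact: pa_cont.
have c1 : {within @I01 R, continuous psi}.
  apply: withinM => //.
  by apply: (@within_compo _ h (fun x => chi (x + s0))) => //; exact: contDr.
have c2 : {within @I01 R, continuous psi'}.
  apply: withinD; apply: withinM => //.
  - by apply: (@within_compo _ h (fun x => chi (x + s0))) => //; exact: contDr.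
  - apply: (@within_eq _ (fun x => -1 * (c1_der a x * (pa x * pa x)))).
      by move=> x _; rewrite mulN1r expr2.
    apply: withinM; first exact: within_cst.
    by apply: withinM; [exact: c1_derC|exact: withinM].
  - apply: withinM; last by apply: withinM => //; exact: within_cst.
    by apply: (@within_compo _ h (fun x => chi' (x + s0))) => //; exact: contDr.
have dpa x : 0 < x < 1 -> is_derive x 1 pa (- (c1_der a x * pa x ^+ 2)).
  move=> x01.
  have d1 := @is_deriveV _ _ _ _ 1 (lt0r_neq0 (@a_gt0 x (oo_cc x01))) (@c1_derP _ a x x01).
  have -> : - (c1_der a x * pa x ^+ 2) = - a x ^- 2 *: c1_der a x.
    rewrite pa_id; last exact: oo_cc.
    by rewrite scaleNr exprVn mulrC.
  apply: near_eq_is_derive d1.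
  have /near_in_itvoo : x \in `]0, 1[ by rewrite in_itv.
  by apply: filterS => z; rewrite in_itv/= => /andP[z0 z1]; rewrite pa_id// !ltW.
have d : forall x : R, 0 < x < 1 -> is_derive x 1 psi (psi' x).
  move=> x x01; apply: is_derive_mul; last exact: dpa.
  apply: (@is_derive_compo _ (fun y => chi (y + s0)) h); last exact: dh.
  have hx : -1 < h x + s0.
    have : 0 <= h x by apply: h0; exact: oo_cc.
    by lra.
  exact: (@is_derive_translate _ chi s0 (h x) _ (dchi _ hx)).
exists (MkC1I c1 c2 d); split=> //= x x01.
rewrite /psi /psi'.
have e1 := apa x01.
rewrite (_ : _ + _ = c1_der a x * (chi (h x + s0) * pa x) * (1 - a x * pa x) +
   a x * pa x * (chi' (h x + s0) * (sg * pa x))); last by ring.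
by rewrite e1; ring.
Qed.

Lemma hL_derive01 x : 0 < x < 1 -> is_derive x 1 hL (1 * pa x).
Proof. by move=> /andP[x0 _]; rewrite mul1r; exact: hL_derive. Qed.

Lemma hR_derive01 x : 0 < x < 1 -> is_derive x 1 hR (-1 * pa x).
Proof.
move=> /andP[x0 _].
have := is_derive_sub (is_derive_cst Ht x (1:R)) (hL_derive x0).
by move=> /is_derive_eq; apply; rewrite sub0r mulN1r.
Qed.

Lemma hR_cont : continuous hR.
Proof. by move=> x; apply: cvgB; [exact: cvg_cst|exact: hL_cont]. Qed.

Lemma leftward_transport gam (w f : R -> R -> R) (F g y : R -> R) :
  cl2 w -> source pa hL gam f F -> tl2 g -> tl2 y -> weak_leftward a w f g y ->
  weak_transport pa hL Ht w f g y true.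
Proof.
move=> wc fF g2 y2 wl chi chi' dchi cchi s0 s t s00 s_0 st _.
have t0 : 0 <= t by exact: le_trans st.
have [psi [psiE dpsi]] := transported_test (continuous_subspaceT hL_cont)
  (fun x x01 => (proj1 (andP (hL01 x01)))) hL_derive01 dchi cchi s00.
have pE r : pair pa hL (w r) chi s0 = Int 0 1 (fun x => w r x * psi x).
  by apply: eq_Int => x _; rewrite psiE.
pose G r := g r * chi (Ht + s0) - y r * chi s0 +
  (pair pa hL (f r) chi s0 - pair pa hL (w r) chi' s0).
have wpa : {within `[0, 1], continuous pa} by apply: continuous_subspaceT; exact: pa_cont.
have tc (c : R -> R) : continuous c -> {within `[0, 1], continuous (fun x => c (hL x + s0) * pa x)}.
  by move=> cc; apply: test_cont => //; exact: continuous_subspaceT hL_cont.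
have ph (c : R -> R) : continuous c -> cl2 (fun (_ : R) x => c (hL x + s0) * pa x).
  by move=> cc; apply: cl2_cst; apply: sqi_cont; exact: tc.
have Gi u : 0 <= u -> itg 0 u G.
  move=> u0; apply: itgD.
    by apply: itgB; apply: itgZr; apply: sqi_itg; [exact: g2|exact: y2].
  apply: itgB.
    by apply: (source_itg fF (phi := fun _ x => chi (hL x + s0) * pa x)) => //; exact: ph.
  by apply: cont0_itg => //; apply: cl2_pair => //; apply: ph; case: dchi.
have main u : 0 <= u -> Int 0 1 (fun x => w u x * psi x) =
    Int 0 1 (fun x => w 0 x * psi x) + Int 0 u G.
  move=> u0; rewrite (wl psi u u0); congr (_ + _); apply: eq_Int => r /andP[r0 _].
  rewrite /G; congr (_ + _).
    rewrite !psiE hL0 add0r -/Ht.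
    have a0 : a 0 * pa 0 = 1 by apply: apa; rewrite lexx ler01.
    have a1 : a 1 * pa 1 = 1 by apply: apa; rewrite lexx ler01.
    rewrite (_ : a 1 * g r * _ = (a 1 * pa 1) * (g r * chi (Ht + s0))); last by ring.
    rewrite (_ : a 0 * y r * _ = (a 0 * pa 0) * (y r * chi s0)); last by ring.
    by rewrite a0 a1 !mul1r.
  have ws := sqi_itg (cl2_sqi wc r0).
  have fs := sqi_itg (source_sqi fF r0).
  have i1 : itg 0 1 (fun x => w r x * (chi' (hL x + s0) * pa x)).
    by apply: itg_cMr => //; apply: tc; case: dchi.
  have i2 : itg 0 1 (fun x => f r x * (chi (hL x + s0) * pa x)).
    by apply: itg_cMr => //; apply: tc.
  rewrite /pair -IntB//; apply: eq_Int => x x01.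
  by rewrite (dpsi x x01) psiE mul1r; ring.
rewrite !pE (main t t0) (main s s_0) -/G.
have := Int_diff s_0 st (Gi t t0) => <-; ring.
Qed.

Lemma rightward_transport gam (w f : R -> R -> R) (F g : R -> R) :
  cl2 w -> source pa hR gam f F -> tl2 g -> weak_rightward a w f g ->
  weak_transport pa hR Ht w f g (fun=> 0) false.
Proof.
move=> wc fF g2 wl chi chi' dchi cchi s0 s t s00 s_0 st [//|chi0].
have t0 : 0 <= t by exact: le_trans st.
have [psi [psiE dpsi]] := transported_test (continuous_subspaceT hR_cont)
  (fun x x01 => (proj1 (andP (hR01 x01)))) hR_derive01 dchi cchi s00.
have pE r : pair pa hR (w r) chi s0 = Int 0 1 (fun x => w r x * psi x).
  by apply: eq_Int => x _; rewrite psiE.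
pose G r := g r * chi (Ht + s0) - 0 * chi s0 +
  (pair pa hR (f r) chi s0 - pair pa hR (w r) chi' s0).
have wpa : {within `[0, 1], continuous pa} by apply: continuous_subspaceT; exact: pa_cont.
have tc (c : R -> R) : continuous c -> {within `[0, 1], continuous (fun x => c (hR x + s0) * pa x)}.
  by move=> cc; apply: test_cont => //; exact: continuous_subspaceT hR_cont.
have ph (c : R -> R) : continuous c -> cl2 (fun (_ : R) x => c (hR x + s0) * pa x).
  by move=> cc; apply: cl2_cst; apply: sqi_cont; exact: tc.
have Gi u : 0 <= u -> itg 0 u G.
  move=> u0; apply: itgD.
    apply: itgB; apply: itgZr; last exact: itg_cst.
    by apply: sqi_itg; exact: g2.
  apply: itgB.
    by apply: (source_itg fF (phi := fun _ x => chi (hR x + s0) * pa x)) => //; exact: ph.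
  by apply: cont0_itg => //; apply: cl2_pair => //; apply: ph; case: dchi.
have psi1 : psi 1 = 0 by rewrite psiE /hR /Ht subrr add0r chi0 mul0r.
have main u : 0 <= u -> Int 0 1 (fun x => w u x * psi x) =
    Int 0 1 (fun x => w 0 x * psi x) + Int 0 u G.
  move=> u0; rewrite (wl psi u psi1 u0); congr (_ + _); apply: eq_Int => r /andP[r0 _].
  rewrite /G; congr (_ + _).
    rewrite !psiE /hR hL0 subr0 mul0r subr0.
    have a0 : a 0 * pa 0 = 1 by apply: apa; rewrite lexx ler01.
    rewrite (_ : a 0 * g r * _ = (a 0 * pa 0) * (g r * chi (Ht + s0))); last by ring.
    by rewrite a0 mul1r.
  have ws := sqi_itg (cl2_sqi wc r0).
  have fs := sqi_itg (source_sqi fF r0).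
  have i1 : itg 0 1 (fun x => w r x * (chi' (hR x + s0) * pa x)).
    by apply: itg_cMr => //; apply: tc; case: dchi.
  have i2 : itg 0 1 (fun x => f r x * (chi (hR x + s0) * pa x)).
    by apply: itg_cMr => //; apply: tc.
  rewrite /pair -IntB//; apply: eq_Int => x x01.
  by rewrite (dpsi x x01) psiE; ring.
rewrite !pE (main t t0) (main s s_0) -/G.
have := Int_diff s_0 st (Gi t t0) => <-; ring.
Qed.

Lemma pa01 x : 0 <= x <= 1 -> 0 < pa x.
Proof. by move=> _; exact: pa_gt0. Qed.

(** Leftward waves leave through x = 0, where the test functions are free: the
    trace is part of the weak formulation and is released by the energy. *)
Lemma energy_left gam rho (w f : R -> R -> R) (F g y : R -> R) t1 t2 :
  0 <= gam -> 0 < rho -> cl2 w -> source pa hL gam f F -> tl2 g -> tl2 y ->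
  weak_leftward a w f g y -> 0 <= t1 -> t1 <= t2 ->
  Ew pa hL gam (w t2) - Ew pa hL gam (w t1) <=
  Int t1 t2 (fun r => - (gam - rho) * Ew pa hL gam (w r) +
    expR (gam * Ht) * g r ^+ 2 + rho^-1 * F r ^+ 2 - y r ^+ 2).
Proof.
move=> gam0 rho0 wc fF g2 y2 wl t10 t12; have [hi chi hiK] := hL_inverse.
apply: (@energy R pa hL hi Ht gam Ht_ge0 gam0 (continuous_subspaceT pa_cont) pa01
  (continuous_subspaceT hL_cont) hL01 chi hiK hL_sub w f F g y true) => //.
  exact: (leftward_transport wc fF g2 y2 wl).
by left.
Qed.

(** Rightward waves leave through x = 1, where the test functions vanish: no
    outflow trace appears. *)
Lemma energy_right gam rho (w f : R -> R -> R) (F g : R -> R) t1 t2 :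
  0 <= gam -> 0 < rho -> cl2 w -> source pa hR gam f F -> tl2 g ->
  weak_rightward a w f g -> 0 <= t1 -> t1 <= t2 ->
  Ew pa hR gam (w t2) - Ew pa hR gam (w t1) <=
  Int t1 t2 (fun r => - (gam - rho) * Ew pa hR gam (w r) +
    expR (gam * Ht) * g r ^+ 2 + rho^-1 * F r ^+ 2).
Proof.
move=> gam0 rho0 wc fF g2 wl t10 t12; have [hi chi hiK] := hR_inverse.
have := @energy R pa hR hi Ht gam Ht_ge0 gam0 (continuous_subspaceT pa_cont) pa01
  (continuous_subspaceT hR_cont) hR01 chi hiK hR_sub w f F g (fun=> 0) false wc fF g2 _
  (rightward_transport wc fF g2 wl) _ t1 t2 rho t10 t12 rho0.
rewrite (eq_Int (g := fun r => - (gam - rho) * Ew pa hR gam (w r) +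
    expR (gam * Ht) * g r ^+ 2 + rho^-1 * F r ^+ 2)); last first.
  by move=> r _; rewrite expr0n subr0.
apply; last by right.
by move=> t t0; apply: sqi_cont; exact: within_cst.
Qed.

End travel.

(** * Volterra operators on the triangle *)

Section volterra.
Variable R : realType.
Implicit Types (k : R -> R -> R) (w f g phi : R -> R) (a b c e s t r x y xi C : R).

Definition cT k : Prop := {within @triangle R, continuous (fun z => k z.1 z.2)}.

(** The composition of k with a retraction of the plane onto the triangle:
    continuous everywhere, and equal to k wherever V and Vs look at it. *)
Definition kb k x xi : R := k (c01 x) (Num.min (c01 x) (c01 xi)).

Lemma kb_id k x xi : 0 <= xi -> xi <= x -> x <= 1 -> kb k x xi = k x xi.
Proof.
move=> xi0 xix x1; rewrite /kb !c01_id ?min_r//; first by rewrite xi0 (le_trans xix).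
by rewrite (le_trans xi0).
Qed.

Lemma kb_c01 k x xi : kb k (c01 x) (c01 xi) = kb k x xi.
Proof. by rewrite /kb !(c01_id (c01_in _)). Qed.

Lemma kb_cont k : cT k -> continuous (fun z : R * R => kb k z.1 z.2).
Proof.
move=> kT.
pose r (z : R * R) := (c01 z.1, Num.min (c01 z.1) (c01 z.2)).
apply: (@retract_cont _ _ (@triangle R) r (fun z => k z.1 z.2)) => //.
  have c1 : continuous (fun z : R * R => c01 z.1).
    by move=> z; apply: (@cvg_comp _ _ _ (fun z : R * R => z.1) (@c01 R) (nbhs z) (nbhs z.1)); [exact: cvg_fst|exact: c01_cont].
  have c2 : continuous (fun z : R * R => c01 z.2).
    by move=> z; apply: (@cvg_comp _ _ _ (fun z : R * R => z.2) (@c01 R) (nbhs z) (nbhs z.2)); [exact: cvg_snd|exact: c01_cont].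
  move=> z; apply: (@cvg_pair _ _ _ (nbhs z) (nbhs (c01 z.1)) (nbhs (Num.min (c01 z.1) (c01 z.2)))); first exact: c1.
  by apply: (@continuous_min _ _ (fun z : R * R => c01 z.1) (fun z : R * R => c01 z.2)); [exact: c1|exact: c2].
move=> z; rewrite /triangle/= /r/=; have /andP[h1 h2] := c01_in z.1; have /andP[h3 h4] := c01_in z.2.
by split; [rewrite le_min h1|split => //; rewrite ge_min lexx].
Qed.

Lemma kb_cont1 k xi : cT k -> continuous (fun x => kb k x xi).
Proof.
move=> /kb_cont ck x; apply: (@continuous_comp _ _ _ (fun x : R => (x, xi)) (fun z : R * R => kb k z.1 z.2)); last exact: ck.
by apply: (@cvg_pair _ _ _ (nbhs x) (nbhs x) (nbhs xi)); [exact: cvg_id|exact: cvg_cst].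
Qed.

Lemma kb_cont2 k x : cT k -> continuous (kb k x).
Proof.
move=> /kb_cont ck xi; apply: (@continuous_comp _ _ _ (fun xi : R => (x, xi)) (fun z : R * R => kb k z.1 z.2)); last exact: ck.
by apply: (@cvg_pair _ _ _ (nbhs xi) (nbhs x) (nbhs xi)); [exact: cvg_cst|exact: cvg_id].
Qed.

Let square : set (R * R) := `[0, 1] `*` `[0, 1].

Let compact_square : compact square.
Proof. by apply: compact_setX; exact: segment_compact. Qed.

Lemma kb_bounded k : cT k -> exists2 C, 0 <= C & forall x xi, `|kb k x xi| <= C.
Proof.
move=> kT; have /compact_bounded[M [_ MP]] :=
  continuous_compact (continuous_subspaceT (kb_cont kT)) compact_square.
exists (`|M| + 1); first by rewrite addr_ge0.
move=> x xi; rewrite -kb_c01; apply: (MP (`|M| + 1)); first by rewrite ltr_pwDr// ler_norm.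
exists (c01 x, c01 xi) => //; split; rewrite /= in_itv/= c01_in//.
Qed.

Lemma c01_lip (u v : R) : `|c01 u - c01 v| <= `|u - v|.
Proof.
have H (p q : R) : p <= q -> 0 <= c01 q - c01 p <= q - p.
  move=> pq; rewrite /c01; case: (lerP 0 p) => h1; case: (lerP 0 q) => h2; try lra.
  - by case: (lerP 1 p) => h3; case: (lerP 1 q) => h4; lra.
  - by rewrite (min_r ler01); case: (lerP 1 q) => h4; lra.
have [uv|/ltW vu] := lerP u v.
  by have /andP[h1 h2] := H _ _ uv; rewrite distrC ger0_norm//; lra.
by have /andP[h1 h2] := H _ _ vu; rewrite !ger0_norm//; lra.
Qed.

Lemma kb_heine k e : cT k -> 0 < e -> exists2 d, 0 < d & forall x y xi eta,
  `|x - y| < d -> `|xi - eta| < d -> `|kb k x xi - kb k y eta| < e.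
Proof.
move=> kT e0; have [d d0 dP] := heine compact_square (kb_cont kT) e0.
exists d => // x y xi eta xy xe.
rewrite -kb_c01 -(kb_c01 k y).
apply: (dP (c01 x, c01 xi) (c01 y, c01 eta)).
  by split; rewrite /= in_itv/= c01_in.
by split => /=; apply: le_lt_trans (c01_lip _ _) _.
Qed.

(** Vs is the adjoint of V for the pairing int_0^1 f g. *)
Definition V k w x : R := Int 0 x (fun xi => k x xi * w xi).
Definition Vs k phi xi : R := Int xi 1 (fun x => k x xi * phi x).

Lemma V_kb k w x : x <= 1 -> V k w x = Int 0 x (fun xi => kb k x xi * w xi).
Proof. by move=> x1; apply: eq_Int => xi /andP[xi0 xix]; rewrite kb_id. Qed.

Lemma Vs_kb k phi xi : 0 <= xi -> Vs k phi xi = Int xi 1 (fun x => kb k x xi * phi x).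
Proof. by move=> xi0; apply: eq_Int => x /andP[xix x1]; rewrite kb_id. Qed.

Lemma kb_itg1 k w x a b : cT k -> itg a b w -> itg a b (fun xi => kb k x xi * w xi).
Proof. by move=> kT wi; apply: itg_cM => //; apply: continuous_subspaceT; exact: kb_cont2. Qed.

Lemma kb_itg2 k w xi a b : cT k -> itg a b w -> itg a b (fun x => kb k x xi * w x).
Proof. by move=> kT wi; apply: itg_cM => //; apply: continuous_subspaceT; exact: kb_cont1. Qed.

Lemma within_eps f a b : (forall x, a <= x <= b -> forall e, 0 < e ->
    exists2 d, 0 < d & forall y, a <= y <= b -> `|x - y| < d -> `|f x - f y| <= e) ->
  {within `[a, b], continuous f}.
Proof.
move=> H; apply/subspace_continuousP => x; rewrite /= in_itv/= => xab.
apply/cvgrPdist_le => e e0; have [d d0 dP] := H x xab e e0.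
rewrite near_withinE; exists d => // y /= xy; rewrite in_itv/= => yab.
exact: dP.
Qed.

(** Integrals of |f| over short intervals are small, uniformly in the position
    of the interval, by Cauchy-Schwarz. *)
Lemma prim_abs_small f a b e : sqi a b f -> a <= b -> 0 < e ->
  exists2 d, 0 < d & forall x y, a <= x -> x <= y -> y <= b -> y - x < d ->
    Int x y (fun r => `|f r|) <= e.
Proof.
move=> fs ab e0; pose N := Int a b (fun x => f x ^+ 2).
have N0 : 0 <= N by apply: Int_ge0 => x _; exact: sqr_ge0.
exists (e ^+ 2 / (N + 1)); first by rewrite divr_gt0 ?exprn_gt0// ltr_wpDl.
move=> x y ax xy yb xyd.
have fxy := sqi_sub ax yb fs.
have := cauchy_schwarz (sqi_norm fxy) (sqi_cont (@within_cst R x y 1)).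
rewrite (eq_Int (g := fun r => `|f r|)); last by move=> r _; rewrite mulr1.
rewrite expr1n Int_cst// mul1r => CS.
have I0 : 0 <= Int x y (fun r => `|f r|) by exact: Int_ge0.
rewrite -(ler_pXn2r (n := 2))// ?nnegrE ?(ltW e0)//.
apply: (le_trans CS); rewrite (eq_Int (g := fun r => f r ^+ 2)); last first.
  by move=> r _; rewrite real_normK ?num_real.
apply: (@le_trans _ _ (N * (y - x))).
  rewrite ler_wpM2r ?subr_ge0//; apply: Int_le_set => //; first by case: fs.
  by move=> r _; exact: sqr_ge0.
apply: (@le_trans _ _ ((N + 1) * (e ^+ 2 / (N + 1)))).
  by apply: ler_pM => //; rewrite ?subr_ge0 ?lerDl ?(ltW xyd).
by rewrite mulrC divfK// gt_eqF// ltr_wpDl.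
Qed.

Lemma V_cont k w : cT k -> sqi 0 1 w -> {within `[0, 1], continuous (V k w)}.
Proof.
move=> kT ws; apply: within_eps => x x01 e e0.
have wi := sqi_itg ws.
have [C C0 CP] := kb_bounded kT.
pose N := Int 0 1 (fun x => `|w x|).
have N0 : 0 <= N by exact: Int_ge0.
have e1 : 0 < e / 2 / (N + 1) by rewrite !divr_gt0// ltr_wpDl.
have e2 : 0 < e / 2 / (C + 1) by rewrite !divr_gt0// ltr_wpDl.
have [d1 d10 D1] := kb_heine kT e1.
have [d2 d20 D2] := prim_abs_small ws ler01 e2.
exists (Num.min d1 d2); first by rewrite lt_min d10.
have main u v : 0 <= u -> u <= v -> v <= 1 -> v - u < Num.min d1 d2 -> `|V k w v - V k w u| <= e.
  move=> u0 uv v1; rewrite lt_min => /andP[uv1 uv2].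
  have u1 : u <= 1 by exact: le_trans v1.
  have v0 : 0 <= v by exact: le_trans uv.
  have wu := itg_sub (lexx 0) u1 wi.
  have wv := itg_sub (lexx 0) v1 wi.
  have wuv := itg_sub u0 v1 wi.
  rewrite !V_kb// (Int_cat u0 uv (kb_itg1 v kT wv)) addrAC -IntB; [|exact: kb_itg1|exact: kb_itg1].
  rewrite (splitr e) (le_trans (ler_normD _ _))//; apply: lerD.
    have ii : itg 0 u (fun xi => kb k v xi * w xi - kb k u xi * w xi).
      by apply: itgB; exact: kb_itg1.
    apply: (le_trans (Int_norm ii)).
    apply: (@le_trans _ _ (Int 0 u (fun xi => e / 2 / (N + 1) * `|w xi|))).
      apply: Int_le; [exact: itg_norm|by apply: itgZ; exact: itg_norm|move=> r _].
      rewrite -mulrBl normrM ler_wpM2r// ltW// D1 ?subrr ?normr0//.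
      by rewrite ger0_norm ?subr_ge0.
    rewrite IntZ; last exact: itg_norm.
    apply: (@le_trans _ _ (e / 2 / (N + 1) * (N + 1))).
      rewrite ler_wpM2l ?(ltW e1)// (@le_trans _ _ N) ?lerDl//.
      by apply: Int_le_set => //; exact: itg_norm.
    by rewrite divfK// gt_eqF// ltr_wpDl.
  apply: (le_trans (Int_norm (kb_itg1 v kT wuv))).
  apply: (@le_trans _ _ (Int u v (fun xi => C * `|w xi|))).
    apply: Int_le; [by apply: itg_norm; exact: kb_itg1|by apply: itgZ; exact: itg_norm|].
    by move=> r _; rewrite normrM ler_wpM2r.
  rewrite IntZ; last exact: itg_norm.
  apply: (@le_trans _ _ (C * (e / 2 / (C + 1)))).
    by rewrite ler_wpM2l// D2.
  rewrite mulrA ler_pdivrMr ?ltr_wpDl// mulrC ler_wpM2l ?lerDl//.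
  by rewrite divr_ge0 ?(ltW e0).
move=> y y01 xy; have [xley|/ltW ylex] := leP x y.
  rewrite distrC; apply: main => //; [by case/andP: x01|by case/andP: y01|].
  by move: xy; rewrite distrC ger0_norm ?subr_ge0.
apply: main => //; [by case/andP: y01|by case/andP: x01|].
by move: xy; rewrite ger0_norm ?subr_ge0.
Qed.

Lemma Vs_cont k w : cT k -> sqi 0 1 w -> {within `[0, 1], continuous (Vs k w)}.
Proof.
move=> kT ws; apply: within_eps => x x01 e e0.
have wi := sqi_itg ws.
have [C C0 CP] := kb_bounded kT.
pose N := Int 0 1 (fun x => `|w x|).
have N0 : 0 <= N by exact: Int_ge0.
have e1 : 0 < e / 2 / (N + 1) by rewrite !divr_gt0// ltr_wpDl.
have e2 : 0 < e / 2 / (C + 1) by rewrite !divr_gt0// ltr_wpDl.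
have [d1 d10 D1] := kb_heine kT e1.
have [d2 d20 D2] := prim_abs_small ws ler01 e2.
exists (Num.min d1 d2); first by rewrite lt_min d10.
have main u v : 0 <= u -> u <= v -> v <= 1 -> v - u < Num.min d1 d2 -> `|Vs k w u - Vs k w v| <= e.
  move=> u0 uv v1; rewrite lt_min => /andP[uv1 uv2].
  have u1 : u <= 1 by exact: le_trans v1.
  have v0 : 0 <= v by exact: le_trans uv.
  have wu := itg_sub u0 (lexx 1) wi.
  have wv := itg_sub v0 (lexx 1) wi.
  have wuv := itg_sub u0 v1 wi.
  rewrite !Vs_kb// (Int_cat uv v1 (kb_itg2 u kT wu)) -addrA -IntB; [|exact: kb_itg2|exact: kb_itg2].
  rewrite addrC (splitr e) (le_trans (ler_normD _ _))//; apply: lerD.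
    have ii : itg v 1 (fun xi => kb k xi u * w xi - kb k xi v * w xi).
      by apply: itgB; exact: kb_itg2.
    apply: (le_trans (Int_norm ii)).
    apply: (@le_trans _ _ (Int v 1 (fun xi => e / 2 / (N + 1) * `|w xi|))).
      apply: Int_le; [exact: itg_norm|by apply: itgZ; exact: itg_norm|move=> r _].
      rewrite -mulrBl normrM ler_wpM2r// ltW// D1 ?subrr ?normr0//.
      by rewrite distrC ger0_norm ?subr_ge0.
    rewrite IntZ; last exact: itg_norm.
    apply: (@le_trans _ _ (e / 2 / (N + 1) * (N + 1))).
      rewrite ler_wpM2l ?(ltW e1)// (@le_trans _ _ N) ?lerDl//.
      by apply: Int_le_set => //; exact: itg_norm.
    by rewrite divfK// gt_eqF// ltr_wpDl.
  apply: (le_trans (Int_norm (kb_itg2 u kT wuv))).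
  apply: (@le_trans _ _ (Int u v (fun xi => C * `|w xi|))).
    apply: Int_le; [by apply: itg_norm; exact: kb_itg2|by apply: itgZ; exact: itg_norm|].
    by move=> r _; rewrite normrM ler_wpM2r.
  rewrite IntZ; last exact: itg_norm.
  apply: (@le_trans _ _ (C * (e / 2 / (C + 1)))).
    by rewrite ler_wpM2l// D2.
  rewrite mulrA ler_pdivrMr ?ltr_wpDl// mulrC ler_wpM2l ?lerDl//.
  by rewrite divr_ge0 ?(ltW e0).
move=> y y01 xy; have [xley|/ltW ylex] := leP x y.
  apply: main => //; [by case/andP: x01|by case/andP: y01|].
  by move: xy; rewrite distrC ger0_norm ?subr_ge0.
rewrite distrC; apply: main => //; [by case/andP: y01|by case/andP: x01|].
by move: xy; rewrite ger0_norm ?subr_ge0.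
Qed.

(** Joint measurability, as the pointwise limit of kernels that are piecewise
    constant in the first variable. *)
Lemma kb_measurable k : cT k -> measurable_fun setT (fun z : R * R => kb k z.1 z.2).
Proof.
move=> kT.
pose A (n j : nat) := [set x : R | j%:R <= n.+1%:R * c01 x < j.+1%:R].
pose kn (n : nat) (z : R * R) : R :=
  \sum_(j <- index_enum 'I_n.+2) (\1_(A n j) z.1 * kb k (j%:R / n.+1%:R) z.2).
apply: (@measurable_fun_cvg _ _ _ _ kn).
  move=> n; apply: measurable_sum => j; apply: measurable_funM.
    suff mA : measurable_fun [set: R] (\1_(A n j) : R -> R) by exact: (measurableT_comp mA measurable_fst).
    apply: measurable_indic.
    have -> : A n j = (fun x => n.+1%:R * c01 x) @^-1` `[j%:R, j.+1%:R[.
      by apply/seteqP; split => x; rewrite /A /= in_itv.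
    rewrite -[X in measurable X]setTI; apply: continuous_measurable_fun => //.
    by move=> x; apply: cvgM; [exact: cvg_cst|exact: c01_cont].
  have mk : measurable_fun [set: R] (kb k (j%:R / n.+1%:R)).
    by apply: continuous_measurable_fun; exact: kb_cont2.
  exact: (measurableT_comp mk measurable_snd).
move=> [x xi] _; apply/cvgrPdist_lt => e e0.
have [d d0 dP] := kb_heine kT e0.
have [N _ NP] : \forall n \near \oo, (n.+1%:R)^-1 < d.
  by near=> n; near: n; exact: near_infty_natSinv_lt (PosNum d0).
exists N => // n /= nN; have := NP n nN; rewrite /= => nd.
have n0 : (0:R) < n.+1%:R by rewrite ltr0n.
have /andP[x0 x1] := c01_in x.
have y0 : 0 <= n.+1%:R * c01 x by rewrite mulr_ge0.
pose m := Num.truncn (n.+1%:R * c01 x).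
have /andP[m1 m2] := truncn_itv y0; rewrite -/m in m1 m2.
have mn : (m < n.+2)%N.
  rewrite ltnS -(ler_nat R) (le_trans m1)//.
  by rewrite -[leRHS]mulr1 ler_wpM2l// ltW.
rewrite /kn /= (bigD1_seq (Ordinal mn)) ?mem_index_enum ?index_enum_uniq//= big1 ?addr0; last first.
  move=> j jm; rewrite indicE memNset ?mul0r// => /andP[j1 j2].
  move/eqP: jm; apply; apply/val_inj => /=; apply/eqP.
  rewrite eqn_leq -ltnS -(ltr_nat R) (le_lt_trans j1 m2)/=.
  by rewrite -ltnS -(ltr_nat R) (le_lt_trans m1 j2).
rewrite indicE mem_set; last by rewrite /A /= m1 m2.
rewrite mul1r.
have -> : kb k x xi = kb k (c01 x) xi by rewrite -(kb_c01 k (c01 x)) c01_id ?c01_in// kb_c01.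
apply: dP; last by rewrite subrr normr0.
have -> : c01 x - m%:R / n.+1%:R = (n.+1%:R * c01 x - m%:R) / n.+1%:R.
  by field; rewrite addrC natr1 gt_eqF.
rewrite ger0_norm ?divr_ge0 ?subr_ge0// (le_lt_trans _ nd)//.
rewrite -[leRHS]mul1r ler_wpM2r ?invr_ge0//.
by rewrite lerBlDl natr1 ltW.
Unshelve. all: by end_near. Qed.

Lemma EInt a b f : itg a b f ->
  (\int[leb]_(x in `[a, b]) (f x)%:E)%E = (Int a b f)%:E.
Proof. by move=> fi; rewrite /Rintegral fineK//; exact: integrable_fin_num. Qed.

(** Fubini's theorem for the integrand extended by zero from the triangle to
    the plane. *)
Lemma Fubini_triangle k w phi : cT k -> itg 0 1 w -> itg 0 1 phi ->
  Int 0 1 (fun x => V k w x * phi x) = Int 0 1 (fun xi => w xi * Vs k phi xi).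
Proof.
move=> kT wi pi.
pose W := w \_ `[0, 1]; pose P := phi \_ `[0, 1].
pose T := measurableTypeR R.
pose F (z : T * T) : R := if z.2 <= z.1 then kb k z.1 z.2 * (W z.2 * P z.1) else 0.
have [C C0 CP] := kb_bounded kT.
have m01 : measurable (`[0, 1] : set T) by exact: measurable_itv.
have WI : leb.-integrable [set: T] (EFin \o W).
  by have := (@integrable_mkcond _ T R (@lebesgue_measure R) _ (EFin \o w) m01).1 wi; rewrite restrict_EFin.
have PI : leb.-integrable [set: T] (EFin \o P).
  by have := (@integrable_mkcond _ T R (@lebesgue_measure R) _ (EFin \o phi) m01).1 pi; rewrite restrict_EFin.
have mW : measurable_fun [set: T] W by case/integrableP: WI => /measurable_EFinP.
have mP : measurable_fun [set: T] P by case/integrableP: PI => /measurable_EFinP.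
have mF : measurable_fun [set: T * T] F.
  apply: measurable_fun_ifT; [exact: (measurable_fun_ler measurable_snd measurable_fst)| |exact: measurable_cst].
  apply: measurable_funM; first exact: kb_measurable.
  apply: measurable_funM.
    exact: (measurableT_comp mW measurable_snd).
  exact: (measurableT_comp mP measurable_fst).
have mEF : measurable_fun [set: T * T] (EFin \o F) by exact/measurable_EFinP.
have Fle x y : `|F (x, y)| <= C * `|P x| * `|W y|.
  rewrite /F /=; case: ifP => _; last by rewrite normr0 !mulr_ge0.
  by rewrite !normrM -mulrA [`|P x| * _]mulrC ler_wpM2r ?mulr_ge0.
have mFx x : measurable_fun [set: T] (fun y => F (x, y)).
  exact: (measurableT_comp mF (pair1_measurable x)).
have normI (f : R -> R) : leb.-integrable [set: T] (EFin \o f) ->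
    exists2 M : R, 0 <= M & (\int[leb]_y (`|f y|)%:E)%E = M%:E.
  move=> /integrable_norm fi; exists (fine (\int[leb]_y (`|f y|)%:E)%E).
    by rewrite fine_ge0// integral_ge0// => y _; rewrite lee_fin.
  by rewrite fineK//; exact: (integrable_fin_num _ fi).
have [NW NW0 NWE] := normI _ WI; have [NP NP0 NPE] := normI _ PI.
have mnW : measurable_fun [set: T] (fun y => (`|W y|)%:E).
  by apply/measurable_EFinP; exact: measurableT_comp.
have mnP : measurable_fun [set: T] (fun y => (`|P y|)%:E).
  by apply/measurable_EFinP; exact: measurableT_comp.
have FI : (leb \x leb)%E.-integrable [set: T * T] (EFin \o F).
  apply/integrable12ltyP => //.
  apply: (@le_lt_trans _ _ (\int[leb]_x ((C * NW)%:E * (`|P x|)%:E))%E); last first.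
    rewrite ge0_integralZl_EFin// ?mulr_ge0//.
    by rewrite NPE -EFinM ltry.
  have in1 x : (\int[leb]_y `|(F (x, y))%:E| <= (C * NW)%:E * (`|P x|)%:E)%E.
    apply: (@le_trans _ _ (\int[leb]_y ((C * `|P x|)%:E * (`|W y|)%:E))%E).
      apply: ge0_le_integral => //.
      - by apply/measurable_EFinP; apply: measurableT_comp.
      - by apply: measurable_funeM.
      - by move=> y _; rewrite /= lee_fin.
    rewrite ge0_integralZl_EFin// ?mulr_ge0//.
    by rewrite NWE -!EFinM lee_fin mulrAC.
  apply: ge0_le_integral => //.
  - by move=> x _; exact: integral_ge0.
  - apply: (@measurable_fun_fubini_tonelli_F _ _ T T R (@lebesgue_measure R) (fun z => `|(EFin \o F) z|%E)) => //.
    by apply/measurable_EFinP; exact: measurableT_comp.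
  - by apply: measurable_funeM.
  - by move=> x _; exact: in1.
have := Fubini FI.
have -> : (fun x => \int[leb]_y (F (x, y))%:E)%E = EFin \o ((fun x => V k w x * phi x) \_ `[0, 1]).
  apply/funext => x /=; rewrite patchE; case: ifPn => xI; last first.
    rewrite integral0_eq// => y _; rewrite /F/= /P patchE (negbTE xI) !mulr0.
    by case: ifP.
  move: xI; rewrite inE/= in_itv/= => /andP[x0 x1].
  rewrite V_kb// -IntZr; last by apply: kb_itg1 => //; exact: itg_sub wi.
  rewrite -EInt; last by apply: itgZr; apply: kb_itg1 => //; exact: itg_sub wi.
  rewrite [RHS]integral_mkcond; apply: eq_integral => y _.
  rewrite /F/= /W /P !patchE !mem_setE /= !in_itv/= x0 x1 /=.
  have [yx|xy] := lerP y x; rewrite ?andbF//= andbT.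
  rewrite (le_trans yx x1) andbT; case: ifP => // _; last by rewrite mul0r mulr0.
  by rewrite mulrA.
have -> : (fun y => \int[leb]_x (F (x, y))%:E)%E = EFin \o ((fun y => w y * Vs k phi y) \_ `[0, 1]).
  apply/funext => y /=; rewrite patchE; case: ifPn => yI; last first.
    rewrite integral0_eq// => x _; rewrite /F/= /W patchE (negbTE yI) mul0r mulr0.
    by case: ifP.
  move: yI; rewrite inE/= in_itv/= => /andP[y0 y1].
  rewrite Vs_kb// -IntZ; last by apply: kb_itg2 => //; exact: itg_sub pi.
  rewrite -EInt; last by apply: itgZ; apply: kb_itg2 => //; exact: itg_sub pi.
  rewrite [RHS]integral_mkcond; apply: eq_integral => x _.
  rewrite /F/= /W /P !patchE !mem_setE /= !in_itv/= y0 y1 /=.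
  have [yx|xy] := lerP y x => //=.
  rewrite (le_trans y0 yx) /=; case: ifP => // _; last by rewrite !mulr0.
  by rewrite mulrCA.
move=> E; rewrite [LHS]Rintegral_mkcond [RHS]Rintegral_mkcond /Rintegral; congr fine; exact: E.
Qed.

End volterra.

(** * Volterra operators and derivatives *)

Section volterra_c1.
Variable R : realType.
Implicit Types (k : R -> R -> R) (w f g phi F D : R -> R) (a b c e s t r x y xi C : R).

Lemma eq_Int_oo a b f g : itg a b f -> itg a b g ->
  (forall x, a < x < b -> f x = g x) -> Int a b f = Int a b g.
Proof.
move=> fi gi fg.
have S0 h : itg a b h -> Int a b h = Rintegral (@lebesgue_measure R) `]a, b[%classic h.
  move=> hi; rewrite -(@Rintegral_itv_bndo_bndc _ (BLeft a) b); last first.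
    by apply: integrableS hi => //; apply: subset_itv; rewrite bnd_simp.
  rewrite -(@Rintegral_itv_obnd_cbnd _ a (BLeft b))//.
  by apply: integrableS hi => //; apply: subset_itv; rewrite bnd_simp.
rewrite !S0//; apply: eq_Rintegral => x; rewrite inE/= in_itv/=; exact: fg.
Qed.

(** F is the integral of the continuous function D: a form of C^1 on [0, 1]
    that requires no differentiability at the end points, and is easier to
    establish for integral operators. *)
Definition C1on F D := {within `[0, 1], continuous D} /\
  forall x, 0 <= x <= 1 -> F x = F 0 + Int 0 x D.

Lemma C1on_C1I F D : C1on F D ->
  exists psi : C1I R, forall x, 0 <= x <= 1 -> psi x = F x /\ c1_der psi x = D x.
Proof.
move=> [cD FD]; pose E x := D (c01 x).
have cE : continuous E by exact: ext01_cont.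
have ED x : 0 <= x <= 1 -> E x = D x by move=> x01; rewrite /E c01_id.
pose G x := F 0 + Int 0 x E.
have cG : continuous G by move=> x; apply: (@cvgD _ R^o); [exact: cvg_cst|exact: prim_cont].
have dG x : 0 < x < 1 -> is_derive x 1 G (E x).
  move=> /andP[x0 _]; have := is_derive_add (is_derive_cst (F 0) x (1:R)) (prim_derive cE x0).
  by rewrite add0r.
exists (@MkC1I R G E (continuous_subspaceT cG) (continuous_subspaceT cE) dG) => x x01 /=.
split; last exact: ED.
rewrite FD// /G; congr (_ + _); apply: eq_Int => r /andP[r0 rx].
by rewrite ED// r0 (le_trans rx)//; case/andP: x01.
Qed.

Lemma C1I_C1on (psi : C1I R) : C1on psi (c1_der psi).
Proof.
split=> [|x /andP[x0 x1]]; first exact: c1_derC.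
have sub : `[0, x] `<=` @I01 R by apply: subset_itvl; rewrite bnd_simp.
rewrite (_ : Int 0 x (c1_der psi) = psi x - psi 0); first by ring.
apply: Int_derive => //.
- by move=> r /andP[r0 rx]; apply: c1_derP; rewrite r0 (lt_le_trans rx).
- exact: continuous_subspaceW sub (@c1_funC R psi).
- exact: continuous_subspaceW sub (@c1_derC R psi).
Qed.

Lemma C1onB F D G E : C1on F D -> C1on G E -> C1on (fun x => F x - G x) (fun x => D x - E x).
Proof.
move=> [cD FD] [cE GE]; split; first exact: withinB.
move=> x x01; have /andP[x0 x1] := x01.
rewrite FD// GE// IntB; first by ring.
  by apply: itg_sub (itg_within cD).
by apply: itg_sub (itg_within cE).
Qed.

Lemma Vs1 k phi : Vs k phi 1 = 0.
Proof. exact: Int_point. Qed.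

Lemma V0 k phi : V k phi 0 = 0.
Proof. exact: Int_point. Qed.

Lemma cT_diag k : cT k -> {within `[0, 1], continuous (fun x => k x x)}.
Proof.
move=> kT; apply: (@within_eq _ (fun x => kb k x x)).
  by move=> x /andP[x0 x1]; rewrite kb_id.
apply: continuous_subspaceT => x.
apply: (@continuous_comp _ _ _ (fun x : R => (x, x)) (fun z : R * R => kb k z.1 z.2)); last exact: kb_cont.
by apply: (@cvg_pair _ _ _ (nbhs x) (nbhs x) (nbhs x)); exact: cvg_id.
Qed.

(** x < 1 because the partial derivatives of a C1T are only known inside. *)
Lemma V_dxi (k : C1T R) x xi : 0 <= xi -> xi <= x -> x < 1 ->
  Int xi x (dxi k x) = k x x - k x xi.
Proof.
move=> xi0 xix x1; have x1' := ltW x1; have x0 := le_trans xi0 xix.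
have H (f : R -> R -> R) : cT f -> {within `[xi, x], continuous (f x)}.
  move=> fT; apply: (@within_eq _ (kb f x)).
    by move=> r /andP[r1 r2]; rewrite kb_id// (le_trans xi0).
  by apply: continuous_subspaceT; exact: kb_cont2.
apply: Int_derive => //; [|exact: H (@c1t_funC R k)|exact: H (@c1t_dxiC R k)].
move=> r /andP[r1 r2]; have r0 := le_lt_trans xi0 r1.
by apply: c1t_dxiP => //; rewrite r0.
Qed.

(** Integration by parts in the first variable of the kernel. *)
Lemma Vs_dx (k : C1T R) (h h' : R -> R) xi : 0 < xi -> xi <= 1 ->
  {within `[0, 1], continuous h} -> {within `[0, 1], continuous h'} ->
  (forall x, 0 < x < 1 -> is_derive x 1 h (h' x)) ->
  Vs k h' xi = k 1 xi * h 1 - k xi xi * h xi - Vs (dx k) h xi.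
Proof.
move=> xi0 xi1 ch ch' dh; have xi0' := ltW xi0.
have H (f : R -> R -> R) : cT f -> {within `[xi, 1], continuous (fun x => f x xi)}.
  move=> fT; apply: (@within_eq _ (fun x => kb f x xi)).
    by move=> r /andP[r1 r2]; rewrite kb_id.
  by apply: continuous_subspaceT; exact: kb_cont1.
have sub : (`[xi, 1] `<=` (`[0, 1] : set R))%classic by apply: subset_itvr; rewrite bnd_simp.
have ch1 := continuous_subspaceW sub ch; have ch1' := continuous_subspaceW sub ch'.
have kc := H _ (@c1t_funC R k); have kxc := H _ (@c1t_dxC R k).
have <- : Int xi 1 (fun x => k x xi * h' x + h x * dx k x xi) = k 1 xi * h 1 - k xi xi * h xi.
  apply: (@Int_derive _ (fun x => k x xi * h x)) => //; [|exact: withinM|].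
    move=> r /andP[r1 r2]; apply: is_derive_mul; first by apply: c1t_dxP; rewrite ?xi0.
    by apply: dh; rewrite (lt_trans xi0).
  by apply: withinD; exact: withinM.
rewrite IntD; [|by apply: itg_within; exact: withinM|by apply: itg_within; exact: withinM].
rewrite [X in _ + X - _](eq_Int (g := fun x => dx k x xi * h x)); last by move=> x _; rewrite mulrC.
by rewrite addrK.
Qed.

(** Differentiation under the integral sign is replaced by Fubini's theorem,
    applied to the kernel dxi k and to the indicator function of [xi, 1]. *)
Lemma Vs_C1on (k : C1T R) phi : {within `[0, 1], continuous phi} ->
  C1on (Vs k phi) (fun xi => Vs (dxi k) phi xi - k xi xi * phi xi).
Proof.
move=> cphi.
have kT : cT k := @c1t_funC R k. have kxT : cT (dxi k) := @c1t_dxiC R k.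
have cdk := withinM (cT_diag kT) cphi.
have cVs := Vs_cont kxT (sqi_cont cphi).
have cD := withinB cVs cdk.
have phii := itg_within cphi.
have main xi : 0 <= xi <= 1 -> Vs k phi xi = - Int xi 1 (fun xi => Vs (dxi k) phi xi - k xi xi * phi xi).
  move=> /andP[xi0 xi1].
  rewrite IntB; [|exact: itg_sub (itg_within cVs)|exact: itg_sub (itg_within cdk)].
  suff -> : Int xi 1 (fun s => Vs (dxi k) phi s) =
      Int xi 1 (fun x => k x x * phi x) - Vs k phi xi by ring.
  pose w : R -> R := \1_(`[xi, 1]%classic).
  have ws : sqi 0 1 w.
    have /(@sqi_bM _ 0 1 _ w 1) : sqi 0 1 (fun=> 1 : R) by apply: sqi_cont; exact: within_cst.
    move=> H; apply: (@sqi_eq _ _ _ (fun x => w x * 1)); first by move=> x _; rewrite mulr1.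
    apply: H => [|x _].
      by apply: measurable_indic; exact: measurable_itv.
    by rewrite /w indicE; case: (_ \in _); rewrite ?normr1 ?normr0.
  have wi := sqi_itg ws.
  have w1 x : xi <= x <= 1 -> w x = 1 by move=> h; rewrite /w indicE mem_set//= in_itv.
  have w0 x : x < xi -> w x = 0.
    by move=> h; rewrite /w indicE memNset//= in_itv/= leNgt h.
  have := Fubini_triangle kxT wi phii.
  have Vw : itg 0 1 (fun x => V (dxi k) w x * phi x).
    by apply: itg_within; apply: withinM => //; exact: V_cont.
  have wV : itg 0 1 (fun x => w x * Vs (dxi k) phi x) by apply: itg_cMr.
  rewrite (Int_cat xi0 xi1 Vw) (Int_cat xi0 xi1 wV).
  have z0 : Int 0 xi (fun=> 0 : R) = 0 by rewrite Int_cst// mul0r.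
  have I0 x y : y <= xi -> Int 0 y (fun s => kb (dxi k) x s * w s) = 0.
    move=> yxi; have [y0|y0] := ltP y 0; first by rewrite Int_empty.
    transitivity (Int 0 y (fun=> 0 : R)); last by rewrite Int_cst// mul0r.
    apply: eq_Int_oo; [|exact: itg_cst|].
      by apply: kb_itg1 => //; apply: itg_sub wi => //; exact: le_trans xi1.
    by move=> r /andP[_ ry]; rewrite w0 ?mulr0// (lt_le_trans ry).
  have V0 x : x <= xi -> V (dxi k) w x = 0.
    by move=> xxi; rewrite V_kb ?I0// (le_trans xxi).
  rewrite [X in X + _ = _](eq_Int (g := fun=> 0)); last first.
    by move=> x /andP[_ xxi]; rewrite V0// mul0r.
  rewrite [X in _ = X + _](eq_Int_oo (g := fun=> 0)); last first.
  - by move=> x /andP[x0 xxi]; rewrite w0// mul0r.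
  - exact: itg_cst.
  - exact: itg_sub wV.
  rewrite z0 !add0r => E.
  have -> : Int xi 1 (fun s => Vs (dxi k) phi s) = Int xi 1 (fun x => w x * Vs (dxi k) phi x).
    by apply: eq_Int => x xx; rewrite w1// mul1r.
  have i1 : itg xi 1 (fun x => k x x * phi x) by exact: itg_sub (itg_within cdk).
  have i2 : itg xi 1 (fun x => kb k x xi * phi x).
    by apply: kb_itg2 => //; exact: itg_sub phii.
  rewrite Vs_kb// -IntB// -E; apply: eq_Int_oo; [exact: itg_sub Vw|exact: itgB|].
  move=> x /andP[xix x1]; have xix' := ltW xix; have x1' := ltW x1.
  have wx : itg 0 x (fun s => kb (dxi k) x s * w s).
    by apply: kb_itg1 => //; exact: itg_sub wi.
  rewrite V_kb// (Int_cat xi0 xix' wx) I0// add0r -mulrBl kb_id//; congr (_ * _).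
  rewrite -V_dxi//; apply: eq_Int => s /andP[s1 s2].
  by rewrite w1 ?s1 ?mulr1 ?kb_id// ?(le_trans s2)// (le_trans xi0).
split=> // x /andP[x0 x1].
rewrite (main x) ?x0// (main 0) ?lexx ?ler01//.
rewrite (Int_cat x0 x1); last exact: itg_within.
by ring.
Qed.

End volterra_c1.

(** * Volterra equations of the second kind *)

Section volterra_solve.
Variable R : realType.
Implicit Types (k : R -> R -> R) (w f g h phi F D e : R -> R) (a b c s t r x y xi C M : R).

Lemma half_pow_small C r : 0 <= C -> 0 < r -> exists n, C * 2^-1 ^+ n < r.
Proof.
move=> C0 r0; exists (Num.bound (C / r)).
set n := Num.bound _; have : C / r < n%:R by exact: archi_boundP (divr_ge0 C0 (ltW r0)).
rewrite ltr_pdivrMr// exprVn ltr_pdivrMr ?exprn_gt0// => /lt_le_trans; apply.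
by rewrite mulrC ler_pM2l// -natrX ler_nat ltnW// ltn_expl.
Qed.

(** A fixed point of a contraction for the supremum norm weighted by e.  The
    limit of the iterates fn n is the supremum of the lower bounds fn n - c n,
    where c n is the tail of the geometric series. *)
Lemma picard (T : (R -> R) -> R -> R) (e : R -> R) :
  {within `[0, 1], continuous e} -> (forall x, 0 <= x <= 1 -> 1 <= e x) ->
  (forall f : R -> R, {within `[0, 1], continuous f} -> {within `[0, 1], continuous (T f)}) ->
  (forall (f g : R -> R) (M : R), {within `[0, 1], continuous f} -> {within `[0, 1], continuous g} -> 0 <= M ->
    (forall x, 0 <= x <= 1 -> `|f x - g x| <= M * e x) ->
    forall x, 0 <= x <= 1 -> `|T f x - T g x| <= M / 2 * e x) ->
  exists2 f : R -> R, {within `[0, 1], continuous f} & forall x : R, 0 <= x <= 1 -> T f x = f x.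
Proof.
move=> ce e1 cT' Tc.
have e0 x : 0 <= x <= 1 -> 0 <= e x by move=> x01; rewrite (le_trans ler01)// e1.
have [E E0 eE] := within_bounded ce.
pose fn n := iter n T (fun=> 0).
have cfn n : {within `[0, 1], continuous (fn n)}.
  by elim: n => [|n IH] /=; [exact: within_cst|exact: cT'].
have [M M0 MP] := within_bounded (withinB (cfn 1%N) (cfn 0%N)).
pose h n : R := 2^-1 ^+ n.
have h0 n : 0 <= h n by rewrite exprn_ge0.
have hS n : h n.+1 = h n / 2 by rewrite /h exprSr.
have step n x : 0 <= x <= 1 -> `|fn n.+1 x - fn n x| <= M * h n * e x.
  elim: n x => [|n IH] x x01.
    by rewrite /h expr0 mulr1 (le_trans (MP _ x01))// ler_peMr// e1.
  by rewrite hS mulrA; exact: (Tc _ _ _ (cfn n.+1) (cfn n) (mulr_ge0 M0 (h0 n)) IH).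
pose c n x := 2 * M * h n * e x.
have dist n p x : 0 <= x <= 1 -> `|fn (n + p)%N x - fn n x| <= 2 * M * (h n - h (n + p)%N) * e x.
  move=> x01; elim: p => [|p IH]; first by rewrite addn0 !subrr normr0 mulr0 mul0r.
  rewrite addnS (_ : fn (n + p).+1 x - fn n x = (fn (n + p).+1 x - fn (n + p)%N x) + (fn (n + p)%N x - fn n x)); last by ring.
  apply: (le_trans (ler_normD _ _)).
  have := step (n + p)%N x x01; rewrite hS; nra.
have far m n x : 0 <= x <= 1 -> fn m x - c m x <= fn n x + c n x.
  move=> x01; have c0 j : 0 <= c j x by rewrite !mulr_ge0// e0.
  have le_c n' p : `|fn (n' + p)%N x - fn n' x| <= c n' x.
    rewrite (le_trans (dist n' p x x01))// ler_wpM2r ?e0// ler_wpM2l ?mulr_ge0//.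
    by rewrite gerBl.
  have [mn|/ltnW nm] := leqP m n.
    by have := le_c m (n - m)%N; rewrite subnKC// ler_norml => /andP[]; have := c0 n; lra.
  by have := le_c n (m - n)%N; rewrite subnKC// ler_norml => /andP[]; have := c0 m; lra.
pose f x := sup [set fn n x - c n x | n in setT].
have ff n x : 0 <= x <= 1 -> `|f x - fn n x| <= c n x.
  move=> x01.
  have hs : has_sup [set fn n x - c n x | n in setT].
    split; first by exists (fn 0%N x - c 0%N x); exists 0%N.
    by exists (fn 0%N x + c 0%N x) => _ [m _ <-]; exact: far.
  have h1 : fn n x - c n x <= f x by apply: (sup_upper_bound hs); exists n.
  have h2 : f x <= fn n x + c n x by apply: ge_sup; [by case: hs|move=> _ [m _ <-]; exact: far].
  by rewrite ler_norml; lra.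
have cE n x : 0 <= x <= 1 -> c n x <= 2 * M * E * h n.
  move=> x01; rewrite /c mulrAC ler_wpM2r// ler_wpM2l ?mulr_ge0//.
  by rewrite (le_trans (ler_norm _))// eE.
have K0 : 0 <= 2 * M * E by rewrite !mulr_ge0.
have cf : {within `[0, 1], continuous f}.
  apply: within_eps => x x01 r r0.
  have [n nP] := half_pow_small K0 (ltac:(by rewrite divr_gt0) : 0 < r / 3).
  have := cfn n; move/subspace_continuousP => /(_ x); rewrite /= in_itv/= => /(_ x01).
  move/cvgrPdist_lt => /(_ (r / 3)); rewrite divr_gt0// => /(_ erefl).
  rewrite near_withinE => -[d /= d0 dP]; exists d => // y y01 xy.
  have h1 := ff n x x01; have h2 := ff n y y01.
  have h3 := cE n x x01; have h4 := cE n y y01.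
  have : `|fn n x - fn n y| < r / 3 by apply: dP => //; rewrite /= in_itv.
  move: h1 h2; rewrite !ler_norml ltr_norml => /andP[a1 a2] /andP[a3 a4] /andP[a5 a6].
  have {}nP : 2 * M * E * h n < r / 3 by [].
  by move: a1 a2 a3 a4 a5 a6 h3 h4 nP; clear => *; apply/andP; split; lra.
exists f => // x x01; apply/eqP; rewrite -subr_eq0 -normr_le0.
apply/ler_addgt0Pr => r r0; rewrite add0r.
have [n nP] := half_pow_small K0 (ltac:(by rewrite divr_gt0) : 0 < r / 2).
have h1 := ff n.+1 x x01; rewrite distrC in h1.
have h2 : `|T f x - T (fn n) x| <= 2 * M * h n / 2 * e x.
  by apply: Tc => //; [rewrite !mulr_ge0|move=> y y01; exact: ff].
have h3 := cE n x x01.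
rewrite (_ : T f x - f x = (T f x - T (fn n) x) + (fn n.+1 x - f x)); last by rewrite /=; ring.
apply: (le_trans (ler_normD _ _)).
have h4 : c n.+1 x = c n x / 2 by rewrite /c hS; ring.
have h5 : 2 * M * h n / 2 * e x = c n x / 2 by rewrite /c; ring.
rewrite h4 in h1; rewrite h5 in h2.
rewrite (le_trans (lerD h2 h1))// -splitr.
by rewrite (le_trans h3)// (le_trans (ltW nP))// ler_piMr ?(ltW r0)// invf_le1// ler1n.
Qed.

Lemma expR_lin_cont C : continuous (fun s => expR (C * s)).
Proof.
move=> s; apply: (@continuous_comp _ _ _ (fun s => C * s) expR); last exact: continuous_expR.
by apply: cvgM; [exact: cvg_cst|exact: cvg_id].
Qed.

Lemma Int_expR C a b : C != 0 -> a <= b ->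
  Int a b (fun s => expR (C * s)) = (expR (C * b) - expR (C * a)) / C.
Proof.
move=> C0 ab.
have -> : (expR (C * b) - expR (C * a)) / C = C^-1 * expR (C * b) - C^-1 * expR (C * a) by ring.
apply: (@Int_derive _ (fun s => C^-1 * expR (C * s))) => //.
- move=> x _; have := is_derive_scale C^-1 (is_derive_compo (is_derive_expR (C * x)) (is_derive_scale C (is_derive_id x 1))).
  by move=> /is_derive_eq; apply; field.
- by apply: continuous_subspaceT => x; apply: cvgM; [exact: cvg_cst|exact: expR_lin_cont].
- by apply: continuous_subspaceT; exact: expR_lin_cont.
Qed.

Lemma Volterra_lip k f g e C M x : cT k -> (forall x xi, `|kb k x xi| <= C) ->
  {within `[0, 1], continuous f} -> {within `[0, 1], continuous g} -> {within `[0, 1], continuous e} ->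
  (forall x, 0 <= x <= 1 -> `|f x - g x| <= M * e x) -> 0 <= x <= 1 ->
  `|V k f x - V k g x| <= C * M * Int 0 x e /\ `|Vs k f x - Vs k g x| <= C * M * Int x 1 e.
Proof.
move=> kT CP cf cg ce H x01; have /andP[x0 x1] := x01.
have fi := itg_within cf; have gi := itg_within cg; have ei := itg_within ce.
have fi1 := itg_sub (lexx 0) x1 fi; have fi2 := itg_sub x0 (lexx 1) fi.
have gi1 := itg_sub (lexx 0) x1 gi; have gi2 := itg_sub x0 (lexx 1) gi.
have ei1 := itg_sub (lexx 0) x1 ei; have ei2 := itg_sub x0 (lexx 1) ei.
have main r : 0 <= r <= 1 -> forall kk, `|kk| <= C -> `|kk * f r - kk * g r| <= C * M * e r.
  by move=> r01 kk kC; rewrite -mulrBr normrM -mulrA ler_pM// H.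
split.
  rewrite !V_kb// -IntB; [|exact: kb_itg1|exact: kb_itg1].
  have ii : itg 0 x (fun xi => kb k x xi * f xi - kb k x xi * g xi) by apply: itgB; exact: kb_itg1.
  rewrite (le_trans (Int_norm ii))// -IntZ//; apply: Int_le; [exact: itg_norm|exact: itgZ|].
  by move=> r /andP[r0 rx]; apply: main => //; rewrite r0 (le_trans rx).
rewrite !Vs_kb// -IntB; [|exact: kb_itg2|exact: kb_itg2].
have ii : itg x 1 (fun r => kb k r x * f r - kb k r x * g r) by apply: itgB; exact: kb_itg2.
rewrite (le_trans (Int_norm ii))// -IntZ//; apply: Int_le; [exact: itg_norm|exact: itgZ|].
by move=> r /andP[xr r1]; apply: main => //; rewrite r1 andbT (le_trans x0).
Qed.

(** The exponential weight e^(L x) with L = 2 C + 1 makes V a contraction of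
    ratio C / L < 1 / 2. *)
Lemma V_solve k h : cT k -> {within `[0, 1], continuous h} ->
  exists2 c : R -> R, {within `[0, 1], continuous c} & forall x, 0 <= x <= 1 -> c x + V k c x = h x.
Proof.
move=> kT ch; have [C C0 CP] := kb_bounded kT.
pose L := 2 * C + 1; have L0 : 0 < L by rewrite /L; lra.
pose e x := expR (L * x).
have ce : continuous e by exact: expR_lin_cont.
have [||||c cc cP] := @picard (fun (c : R -> R) x => h x - V k c x) e.
- exact: continuous_subspaceT.
- by move=> x /andP[x0 _]; rewrite /e -expR0 ler_expR mulr_ge0// ltW.
- by move=> f cf; apply: withinB => //; apply: V_cont => //; exact: sqi_cont.
- move=> f g M cf cg M0 H x x01.
  have [+ _] := Volterra_lip kT CP cf cg (continuous_subspaceT ce) H x01.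
  rewrite (_ : h x - _ - _ = - (V k f x - V k g x)) ?normrN; last by ring.
  have /andP[x0 _] := x01.
  move=> /le_trans; apply; rewrite Int_expR ?gt_eqF// mulr0 expR0.
  have -> : C * M * ((expR (L * x) - 1) / L) = C / L * (M * (e x - 1)) by rewrite /e; ring.
  apply: (@le_trans _ _ (2^-1 * (M * (e x)))); last by rewrite mulrCA mulrA.
  apply: ler_pM; rewrite ?divr_ge0 ?(ltW L0)//.
  + by rewrite mulr_ge0// subr_ge0 -expR0 ler_expR mulr_ge0// ltW.
  + by rewrite ler_pdivrMr// /L; lra.
  + by rewrite ler_wpM2l//; lra.
- by exists c => // x x01; have := cP x x01; lra.
Qed.

(** The weight now decreases, and is rescaled so as to be at least 1. *)
Lemma Vs_solve k h : cT k -> {within `[0, 1], continuous h} ->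
  exists2 c : R -> R, {within `[0, 1], continuous c} & forall x, 0 <= x <= 1 -> c x + Vs k c x = h x.
Proof.
move=> kT ch; have [C C0 CP] := kb_bounded kT.
pose L := 2 * C + 1; have L0 : 0 < L by rewrite /L; lra.
pose e x := expR (- L * x); pose E := expR L; have E0 : 0 < E := expR_gt0 _.
have ce : continuous e by exact: expR_lin_cont.
have cEe : {within `[0, 1], continuous (fun x => E * e x)}.
  by apply: withinM; [exact: within_cst|exact: continuous_subspaceT].
have [||||c cc cP] := @picard (fun (c : R -> R) x => h x - Vs k c x) (fun x => E * e x).
- exact: cEe.
- move=> x /andP[_ x1]; rewrite /e /E -expRD -expR0 ler_expR.
  by have := ler_wpM2l (ltW L0) x1; lra.
- by move=> f cf; apply: withinB => //; apply: Vs_cont => //; exact: sqi_cont.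
- move=> f g M cf cg M0 H x x01.
  have [_ +] := Volterra_lip kT CP cf cg cEe H x01.
  rewrite (_ : h x - _ - _ = - (Vs k f x - Vs k g x)) ?normrN; last by ring.
  have /andP[_ x1] := x01.
  move=> /le_trans; apply; rewrite IntZ; last exact: itg_cont.
  rewrite Int_expR ?oppr_eq0 ?gt_eqF// -/(e x) -/(e 1).
  have -> : C * M * (E * ((e 1 - e x) / - L)) = C / L * (M * (E * (e x - e 1))).
    by field; rewrite gt_eqF.
  apply: (@le_trans _ _ (2^-1 * (M * (E * e x)))); last by rewrite mulrCA mulrA.
  apply: ler_pM; rewrite ?divr_ge0 ?(ltW L0)//.
  + rewrite !mulr_ge0 ?(ltW E0)// subr_ge0 ler_expR.
    by have := ler_wpM2l (ltW L0) x1; lra.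
  + by rewrite ler_pdivrMr// /L; lra.
  + by rewrite ler_wpM2l// ler_wpM2l ?(ltW E0)// gerBl expR_ge0.
- by exists c => // x x01; have := cP x x01; lra.
Qed.

(** The correction b = (I + V)^-1 f - f at x is bounded by the L^1 norm of f on
    [0, x] alone; this causality is what weighted estimates rely on. *)
Lemma V_apriori k : cT k -> exists2 K, 0 <= K & forall f b : R -> R, sqi 0 1 f ->
  {within `[0, 1], continuous b} ->
  (forall x, 0 <= x <= 1 -> b x + V k b x = - V k f x) ->
  forall x, 0 <= x <= 1 -> `|b x| <= K * Int 0 x (fun s => `|f s|).
Proof.
move=> kT; have [C C0 CP] := kb_bounded kT.
pose L := 2 * C + 1; have L0 : 0 < L by rewrite /L; lra.
exists (2 * C * expR L); first by rewrite !mulr_ge0 ?expR_ge0.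
move=> f b fs cb bE x0 x01; have /andP[x00 x01'] := x01.
have fi := itg_norm (sqi_itg fs); have bi := itg_norm (itg_within cb).
have sub : (`[0, x0] `<=` (`[0, 1] : set R))%classic by apply: subset_itvl; rewrite bnd_simp.
pose m x := `|b x| * expR (- L * x).
have cm : {within `[0, x0], continuous m}.
  apply: withinM; last by apply: continuous_subspaceT; exact: expR_lin_cont.
  apply: (@within_compo _ b Num.norm); first exact: norm_continuous.
  exact: continuous_subspaceW sub cb.
(* The bound is read at a maximum point of |b x| e^(- L x). *)
have [xs xsI xsM] := @EVT_max R m 0 x0 x00 cm.
have /andP[xs0 xsx] : 0 <= xs <= x0 by move: xsI; rewrite in_itv.
have xs1 := le_trans xsx x01'.
pose I := Int 0 x0 (fun s => `|f s|); have I0 : 0 <= I by exact: Int_ge0.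
set X := m xs in xsM.
have bX x : 0 <= x <= x0 -> `|b x| <= X * expR (L * x).
  move=> xx; have : m x <= X by apply: xsM; rewrite in_itv.
  rewrite -(ler_pM2r (expR_gt0 (L * x))) /m -mulrA -expRD.
  by rewrite (_ : - L * x + L * x = 0) ?expR0 ?mulr1//; ring.
have Xb : `|b xs| = X * expR (L * xs).
  by rewrite /X /m -mulrA -expRD (_ : - L * xs + L * xs = 0) ?expR0 ?mulr1//; ring.
have X0 : 0 <= X by rewrite /X /m mulr_ge0// expR_ge0.
have Vb g : itg 0 1 g -> `|V k g xs| <= C * Int 0 xs (fun s => `|g s|).
  move=> gi; have gi' := itg_sub (lexx 0) xs1 gi.
  rewrite V_kb// (le_trans (Int_norm (kb_itg1 xs kT gi')))// -IntZ; last exact: itg_norm.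
  apply: Int_le; [by apply: itg_norm; exact: kb_itg1|by apply: itgZ; exact: itg_norm|].
  by move=> r _; rewrite normrM ler_wpM2r.
have h1 : Int 0 xs (fun s => `|f s|) <= I by apply: Int_le_set => //; exact: itg_sub fi.
have h2 : Int 0 xs (fun s => `|b s|) <= X * ((expR (L * xs) - 1) / L).
  have <- : Int 0 xs (fun s => expR (L * s)) = (expR (L * xs) - 1) / L.
    by rewrite Int_expR ?gt_eqF// mulr0 expR0.
  rewrite -IntZ; last by apply: itg_cont; exact: expR_lin_cont.
  apply: Int_le; [exact: itg_sub bi|by apply: itgZ; apply: itg_cont; exact: expR_lin_cont|].
  by move=> r /andP[r0 rx]; apply: bX; rewrite r0 (le_trans rx).
have h3 : `|b xs| <= C * I + C * (X * ((expR (L * xs) - 1) / L)).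
  have -> : b xs = - V k f xs - V k b xs by have := bE xs; rewrite xs0 xs1 => /(_ erefl); lra.
  apply: (le_trans (ler_normB _ _)); rewrite normrN; apply: lerD.
    by rewrite (le_trans (Vb _ (sqi_itg fs)))// ler_wpM2l.
  by rewrite (le_trans (Vb _ (itg_within cb)))// ler_wpM2l.
have h4 : C * (X * ((expR (L * xs) - 1) / L)) <= 2^-1 * (X * expR (L * xs)).
  rewrite (_ : C * _ = C / L * (X * (expR (L * xs) - 1))); last by field; rewrite gt_eqF.
  apply: ler_pM; rewrite ?divr_ge0 ?(ltW L0)//.
  - by rewrite mulr_ge0// subr_ge0 -expR0 ler_expR mulr_ge0// ltW.
  - by rewrite ler_pdivrMr// /L; lra.
  - by rewrite ler_wpM2l//; lra.
have h5 : X <= 2 * C * I.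
  apply: (@le_trans _ _ (X * expR (L * xs))).
    by rewrite ler_peMr// -expR0 ler_expR mulr_ge0// ltW.
  by rewrite -Xb in h4 *; lra.
apply: (le_trans (bX x0 _)); first by rewrite x00 lexx.
rewrite -/I [leRHS]mulrAC; apply: ler_pM => //; rewrite ?expR_ge0//.
by rewrite ler_expR ler_piMr// ltW.
Qed.

(** S f stands for (I + V)^-1 f - f; in particular it is Lipschitz in f. *)
Lemma V_inverse k : cT k -> exists S : (R -> R) -> R -> R, exists2 K, 0 <= K &
  (forall f, sqi 0 1 f -> [/\ {within `[0, 1], continuous (S f)},
     (forall x, 0 <= x <= 1 -> S f x + V k (S f) x = - V k f x) &
     forall x, 0 <= x <= 1 -> `|S f x| <= K * Int 0 x (fun s => `|f s|)]) /\
  (forall f g, sqi 0 1 f -> sqi 0 1 g -> forall x, 0 <= x <= 1 ->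
     `|S f x - S g x| <= K * Int 0 x (fun s => `|f s - g s|)).
Proof.
move=> kT.
have /choice[S SP] : forall f, exists c : R -> R, sqi 0 1 f -> {within `[0, 1], continuous c} /\
    forall x, 0 <= x <= 1 -> c x + V k c x = - V k f x.
  move=> f; have [fs|nfs] := pselect (sqi 0 1 f); last by exists f.
  have [|c cc cP] := @V_solve k (fun x => - V k f x) kT; last by exists c.
  by apply: (@within_compo _ (V k f) -%R); [exact: opp_continuous|exact: V_cont].
have [K K0 KP] := V_apriori kT.
exists S; exists K => //; split=> [f fs|f g fs gs x x01].
  by have [h1 h2] := SP f fs; split => // x x01; exact: KP.
have [f1 f2] := SP f fs; have [g1 g2] := SP g gs.
apply: (KP _ (fun x => S f x - S g x)) => //; [exact: sqiB|exact: withinB|].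
move=> y y01; have := f2 y y01; have := g2 y y01; have /andP[y0 y1] := y01.
have VB h1 h2 : itg 0 1 h1 -> itg 0 1 h2 -> V k (fun s => h1 s - h2 s) y = V k h1 y - V k h2 y.
  move=> i1 i2; rewrite /V -IntB.
  - by apply: eq_Int => r _; rewrite mulrBr.
  - by apply: (@itg_eq _ _ _ (fun r => kb k y r * h1 r)); [move=> r /andP[r0 ry]; rewrite kb_id|apply: kb_itg1 => //; exact: itg_sub i1].
  - by apply: (@itg_eq _ _ _ (fun r => kb k y r * h2 r)); [move=> r /andP[r0 ry]; rewrite kb_id|apply: kb_itg1 => //; exact: itg_sub i2].
rewrite !VB; [lra|exact: sqi_itg|exact: sqi_itg|exact: itg_within|exact: itg_within].
Qed.

End volterra_solve.

(** * Weak equations in terms of the pairing *)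

Notation ip f g := (Int 0 1 (fun x => f x * g x)).

Section pairing.
Variable R : realType.
Implicit Types (k : R -> R -> R) (f g h phi : R -> R) (a b c s t r x y xi C K : R) (w : R -> R -> R).

Lemma ipDl f g h : sqi 0 1 f -> sqi 0 1 g -> sqi 0 1 h ->
  ip (fun x => f x + g x) h = ip f h + ip g h.
Proof.
by move=> fs gs hs; rewrite -IntD; [apply: eq_Int => x _; rewrite mulrDl|exact: sqi_mul|exact: sqi_mul].
Qed.

Lemma ipBl f g h : sqi 0 1 f -> sqi 0 1 g -> sqi 0 1 h ->
  ip (fun x => f x - g x) h = ip f h - ip g h.
Proof.
by move=> fs gs hs; rewrite -IntB; [apply: eq_Int => x _; rewrite mulrBl|exact: sqi_mul|exact: sqi_mul].
Qed.

Lemma ipC f g : ip f g = ip g f.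
Proof. by apply: eq_Int => x _; rewrite mulrC. Qed.

Lemma ipDr f g h : sqi 0 1 f -> sqi 0 1 g -> sqi 0 1 h ->
  ip h (fun x => f x + g x) = ip h f + ip h g.
Proof. by move=> fs gs hs; rewrite ipC ipDl// !(ipC _ h). Qed.

Lemma ipBr f g h : sqi 0 1 f -> sqi 0 1 g -> sqi 0 1 h ->
  ip h (fun x => f x - g x) = ip h f - ip h g.
Proof. by move=> fs gs hs; rewrite ipC ipBl// !(ipC _ h). Qed.

Lemma ipZl c f h : sqi 0 1 f -> sqi 0 1 h -> ip (fun x => f x * c) h = c * ip f h.
Proof.
move=> fs hs; rewrite -IntZ; last exact: sqi_mul.
by apply: eq_Int => x _; rewrite -mulrA mulrCA.
Qed.

Lemma ip_eqr f g h : sqi 0 1 f -> sqi 0 1 g -> sqi 0 1 h ->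
  (forall x, 0 < x < 1 -> f x = g x) -> ip h f = ip h g.
Proof.
by move=> fs gs hs fg; apply: eq_Int_oo => [||x /fg ->//]; exact: sqi_mul.
Qed.

Lemma ip_eql f g h : (forall x, 0 <= x <= 1 -> f x = g x) -> ip f h = ip g h.
Proof. by move=> fg; apply: eq_Int => x /fg ->. Qed.

Lemma V_sqi k f : cT k -> sqi 0 1 f -> sqi 0 1 (V k f).
Proof. by move=> kT fs; apply: sqi_cont; exact: V_cont. Qed.

Lemma Vs_sqi k f : cT k -> sqi 0 1 f -> sqi 0 1 (Vs k f).
Proof. by move=> kT fs; apply: sqi_cont; exact: Vs_cont. Qed.

Lemma ipV k f phi : cT k -> sqi 0 1 f -> sqi 0 1 phi -> ip (V k f) phi = ip f (Vs k phi).
Proof. by move=> kT fs ps; apply: Fubini_triangle => //; exact: sqi_itg. Qed.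

Lemma V_itg k f x : cT k -> itg 0 1 f -> x <= 1 -> itg 0 x (fun xi => k x xi * f xi).
Proof.
move=> kT fi x1; apply: (@itg_eq _ _ _ (fun xi => kb k x xi * f xi)).
  by move=> xi /andP[xi0 xix]; rewrite kb_id.
by apply: kb_itg1 => //; exact: itg_sub fi.
Qed.

Lemma Vs_itg k f xi : cT k -> itg 0 1 f -> 0 <= xi -> itg xi 1 (fun x => k x xi * f x).
Proof.
move=> kT fi xi0; apply: (@itg_eq _ _ _ (fun x => kb k x xi * f x)).
  by move=> x /andP[xix x1]; rewrite kb_id.
by apply: kb_itg2 => //; exact: itg_sub fi.
Qed.

Lemma VB k f g x : cT k -> itg 0 1 f -> itg 0 1 g -> x <= 1 ->
  V k (fun r => f r - g r) x = V k f x - V k g x.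
Proof.
move=> kT fi gi x1; rewrite /V -IntB; [|exact: V_itg|exact: V_itg].
by apply: eq_Int => r _; rewrite mulrBr.
Qed.

Lemma VsZ k c f xi : cT k -> itg 0 1 f -> 0 <= xi ->
  c * Vs k f xi = Vs k (fun x => c * f x) xi.
Proof.
move=> kT fi xi0; rewrite /Vs -IntZ; last exact: Vs_itg.
by apply: eq_Int => r _; rewrite mulrCA.
Qed.

(** Five is the largest number of terms in a kernel equation: a pointwise
    identity between kernels becomes one between their adjoint operators. *)
Lemma Vs_sum5 k1 k2 k3 k4 k5 f1 f2 f3 f4 f5 xi : 0 <= xi ->
  cT k1 -> cT k2 -> cT k3 -> cT k4 -> cT k5 ->
  itg 0 1 f1 -> itg 0 1 f2 -> itg 0 1 f3 -> itg 0 1 f4 -> itg 0 1 f5 ->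
  (forall x, xi <= x -> x <= 1 -> k1 x xi * f1 x + k2 x xi * f2 x + k3 x xi * f3 x + k4 x xi * f4 x + k5 x xi * f5 x = 0) ->
  xi <= 1 ->
  Vs k1 f1 xi + Vs k2 f2 xi + Vs k3 f3 xi + Vs k4 f4 xi + Vs k5 f5 xi = 0.
Proof.
move=> xi0 k1T k2T k3T k4T k5T i1 i2 i3 i4 i5 H xi1.
have j1 := Vs_itg k1T i1 xi0; have j2 := Vs_itg k2T i2 xi0; have j3 := Vs_itg k3T i3 xi0.
have j4 := Vs_itg k4T i4 xi0; have j5 := Vs_itg k5T i5 xi0.
rewrite /Vs -IntD// -IntD//; last exact: itgD.
rewrite -IntD//; last by apply: itgD => //; exact: itgD.
rewrite -IntD//; last by apply: itgD => //; apply: itgD => //; exact: itgD.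
transitivity (Int xi 1 (fun=> 0 : R)); last by rewrite Int_cst// mul0r.
by apply: eq_Int => x /andP[h1 h2]; exact: H.
Qed.

Lemma V_bound k : cT k -> exists2 C, 0 <= C & forall f, sqi 0 1 f ->
  forall x, 0 <= x <= 1 -> `|V k f x| <= C * Int 0 x (fun s => `|f s|).
Proof.
move=> kT; have [C C0 CP] := kb_bounded kT; exists C => // f fs x /andP[x0 x1].
have fi := itg_sub (lexx 0) x1 (sqi_itg fs).
rewrite V_kb// (le_trans (Int_norm (kb_itg1 x kT fi)))// -IntZ; last exact: itg_norm.
apply: Int_le; [by apply: itg_norm; exact: kb_itg1|by apply: itgZ; exact: itg_norm|].
by move=> r _; rewrite normrM ler_wpM2r.
Qed.

Lemma Int_abs_sq f x : sqi 0 1 f -> 0 <= x <= 1 ->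
  Int 0 x (fun s => `|f s|) ^+ 2 <= Int 0 1 (fun s => f s ^+ 2).
Proof.
move=> fs /andP[x0 x1]; have fx := sqi_sub (lexx 0) x1 fs.
have := cauchy_schwarz (sqi_norm fx) (sqi_cont (@within_cst R 0 x 1)).
rewrite (eq_Int (g := fun s => `|f s|)); last by move=> r _; rewrite mulr1.
rewrite expr1n Int_cst// mul1r subr0.
rewrite (_ : Int 0 x (fun s => `|f s| ^+ 2) = Int 0 x (fun s => f s ^+ 2)); last first.
  by apply: eq_Int => r _; rewrite real_normK ?num_real.
move=> /le_trans; apply; have [_ fi] := fs.
apply: (@le_trans _ _ (Int 0 x (fun s => f s ^+ 2))).
  by rewrite ler_piMr//; apply: Int_ge0 => r _; exact: sqr_ge0.
by apply: Int_le_set => // r _; exact: sqr_ge0.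
Qed.

(** Operators that are causal and Lipschitz in the sense of [V_inverse] map
    continuous curves to continuous curves. *)
Lemma cl2_volterra (T : (R -> R) -> R -> R) K w : 0 <= K ->
  (forall f, sqi 0 1 f -> sqi 0 1 (T f)) ->
  (forall f g, sqi 0 1 f -> sqi 0 1 g -> forall x, 0 <= x <= 1 ->
     `|T f x - T g x| <= K * Int 0 x (fun s => `|f s - g s|)) ->
  cl2 w -> cl2 (fun t => T (w t)).
Proof.
move=> K0 Ts TK cw; apply: (@cl2_lip _ _ w w (K ^+ 2)) => // [t t0|s t s0 t0].
  by apply: Ts; exact: cl2_sqi.
have ws := cl2_sqi cw s0; have wt := cl2_sqi cw t0.
set N := Int 0 1 (fun x => (w t x - w s x) ^+ 2).
have N0 : 0 <= N by apply: Int_ge0 => x _; exact: sqr_ge0.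
apply: (@le_trans _ _ (K ^+ 2 * N)); last by rewrite ler_wpM2l ?sqr_ge0// lerDl.
rewrite (_ : K ^+ 2 * N = Int 0 1 (fun=> K ^+ 2 * N)); last by rewrite Int_cst// subr0 mulr1.
apply: Int_le; [by case: (sqiB (Ts _ wt) (Ts _ ws))|exact: itg_cst|move=> x x01].
have d := sqiB wt ws.
rewrite -[X in X ^+ 2]/(T (w t) x - T (w s) x) -[leLHS]real_normK ?num_real//.
apply: (@le_trans _ _ ((K * Int 0 x (fun r => `|w t r - w s r|)) ^+ 2)).
  by rewrite ler_pXn2r ?nnegrE ?TK// mulr_ge0//; exact: Int_ge0.
by rewrite exprMn ler_wpM2l ?sqr_ge0//; exact: Int_abs_sq.
Qed.

Lemma cl2_V k w : cT k -> cl2 w -> cl2 (fun t => V k (w t)).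
Proof.
move=> kT; have [C C0 CP] := V_bound kT; apply: cl2_volterra C0 _ _ => [f fs|f g fs gs x x01].
  exact: V_sqi.
have /andP[_ x1] := x01.
by rewrite -VB ?CP//; [exact: sqiB|exact: sqi_itg|exact: sqi_itg].
Qed.

(** A continuous curve plus an output injection, whose gain b is continuous in x
    and whose signal y is only square integrable in time. *)
Definition is_src (f : R -> R -> R) : Prop := exists w (b y : R -> R),
  [/\ cl2 w, {within `[0, 1], continuous b}, tl2 y &
    forall t x, 0 <= t -> 0 <= x <= 1 -> f t x = w t x + b x * y t].

Lemma is_src_sqi (f : R -> R -> R) t : is_src f -> 0 <= t -> sqi 0 1 (f t).
Proof.
move=> [w [b [y [wc bc yt E]]]] t0.
apply: (@sqi_eq _ _ _ (fun x => w t x + y t * b x)); first by move=> x x01; rewrite E// [y t * _]mulrC.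
by apply: sqiD; [exact: cl2_sqi|apply: sqiZ; exact: sqi_cont].
Qed.

Lemma is_src_itg (f : R -> R -> R) phi t : is_src f -> sqi 0 1 phi -> 0 <= t -> itg 0 t (fun s => ip (f s) phi).
Proof.
move=> [w [b [y [wc bc yt E]]]] ps t0.
apply: (@itg_eq _ _ _ (fun s => ip (w s) phi + y s * ip b phi)).
  move=> s /andP[s0 _]; have ws := cl2_sqi wc s0; have bs := sqi_cont bc.
  rewrite -ipZl// -ipDl//; first by apply: ip_eql => x x01; rewrite E.
  by apply: (@sqi_eq _ _ _ (fun x => y s * b x)); [move=> x _; rewrite mulrC|exact: sqiZ].
apply: itgD; last by apply: itgZr; apply: sqi_itg; exact: yt.
by apply: cont0_itg => //; apply: cl2_pair => //; exact: cl2_cst.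
Qed.

Lemma cl2_src w : cl2 w -> is_src w.
Proof.
move=> wc; exists w, (fun=> 0), (fun=> 0); split=> //; first exact: within_cst.
  by move=> t t0; apply: sqi_cont; exact: within_cst.
by move=> t x _ _; rewrite mul0r addr0.
Qed.

(** The derivative of a phi: the formal adjoint of - a d/dx. *)
Definition dmul (a : C1I R) (phi : C1I R) x : R := c1_der a x * phi x + a x * c1_der phi x.

Lemma dmul_cont (a phi : C1I R) : {within `[0, 1], continuous (dmul a phi)}.
Proof.
by apply: withinD; apply: withinM; do ?[exact: c1_funC|exact: c1_derC].
Qed.

Lemma dmul_sqi (a phi : C1I R) : sqi 0 1 (dmul a phi).
Proof. by apply: sqi_cont; exact: dmul_cont. Qed.

Lemma c1_sqi (phi : C1I R) : sqi 0 1 phi.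
Proof. by apply: sqi_cont; exact: c1_funC. Qed.

Lemma weak_leftwardE (a : C1I R) w (f : R -> R -> R) (g y : R -> R) : cl2 w -> is_src f -> tl2 g -> tl2 y ->
  weak_leftward a w f g y <-> forall (psi : C1I R) t, 0 <= t ->
   ip (w t) psi = ip (w 0) psi + Int 0 t (fun s => a 1 * g s * psi 1 - a 0 * y s * psi 0 - ip (w s) (dmul a psi) + ip (f s) psi).
Proof.
move=> wc fs gt yt.
have E (psi : C1I R) t : 0 <= t -> Int 0 t (fun s => a 1 * g s * psi 1 - a 0 * y s * psi 0
           + Int 0 1 (fun x => - (w s x * (c1_der a x * psi x + a x * c1_der psi x)) + f s x * psi x)) =
   Int 0 t (fun s => a 1 * g s * psi 1 - a 0 * y s * psi 0 - ip (w s) (dmul a psi) + ip (f s) psi).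
  move=> t0; apply: eq_Int => s /andP[s0 _].
  have ws := cl2_sqi wc s0; have fss := is_src_sqi fs s0.
  have i1 := sqi_mul ws (dmul_sqi a psi); have i2 := sqi_mul fss (c1_sqi psi).
  by rewrite (IntD (itgN i1) i2) IntN// addrA.
split=> H psi t t0; first by rewrite -(E psi t t0); exact: (H psi t t0).
by have := H psi t t0; rewrite -(E psi t t0); exact.
Qed.

Lemma weak_rightwardE (a : C1I R) w (f : R -> R -> R) (g : R -> R) : cl2 w -> is_src f -> tl2 g ->
  weak_rightward a w f g <-> forall (phi : C1I R) t, phi 1 = 0 -> 0 <= t ->
   ip (w t) phi = ip (w 0) phi + Int 0 t (fun s => a 0 * g s * phi 0 + ip (w s) (dmul a phi) + ip (f s) phi).
Proof.
move=> wc fs gt.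
have E (psi : C1I R) t : 0 <= t -> Int 0 t (fun s => a 0 * g s * psi 0
           + Int 0 1 (fun x => w s x * (c1_der a x * psi x + a x * c1_der psi x) + f s x * psi x)) =
   Int 0 t (fun s => a 0 * g s * psi 0 + ip (w s) (dmul a psi) + ip (f s) psi).
  move=> t0; apply: eq_Int => s /andP[s0 _].
  have ws := cl2_sqi wc s0; have fss := is_src_sqi fs s0.
  have i1 := sqi_mul ws (dmul_sqi a psi); have i2 := sqi_mul fss (c1_sqi psi).
  by rewrite (IntD i1 i2) addrA.
split=> H psi t p1 t0; first by rewrite -(E psi t t0); exact: (H psi t p1 t0).
by have := H psi t p1 t0; rewrite -(E psi t t0); exact.
Qed.

Lemma leftward_itg (a : C1I R) w (f : R -> R -> R) (g y : R -> R) (psi : C1I R) t : cl2 w -> is_src f -> tl2 g -> tl2 y -> 0 <= t ->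
  itg 0 t (fun s => a 1 * g s * psi 1 - a 0 * y s * psi 0 - ip (w s) (dmul a psi) + ip (f s) psi).
Proof.
move=> wc fs gt yt t0; apply: itgD; last by apply: is_src_itg => //; exact: c1_sqi.
apply: itgB; last by apply: is_src_itg => //; [exact: cl2_src|exact: dmul_sqi].
by apply: itgB; apply: itgZr; apply: itgZ; apply: sqi_itg; [exact: gt|exact: yt].
Qed.

Lemma rightward_itg (a : C1I R) w (f : R -> R -> R) (g : R -> R) (psi : C1I R) t : cl2 w -> is_src f -> tl2 g -> 0 <= t ->
  itg 0 t (fun s => a 0 * g s * psi 0 + ip (w s) (dmul a psi) + ip (f s) psi).
Proof.
move=> wc fs gt t0; apply: itgD; last by apply: is_src_itg => //; exact: c1_sqi.
apply: itgD; last by apply: is_src_itg => //; [exact: cl2_src|exact: dmul_sqi].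
by apply: itgZr; apply: itgZ; apply: sqi_itg; exact: gt.
Qed.

Lemma tl2B g h : tl2 g -> tl2 h -> tl2 (fun t => g t - h t).
Proof. by move=> gt ht t t0; apply: sqiB; [exact: gt|exact: ht]. Qed.

Lemma leftwardB (a : C1I R) w1 w2 (f1 f2 : R -> R -> R) (g1 g2 y1 y2 : R -> R) : cl2 w1 -> is_src f1 -> tl2 g1 -> tl2 y1 ->
  cl2 w2 -> is_src f2 -> tl2 g2 -> tl2 y2 -> is_src (fun t x => f1 t x - f2 t x) ->
  weak_leftward a w1 f1 g1 y1 -> weak_leftward a w2 f2 g2 y2 ->
  weak_leftward a (fun t x => w1 t x - w2 t x) (fun t x => f1 t x - f2 t x)
    (fun t => g1 t - g2 t) (fun t => y1 t - y2 t).
Proof.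
move=> w1c f1s g1t y1t w2c f2s g2t y2t fs.
move=> /(weak_leftwardE _ w1c f1s g1t y1t) H1 /(weak_leftwardE _ w2c f2s g2t y2t) H2.
apply/(weak_leftwardE _ (cl2B w1c w2c) fs (tl2B g1t g2t) (tl2B y1t y2t)) => psi t t0.
have ps := c1_sqi psi.
rewrite !ipBl//; try exact: cl2_sqi.
rewrite (H1 psi t t0) (H2 psi t t0) opprD addrACA -(IntB (@leftward_itg a _ _ _ _ psi t w1c f1s g1t y1t t0) (@leftward_itg a _ _ _ _ psi t w2c f2s g2t y2t t0)).
congr (_ + _); apply: eq_Int => s /andP[s0 _].
rewrite !ipBl//; try exact: cl2_sqi; try exact: is_src_sqi; try exact: dmul_sqi.
by ring.
Qed.

Lemma rightwardB (a : C1I R) w1 w2 (f1 f2 : R -> R -> R) (g1 g2 : R -> R) : cl2 w1 -> is_src f1 -> tl2 g1 ->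
  cl2 w2 -> is_src f2 -> tl2 g2 -> is_src (fun t x => f1 t x - f2 t x) ->
  weak_rightward a w1 f1 g1 -> weak_rightward a w2 f2 g2 ->
  weak_rightward a (fun t x => w1 t x - w2 t x) (fun t x => f1 t x - f2 t x)
    (fun t => g1 t - g2 t).
Proof.
move=> w1c f1s g1t w2c f2s g2t fs.
move=> /(weak_rightwardE _ w1c f1s g1t) H1 /(weak_rightwardE _ w2c f2s g2t) H2.
apply/(weak_rightwardE _ (cl2B w1c w2c) fs (tl2B g1t g2t)) => psi t p1 t0.
have ps := c1_sqi psi.
rewrite !ipBl//; try exact: cl2_sqi.
rewrite (H1 psi t p1 t0) (H2 psi t p1 t0) opprD addrACA -(IntB (@rightward_itg a _ _ _ psi t w1c f1s g1t t0) (@rightward_itg a _ _ _ psi t w2c f2s g2t t0)).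
congr (_ + _); apply: eq_Int => s /andP[s0 _].
rewrite !ipBl//; try exact: cl2_sqi; try exact: is_src_sqi; try exact: dmul_sqi.
by ring.
Qed.

End pairing.

(** * The backstepping transformations *)

(** Ring tactics would otherwise compare integrands up to conversion. *)
Ltac gen_Int := repeat match goal with |- context [Rintegral ?m ?s ?f] =>
  let X := fresh "X" in set X := (Rintegral m s f); clearbody X end.

Section kernel_tests.
Variable R : realType.
Implicit Types (k : R -> R -> R) (f g h phi : R -> R) (a b c s t r x y xi C K : R) (w : R -> R -> R).

Lemma cTk (k : C1T R) : cT k. Proof. exact: c1t_funC. Qed.
Lemma cTx (k : C1T R) : cT (dx k). Proof. exact: c1t_dxC. Qed.
Lemma cTxi (k : C1T R) : cT (dxi k). Proof. exact: c1t_dxiC. Qed.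

Lemma cT_row0 k : cT k -> {within `[0, 1], continuous (fun x => k x 0)}.
Proof.
move=> kT; apply: (@within_eq _ (fun x => kb k x 0)).
  by move=> x /andP[x0 x1]; rewrite kb_id.
by apply: continuous_subspaceT; exact: kb_cont1.
Qed.

Lemma cT_col1 k : cT k -> {within `[0, 1], continuous (k 1)}.
Proof.
move=> kT; apply: (@within_eq _ (kb k 1)).
  by move=> x /andP[x0 x1]; rewrite kb_id.
by apply: continuous_subspaceT; exact: kb_cont2.
Qed.

Lemma dmul_derive (a phi : C1I R) x : 0 < x < 1 ->
  is_derive x 1 (fun x => a x * phi x) (dmul a phi x).
Proof.
move=> x01; have := is_derive_mul (c1_derP a x01) (c1_derP phi x01).
by move=> /is_derive_eq; apply; rewrite /dmul; ring.
Qed.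

Lemma mul_c1_cont (a phi : C1I R) : {within `[0, 1], continuous (fun x => a x * phi x)}.
Proof. by apply: withinM; exact: c1_funC. Qed.

Lemma Vs_dmul (k : C1T R) (a phi : C1I R) xi : 0 < xi -> xi <= 1 ->
  Vs k (dmul a phi) xi = k 1 xi * (a 1 * phi 1) - k xi xi * (a xi * phi xi)
    - Vs (dx k) (fun x => a x * phi x) xi.
Proof.
move=> xi0 xi1; apply: (@Vs_dx _ k (fun x => a x * phi x)) => //.
- exact: mul_c1_cont.
- exact: dmul_cont.
- exact: dmul_derive.
Qed.

Lemma eq_Vs k f g xi : 0 <= xi -> (forall x, 0 <= x <= 1 -> f x = g x) -> Vs k f xi = Vs k g xi.
Proof.
by move=> xi0 fg; apply: eq_Int => x /andP[xix x1]; rewrite fg// (le_trans xi0).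
Qed.

(** (I + V)^-1 is adjoint to (I + Vs)^-1. *)
Lemma solve_adj k g h phi psi : cT k -> sqi 0 1 g -> sqi 0 1 phi ->
  (forall x, 0 <= x <= 1 -> g x + V k g x = h x) ->
  (forall x, 0 <= x <= 1 -> phi x + Vs k phi x = psi x) ->
  ip g psi = ip h phi.
Proof.
move=> kT gs ps gh pp.
have -> : ip h phi = ip (fun x => g x + V k g x) phi by apply: ip_eql => x x01; rewrite gh.
rewrite ipDl//; last exact: V_sqi.
rewrite ipV// -ipDr//; last exact: Vs_sqi.
by rewrite ipC [RHS]ipC; apply: ip_eql => x x01; rewrite pp.
Qed.

End kernel_tests.

Section observer_error.
Variables (R : realType) (P : plant R) (lam_lo mu_lo : R) (m1 m2 m1h m2h : C1T R).
Hypothesis Padm : admissible P lam_lo mu_lo.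
Hypothesis Pker : observer_kernels P m1 m2.
Implicit Types (f g h phi : R -> R) (a b c s t r x y xi C K : R) (w : R -> R -> R).

Let cth : {within `[0, 1], continuous (th P)}. Proof. by case: Padm. Qed.
Let csig : {within `[0, 1], continuous (sig P)}. Proof. by case: Padm. Qed.
Let com : {within `[0, 1], continuous (om P)}. Proof. by case: Padm. Qed.

(** Testing beta with psi amounts to testing v - vh with the phi that solves
    phi + Vs m2 phi = psi; the equation for m2, together with m2 (1, .) = 0,
    computes the adjoint transport operator on psi from the one on phi. *)
Lemma observer_test (psi : C1I R) : exists2 phi : C1I R,
  (forall x, 0 <= x <= 1 -> phi x + Vs m2 phi x = psi x) &
  forall xi, 0 < xi < 1 -> dmul (mu P) psi xi =
    dmul (mu P) phi xi + Vs m2 (dmul (mu P) phi) xi - Vs m1 (fun x => th P x * phi x) xi.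
Proof.
have [c cc cE] := Vs_solve (@cTk R m2) (@c1_funC R psi).
have [phi phiE] := C1on_C1I (C1onB (C1I_C1on psi) (Vs_C1on m2 cc)).
have pc x : 0 <= x <= 1 -> phi x = c x.
  by move=> x01; have [-> _] := phiE x x01; have := cE x x01; lra.
have VE k xi : 0 <= xi -> Vs k phi xi = Vs k c xi by move=> xi0; exact: eq_Vs.
exists phi => [x x01|xi /andP[xi0 xi1]].
  have /andP[x0 _] := x01.
  by rewrite VE// pc// cE.
have xi0' := ltW xi0; have xi1' := ltW xi1.
have xi01 : 0 <= xi <= 1 by rewrite xi0'.
have [p1 p2] := phiE xi xi01.
have [_ K2 _ K4] := Pker.
rewrite Vs_dmul// K4 ?mul0r ?sub0r; last by rewrite /I01/= in_itv/= xi0'.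
have pi : itg 0 1 phi := itg_within (@c1_funC R phi).
have mupi : itg 0 1 (fun x => mu P x * phi x) by apply: itg_within; exact: mul_c1_cont.
have thpi : itg 0 1 (fun x => th P x * phi x) by apply: itg_within; apply: withinM => //; exact: c1_funC.
have ker x : xi <= x -> x <= 1 -> m2 x xi * (c1_der (mu P) xi * phi x) + dxi m2 x xi * (mu P xi * phi x) +
    dx m2 x xi * (mu P x * phi x) + m1 x xi * (th P x * phi x) + m1 x xi * 0 = 0.
  move=> xix x1; have := K2 x xi (conj xi0' (conj xix x1)).
  by move=> /(congr1 (fun z => z * phi x)); lra.
have := Vs_sum5 xi0' (@cTk R m2) (@cTxi R m2) (@cTx R m2) (@cTk R m1) (@cTk R m1)
  (itgZ _ pi) (itgZ _ pi) mupi thpi (itg_cst _ _ _) ker xi1'.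
rewrite -!VsZ//; [|exact: cTxi|exact: cTk].
have -> : Vs m1 (fun=> 0) xi = 0.
  by transitivity (Int xi 1 (fun=> 0 : R)); [apply: eq_Int => x _; rewrite mulr0|rewrite Int_cst// mul0r].
have -> : dmul (mu P) psi xi = c1_der (mu P) xi * (phi xi + Vs m2 phi xi) +
    mu P xi * (c1_der phi xi + (Vs (dxi m2) phi xi - m2 xi xi * phi xi)).
  by rewrite /dmul !VE// (pc xi xi01) cE// p2; ring.
by rewrite /dmul; lra.
Qed.

(** In the application ut, vt and yt are u - uh, v - vh and y - yh. *)
Variables (ut vt al be fb : R -> R -> R) (b2' : R -> R) (yt : R -> R).
Hypotheses (utc : cl2 ut) (vtc : cl2 vt) (alc : cl2 al) (bec : cl2 be) (fbc : cl2 fb).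
Hypothesis b2c : {within `[0, 1], continuous b2'}.
Hypothesis yt2 : tl2 yt.
(* fb and b2' are the images by (I + V m2)^-1 of the source and of the gain
   error in the equation of v - vh. *)
Hypothesis beE : forall t x, 0 <= t -> 0 <= x <= 1 -> be t x + V m2 (be t) x = vt t x.
Hypothesis alE : forall t x, 0 <= t -> 0 <= x <= 1 -> al t x = ut t x - V m1 (be t) x.
Hypothesis fbE : forall t x, 0 <= t -> 0 <= x <= 1 -> fb t x + V m2 (fb t) x = th P x * al t x.
Hypothesis b2E : forall x, 0 <= x <= 1 -> b2' x + V m2 b2' x = mu P 0 * (m2 x 0 - m2h x 0).

Let zero2 : tl2 (fun=> 0 : R).
Proof. by move=> t t0; apply: sqi_cont; exact: within_cst. Qed.

Let fv t x := th P x * ut t x - m2h x 0 * mu P 0 * yt t.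
Let fu t x := sig P x * ut t x + om P x * vt t x - m1h x 0 * mu P 0 * yt t.

Lemma src_sub w (b : R -> R) (y : R -> R) : cl2 w -> {within `[0, 1], continuous b} -> tl2 y ->
  is_src (fun t x => w t x - b x * y t).
Proof.
move=> wc bc yc; exists w, (fun x => - b x), y; split=> //.
  by apply: (@within_compo _ b -%R); first exact: opp_continuous.
by move=> t x _ _; rewrite mulNr.
Qed.

Lemma src_add w (b : R -> R) (y : R -> R) : cl2 w -> {within `[0, 1], continuous b} -> tl2 y ->
  is_src (fun t x => w t x + b x * y t).
Proof. by move=> wc bc yc; exists w, b, y. Qed.

(** The exact gain would cancel the trace yt in the transformed equation; what
    is left of the injection is proportional to m2 - m2h. *)
Lemma beta_weak : weak_leftward (mu P) vt fv (fun=> 0) yt ->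
  weak_leftward (mu P) be (fun t x => fb t x + b2' x * yt t) (fun=> 0) yt.
Proof.
have cm2h := withinM (cT_row0 (@cTk R m2h)) (@within_cst R 0 1 (mu P 0)).
have fvs : is_src fv by apply: src_sub => //; exact: cl2_cM.
have bs : is_src (fun t x => fb t x + b2' x * yt t) by exact: src_add.
move=> /(weak_leftwardE _ vtc fvs zero2 yt2) H.
apply/(weak_leftwardE _ bec bs zero2 yt2) => psi t t0.
have [phi phiE phiD] := observer_test psi.
have ps := c1_sqi phi; have Ps := c1_sqi psi.
have Ds := dmul_sqi (mu P) phi.
have beta_phi s : 0 <= s -> ip (be s) psi = ip (vt s) phi.
  move=> s0; apply: (solve_adj (@cTk R m2)) => //; first exact: cl2_sqi.
  by move=> x; exact: beE.
rewrite (beta_phi t t0) (beta_phi 0 (lexx 0)) (H phi t t0); congr (_ + _); apply: eq_Int => s /andP[s0 _].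
have us := cl2_sqi utc s0; have vs := cl2_sqi vtc s0; have als := cl2_sqi alc s0.
have bes := cl2_sqi bec s0; have fbs := cl2_sqi fbc s0.
have thps : sqi 0 1 (fun x => th P x * phi x) by exact: sqi_cM.
have e1 : ip (vt s) (dmul (mu P) phi) =
    ip (be s) (dmul (mu P) phi) + ip (be s) (Vs m2 (dmul (mu P) phi)).
  rewrite -(ipV (@cTk R m2))// -ipDl//; last exact: V_sqi (@cTk R m2) bes.
  by apply: ip_eql => x x01; rewrite beE.
have e3 : ip (be s) (dmul (mu P) psi) = ip (be s) (dmul (mu P) phi) +
    ip (be s) (Vs m2 (dmul (mu P) phi)) - ip (be s) (Vs m1 (fun x => th P x * phi x)).
  have s1 := Vs_sqi (@cTk R m2) Ds; have s2 := Vs_sqi (@cTk R m1) thps.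
  rewrite -ipDr// -ipBr//; last exact: sqiD.
  by apply: ip_eqr => //; [exact: dmul_sqi|apply: sqiB => //; exact: sqiD].
have e2 : ip (fv s) phi = ip (fun x => th P x * al s x) phi +
    ip (be s) (Vs m1 (fun x => th P x * phi x)) - yt s * ip (fun x => m2h x 0 * mu P 0) phi.
  have bms := sqi_cont cm2h.
  rewrite -(ipV (@cTk R m1))// -ipZl//.
  have -> : ip (V m1 (be s)) (fun x => th P x * phi x) = ip (fun x => th P x * V m1 (be s) x) phi.
    by apply: eq_Int => x _; ring.
  have Vbs := V_sqi (@cTk R m1) bes.
  rewrite -ipDl//; [|exact: sqi_cM|exact: sqi_cM].
  rewrite -ipBl//; [|by apply: sqiD; exact: sqi_cM|by apply: (sqi_eq _ (sqiZ (yt s) bms)) => x _; rewrite mulrC].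
  by apply: ip_eql => x x01; rewrite /fv alE//; ring.
have e4 : ip (fb s) psi = ip (fun x => th P x * al s x) phi.
  by apply: (solve_adj (@cTk R m2)) => // x; exact: fbE.
have m2s := sqi_cont (cT_row0 (@cTk R m2)).
have m2hs := sqi_cont (cT_row0 (@cTk R m2h)).
have e5 : ip b2' psi = mu P 0 * ip (fun x => m2 x 0) phi - ip (fun x => m2h x 0 * mu P 0) phi.
  rewrite (solve_adj (@cTk R m2) (sqi_cont b2c) ps b2E phiE) ipZl// -mulrBr -ipBl//.
  have ds := sqiB m2s m2hs.
  rewrite -(ipZl _ ds)//; apply: ip_eql => x _; ring.
have e6 : psi 0 = phi 0 + ip (fun x => m2 x 0) phi by rewrite -phiE ?lexx ?ler01.
have b2s : sqi 0 1 (fun x => b2' x * yt s).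
  by apply: (sqi_eq _ (sqiZ (yt s) (sqi_cont b2c))) => x _; rewrite mulrC.
rewrite ipDl// ipZl//; last exact: sqi_cont.
rewrite e1 e2 e3 e4 e5 e6.
gen_Int; ring.
Qed.

(** Testing V m1 beta with phi amounts to testing beta with chi = Vs m1 phi,
    which leaves the boundary x = 1 thanks to phi 1 = 0; the diagonal value of
    m1 produces the coupling om that has to be cancelled. *)
Lemma alpha_test (phi : C1I R) : phi 1 = 0 -> exists2 chi : C1I R,
  (forall x, 0 <= x <= 1 -> chi x = Vs m1 phi x) &
  forall xi, 0 < xi < 1 -> Vs m1 (dmul (lam P) phi) xi + Vs m1 (fun x => sig P x * phi x) xi +
    om P xi * phi xi + Vs m2 (fun x => om P x * phi x) xi = - dmul (mu P) chi xi.
Proof.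
move=> phi1.
have [chi chiE] := C1on_C1I (Vs_C1on m1 (@c1_funC R phi)).
exists chi => [x x01|xi /andP[xi0 xi1]]; first by have [] := chiE x x01.
have xi0' := ltW xi0; have xi1' := ltW xi1.
have xi01 : 0 <= xi <= 1 by rewrite xi0'.
have [p1 p2] := chiE xi xi01.
have [K1 _ K3 _] := Pker.
have pi : itg 0 1 phi := itg_within (@c1_funC R phi).
have lami : itg 0 1 (fun x => lam P x * phi x) by apply: itg_within; exact: mul_c1_cont.
have sigi : itg 0 1 (fun x => sig P x * phi x) by apply: itg_within; apply: withinM => //; exact: c1_funC.
have omi : itg 0 1 (fun x => om P x * phi x) by apply: itg_within; apply: withinM => //; exact: c1_funC.
have ker x : xi <= x -> x <= 1 -> m1 x xi * (sig P x * phi x) + m2 x xi * (om P x * phi x) +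
    dx m1 x xi * (-1 * (lam P x * phi x)) + m1 x xi * (c1_der (mu P) xi * phi x) +
    dxi m1 x xi * (mu P xi * phi x) = 0.
  move=> xix x1; have := K1 x xi (conj xi0' (conj xix x1)).
  by move=> /(congr1 (fun z => z * phi x)); lra.
have := Vs_sum5 xi0' (@cTk R m1) (@cTk R m2) (@cTx R m1) (@cTk R m1) (@cTxi R m1)
  sigi omi (itgZ _ lami) (itgZ _ pi) (itgZ _ pi) ker xi1'.
rewrite -!VsZ//; [|exact: cTxi|exact: cTk|exact: cTx].
rewrite Vs_dmul// phi1 mulr0 mulr0 sub0r /dmul p1 p2.
have diag : m1 xi xi * (lam P xi + mu P xi) = om P xi.
  have I : @I01 R xi by rewrite /I01/= in_itv/= xi0'.
  rewrite K3// divfK//.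
  have [_ _ _ [l0 lP] [n0 nP]] := Padm.
  by rewrite gt_eqF// addr_gt0//; [exact: lt_le_trans l0 (lP _ I)|exact: lt_le_trans n0 (nP _ I)].
rewrite -diag; lra.
Qed.

Lemma alpha_weak : weak_rightward (lam P) ut fu (fun=> 0) ->
  weak_leftward (mu P) be (fun t x => fb t x + b2' x * yt t) (fun=> 0) yt ->
  weak_rightward (lam P) al (fun t x => (sig P x * al t x - V m1 (fb t) x) +
    (mu P 0 * (m1 x 0 - m1h x 0) - V m1 b2' x) * yt t) (fun=> 0).
Proof.
have cm1h := withinM (cT_row0 (@cTk R m1h)) (@within_cst R 0 1 (mu P 0)).
have cm1 := cT_row0 (@cTk R m1).
have cb : {within `[0, 1], continuous (fun x => mu P 0 * (m1 x 0 - m1h x 0) - V m1 b2' x)}.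
  apply: withinB; last by apply: V_cont; [exact: cTk|exact: sqi_cont].
  by apply: withinM; [exact: within_cst|apply: withinB => //; exact: cT_row0 (@cTk R m1h)].
have fus : is_src fu by apply: src_sub => //; apply: cl2D; exact: cl2_cM.
have bs : is_src (fun t x => fb t x + b2' x * yt t) by exact: src_add.
have as_ : is_src (fun t x => (sig P x * al t x - V m1 (fb t) x) +
    (mu P 0 * (m1 x 0 - m1h x 0) - V m1 b2' x) * yt t).
  apply: src_add => //; apply: cl2B; first exact: cl2_cM.
  by apply: cl2_V => //; exact: cTk.
move=> /(weak_rightwardE _ utc fus zero2) Hu /(weak_leftwardE _ bec bs zero2 yt2) Hb.
apply/(weak_rightwardE _ alc as_ zero2) => phi t phi1 t0.
have [chi chiE chiD] := alpha_test phi1.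
have ps := c1_sqi phi; have cs := c1_sqi chi.
have Ds := dmul_sqi (lam P) phi; have Dm := dmul_sqi (mu P) chi.
have al_phi s : 0 <= s -> ip (al s) phi = ip (ut s) phi - ip (be s) chi.
  move=> s0; have us := cl2_sqi utc s0; have bes := cl2_sqi bec s0.
  have -> : ip (be s) chi = ip (V m1 (be s)) phi.
    rewrite ipV//; last exact: cTk.
    by rewrite ipC [RHS]ipC; apply: ip_eql.
  rewrite -ipBl//; last exact: V_sqi (@cTk R m1) bes.
  by apply: ip_eql => x x01; rewrite alE.
rewrite (al_phi t t0) (al_phi 0 (lexx 0)) (Hu phi t phi1 t0) (Hb chi t t0).
have Ii := @rightward_itg _ (lam P) _ _ _ phi t utc fus zero2 t0.
have Jj := @leftward_itg _ (mu P) _ _ _ _ chi t bec bs zero2 yt2 t0.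
rewrite opprD addrACA -(IntB Ii Jj); congr (_ + _).
apply: eq_Int => s /andP[s0 _]; clear Ii Jj.
have us := cl2_sqi utc s0; have vs := cl2_sqi vtc s0; have als := cl2_sqi alc s0.
have bes := cl2_sqi bec s0; have fbs := cl2_sqi fbc s0.
have sps : sqi 0 1 (fun x => sig P x * phi x) by exact: sqi_cM.
have ops : sqi 0 1 (fun x => om P x * phi x) by exact: sqi_cM.
have V1bs := V_sqi (@cTk R m1) bes; have V2bs := V_sqi (@cTk R m2) bes.
have e1 : ip (ut s) (dmul (lam P) phi) = ip (al s) (dmul (lam P) phi) + ip (be s) (Vs m1 (dmul (lam P) phi)).
  rewrite -(ipV (@cTk R m1))// -ipDl//.
  by apply: ip_eql => x x01; rewrite alE//; ring.
have e2 : ip (fu s) phi = ip (fun x => sig P x * al s x) phi + ip (be s) (Vs m1 (fun x => sig P x * phi x))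
    + ip (be s) (fun x => om P x * phi x) + ip (be s) (Vs m2 (fun x => om P x * phi x))
    - yt s * ip (fun x => m1h x 0 * mu P 0) phi.
  have bms := sqi_cont cm1h.
  rewrite -(ipV (@cTk R m1))// -(ipV (@cTk R m2))// -ipZl//.
  have -> : ip (V m1 (be s)) (fun x => sig P x * phi x) = ip (fun x => sig P x * V m1 (be s) x) phi.
    by apply: eq_Int => x _; ring.
  have -> : ip (be s) (fun x => om P x * phi x) = ip (fun x => om P x * be s x) phi.
    by apply: eq_Int => x _; ring.
  have -> : ip (V m2 (be s)) (fun x => om P x * phi x) = ip (fun x => om P x * V m2 (be s) x) phi.
    by apply: eq_Int => x _; ring.
  have q1 : sqi 0 1 (fun x => sig P x * al s x) by exact: sqi_cM.
  have q2 : sqi 0 1 (fun x => sig P x * V m1 (be s) x) by exact: sqi_cM.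
  have q3 : sqi 0 1 (fun x => om P x * be s x) by exact: sqi_cM.
  have q4 : sqi 0 1 (fun x => om P x * V m2 (be s) x) by exact: sqi_cM.
  have q12 := sqiD q1 q2; have q123 := sqiD q12 q3; have q1234 := sqiD q123 q4.
  have q5 : sqi 0 1 (fun x => m1h x 0 * mu P 0 * yt s).
    by apply: (sqi_eq _ (sqiZ (yt s) bms)) => x _; rewrite mulrC.
  rewrite -(ipDl q1 q2)// -(ipDl q12 q3)// -(ipDl q123 q4)// -(ipBl q1234 q5)//.
  by apply: ip_eql => x x01; rewrite /fu -beE// alE//; ring.
have e3 : ip (be s) (dmul (mu P) chi) = - (ip (be s) (Vs m1 (dmul (lam P) phi)) +
    ip (be s) (Vs m1 (fun x => sig P x * phi x)) + ip (be s) (fun x => om P x * phi x) +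
    ip (be s) (Vs m2 (fun x => om P x * phi x))).
  have s1 := Vs_sqi (@cTk R m1) Ds; have s2 := Vs_sqi (@cTk R m1) sps; have s3 := Vs_sqi (@cTk R m2) ops.
  have s12 := sqiD s1 s2; have s123 := sqiD s12 ops; have s1234 := sqiD s123 s3.
  rewrite -(ipDr s1 s2)// -(ipDr s12 ops)// -(ipDr s123 s3)// -IntN; last exact: sqi_mul.
  transitivity (ip (be s) (fun x => - (Vs m1 (dmul (lam P) phi) x + Vs m1 (fun x => sig P x * phi x) x +
      om P x * phi x + Vs m2 (fun x => om P x * phi x) x))).
    by apply: ip_eqr => //; [exact: sqiN|move=> x x01; rewrite chiD ?opprK].
  by apply: eq_Int => x _; rewrite mulrN.
have e4 g : sqi 0 1 g -> ip g chi = ip (V m1 g) phi.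
  move=> gs; rewrite ipV//; last exact: cTk.
  by rewrite ipC [RHS]ipC; apply: ip_eql.
have m1s := sqi_cont cm1.
have m1hs := sqi_cont (cT_row0 (@cTk R m1h)).
have e5 : chi 0 = ip (fun x => m1 x 0) phi by rewrite chiE ?lexx ?ler01.
have b2s := sqi_cont b2c.
have b2ys : sqi 0 1 (fun x => b2' x * yt s).
  by apply: (sqi_eq _ (sqiZ (yt s) b2s)) => x _; rewrite mulrC.
have e6 : ip (fun x => (sig P x * al s x - V m1 (fb s) x) +
    (mu P 0 * (m1 x 0 - m1h x 0) - V m1 b2' x) * yt s) phi =
    ip (fun x => sig P x * al s x) phi - ip (V m1 (fb s)) phi + yt s * (mu P 0 * ip (fun x => m1 x 0) phi
      - ip (fun x => m1h x 0 * mu P 0) phi - ip (V m1 b2') phi).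
  have q1 : sqi 0 1 (fun x => sig P x * al s x) by exact: sqi_cM.
  have q2 := V_sqi (@cTk R m1) fbs; have q3 := V_sqi (@cTk R m1) b2s.
  have q4 := sqi_cont cm1h.
  have q5 : sqi 0 1 (fun x => m1 x 0 * mu P 0) by apply: (sqi_eq _ (sqiZ (mu P 0) m1s)) => x _; rewrite mulrC.
  have q45 := sqiB q5 q4; have q345 := sqiB q45 q3.
  have q345y : sqi 0 1 (fun x => (m1 x 0 * mu P 0 - m1h x 0 * mu P 0 - V m1 b2' x) * yt s).
    by apply: (sqi_eq _ (sqiZ (yt s) q345)) => x _; rewrite mulrC.
  rewrite -(ipZl _ m1s ps) -(ipBl q5 q4 ps) -(ipBl q45 q3 ps) -(ipZl _ q345 ps) -(ipBl q1 q2 ps) -(ipDl (sqiB q1 q2) q345y ps).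
  by apply: ip_eql => x _; ring.
rewrite e6 e1 e2 e3 (ipDl fbs b2ys cs) (ipZl _ b2s cs) (e4 _ fbs) (e4 _ b2s) e5.
gen_Int; ring.
Qed.

End observer_error.

Section plant_target.
Variables (R : realType) (P : plant R) (lam_lo mu_lo : R) (k1 k2 : C1T R).
Hypothesis Padm : admissible P lam_lo mu_lo.
Hypothesis Pker : control_kernels P k1 k2.
Implicit Types (f g h phi : R -> R) (a b c s t r x y xi C K : R) (w : R -> R -> R).

Let cth : {within `[0, 1], continuous (th P)}. Proof. by case: Padm. Qed.
Let csig : {within `[0, 1], continuous (sig P)}. Proof. by case: Padm. Qed.
Let com : {within `[0, 1], continuous (om P)}. Proof. by case: Padm. Qed.

(** Testing z with psi amounts to testing u with - phi1 and v with phi2.  The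
    boundary terms of the integrations by parts at x = 1 carry k1 (1, .) and
    k2 (1, .), the feedback gains. *)
Lemma target_test (psi : C1I R) : exists phi1 phi2 : C1I R,
  (forall x, 0 <= x <= 1 -> phi1 x = Vs k1 psi x /\ phi2 x = psi x - Vs k2 psi x) /\
  forall xi, 0 < xi < 1 ->
    - dmul (mu P) phi2 xi - om P xi * phi1 xi =
      - (mu P 1 * psi 1) * k2 1 xi - dmul (mu P) psi xi + Vs k2 (dmul (mu P) psi) xi /\
    th P xi * phi2 xi - dmul (lam P) phi1 xi - sig P xi * phi1 xi =
      - (mu P 1 * psi 1) * k1 1 xi + Vs k1 (dmul (mu P) psi) xi.
Proof.
have cpsi := @c1_funC R psi.
have [phi1 phi1E] := C1on_C1I (Vs_C1on k1 cpsi).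
have [phi2 phi2E] := C1on_C1I (C1onB (C1I_C1on psi) (Vs_C1on k2 cpsi)).
exists phi1, phi2; split=> [x x01|xi /andP[xi0 xi1]].
  by have [-> _] := phi1E x x01; have [-> _] := phi2E x x01.
have xi0' := ltW xi0; have xi1' := ltW xi1.
have xi01 : 0 <= xi <= 1 by rewrite xi0'.
have [p1 p1'] := phi1E xi xi01; have [p2 p2'] := phi2E xi xi01.
have [K1 K2 K3 _] := Pker.
have pi : itg 0 1 psi := itg_within cpsi.
have mupi : itg 0 1 (fun x => mu P x * psi x) by apply: itg_within; exact: mul_c1_cont.
have diag : - k1 xi xi * (lam P xi + mu P xi) = th P xi.
  have I : @I01 R xi by rewrite /I01/= in_itv/= xi0'.
  rewrite K3// opprK divfK//.
  have [_ _ _ [l0 lP] [n0 nP]] := Padm.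
  by rewrite gt_eqF// addr_gt0//; [exact: lt_le_trans l0 (lP _ I)|exact: lt_le_trans n0 (nP _ I)].
have i0 : itg 0 1 (fun=> 0 : R) by exact: itg_cst.
have V0 : Vs k1 (fun=> 0) xi = 0.
  by transitivity (Int xi 1 (fun=> 0 : R)); [apply: eq_Int => x _; rewrite mulr0|rewrite Int_cst// mul0r].
have kerv x : xi <= x -> x <= 1 -> k2 x xi * (c1_der (mu P) xi * psi x) + dxi k2 x xi * (mu P xi * psi x) +
    dx k2 x xi * (mu P x * psi x) + k1 x xi * (- om P xi * psi x) + k1 x xi * 0 = 0.
  move=> xix x1; have := K2 x xi (conj xi0' (conj xix x1)).
  by move=> /(congr1 (fun z => z * psi x)); lra.
have keru x : xi <= x -> x <= 1 -> k2 x xi * (th P xi * psi x) + k1 x xi * (c1_der (lam P) xi * psi x) +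
    dxi k1 x xi * (lam P xi * psi x) + k1 x xi * (sig P xi * psi x) + dx k1 x xi * (-1 * (mu P x * psi x)) = 0.
  move=> xix x1; have := K1 x xi (conj xi0' (conj xix x1)).
  by move=> /(congr1 (fun z => z * psi x)); lra.
have := Vs_sum5 xi0' (@cTk R k2) (@cTxi R k2) (@cTx R k2) (@cTk R k1) (@cTk R k1)
  (itgZ _ pi) (itgZ _ pi) mupi (itgZ _ pi) i0 kerv xi1'.
have := Vs_sum5 xi0' (@cTk R k2) (@cTk R k1) (@cTxi R k1) (@cTk R k1) (@cTx R k1)
  (itgZ _ pi) (itgZ _ pi) (itgZ _ pi) (itgZ _ pi) (itgZ _ mupi) keru xi1'.
rewrite V0 -!VsZ//; try (exact: cTk); try (exact: cTxi); try (exact: cTx).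
rewrite !Vs_dmul// /dmul p1 p1' p2 p2' -diag => Hu Hv; split.
  by lra.
by lra.
Qed.

Variables (u v : R -> R -> R) (Uh y : R -> R).
Hypotheses (uc : cl2 u) (vc : cl2 v) (U2 : tl2 Uh) (y2 : tl2 y).

Definition target t x := v t x - V k1 (u t) x - V k2 (v t) x.

Lemma target_cl2 : cl2 target.
Proof. by apply: cl2B; [apply: cl2B => //|]; apply: cl2_V => //; exact: cTk. Qed.

Definition target_inflow t := Uh t - ip (k1 1) (u t) - ip (k2 1) (v t).

Lemma target_inflow_tl2 : tl2 target_inflow.
Proof.
have H (k : C1T R) w : cl2 w -> tl2 (fun t => ip (k 1) (w t)).
  move=> wc t t0; apply: sqi_cont; apply: cont0_within => //.
  apply: cl2_pair => //; apply: cl2_cst; apply: sqi_cont; exact: cT_col1 (@cTk R k).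
by apply: tl2B; [apply: tl2B => //|]; exact: H.
Qed.

(** The relation between k1 (., 0) and k2 (., 0) cancels the boundary condition
    u (0) = q v (0), so that the trace of z at 0 is the one of v. *)
Lemma target_weak :
  weak_leftward (mu P) v (fun t x => th P x * u t x) Uh y ->
  weak_rightward (lam P) u (fun t x => sig P x * u t x + om P x * v t x) (fun t => q P * y t) ->
  weak_leftward (mu P) target (fun _ _ => 0) target_inflow y.
Proof.
have fvs : is_src (fun t x => th P x * u t x) by apply: cl2_src; exact: cl2_cM.
have fus : is_src (fun t x => sig P x * u t x + om P x * v t x).
  by apply: cl2_src; apply: cl2D; exact: cl2_cM.
have z0 : cl2 (fun _ _ => 0 : R) by apply: cl2_cst; apply: sqi_cont; exact: within_cst.
have f0s : is_src (fun _ _ => 0 : R) by exact: cl2_src.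
have qy2 : tl2 (fun t => q P * y t) by move=> t t0; apply: sqiZ; exact: y2.
move=> /(weak_leftwardE _ vc fvs U2 y2) Hv /(weak_rightwardE _ uc fus qy2) Hu.
apply/(weak_leftwardE _ target_cl2 f0s target_inflow_tl2 y2) => psi t t0.
have [phi1 [phi2 [phiE phiD]]] := target_test psi.
have ps := c1_sqi psi; have p1s := c1_sqi phi1; have p2s := c1_sqi phi2.
have Ds := dmul_sqi (mu P) psi; have D1s := dmul_sqi (lam P) phi1; have D2s := dmul_sqi (mu P) phi2.
have phi11 : phi1 1 = 0 by have [-> _] := phiE 1 (ltac:(by rewrite ler01 lexx)); exact: Vs1.
have adj f s : sqi 0 1 f -> 0 <= s -> ip (target s) f = ip (v s) f - ip (u s) (Vs k1 f) - ip (v s) (Vs k2 f).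
  move=> fs s0; have us := cl2_sqi uc s0; have vs := cl2_sqi vc s0.
  have q1 := V_sqi (@cTk R k1) us; have q2 := V_sqi (@cTk R k2) vs.
  by rewrite -(ipV (@cTk R k1) us fs) -(ipV (@cTk R k2) vs fs) -(ipBl vs q1 fs) -(ipBl (sqiB vs q1) q2 fs).
have adjpsi s : 0 <= s -> ip (target s) psi = ip (v s) phi2 - ip (u s) phi1.
  move=> s0; have us := cl2_sqi uc s0; have vs := cl2_sqi vc s0.
  rewrite adj//.
  have -> : ip (u s) phi1 = ip (u s) (Vs k1 psi) by rewrite ipC [RHS]ipC; apply: ip_eql => x /phiE[].
  have -> : ip (v s) phi2 = ip (v s) (fun x => psi x - Vs k2 psi x).
    by rewrite ipC [RHS]ipC; apply: ip_eql => x /phiE[].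
  by rewrite (ipBr ps (Vs_sqi (@cTk R k2) ps) vs); gen_Int; exact: addrAC.
rewrite (adjpsi t t0) (adjpsi 0 (lexx 0)) (Hv phi2 t t0) (Hu phi1 t phi11 t0).
have Ii := @rightward_itg _ (lam P) _ _ _ phi1 t uc fus qy2 t0.
have Jj := @leftward_itg _ (mu P) _ _ _ _ phi2 t vc fvs U2 y2 t0.
rewrite opprD addrACA -(IntB Jj Ii); congr (_ + _).
apply: eq_Int => s /andP[s0 _]; clear Ii Jj.
have us := cl2_sqi uc s0; have vs := cl2_sqi vc s0.
have th2 : sqi 0 1 (fun x => th P x * phi2 x) by exact: sqi_cM.
have sg1 : sqi 0 1 (fun x => sig P x * phi1 x) by exact: sqi_cM.
have om1 : sqi 0 1 (fun x => om P x * phi1 x) by exact: sqi_cM.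
have c1s := sqi_cont (cT_col1 (@cTk R k1)); have c2s := sqi_cont (cT_col1 (@cTk R k2)).
have W1 := Vs_sqi (@cTk R k1) Ds; have W2 := Vs_sqi (@cTk R k2) Ds.
set B := - (mu P 1 * psi 1) in phiD.
have cB1 : sqi 0 1 (fun x => B * k1 1 x) by exact: sqiZ.
have cB2 : sqi 0 1 (fun x => B * k2 1 x) by exact: sqiZ.
have ZB f g : sqi 0 1 f -> sqi 0 1 g -> ip g (fun x => B * f x) = B * ip f g.
  by move=> fs gs; rewrite -IntZ; [apply: eq_Int => x _; ring|exact: sqi_mul].
have N2 := sqiN D2s.
have e1 : - ip (v s) (dmul (mu P) phi2) - ip (v s) (fun x => om P x * phi1 x) =
    B * ip (k2 1) (v s) - ip (v s) (dmul (mu P) psi) + ip (v s) (Vs k2 (dmul (mu P) psi)).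
  have -> : - ip (v s) (dmul (mu P) phi2) = ip (v s) (fun x => - dmul (mu P) phi2 x).
    by rewrite -IntN; [apply: eq_Int => x _; ring|exact: sqi_mul].
  rewrite -(ZB _ _ c2s vs) -(ipBr N2 om1 vs) -(ipBr cB2 Ds vs) -(ipDr (sqiB cB2 Ds) W2 vs).
  apply: ip_eqr => //; [exact: sqiB|by apply: sqiD => //; exact: sqiB|].
  by move=> x /phiD[].
have e2 : ip (u s) (fun x => th P x * phi2 x) - ip (u s) (dmul (lam P) phi1) - ip (u s) (fun x => sig P x * phi1 x) =
    B * ip (k1 1) (u s) + ip (u s) (Vs k1 (dmul (mu P) psi)).
  rewrite -(ZB _ _ c1s us) -(ipBr th2 D1s us) -(ipBr (sqiB th2 D1s) sg1 us) -(ipDr cB1 W1 us).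
  apply: ip_eqr => //; [by apply: sqiB => //; exact: sqiB|exact: sqiD|].
  by move=> x /phiD[].
have e3 := adj _ s Ds s0.
have e4 : ip (fun x => th P x * u s x) phi2 = ip (u s) (fun x => th P x * phi2 x).
  by apply: eq_Int => x _; ring.
have e5 : ip (fun x => sig P x * u s x + om P x * v s x) phi1 =
    ip (u s) (fun x => sig P x * phi1 x) + ip (v s) (fun x => om P x * phi1 x).
  rewrite (ipDl (sqi_cM csig us) (sqi_cM com vs) p1s).
  by congr (_ + _); apply: eq_Int => x _; ring.
have [_ phi21] := phiE 1 (ltac:(by rewrite ler01 lexx)); rewrite Vs1 subr0 in phi21.
have [phi10 phi20] := phiE 0 (ltac:(by rewrite ler01 lexx)).
have [_ _ _ K4] := Pker.
have XE : mu P 0 * Vs k2 psi 0 = q P * lam P 0 * Vs k1 psi 0.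
  have c01 := itg_within (@c1_funC R psi).
  rewrite !VsZ//; try exact: cTk; try exact: itgZ.
  apply: eq_Int => x /andP[x0 x1].
  have := K4 x; rewrite /I01/= in_itv/= x0 x1 => /(_ erefl) E.
  by rewrite mulrCA mulrA E mulrCA !mulrA.
have e6 : ip (fun=> 0) psi = 0.
  by transitivity (Int 0 1 (fun=> 0 : R)); [apply: eq_Int => x _; rewrite mul0r|rewrite Int_cst// mul0r].
rewrite e3 e4 e5 e6 /target_inflow phi21 phi20 phi10.
have XE' := congr1 (fun z => z * y s) XE.
rewrite /B in e1 e2; move: XE' e1 e2; gen_Int; lra.
Qed.

End plant_target.

(** * Weighted norms *)

Section weighted_norms.
Variable R : realType.
Implicit Types (k : R -> R -> R) (W f g h b : R -> R) (c s t r x xi C K kap : R).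

Definition Wn W f : R := Int 0 1 (fun x => W x * f x ^+ 2).

(** kap measures how much W may increase; the constants below depend on the
    weight through kap only. *)
Record weight W kap : Prop := Weight {
  weight_cont : {within `[0, 1], continuous W};
  weight_ge0 : forall x, 0 <= x <= 1 -> 0 <= W x;
  weight_decr : forall xi x, 0 <= xi -> xi <= x -> x <= 1 -> W x <= kap * W xi;
  weight_kap : 0 <= kap }.

Lemma weight1 : weight (fun=> 1) 1.
Proof. by split=> //[|*]; [exact: within_cst|rewrite mulr1]. Qed.

Variables (W : R -> R) (kap : R).
Hypothesis Ww : weight W kap.

Lemma Wn_itg f : sqi 0 1 f -> itg 0 1 (fun x => W x * f x ^+ 2).
Proof. by move=> [_ fi]; apply: itg_cM => //; exact: weight_cont Ww. Qed.

Lemma Wn_ge0 f : 0 <= Wn W f.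
Proof. by apply: Int_ge0 => x x01; rewrite mulr_ge0 ?sqr_ge0// (weight_ge0 Ww). Qed.

Lemma Wn_eq f g : (forall x, 0 <= x <= 1 -> f x = g x) -> Wn W f = Wn W g.
Proof. by move=> fg; apply: eq_Int => x /fg ->. Qed.

Lemma Wn_D f g : sqi 0 1 f -> sqi 0 1 g -> Wn W (fun x => f x + g x) <= 2 * Wn W f + 2 * Wn W g.
Proof.
move=> fs gs; have fi := Wn_itg fs; have gi := Wn_itg gs.
rewrite -!IntZ// -IntD; [|exact: itgZ|exact: itgZ].
apply: Int_le; [exact: Wn_itg (sqiD fs gs)|by apply: itgD; exact: itgZ|move=> x x01].
have W0 := weight_ge0 Ww x01.
rewrite -subr_ge0 (_ : _ - _ = W x * (f x - g x) ^+ 2); last by ring.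
by rewrite mulr_ge0// sqr_ge0.
Qed.

Lemma Wn_N f : Wn W (fun x => - f x) = Wn W f.
Proof. by apply: eq_Int => x _; rewrite sqrrN. Qed.

Lemma Wn_B f g : sqi 0 1 f -> sqi 0 1 g -> Wn W (fun x => f x - g x) <= 2 * Wn W f + 2 * Wn W g.
Proof. by move=> fs gs; rewrite -(Wn_N g); apply: Wn_D => //; exact: sqiN. Qed.

Lemma Wn_mul c f C : {within `[0, 1], continuous f} -> (forall x, 0 <= x <= 1 -> `|f x| <= C) ->
  0 <= C -> forall g, sqi 0 1 g -> Wn W (fun x => f x * g x) <= C ^+ 2 * Wn W g.
Proof.
move=> cf fC C0 g gs; rewrite -IntZ; last exact: Wn_itg.
apply: Int_le; [exact: Wn_itg (sqi_cM cf gs)|by apply: itgZ; exact: Wn_itg|move=> x x01].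
rewrite exprMn mulrCA ler_wpM2r ?(mulr_ge0 (weight_ge0 Ww x01) (sqr_ge0 _))//.
by rewrite -[leLHS]real_normK ?num_real// ler_pXn2r ?nnegrE ?fC.
Qed.

(** A causal operator only brings mass from the left, where W is larger, up to
    the factor kap. *)
Lemma Wn_volterra f g C : 0 <= C -> sqi 0 1 f -> sqi 0 1 g ->
  (forall x, 0 <= x <= 1 -> `|g x| <= C * Int 0 x (fun s => `|f s|)) ->
  Wn W g <= C ^+ 2 * kap * Wn W f.
Proof.
move=> C0 fs gs H; set N := Wn W f.
rewrite (_ : C ^+ 2 * kap * N = Int 0 1 (fun=> C ^+ 2 * kap * N)); last first.
  by rewrite Int_cst// subr0 mulr1.
apply: Int_le; [exact: Wn_itg|exact: itg_cst|move=> x x01].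
have /andP[x0 x1] := x01; have [_ f2i] := fs; have fx := sqi_sub (lexx 0) x1 fs.
have f2x := itg_sub (lexx 0) x1 f2i.
have I0 : 0 <= Int 0 x (fun s => `|f s|) by exact: Int_ge0.
have g2 : g x ^+ 2 <= C ^+ 2 * Int 0 x (fun s => f s ^+ 2).
  rewrite -[leLHS]real_normK ?num_real//.
  apply: (@le_trans _ _ ((C * Int 0 x (fun s => `|f s|)) ^+ 2)).
    by rewrite ler_pXn2r ?nnegrE ?H// mulr_ge0.
  rewrite exprMn ler_wpM2l ?sqr_ge0//.
  have := cauchy_schwarz (sqi_norm fx) (sqi_cont (@within_cst R 0 x 1)).
  rewrite (eq_Int (g := fun s => `|f s|)); last by move=> r _; rewrite mulr1.
  rewrite expr1n Int_cst// mul1r subr0.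
  rewrite (_ : Int 0 x (fun s => `|f s| ^+ 2) = Int 0 x (fun s => f s ^+ 2)); last first.
    by apply: eq_Int => r _; rewrite real_normK ?num_real.
  move=> /le_trans; apply; rewrite ler_piMr//; apply: Int_ge0 => r _; exact: sqr_ge0.
have Wx := weight_ge0 Ww x01.
apply: (@le_trans _ _ (W x * (C ^+ 2 * Int 0 x (fun s => f s ^+ 2)))); first by rewrite ler_wpM2l.
rewrite mulrCA -mulrA ler_wpM2l ?sqr_ge0// -IntZ//.
have Wfi := Wn_itg fs.
apply: (@le_trans _ _ (Int 0 x (fun s => kap * (W s * f s ^+ 2)))).
  apply: Int_le; [exact: itgZ|by apply: itgZ; exact: itg_sub Wfi|move=> s /andP[s0 sx]].
  by rewrite mulrA ler_wpM2r ?sqr_ge0// (weight_decr Ww).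
rewrite IntZ; last exact: itg_sub Wfi.
rewrite ler_wpM2l ?(weight_kap Ww)//; apply: Int_le_set => // s s01.
by rewrite mulr_ge0 ?sqr_ge0// (weight_ge0 Ww).
Qed.

Lemma Wn_near1 f lo hi : (forall x, 0 <= x <= 1 -> lo <= W x <= hi) -> sqi 0 1 f ->
  lo * Wn (fun=> 1) f <= Wn W f /\ Wn W f <= hi * Wn (fun=> 1) f.
Proof.
move=> WH fs; have fi : itg 0 1 (fun x => 1 * f x ^+ 2).
  by have [_] := fs; apply: itg_eq => x _; rewrite mul1r.
by split; rewrite -IntZ//; apply: Int_le => //; do ?[exact: itgZ|exact: Wn_itg];
  move=> x /WH /andP[h1 h2]; rewrite mul1r ler_wpM2r// sqr_ge0.
Qed.

End weighted_norms.

Section weighted_volterra.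
Variable R : realType.
Implicit Types (k : R -> R -> R) (W f g h b : R -> R) (c s t r x xi C K kap : R).

Lemma Wn_V k kap : cT k -> exists2 C, 0 <= C & forall W f, weight W kap -> sqi 0 1 f ->
  Wn W (V k f) <= C * Wn W f.
Proof.
move=> kT; have [C C0 CP] := V_bound kT.
exists (C ^+ 2 * `|kap|); first by rewrite mulr_ge0 ?sqr_ge0.
move=> W f Ww fs; rewrite (ger0_norm (weight_kap Ww)).
by apply: (Wn_volterra Ww C0 fs (V_sqi kT fs)) => x; exact: CP.
Qed.

Lemma Wn_inv k kap : cT k -> exists2 C, 0 <= C & forall W f g, weight W kap -> sqi 0 1 f -> sqi 0 1 g ->
  (forall x, 0 <= x <= 1 -> g x + V k g x = f x) -> Wn W g <= C * Wn W f.
Proof.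
move=> kT; have [K K0 KP] := V_apriori kT.
exists (2 + 2 * (K ^+ 2 * `|kap|)); first by rewrite addr_ge0 ?mulr_ge0 ?sqr_ge0.
move=> W f g Ww fs gs H; rewrite (ger0_norm (weight_kap Ww)).
pose b x := g x - f x.
have cb : {within `[0, 1], continuous b}.
  apply: (@within_eq _ (fun x => - V k g x)).
    by move=> x /H; rewrite /b; lra.
  by apply: (@within_compo _ (V k g) -%R); [exact: opp_continuous|exact: V_cont].
have bE x : 0 <= x <= 1 -> b x + V k b x = - V k f x.
  move=> x01; have /andP[_ x1] := x01.
  by rewrite /b VB//; [have := H x x01; lra|exact: sqi_itg|exact: sqi_itg].
have bb := Wn_volterra Ww K0 fs (sqi_cont cb) (fun x => KP f b fs cb bE x).
rewrite (@Wn_eq _ W g (fun x => f x + b x)); last by move=> x _; rewrite /b; ring.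
by have := Wn_D Ww fs (sqi_cont cb); lra.
Qed.

Lemma Wn_cM (p : R -> R) : {within `[0, 1], continuous p} -> exists2 C, 0 <= C &
  forall W kap f, weight W kap -> sqi 0 1 f -> Wn W (fun x => p x * f x) <= C * Wn W f.
Proof.
move=> cp; have [C C0 CP] := within_bounded cp; exists (C ^+ 2); first exact: sqr_ge0.
by move=> W kap f Ww fs; apply: (Wn_mul Ww).
Qed.

(** F is a square root because [source] asks for a square integrable bound of
    the norm, whereas estimates add up squares. *)
Lemma src_source (p h : R -> R) (gam kap : R) (w : R -> R -> R) (b y : R -> R) :
  weight (fun x => expR (gam * h x) * p x) kap -> cl2 w -> {within `[0, 1], continuous b} -> tl2 y ->
  exists2 F, source p h gam (fun t x => w t x + b x * y t) F &
    forall r, 0 <= r -> F r ^+ 2 = 2 * Ew p h gam (w r) + 2 * Ew p h gam b * y r ^+ 2.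
Proof.
set W := (fun x => _) => Ww wc bc y2.
have EE f : Ew p h gam f = Wn W f by [].
have E0 f : 0 <= Ew p h gam f by rewrite EE; exact: (Wn_ge0 Ww).
have Ec : cont0 (fun t => Ew p h gam (w t)).
  have [h1 h2] := wc.
  have := cl2_pair wc (cl2_cM (weight_cont Ww) wc).
  move=> H t0 t00 e e0; have [d d0 dP] := H t0 t00 e e0; exists d => // t t0' td.
  have := dP t t0' td; rewrite !EE /Wn.
  have E f : ip f (fun x => W x * f x) = Int 0 1 (fun x => W x * f x ^+ 2).
    by apply: eq_Int => x _; ring.
  by rewrite !E.
pose G r := 2 * Ew p h gam (w r) + 2 * Ew p h gam b * y r ^+ 2.
have G0 r : 0 <= G r.
  by apply: addr_ge0; apply: mulr_ge0; rewrite ?sqr_ge0//; apply: mulr_ge0.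
have fs r : 0 <= r -> sqi 0 1 (fun x => b x * y r).
  by move=> r0; apply: (sqi_eq _ (sqiZ (y r) (sqi_cont bc))) => x _; rewrite mulrC.
have Gi t : 0 <= t -> itg 0 t G.
  move=> t0; apply: itgD; first by apply: itgZ; exact: cont0_itg.
  by apply: itgZ; have [] := y2 t t0.
exists (fun r => Num.sqrt (G r)); last by move=> r r0; rewrite sqr_sqrtr.
split=> [r r0|phi s t pc s0 st|t t0|r r0|r r0].
- by apply: sqiD; [exact: cl2_sqi|exact: fs].
- have t0 := le_trans s0 st.
  apply: (@itg_eq _ _ _ (fun r => ip (w r) (phi r) + y r * ip b (phi r))).
    move=> r /andP[sr _]; have r0 := le_trans s0 sr.
    have ps := cl2_sqi pc r0; have ws := cl2_sqi wc r0.
    by rewrite -(ipZl _ (sqi_cont bc) ps) -(ipDl ws (fs r r0) ps).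
  apply: itgD; first by apply: cont0_itg => //; exact: cl2_pair.
  apply: sqi_mul; first exact: tl2_sqi.
  by apply: sqi_cont; apply: cont0_within => //; apply: cl2_pair => //; apply: cl2_cst; exact: sqi_cont.
- split; first by apply: measurableT_comp; [apply: continuous_measurable_fun; exact: sqrt_continuous|exact: itgP (Gi t t0)].
  by apply: (itg_eq _ (Gi t t0)) => r _; rewrite sqr_sqrtr.
- exact: sqrtr_ge0.
- rewrite sqr_sqrtr// EE (le_trans (Wn_D Ww (cl2_sqi wc r0) (fs r r0)))// /G -mulrA lerD// ler_wpM2l//.
  rewrite EE mulrC -IntZ; last exact: (Wn_itg Ww (sqi_cont bc)).
  by rewrite le_eqVlt; apply/orP; left; apply/eqP; apply: eq_Int => x _; ring.
Qed.

End weighted_volterra.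

(** * Bounds on the transformed state and on the sources *)

Section weights.
Variables (R : realType) (a : C1I R) (lo : R).
Hypothesis lo0 : 0 < lo.
Hypothesis alo : forall x, @I01 R x -> lo <= a x.
Implicit Types (x d : R).

(** The weights of the energies of rightward and of leftward waves. *)
Definition wR d x : R := expR (d * hR a x) * pa a x.
Definition wL d x : R := expR (d * hL a x) * pa a x.

Lemma pa_range : exists lo1 hi1 : R, 0 < lo1 /\ forall x, lo1 <= pa a x <= hi1.
Proof.
have pc : {within `[0, 1], continuous (pa a)} := continuous_subspaceT (pa_cont lo0 alo).
have [x1 _ x1P] := EVT_min (ler01) pc; have [x2 _ x2P] := EVT_max (ler01) pc.
exists (pa a x1), (pa a x2); split=> [|x]; first exact: (pa_gt0 lo0 alo).
have -> : pa a x = pa a (c01 x) by rewrite /pa (c01_id (c01_in x)).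
by rewrite x1P ?x2P// in_itv/= c01_in.
Qed.

(** For wR the constant kap does not depend on the rate d, as hR decreases: the
    rate may be chosen after the bounds on the sources of the rightward
    equations.  For wL it does, but d is fixed there. *)
Lemma weights_comparable : exists kap lo1 : R, 0 < lo1 /\ forall d, 0 <= d ->
  weight (wR d) kap /\
  (exists kapL, weight (wL d) kapL) /\
  exists hi1, [/\ 0 <= hi1, (forall x, 0 <= x <= 1 -> lo1 <= wR d x <= hi1) &
    forall x, 0 <= x <= 1 -> lo1 <= wL d x <= hi1].
Proof.
have [lo1 [hi1 [lo10 H]]] := pa_range.
have hi10 : 0 < hi1 by have /andP[h1 h2] := H 0; exact: lt_le_trans lo10 (le_trans h1 h2).
exists (hi1 / lo1), lo1; split=> // d d0.
pose E := expR (d * Ht a).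
have E1 : 1 <= E by rewrite -expR0 ler_expR mulr_ge0// (Ht_ge0 lo0 alo).
have bnd (h : R -> R) x : 0 <= h x <= Ht a -> lo1 <= expR (d * h x) * pa a x <= E * hi1.
  move=> /andP[h1 h2]; have /andP[p1 p2] := H x.
  have e1 : 1 <= expR (d * h x) by rewrite -expR0 ler_expR mulr_ge0.
  have e2 : expR (d * h x) <= E by rewrite ler_expR ler_wpM2l.
  have e0 := le_trans ler01 e1; have p0 := le_trans (ltW lo10) p1.
  apply/andP; split; last exact: ler_pM.
  by rewrite -[leLHS]mul1r; apply: ler_pM => //; exact: ltW.
have bR x : 0 <= x <= 1 -> lo1 <= wR d x <= E * hi1.
  by move=> x01; apply: (bnd (hR a)); exact: (hR01 lo0 alo).
have bL x : 0 <= x <= 1 -> lo1 <= wL d x <= E * hi1.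
  by move=> x01; apply: (bnd (hL a)); exact: (hL01 lo0 alo).
have cexp (h : R -> R) : continuous h -> {within `[0, 1], continuous (fun x => expR (d * h x) * pa a x)}.
  move=> hc; apply: withinM; last exact: continuous_subspaceT (pa_cont lo0 alo).
  apply: continuous_subspaceT => x.
  apply: (@continuous_comp _ _ _ h (fun s => expR (d * s))); first exact: hc.
  exact: expR_lin_cont.
have cR : {within `[0, 1], continuous (wR d)} by apply: cexp; exact: (hR_cont lo0 alo).
have cL : {within `[0, 1], continuous (wL d)} by apply: cexp; exact: (hL_cont lo0 alo).
split; [|split; last by exists (E * hi1); split=> //; rewrite mulr_ge0 ?(ltW hi10)// (le_trans ler01)].
  split=> //.
  - by move=> x /bR/andP[h _]; exact: le_trans (ltW lo10) h.
  - move=> xi x xi0 xix x1; rewrite /wR mulrCA.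
    have /andP[p1 p2] := H xi; have /andP[p3 p4] := H x.
    apply: ler_pM; [exact: expR_ge0|exact: le_trans (ltW lo10) p3| |].
      rewrite ler_expR ler_wpM2l// /hR lerD2l lerN2.
      exact: (hL_le lo0 alo).
    rewrite (le_trans p4)// mulrAC ler_pdivlMr// ler_wpM2l ?(ltW hi10)//.
  - by rewrite divr_ge0 ?(ltW hi10)// ltW.
exists (E * hi1 / lo1); split=> //.
- by move=> x /bL/andP[h _]; exact: le_trans (ltW lo10) h.
- move=> xi x xi0 xix x1.
  have /bL/andP[q1 _] : 0 <= xi <= 1 by rewrite xi0 (le_trans xix).
  have /bL/andP[_ q2] : 0 <= x <= 1 by rewrite x1 (le_trans xi0).
  have Eh0 : 0 <= E * hi1 by rewrite mulr_ge0 ?(ltW hi10)// (le_trans ler01).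
  by rewrite (le_trans q2)// mulrAC ler_pdivlMr// ler_wpM2l.
- by rewrite divr_ge0 ?(ltW lo10)// mulr_ge0 ?(ltW hi10)// (le_trans ler01).
Qed.

End weights.

(** Linear arithmetic is run on opaque norms. *)
Ltac gen_Wn := repeat match goal with |- context [Wn ?W ?f] =>
  let X := fresh "X" in set X := (Wn W f); clearbody X end.

Notation nn f := (Wn (fun=> 1) f).

Section estimates.
Variables (R : realType) (P : plant R) (lam_lo mu_lo : R) (k1 k2 m1 m2 : C1T R).
Hypothesis Padm : admissible P lam_lo mu_lo.
Implicit Types (f g h u v z al be fb W : R -> R) (c s t r x kap eps C K : R).

Let cth : {within `[0, 1], continuous (th P)}. Proof. by case: Padm. Qed.
Let csig : {within `[0, 1], continuous (sig P)}. Proof. by case: Padm. Qed.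
Let com : {within `[0, 1], continuous (om P)}. Proof. by case: Padm. Qed.

Lemma Wn_cont0 W kap (w : R -> R -> R) : weight W kap -> cl2 w -> cont0 (fun t => Wn W (w t)).
Proof.
move=> Ww wc t0 t00 e e0.
have [d d0 dP] := cl2_pair wc (cl2_cM (weight_cont Ww) wc) t00 e0.
exists d => // t t0' td; have := dP t t0' td; rewrite /Wn.
have E f : ip f (fun x => W x * f x) = Int 0 1 (fun x => W x * f x ^+ 2).
  by apply: eq_Int => x _; ring.
by rewrite !E.
Qed.

Lemma cT_opp (k : R -> R -> R) : cT k -> cT (fun x xi => - k x xi).
Proof.
move=> kT; pose g (z : R * R) := k z.1 z.2.
by move=> x; apply: (@continuousN _ _ (subspace _)); exact: kT.
Qed.

Lemma V_opp (k : R -> R -> R) f x : cT k -> itg 0 1 f -> x <= 1 ->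
  V (fun x xi => - k x xi) f x = - V k f x.
Proof.
move=> kT fi x1; rewrite /V -IntN; last exact: V_itg.
by apply: eq_Int => r _; rewrite mulNr.
Qed.

(** v is recovered from z and u by inverting I - V k2. *)
Lemma target_controls kap : exists2 C, 0 <= C & forall W u v z, weight W kap ->
  sqi 0 1 u -> sqi 0 1 v -> sqi 0 1 z ->
  (forall x, 0 <= x <= 1 -> z x = v x - V k1 u x - V k2 v x) ->
  Wn W v <= C * (Wn W u + Wn W z).
Proof.
have [C1 C10 H1] := Wn_inv kap (cT_opp (@cTk R k2)).
have [C2 C20 H2] := Wn_V kap (@cTk R k1).
exists (C1 * (2 + 2 * C2)); first by rewrite mulr_ge0// addr_ge0// mulr_ge0.
move=> W u v z Ww us vs zs zE.
have Vs := V_sqi (@cTk R k1) us; have ss := sqiD zs Vs.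
have Eu := Wn_ge0 Ww u; have Ez := Wn_ge0 Ww z.
apply: (le_trans (H1 W _ _ Ww ss vs _)).
  move=> x x01; have /andP[_ x1] := x01.
  by rewrite V_opp//; [rewrite zE//; ring|exact: cTk|exact: sqi_itg].
rewrite -mulrA ler_wpM2l// (le_trans (Wn_D Ww zs Vs))//.
have := H2 W u Ww us; have := mulr_ge0 C20 Ez.
by move: (Wn W _) (Wn W _) (Wn W _) Eu Ez => *; lra.
Qed.

Lemma plant_source_bound kap : exists2 C, 0 <= C & forall W u v z, weight W kap ->
  sqi 0 1 u -> sqi 0 1 v -> sqi 0 1 z ->
  (forall x, 0 <= x <= 1 -> z x = v x - V k1 u x - V k2 v x) ->
  Wn W (fun x => sig P x * u x + om P x * v x) <= C * (Wn W u + Wn W z).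
Proof.
have [C C0 H] := target_controls kap.
have [C1 C10 H1] := Wn_cM csig; have [C2 C20 H2] := Wn_cM com.
exists (2 * C1 + 2 * C2 * C); first by rewrite addr_ge0 ?mulr_ge0.
move=> W u v z Ww us vs zs zE.
have Eu := Wn_ge0 Ww u; have Ez := Wn_ge0 Ww z.
have h := ler_wpM2l C20 (H W u v z Ww us vs zs zE).
have h1 := H1 W kap u Ww us; have h2 := H2 W kap v Ww vs.
have h3 := mulr_ge0 C10 Ez.
apply: (le_trans (Wn_D Ww (sqi_cM csig us) (sqi_cM com vs))).
rewrite mulrDl; lra.
Qed.

(** The sources fb of beta and sig alpha - V m1 fb of alpha are causal functions
    of alpha. *)
Lemma error_source_bound kap : exists2 C, 0 <= C & forall W al fb, weight W kap ->
  sqi 0 1 al -> sqi 0 1 fb ->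
  (forall x, 0 <= x <= 1 -> fb x + V m2 fb x = th P x * al x) ->
  Wn W fb <= C * Wn W al /\ Wn W (fun x => sig P x * al x - V m1 fb x) <= C * Wn W al.
Proof.
have [C1 C10 H1] := Wn_cM cth; have [C2 C20 H2] := Wn_cM csig.
have [C3 C30 H3] := Wn_inv kap (@cTk R m2); have [C4 C40 H4] := Wn_V kap (@cTk R m1).
have C310 : 0 <= C3 * C1 by rewrite mulr_ge0.
have C4310 : 0 <= C4 * (C3 * C1) by rewrite mulr_ge0.
exists (C3 * C1 + 2 * C2 + 2 * (C4 * (C3 * C1))); first by rewrite !addr_ge0 ?mulr_ge0.
move=> W al fb Ww als fbs fbE.
have Ea := Wn_ge0 Ww al.
have h : Wn W fb <= C3 * C1 * Wn W al.
  apply: (le_trans (H3 W _ _ Ww (sqi_cM cth als) fbs fbE)).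
  by rewrite -mulrA ler_wpM2l//; exact: (H1 W kap).
have h4 := H4 W fb Ww fbs; have h2 := H2 W kap al Ww als; have h5 := ler_wpM2l C40 h.
have q1 := mulr_ge0 C310 Ea; have q2 := mulr_ge0 C20 Ea; have q3 := mulr_ge0 C4310 Ea.
have h6 := Wn_B Ww (sqi_cM csig als) (V_sqi (@cTk R m1) fbs).
by move: Ea h h2 h4 h5 h6 q1 q2 q3; clear -C10; gen_Wn => *; split; rewrite !mulrDl; lra.
Qed.

Lemma nn_small f eps : (forall x, 0 <= x <= 1 -> `|f x| <= eps) -> sqi 0 1 f -> nn f <= eps ^+ 2.
Proof.
move=> H fs; rewrite (_ : eps ^+ 2 = Int 0 1 (fun=> eps ^+ 2)); last by rewrite Int_cst// subr0 mulr1.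
apply: Int_le; [exact: (Wn_itg (@weight1 R))|exact: itg_cst|move=> x x01].
rewrite mul1r -[leLHS]real_normK ?num_real// ler_pXn2r ?nnegrE ?H//.
by rewrite (le_trans _ (H x x01)).
Qed.

(** d1 and d2 are the errors on the observer gains. *)
Lemma gain_error_bound : exists2 C, 0 <= C & forall eps (d1 d2 b2' : R -> R), sqi 0 1 d1 -> sqi 0 1 d2 -> sqi 0 1 b2' ->
  (forall x, 0 <= x <= 1 -> `|d1 x| <= eps) -> (forall x, 0 <= x <= 1 -> `|d2 x| <= eps) ->
  (forall x, 0 <= x <= 1 -> b2' x + V m2 b2' x = mu P 0 * d2 x) ->
  nn b2' <= C * eps ^+ 2 /\ nn (fun x => mu P 0 * d1 x - V m1 b2' x) <= C * eps ^+ 2.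
Proof.
have [C3 C30 H3] := Wn_inv 1 (@cTk R m2); have [C4 C40 H4] := Wn_V 1 (@cTk R m1).
have [M M0 ME] : exists2 M : R, 0 <= M & mu P 0 ^+ 2 = M by exists (mu P 0 ^+ 2); rewrite ?sqr_ge0.
have C3M : 0 <= C3 * M by rewrite mulr_ge0.
exists (C3 * M + 2 * M + 2 * (C4 * (C3 * M))); first by rewrite !addr_ge0 ?mulr_ge0.
move=> eps d1 d2 b2' d1s d2s bs d1e d2e bE.
have w1 := @weight1 R; have e0 := sqr_ge0 eps.
have small d : sqi 0 1 d -> (forall x, 0 <= x <= 1 -> `|d x| <= eps) -> nn (fun x => mu P 0 * d x) <= M * eps ^+ 2.
  move=> ds de; apply: (@le_trans _ _ (M * nn d)); last by rewrite ler_wpM2l// nn_small.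
  rewrite -IntZ; last exact: (Wn_itg w1 ds).
  by rewrite le_eqVlt; apply/orP; left; apply/eqP; apply: eq_Int => x _; rewrite -ME; ring.
have h : nn b2' <= C3 * M * eps ^+ 2.
  by rewrite (le_trans (H3 _ _ _ w1 (sqiZ _ d2s) bs bE))// -mulrA ler_wpM2l// small.
have h4 := H4 _ b2' w1 bs; have h5 := ler_wpM2l C40 h; have h1 := small _ d1s d1e.
have h6 := Wn_B w1 (sqiZ (mu P 0) d1s) (V_sqi (@cTk R m1) bs).
have q1 := mulr_ge0 C3M e0; have q2 := mulr_ge0 M0 e0; have q3 := mulr_ge0 C40 q1.
by move: h h1 h4 h5 h6 q1 q2 q3; clear -C30; gen_Wn => *; split; rewrite !mulrDl; lra.
Qed.

Lemma error_equiv : exists2 C, 0 <= C & forall (ut vt al be : R -> R),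
  sqi 0 1 ut -> sqi 0 1 vt -> sqi 0 1 al -> sqi 0 1 be ->
  (forall x, 0 <= x <= 1 -> be x + V m2 be x = vt x) ->
  (forall x, 0 <= x <= 1 -> al x = ut x - V m1 be x) ->
  nn ut + nn vt <= C * (nn al + nn be) /\ nn al + nn be <= C * (nn ut + nn vt).
Proof.
have [C1 C10 H1] := Wn_V 1 (@cTk R m1); have [C2 C20 H2] := Wn_V 1 (@cTk R m2).
have [C3 C30 H3] := Wn_inv 1 (@cTk R m2).
have C130 : 0 <= C1 * C3 by rewrite mulr_ge0.
exists (2 + 2 * C1 + 2 * C2 + C3 + 2 * (C1 * C3)); first by rewrite !addr_ge0 ?mulr_ge0.
move=> ut vt al be us vs als bes beE alE.
have w1 := @weight1 R.
have V1s := V_sqi (@cTk R m1) bes; have V2s := V_sqi (@cTk R m2) bes.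
have h1 := H1 _ be w1 bes; have h2 := H2 _ be w1 bes; have h3 := H3 _ _ _ w1 vs bes beE.
have u2 := Wn_ge0 w1 ut; have v2 := Wn_ge0 w1 vt; have a2 := Wn_ge0 w1 al; have b2 := Wn_ge0 w1 be.
have hu : nn ut <= 2 * nn al + 2 * nn (V m1 be).
  rewrite (@Wn_eq _ _ ut (fun x => al x + V m1 be x)); first exact: (Wn_D w1 als V1s).
  by move=> x x01; rewrite alE// subrK.
have hv : nn vt <= 2 * nn be + 2 * nn (V m2 be).
  rewrite (@Wn_eq _ _ vt (fun x => be x + V m2 be x)); first exact: (Wn_D w1 bes V2s).
  by move=> x x01; rewrite beE.
have ha : nn al <= 2 * nn ut + 2 * nn (V m1 be).
  rewrite (@Wn_eq _ _ al (fun x => ut x - V m1 be x)); first exact: (Wn_B w1 us V1s).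
  exact: alE.
have h13 := ler_wpM2l C10 h3.
move: u2 v2 a2 b2 hu hv ha h1 h2 h3 h13.
move: (nn ut) (nn vt) (nn al) (nn be) (nn (V m1 be)) (nn (V m2 be)) => U V' A B X Y u2 v2 a2 b2 hu hv ha h1 h2 h3 h13.
have q1 := mulr_ge0 C10 a2; have q2 := mulr_ge0 C20 a2; have q3 := mulr_ge0 C30 a2; have q4 := mulr_ge0 C130 a2.
have r1 := mulr_ge0 C10 b2; have r2 := mulr_ge0 C20 b2; have r3 := mulr_ge0 C30 b2; have r4 := mulr_ge0 C130 b2.
have s1 := mulr_ge0 C10 u2; have s2 := mulr_ge0 C20 u2; have s3 := mulr_ge0 C30 u2; have s4 := mulr_ge0 C130 u2.
have t1 := mulr_ge0 C10 v2; have t2 := mulr_ge0 C20 v2; have t3 := mulr_ge0 C30 v2; have t4 := mulr_ge0 C130 v2.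
by clear -q1 q2 q3 q4 r1 r2 r3 r4 s1 s2 s3 s4 t1 t2 t3 t4 u2 v2 a2 b2 hu hv ha h1 h2 h3 h13;
  split; rewrite !mulrDl !mulrDr; lra.
Qed.

Lemma target_bound : exists2 C, 0 <= C & forall u v, sqi 0 1 u -> sqi 0 1 v ->
  nn (fun x => v x - V k1 u x - V k2 v x) <= C * (nn u + nn v).
Proof.
have [C1 C10 H1] := Wn_V 1 (@cTk R k1); have [C2 C20 H2] := Wn_V 1 (@cTk R k2).
exists (4 + 4 * C1 + 2 * C2); first by rewrite !addr_ge0 ?mulr_ge0.
move=> u v us vs; have w1 := @weight1 R.
have V1s := V_sqi (@cTk R k1) us; have V2s := V_sqi (@cTk R k2) vs.
have h1 := H1 _ u w1 us; have h2 := H2 _ v w1 vs.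
have h3 := Wn_B w1 vs V1s; have h4 := Wn_B w1 (sqiB vs V1s) V2s.
have u2 := Wn_ge0 w1 u; have v2 := Wn_ge0 w1 v.
have q1 := mulr_ge0 C10 v2; have q2 := mulr_ge0 C20 u2.
by move: u2 v2 q1 q2 h1 h2 h3 h4; clear -C10; gen_Wn => *; rewrite !mulrDl !mulrDr; lra.
Qed.

End estimates.

Section lyapunov.
Variable R : realType.

(** The choice of the constants: the rate del absorbs the couplings with u and
    alpha, B the source of beta, A1 the inflow Q y of u and the coupling of u
    with z, A2 the inflow of z.  Smallness of eps is asked by the last two
    hypotheses only: for the trace yt, and for the part of the inflow that is
    proportional to the state. *)
Lemma lyapunov_rate (del C2 Ca Cd Cf Cb Cw C5 Q H2 B A1 G A2 e2 Eu Ez Eb Ea Fu Fb Fa g y yt Phi : R) :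
  0 <= C2 -> 0 <= Ca -> 0 <= Cd -> 0 <= Cf -> 0 <= C5 -> 0 <= Q -> 0 <= H2 -> 0 <= e2 ->
  0 <= Eu -> 0 <= Ez -> 0 <= Eb -> 0 <= Ea -> 0 <= y -> 0 <= yt ->
  del = 2 + 2 * C2 + 2 * Ca -> B = 2 * Cf + 1 -> A1 = 2 * (C2 * Cd) + 1 + Q ->
  G = A1 * (H2 * C5) -> A2 = G + 1 ->
  Fu <= 2 * (C2 * (Eu + Cd * Ez)) -> Fb <= 2 * (Cf * Ea) + 2 * (Cb * e2) * yt ->
  Fa <= 2 * (Ca * Ea) + 2 * (Cb * e2) * yt ->
  g <= C5 * (e2 + e2 * Phi + Eb + Ea) -> Phi <= Cw * (Eu + Ez + Eb + Ea) ->
  2 * (Cb * e2) * (1 + B) <= 1 -> G * e2 * Cw <= 2^-1 ->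
  (- (del - 1) * Eu + Q * y + Fu) + A1 * (- Ez + H2 * g - y) +
    A2 * ((- Eb + Fb - yt) + B * (- (del - 1) * Ea + Fa)) <=
  G * e2 - 2^-1 * (Eu + Ez + Eb + Ea).
Proof.
move=> C20 Ca0 Cd0 Cf0 C50 Q0 H20 e20 Eu0 Ez0 Eb0 Ea0 y0 yt0 -> BE A1E GE A2E HFu HFb HFa Hg HP Hs HG.
have C2d0 : 0 <= C2 * Cd by exact: mulr_ge0.
have A10 : 0 <= A1 by rewrite A1E; lra.
have G0 : 0 <= G by rewrite GE !mulr_ge0.
have A20 : 0 <= A2 by rewrite A2E; lra.
have B0 : 0 <= B by rewrite BE; lra.
have AH0 : 0 <= A1 * H2 by exact: mulr_ge0.
have h1 : - (2 + 2 * C2 + 2 * Ca - 1) * Eu + Fu <= - Eu + 2 * (C2 * Cd) * Ez.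
  have := mulr_ge0 Ca0 Eu0; lra.
have h2 : Q * y + 2 * (C2 * Cd) * Ez + A1 * (- Ez + H2 * g - y) <= - Ez + A1 * H2 * g.
  rewrite A1E; have := mulr_ge0 C2d0 y0; have := mulr_ge0 Q0 Ez0; lra.
have h3 : A1 * H2 * g <= G * e2 + G * e2 * Phi + G * (Eb + Ea).
  have := ler_wpM2l AH0 Hg; rewrite GE; lra.
have h4 : G * e2 * Phi <= 2^-1 * (Eu + Ez + Eb + Ea).
  apply: (@le_trans _ _ (G * e2 * (Cw * (Eu + Ez + Eb + Ea)))).
    by rewrite ler_wpM2l// mulr_ge0.
  by rewrite mulrA ler_wpM2r// !addr_ge0.
(* Multiplied by A2 = G + 1, this dominates the term G (E_b + E_a) of h3. *)
have h5 : - Eb + Fb - yt + B * (- (2 + 2 * C2 + 2 * Ca - 1) * Ea + Fa) <= - Eb - Ea.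
  have q1 : B * (- (2 + 2 * C2 + 2 * Ca - 1) * Ea + Fa) <= B * (- Ea + 2 * (Cb * e2) * yt).
    by rewrite ler_wpM2l//; have := mulr_ge0 C20 Ea0; lra.
  have q2 := ler_wpM2r yt0 Hs.
  have q3 : 2 * (Cf * Ea) - B * Ea = - Ea by rewrite BE; ring.
  lra.
have h6 := ler_wpM2l A20 h5.
rewrite A2E in h6 *; lra.
Qed.

Lemma lyapunov_decay (del Q H2 B A1 A2 c D T : R) (Eu Ez Eb Ea Fu Fb Fa g y yt : R -> R) :
  0 <= A1 -> 0 <= A2 -> 0 <= B -> 0 < c -> 0 <= D -> 0 <= T ->
  cont0 Eu -> cont0 Ez -> cont0 Eb -> cont0 Ea ->
  tl2 Fu -> tl2 Fb -> tl2 Fa -> tl2 g -> tl2 y -> tl2 yt ->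
  (forall s t, 0 <= s -> s <= t -> Eu t - Eu s <= Int s t (fun r => - (del - 1) * Eu r + Q * y r ^+ 2 + Fu r ^+ 2)) ->
  (forall s t, 0 <= s -> s <= t -> Ez t - Ez s <= Int s t (fun r => - Ez r + H2 * g r ^+ 2 - y r ^+ 2)) ->
  (forall s t, 0 <= s -> s <= t -> Eb t - Eb s <= Int s t (fun r => - Eb r + Fb r ^+ 2 - yt r ^+ 2)) ->
  (forall s t, 0 <= s -> s <= t -> Ea t - Ea s <= Int s t (fun r => - (del - 1) * Ea r + Fa r ^+ 2)) ->
  let V t := Eu t + A1 * Ez t + A2 * (Eb t + B * Ea t) in
  (forall r, 0 <= r -> r <= T ->
    (- (del - 1) * Eu r + Q * y r ^+ 2 + Fu r ^+ 2) + A1 * (- Ez r + H2 * g r ^+ 2 - y r ^+ 2) +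
    A2 * ((- Eb r + Fb r ^+ 2 - yt r ^+ 2) + B * (- (del - 1) * Ea r + Fa r ^+ 2)) <= D - c * V r) ->
  V T <= expR (- c * T) * V 0 + D / c.
Proof.
move=> A10 A20 B0 c0 D0 T0 cu cz cb ca fu fb fa g2 y2 yt2 Hu Hz Hb Ha V HV.
have cV : cont0 V.
  apply: cont0D; first by apply: cont0D => //; exact: cont0Z.
  by apply: cont0Z; apply: cont0D => //; exact: cont0Z.
apply: gronwall => // s t s0 st tT.
have sq (f : R -> R) : tl2 f -> itg s t (fun r => f r ^+ 2) by move=> /(tl2_sqi s0 st)[].
have ci (f : R -> R) : cont0 f -> itg s t f by move=> ?; exact: cont0_itg.
have i1 : itg s t (fun r => - (del - 1) * Eu r + Q * y r ^+ 2 + Fu r ^+ 2).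
  by apply: itgD; [apply: itgD; apply: itgZ; [exact: ci|exact: sq]|exact: sq].
have i2 : itg s t (fun r => - Ez r + H2 * g r ^+ 2 - y r ^+ 2).
  by apply: itgB; [apply: itgD; [apply: itgN; exact: ci|apply: itgZ; exact: sq]|exact: sq].
have i3 : itg s t (fun r => - Eb r + Fb r ^+ 2 - yt r ^+ 2).
  by apply: itgB; [apply: itgD; [apply: itgN; exact: ci|exact: sq]|exact: sq].
have i4 : itg s t (fun r => - (del - 1) * Ea r + Fa r ^+ 2).
  by apply: itgD; [apply: itgZ; exact: ci|exact: sq].
have i12 := itgD i1 (itgZ A1 i2); have i34 := itgD i3 (itgZ B i4); have iS := itgD i12 (itgZ A2 i34).
apply: (@le_trans _ _ (Int s t (fun r => (- (del - 1) * Eu r + Q * y r ^+ 2 + Fu r ^+ 2) + A1 * (- Ez r + H2 * g r ^+ 2 - y r ^+ 2) +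
    A2 * ((- Eb r + Fb r ^+ 2 - yt r ^+ 2) + B * (- (del - 1) * Ea r + Fa r ^+ 2))))); last first.
  apply: Int_le => //.
    by apply: itgB; [exact: itg_cst|apply: itgZ; exact: ci].
  move=> r /andP[sr rt]; apply: HV; [exact: le_trans sr|exact: le_trans tT].
rewrite (IntD i12 (itgZ A2 i34)) (IntD i1 (itgZ A1 i2)) (IntZ A2 i34) (IntD i3 (itgZ B i4)) (IntZ B i4) (IntZ A1 i2).
have hu := Hu s t s0 st; have hz := ler_wpM2l A10 (Hz s t s0 st).
have hb := Hb s t s0 st; have ha := ler_wpM2l B0 (Ha s t s0 st).
have hab := ler_wpM2l A20 (lerD hb ha).
rewrite (_ : V t - V s = (Eu t - Eu s) + A1 * (Ez t - Ez s) + A2 * ((Eb t - Eb s) + B * (Ea t - Ea s))); last by rewrite /V; ring.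
by apply: lerD => //; apply: lerD.
Qed.

End lyapunov.

Section inflow.
Variables (R : realType) (P : plant R) (k1 k2 : C1T R).

Lemma sq5 (a b c d e : R) : (a + b + c + d + e) ^+ 2 <= 5 * (a ^+ 2 + b ^+ 2 + c ^+ 2 + d ^+ 2 + e ^+ 2).
Proof.
rewrite -subr_ge0.
have -> : 5 * (a ^+ 2 + b ^+ 2 + c ^+ 2 + d ^+ 2 + e ^+ 2) - (a + b + c + d + e) ^+ 2 =
  (a - b) ^+ 2 + (a - c) ^+ 2 + (a - d) ^+ 2 + (a - e) ^+ 2 + (b - c) ^+ 2 + (b - d) ^+ 2 + (b - e) ^+ 2 +
  (c - d) ^+ 2 + (c - e) ^+ 2 + (d - e) ^+ 2 by ring.
by rewrite !addr_ge0// sqr_ge0.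
Qed.

Lemma inflow_algebra (d I1 I2 I3 I4 K1 K2 n1 n2 p1 p2 p3 p4 e : R) :
  0 <= K1 -> 0 <= K2 -> 0 <= p1 -> 0 <= p2 -> 0 <= p3 -> 0 <= p4 -> 0 <= e -> d <= e ->
  I1 <= n1 * p1 -> I2 <= n2 * p2 -> I3 <= K1 * p3 -> I4 <= K2 * p4 ->
  n1 * p1 <= e * p1 -> n2 * p2 <= e * p2 ->
  5 * (d + I1 + I2 + I3 + I4) <= 5 * (1 + K1 + K2) * (e + e * (p1 + p2) + p3 + p4).
Proof.
move=> K10 K20 p10 p20 p30 p40 e0 de h1 h2 h3 h4 q1 q2; rewrite -mulrA ler_wpM2l//.
have r1 := mulr_ge0 e0 p10; have r2 := mulr_ge0 e0 p20.
have x1 : K1 * p3 <= K1 * (e + e * (p1 + p2) + p3 + p4) by rewrite ler_wpM2l//; lra.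
have x2 : K2 * p4 <= K2 * (e + e * (p1 + p2) + p3 + p4) by rewrite ler_wpM2l//; lra.
rewrite !mulrDl mul1r; lra.
Qed.

Lemma nnE (f : R -> R) : nn f = Int 0 1 (fun x => f x ^+ 2).
Proof. by apply: eq_Int => x _; rewrite mul1r. Qed.

Lemma ip_sq_le (f g : R -> R) : sqi 0 1 f -> sqi 0 1 g -> ip f g ^+ 2 <= nn f * nn g.
Proof. by move=> fs gs; rewrite !nnE; exact: cauchy_schwarz. Qed.

(** The inflow of z splits into the operator error, the errors on the kernels
    applied to the observer state, and the exact feedback applied to the
    observer error. *)
Lemma inflow_bound : exists2 C, 0 <= C & forall (eps : R) (k1h k2h : C1T R) (U : control_operator R) (u v uh vh : R -> R),
  sqi 0 1 u -> sqi 0 1 v -> sqi 0 1 uh -> sqi 0 1 vh ->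
  (forall x, 0 <= x <= 1 -> `|k1 1 x - k1h 1 x| <= eps) ->
  (forall x, 0 <= x <= 1 -> `|k2 1 x - k2h 1 x| <= eps) ->
  control_error P k1h k2h U uh vh <= eps ->
  (control P U uh vh - ip (k1 1) u - ip (k2 1) v) ^+ 2 <=
  C * (eps ^+ 2 + eps ^+ 2 * (nn uh + nn vh) + nn (fun x => u x - uh x) + nn (fun x => v x - vh x)).
Proof.
have w1 := @weight1 R.
have c1 := sqi_cont (cT_col1 (@cTk R k1)); have c2 := sqi_cont (cT_col1 (@cTk R k2)).
have K1 := Wn_ge0 w1 (k1 1); have K2 := Wn_ge0 w1 (k2 1).
exists (5 * (1 + nn (k1 1) + nn (k2 1))); first by rewrite mulr_ge0// !addr_ge0.
move=> eps k1h k2h U u v uh vh us vs uhs vhs k1e k2e ce.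
have c1h := sqi_cont (cT_col1 (@cTk R k1h)); have c2h := sqi_cont (cT_col1 (@cTk R k2h)).
set d := feedback k1h k2h uh vh - control P U uh vh.
have d2 : d ^+ 2 <= eps ^+ 2.
  have d1 : `|d| <= eps by exact: ce.
  by rewrite -[leLHS]real_normK ?num_real// ler_pXn2r ?nnegrE// (le_trans _ d1).
have s1 := sqiB c1 c1h; have s2 := sqiB c2 c2h.
have ut := sqiB us uhs; have vt := sqiB vs vhs.
have -> : control P U uh vh - ip (k1 1) u - ip (k2 1) v =
   - d - ip (fun x => k1 1 x - k1h 1 x) uh - ip (fun x => k2 1 x - k2h 1 x) vh
   - ip (k1 1) (fun x => u x - uh x) - ip (k2 1) (fun x => v x - vh x).
  rewrite (ipBl c1 c1h uhs) (ipBl c2 c2h vhs) (ipBr us uhs c1) (ipBr vs vhs c2) /d /feedback.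
  by gen_Int; ring.
have := sq5 (- d) (- ip (fun x => k1 1 x - k1h 1 x) uh) (- ip (fun x => k2 1 x - k2h 1 x) vh)
   (- ip (k1 1) (fun x => u x - uh x)) (- ip (k2 1) (fun x => v x - vh x)).
rewrite !sqrrN.
have h1 := ip_sq_le s1 uhs; have h2 := ip_sq_le s2 vhs.
have h3 := ip_sq_le c1 ut; have h4 := ip_sq_le c2 vt.
have q1 := ler_wpM2r (Wn_ge0 w1 uh) (nn_small k1e s1).
have q2 := ler_wpM2r (Wn_ge0 w1 vh) (nn_small k2e s2).
have p1 := Wn_ge0 w1 uh; have p2 := Wn_ge0 w1 vh.
have p3 := Wn_ge0 w1 (fun x => u x - uh x); have p4 := Wn_ge0 w1 (fun x => v x - vh x).
have e0 := sqr_ge0 eps.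
move/le_trans; apply.
exact: (inflow_algebra K1 K2 p1 p2 p3 p4 e0 d2 h1 h2 h3 h4 q1 q2).
Qed.

End inflow.

(** * The decay estimate *)

Section error_system.
Variables (R : realType).
Implicit Types (f g h : R -> R) (x t r : R) (w : R -> R -> R).

(** (I + V k)^-1, on functions, on curves and on continuous functions. *)
Lemma resolvent (k : R -> R -> R) : cT k -> exists J : (R -> R) -> R -> R,
  [/\ forall f, sqi 0 1 f -> forall x, 0 <= x <= 1 -> J f x + V k (J f) x = f x,
      forall w, cl2 w -> cl2 (fun t => J (w t)) &
      forall f, {within `[0, 1], continuous f} -> {within `[0, 1], continuous (J f)}].
Proof.
move=> kT; have [S [K K0 [SP SL]]] := V_inverse kT.
have Ss f : sqi 0 1 f -> sqi 0 1 (S f) by move=> /SP[cS _ _]; exact: sqi_cont.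
exists (fun f x => f x + S f x); split=> [f fs x x01|w wc|f cf].
- have [cS SE _] := SP f fs; have /andP[_ x1] := x01.
  have -> : V k (fun x => f x + S f x) x = V k f x + V k (S f) x.
    have -> : V k (fun x => f x + S f x) x = V k (fun x => f x - - S f x) x.
      by apply: eq_Int => r _; rewrite opprK.
    rewrite VB//; [|exact: sqi_itg|by apply: sqi_itg; apply: sqiN; exact: Ss].
    congr (_ + _); rewrite /V -IntN; first by apply: eq_Int => r _; rewrite mulrN opprK.
    by apply: V_itg => //; apply: sqi_itg; apply: sqiN; exact: Ss.
  by have := SE x x01; lra.
- by apply: cl2D => //; exact: cl2_volterra K0 Ss SL wc.
- by have [cS _ _] := SP f (sqi_cont cf); exact: withinD.
Qed.

Lemma closed_loop_error (P : plant R) (m1h m2h : C1T R) (u v uh vh : R -> R -> R) (Uh y yh : R -> R)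
    (lam_lo mu_lo : R) : admissible P lam_lo mu_lo ->
  cl2 u -> cl2 v -> cl2 uh -> cl2 vh -> tl2 Uh -> tl2 y -> tl2 yh ->
  weak_rightward (lam P) u (fun t x => sig P x * u t x + om P x * v t x) (fun t => q P * y t) ->
  weak_leftward (mu P) v (fun t x => th P x * u t x) Uh y ->
  weak_rightward (lam P) uh (fun t x => sig P x * uh t x + om P x * vh t x
     + m1h x 0 * mu P 0 * (y t - yh t)) (fun t => q P * y t) ->
  weak_leftward (mu P) vh (fun t x => th P x * uh t x + m2h x 0 * mu P 0 * (y t - yh t)) Uh yh ->
  let ut t x := u t x - uh t x in let vt t x := v t x - vh t x in let yt t := y t - yh t in
  weak_rightward (lam P) ut (fun t x => sig P x * ut t x + om P x * vt t x - m1h x 0 * mu P 0 * yt t) (fun=> 0) /\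
  weak_leftward (mu P) vt (fun t x => th P x * ut t x - m2h x 0 * mu P 0 * yt t) (fun=> 0) yt.
Proof.
move=> [csig com cth _ _] uc vc uhc vhc U2 y2 yh2 Wu Wv Wuh Wvh ut vt yt.
have yt2 : tl2 yt by exact: tl2B.
have qy2 : tl2 (fun t => q P * y t) by move=> t t0; apply: sqiZ; exact: y2.
have cm (k : C1T R) := withinM (cT_row0 (@cTk R k)) (@within_cst R 0 1 (mu P 0)).
have utc : cl2 ut by exact: cl2B. have vtc : cl2 vt by exact: cl2B.
have su w1 w2 : cl2 w1 -> cl2 w2 -> cl2 (fun t x => sig P x * w1 t x + om P x * w2 t x).
  by move=> c1 c2; apply: cl2D; exact: cl2_cM.
have sv w : cl2 w -> cl2 (fun t x => th P x * w t x) by exact: cl2_cM.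
have fuE : (fun t x => sig P x * ut t x + om P x * vt t x - m1h x 0 * mu P 0 * yt t) =
  (fun t x => (sig P x * u t x + om P x * v t x) - (sig P x * uh t x + om P x * vh t x
     + m1h x 0 * mu P 0 * (y t - yh t))).
  by apply/funext => t; apply/funext => x; rewrite /ut /vt /yt; ring.
have fvE : (fun t x => th P x * ut t x - m2h x 0 * mu P 0 * yt t) =
  (fun t x => (th P x * u t x) - (th P x * uh t x + m2h x 0 * mu P 0 * (y t - yh t))).
  by apply/funext => t; apply/funext => x; rewrite /ut /yt; ring.
split.
  have -> : (fun=> 0) = (fun t => q P * y t - q P * y t) by apply/funext => t; rewrite subrr.
  rewrite fuE; apply: rightwardB => //; [exact: cl2_src (su _ _ uc vc)|exact: src_add (su _ _ uhc vhc) (cm m1h) yt2|].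
  by rewrite -fuE; exact: src_sub (su _ _ utc vtc) (cm m1h) yt2.
have -> : (fun=> 0) = (fun t => Uh t - Uh t) by apply/funext => t; rewrite subrr.
rewrite fvE; apply: leftwardB => //; [exact: cl2_src (sv _ uc)|exact: src_add (sv _ uhc) (cm m2h) yt2|].
by rewrite -fvE; exact: src_sub (sv _ utc) (cm m2h) yt2.
Qed.

End error_system.

Lemma Wn0 (R : realType) (W : R -> R) : Wn W (fun=> 0) = 0.
Proof.
transitivity (Int 0 1 (fun=> 0 : R)); last by rewrite Int_cst// mul0r.
by apply: eq_Int => x _; rewrite expr0n mulr0.
Qed.

(** The energy inequalities are stated for sources with an injection term. *)
Lemma source_pad (R : realType) (f : R -> R -> R) : f = (fun t x => f t x + 0 * 0).
Proof. by apply/funext => t; apply/funext => x; rewrite mul0r addr0. Qed.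

Section source_energy.
Variables (R : realType) (a : C1I R) (lo : R).
Hypothesis lo0 : 0 < lo.
Hypothesis alo : forall x, @I01 R x -> lo <= a x.

Lemma rightward_energy (del kap : R) (ww w : R -> R -> R) (b y g : R -> R) :
  0 <= del -> weight (wR a del) kap -> cl2 ww -> cl2 w -> {within `[0, 1], continuous b} -> tl2 y -> tl2 g ->
  weak_rightward a ww (fun t x => w t x + b x * y t) g ->
  exists F, [/\ tl2 F,
    (forall r, 0 <= r -> F r ^+ 2 = 2 * Wn (wR a del) (w r) + 2 * Wn (wR a del) b * y r ^+ 2) &
    forall s t, 0 <= s -> s <= t -> Wn (wR a del) (ww t) - Wn (wR a del) (ww s) <=
      Int s t (fun r => - (del - 1) * Wn (wR a del) (ww r) + expR (del * Ht a) * g r ^+ 2 + F r ^+ 2)].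
Proof.
move=> del0 Ww wwc wc bc y2 g2 Hw.
have [F Fs FE] := src_source Ww wc bc y2.
exists F; split=> [t t0| |s t s0 st]; [exact: source_tl2 Fs t t0|by move=> r r0; rewrite FE|].
apply: le_trans (energy_right lo0 alo del0 ltr01 wwc Fs g2 Hw s0 st) _.
rewrite le_eqVlt; apply/orP; left; apply/eqP; apply: eq_Int => r _.
by rewrite invr1 mul1r.
Qed.

(** The weight parameter 2 leaves the decay rate 1 once one unit is spent on
    separating the source. *)
Lemma leftward_energy (kap : R) (ww w : R -> R -> R) (b y g yt : R -> R) :
  weight (wL a 2) kap -> cl2 ww -> cl2 w -> {within `[0, 1], continuous b} -> tl2 y -> tl2 g -> tl2 yt ->
  weak_leftward a ww (fun t x => w t x + b x * y t) g yt ->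
  exists F, [/\ tl2 F,
    (forall r, 0 <= r -> F r ^+ 2 = 2 * Wn (wL a 2) (w r) + 2 * Wn (wL a 2) b * y r ^+ 2) &
    forall s t, 0 <= s -> s <= t -> Wn (wL a 2) (ww t) - Wn (wL a 2) (ww s) <=
      Int s t (fun r => - Wn (wL a 2) (ww r) + expR (2 * Ht a) * g r ^+ 2 + F r ^+ 2 - yt r ^+ 2)].
Proof.
move=> Ww wwc wc bc y2 g2 yt2 Hw.
have [F Fs FE] := src_source Ww wc bc y2.
exists F; split=> [t t0| |s t s0 st]; [exact: source_tl2 Fs t t0|by move=> r r0; rewrite FE|].
apply: le_trans (energy_left lo0 alo (ler0n _ 2) ltr01 wwc Fs g2 yt2 Hw s0 st) _.
rewrite le_eqVlt; apply/orP; left; apply/eqP; apply: eq_Int => r _.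
by rewrite invr1 mul1r (_ : 2 - 1 = 1 :> R) ?mulN1r//; ring.
Qed.

End source_energy.

Lemma small_gain (R : realType) (e Cb B G Cw : R) : e * (1 + (2 * Cb * (1 + B) + 2 * (G * Cw))) <= 1 ->
  0 <= e * (2 * Cb * (1 + B)) -> 0 <= e * (2 * (G * Cw)) -> 0 <= e ->
  2 * (Cb * e) * (1 + B) <= 1 /\ G * e * Cw <= 2^-1.
Proof. by move=> h1 h2 h3 e0; split; lra. Qed.

Section decay_algebra.
Variable R : realType.
Implicit Types (lo hi C : R).

Lemma energy_equiv_algebra lo hi C (Ph D U Z B A EU EZ EB EA : R) : 0 < lo -> 0 <= hi -> 0 <= C ->
  Ph <= C * (U + Z + B + A) -> U + Z + B + A <= C * Ph -> D <= C * (B + A) ->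
  lo * U <= EU -> lo * Z <= EZ -> lo * B <= EB -> lo * A <= EA ->
  EU <= hi * U -> EZ <= hi * Z -> EB <= hi * B -> EA <= hi * A ->
  Ph <= C / lo * (EU + EZ + EB + EA) /\ EU + EZ + EB + EA <= hi * C * Ph /\ D <= C / lo * (EB + EA).
Proof.
move=> lo0 hi0 C0 h1 h2 h3 u1 z1 b1 a1 u2 z2 b2 a2.
have i0 : 0 <= C / lo by rewrite divr_ge0// ltW.
have e X : C / lo * (lo * X) = C * X by field; rewrite gt_eqF.
have k1 : lo * (U + Z + B + A) <= EU + EZ + EB + EA by rewrite !mulrDr; lra.
have k2 : lo * (B + A) <= EB + EA by rewrite !mulrDr; lra.
have k3 := ler_wpM2l i0 k1; have k4 := ler_wpM2l i0 k2; rewrite !e in k3 k4.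
have k5 := ler_wpM2l hi0 h2.
split; first exact: le_trans h1 k3.
split; last exact: le_trans h3 k4.
by rewrite -mulrA; apply: le_trans k5; rewrite !mulrDr; lra.
Qed.

Lemma lyapunov_equiv_algebra (A1 A2 B EU EZ EB EA : R) : 1 <= A1 -> 1 <= A2 -> 1 <= B ->
  0 <= EU -> 0 <= EZ -> 0 <= EB -> 0 <= EA ->
  let W := EU + EZ + EB + EA in let V := EU + A1 * EZ + A2 * (EB + B * EA) in
  W <= V /\ V <= (1 + A1 + A2 * (1 + B)) * W.
Proof.
move=> A11 A21 B1 u0 z0 b0 a0 W V'.
have A10 := le_trans ler01 A11; have A20 := le_trans ler01 A21; have B0 := le_trans ler01 B1.
have W0 : 0 <= W by rewrite /W !addr_ge0.
have h1 : EZ <= A1 * EZ by rewrite ler_peMl.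
have h2 : EA <= B * EA by rewrite ler_peMl.
have BA0 : 0 <= EB + B * EA by rewrite addr_ge0// mulr_ge0.
have h3 : EB + B * EA <= A2 * (EB + B * EA) by rewrite ler_peMl.
have k1 : A1 * EZ <= A1 * W by rewrite ler_wpM2l// /W; lra.
have k2 : EB + B * EA <= (1 + B) * W.
  have : EB <= W by rewrite /W; lra.
  have : B * EA <= B * W by rewrite ler_wpM2l// /W; lra.
  by rewrite mulrDl mul1r; lra.
have k3 := ler_wpM2l A20 k2.
split; first by rewrite /W /V'; lra.
have e : (1 + A1 + A2 * (1 + B)) * W = W + A1 * W + A2 * ((1 + B) * W) by ring.
rewrite e /V'; have : EU <= W by rewrite /W; lra.
by move: k1 k3 {e k2}; rewrite /W; lra.
Qed.

Lemma inflow_energy_algebra (C c e nu nv nuh nvh D1 D2 EB EA : R) : 0 <= C -> 0 <= c -> 0 <= e ->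
  0 <= nu -> 0 <= nv -> 0 <= nuh -> 0 <= nvh -> 0 <= EB -> 0 <= EA -> D1 + D2 <= c * (EB + EA) ->
  C * (e + e * (nuh + nvh) + D1 + D2) <= C * (1 + c) * (e + e * (nu + nv + nuh + nvh) + EB + EA).
Proof.
move=> C0 c0 e0 u0 v0 h0 k0 b0 a0 H; rewrite -mulrA ler_wpM2l//.
have q1 := mulr_ge0 e0 u0; have q2 := mulr_ge0 e0 v0.
have q3 := mulr_ge0 e0 h0; have q4 := mulr_ge0 e0 k0.
have q5 : c * (EB + EA) <= c * (e + e * (nu + nv + nuh + nvh) + EB + EA) by rewrite ler_wpM2l//; lra.
by rewrite mulrDl mul1r; lra.
Qed.

Lemma ratio_algebra lo hi (n E1 E2 : R) : 0 < lo -> 0 <= hi -> E1 <= hi * n -> lo * n <= E2 ->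
  E1 <= hi / lo * E2.
Proof.
move=> lo0 hi0 h1 h2; apply: le_trans h1 _; rewrite -mulrA ler_wpM2l//.
by rewrite ler_pdivlMl.
Qed.

Lemma ratio_algebra2 lo hi C (n n' E1 E2 : R) : 0 < lo -> 0 <= hi -> 0 <= C ->
  E1 <= hi * n' -> n' <= C * n -> lo * n <= E2 -> E1 <= hi * C / lo * E2.
Proof.
move=> lo0 hi0 C0 h1 h2 h3; apply: (ratio_algebra lo0 (mulr_ge0 hi0 C0)) h3.
by rewrite (le_trans h1)// -mulrA ler_wpM2l.
Qed.

Lemma half_rate (M V W D : R) : 0 < M -> V <= M * W -> D - 2^-1 * W <= D - (2 * M)^-1 * V.
Proof.
move=> M0 h; rewrite lerD2l lerN2 invfM -mulrA ler_wpM2l//.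
by rewrite ler_pdivrMl.
Qed.

Lemma plant_term C C' (F S N EU ZR EZ : R) : 0 <= C -> F = 2 * S + 2 * N * 0 ^+ 2 -> N = 0 ->
  S <= C * (EU + ZR) -> ZR <= C' * EZ -> F <= 2 * (C * (EU + C' * EZ)).
Proof.
move=> C0 -> -> h1 h2; rewrite mulr0 mul0r addr0 ler_wpM2l// (le_trans h1)// ler_wpM2l//.
by rewrite lerD2l.
Qed.

Lemma gain_term hi C C' (F S N n E e y : R) : 0 <= hi -> 0 <= y -> F = 2 * S + 2 * N * y ->
  S <= C * E -> N <= hi * n -> n <= C' * e -> F <= 2 * (C * E) + 2 * (hi * C' * e) * y.
Proof.
move=> hi0 y0 -> h1 h2 h3; apply: lerD; first by rewrite ler_wpM2l.
by rewrite ler_wpM2r// ler_wpM2l// (le_trans h2)// -mulrA ler_wpM2l.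
Qed.

Lemma decay_algebra (Cw M h ex PT P0 WT VT V0 W0 G e2 c : R) : 0 <= Cw -> 0 <= M -> 0 <= ex -> 0 <= P0 ->
  PT <= Cw * WT -> WT <= VT -> VT <= ex * V0 + G * e2 / c -> V0 <= M * W0 -> W0 <= h * P0 ->
  PT <= (1 + Cw * (M * h)) * ex * P0 + Cw * (G / c) * e2.
Proof.
move=> Cw0 M0 ex0 P00 h1 h2 h3 h4 h5.
have k1 := ler_wpM2l M0 h5; have k2 := ler_wpM2l ex0 (le_trans h4 k1).
have k3 : WT <= ex * (M * (h * P0)) + G * e2 / c by rewrite (le_trans h2)// (le_trans h3)// lerD2r.
have k4 := ler_wpM2l Cw0 k3.
apply: le_trans h1 _; apply: le_trans k4 _; rewrite -subr_ge0.
by rewrite (_ : _ - _ = ex * P0) ?mulr_ge0//; ring.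
Qed.

End decay_algebra.

Section decay.
Variables (R : realType) (P : plant R) (lam_lo mu_lo : R) (k1 k2 m1 m2 : C1T R).
Hypothesis Padm : admissible P lam_lo mu_lo.
Hypothesis Kc : control_kernels P k1 k2.
Hypothesis Ko : observer_kernels P m1 m2.

Let csig : {within `[0, 1], continuous (sig P)}. Proof. by case: Padm. Qed.
Let com : {within `[0, 1], continuous (om P)}. Proof. by case: Padm. Qed.
Let cth : {within `[0, 1], continuous (th P)}. Proof. by case: Padm. Qed.
Let l0 : 0 < lam_lo. Proof. by case: Padm => _ _ _ []. Qed.
Let lP : forall x, @I01 R x -> lam_lo <= lam P x. Proof. by case: Padm => _ _ _ []. Qed.
Let n0 : 0 < mu_lo. Proof. by case: Padm => _ _ _ _ []. Qed.
Let nP : forall x, @I01 R x -> mu_lo <= mu P x. Proof. by case: Padm => _ _ _ _ []. Qed.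

Lemma Phi2E (u v uh vh : R -> R -> R) t :
  Phi2 u v uh vh t = nn (u t) + nn (v t) + nn (uh t) + nn (vh t).
Proof. by rewrite /Phi2 /I01 !L2norm_sqi !nnE. Qed.

Lemma state_energy_algebra (C1 C2 C3 U V' Z H G D E B A : R) :
  0 <= C1 -> 0 <= C2 -> 0 <= C3 -> 0 <= U -> 0 <= V' -> 0 <= Z -> 0 <= H -> 0 <= G -> 0 <= B -> 0 <= A ->
  V' <= C1 * (U + Z) -> Z <= C2 * (U + V') -> D + E <= C3 * (A + B) -> A + B <= C3 * (D + E) ->
  H <= 2 * U + 2 * D -> G <= 2 * V' + 2 * E -> D <= 2 * U + 2 * H -> E <= 2 * V' + 2 * G ->
  let C := 3 + 3 * C1 + C2 + 2 * C3 in
  U + V' + H + G <= C * (U + Z + B + A) /\ U + Z + B + A <= C * (U + V' + H + G) /\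
  D + E <= C * (B + A).
Proof.
move=> C10 C20 C30 U0 V0 Z0 H0 G0 B0 A0 h1 h2 h3 h4 hu hv hut hvt C.
have p1 : C1 * (U + Z) <= C1 * (U + Z + B + A) by rewrite ler_wpM2l//; lra.
have p3 : C3 * (A + B) <= C3 * (U + Z + B + A) by rewrite ler_wpM2l//; lra.
have p2 : 0 <= C2 * (U + Z + B + A) by rewrite mulr_ge0// !addr_ge0.
have q1 : 0 <= C1 * (U + V' + H + G) by rewrite mulr_ge0// !addr_ge0.
have q2 : C2 * (U + V') <= C2 * (U + V' + H + G) by rewrite ler_wpM2l//; lra.
have q3 : C3 * (D + E) <= C3 * (2 * (U + V' + H + G)) by rewrite ler_wpM2l//; lra.
have r1 : 0 <= C1 * (B + A) by rewrite mulr_ge0// addr_ge0.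
have r2 : 0 <= C2 * (B + A) by rewrite mulr_ge0// addr_ge0.
have r3 : 0 <= C3 * (B + A) by rewrite mulr_ge0// addr_ge0.
have e X : C * X = 3 * X + 3 * (C1 * X) + C2 * X + 2 * (C3 * X) by rewrite /C; ring.
rewrite !e; clear e C; split; [lra|split; lra].
Qed.

Lemma state_energy_equiv : exists2 C, 0 <= C &
  forall (u v uh vh z al be : R -> R),
  sqi 0 1 u -> sqi 0 1 v -> sqi 0 1 uh -> sqi 0 1 vh -> sqi 0 1 al -> sqi 0 1 be ->
  (forall x, 0 <= x <= 1 -> z x = v x - V k1 u x - V k2 v x) ->
  (forall x, 0 <= x <= 1 -> be x + V m2 be x = v x - vh x) ->
  (forall x, 0 <= x <= 1 -> al x = (u x - uh x) - V m1 be x) ->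
  nn u + nn v + nn uh + nn vh <= C * (nn u + nn z + nn be + nn al) /\
  nn u + nn z + nn be + nn al <= C * (nn u + nn v + nn uh + nn vh) /\
  nn (fun x => u x - uh x) + nn (fun x => v x - vh x) <= C * (nn be + nn al).
Proof.
have [C1 C10 H1] := target_controls k1 k2 1; have [C2 C20 H2] := target_bound k1 k2.
have [C3 C30 H3] := error_equiv m1 m2.
have w1 := @weight1 R.
have Cnn : 0 <= 3 + 3 * C1 + C2 + 2 * C3 by rewrite !addr_ge0 ?mulr_ge0.
exists (3 + 3 * C1 + C2 + 2 * C3) => //.
move=> u v uh vh z al be us vs uhs vhs als bes zE beE alE.
have ut := sqiB us uhs; have vt := sqiB vs vhs.
have zs : sqi 0 1 z.
  apply: (@sqi_eq _ _ _ (fun x => v x - V k1 u x - V k2 v x)); first by move=> x x01; rewrite zE.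
  by apply: sqiB; [apply: sqiB => //|]; apply: V_sqi => //; exact: cTk.
have h1 := H1 _ u v z w1 us vs zs zE; have h2 := H2 u v us vs.
have [h3 h4] := H3 _ _ al be ut vt als bes beE alE.
rewrite -(@Wn_eq _ _ z) in h2; last exact: zE.
have hu : nn uh <= 2 * nn u + 2 * nn (fun x => u x - uh x).
  rewrite (@Wn_eq _ _ uh (fun x => u x - (u x - uh x))); first exact: (Wn_B w1 us ut).
  by move=> x _; ring.
have hv : nn vh <= 2 * nn v + 2 * nn (fun x => v x - vh x).
  rewrite (@Wn_eq _ _ vh (fun x => v x - (v x - vh x))); first exact: (Wn_B w1 vs vt).
  by move=> x _; ring.
have hut := Wn_B w1 us uhs; have hvt := Wn_B w1 vs vhs.
have pu := Wn_ge0 w1 u; have pv := Wn_ge0 w1 v; have pz := Wn_ge0 w1 z.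
have pa' := Wn_ge0 w1 al; have pb := Wn_ge0 w1 be; have puh := Wn_ge0 w1 uh; have pvh := Wn_ge0 w1 vh.
exact: (state_energy_algebra C10 C20 C30 pu pv pz puh pvh pb pa' h1 h2 h3 h4 hu hv hut hvt).
Qed.

Lemma energy_weights : exists kap lo : R, 0 < lo /\ forall del, 0 <= del ->
  weight (wR (lam P) del) kap /\ exists hi, [/\ 0 <= hi,
   (exists kapL, weight (wL (mu P) 2) kapL),
   (forall f, sqi 0 1 f -> lo * nn f <= Wn (wR (lam P) del) f /\ Wn (wR (lam P) del) f <= hi * nn f) &
   (forall f, sqi 0 1 f -> lo * nn f <= Wn (wL (mu P) 2) f /\ Wn (wL (mu P) 2) f <= hi * nn f)].
Proof.
have [kap [lo1 [lo10 H1]]] := weights_comparable l0 lP.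
have [kap2 [lo2 [lo20 H2]]] := weights_comparable n0 nP.
exists kap, (Num.min lo1 lo2); split=> [|del del0]; first by rewrite lt_min lo10.
have [wRd [_ [hi1 [hi10 hR1 _]]]] := H1 del del0.
have [_ [[kapL wLd] [hi2 [hi20 _ hL2]]]] := H2 2 (ler0n _ 2).
split=> //; exists (Num.max hi1 hi2); split=> [|||].
- by rewrite le_max hi10.
- by exists kapL.
- move=> f fs; apply: (Wn_near1 wRd) => // x /hR1/andP[h1 h2].
  by rewrite ge_min h1/= le_max h2.
- move=> f fs; apply: (Wn_near1 wLd) => // x /hL2/andP[h1 h2].
  by rewrite ge_min h1 orbT/= le_max h2 orbT.
Qed.

Definition decay_estimate (eps c K D : R) (u v uh vh : R -> R -> R) (T : R) : Prop :=
  Phi2 u v uh vh T <= K * expR (- c * T) * Phi2 u v uh vh 0 + D * eps ^+ 2.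

(** The order of the choices matters: first del, from constants that depend on
    kap only, then the weights and hi, which depend on del, then B, A1, G, A2
    and finally the bound on eps. *)
Lemma decay : exists eps0 c K D : R, [/\ 0 < eps0, 0 < c, 1 <= K & 0 <= D] /\
  forall (eps : R) (k1h k2h m1h m2h : C1T R) (U : control_operator R) (u v uh vh : R -> R -> R) (T : R),
  0 < eps -> eps <= eps0 -> 0 <= T ->
  (forall x, 0 <= x <= 1 -> `|k1 1 x - k1h 1 x| <= eps) ->
  (forall x, 0 <= x <= 1 -> `|k2 1 x - k2h 1 x| <= eps) ->
  (forall x, 0 <= x <= 1 -> `|m1 x 0 - m1h x 0| <= eps) ->
  (forall x, 0 <= x <= 1 -> `|m2 x 0 - m2h x 0| <= eps) ->
  closed_loop P m1h m2h U u v uh vh ->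
  (forall t, 0 <= t -> t <= T -> control_error P k1h k2h U (uh t) (vh t) <= eps) ->
  decay_estimate eps c K D u v uh vh T.
Proof.
have [kap [lo [lo0 HW]]] := energy_weights.
have [C2 C20 HC2] := plant_source_bound k1 k2 Padm kap.
have [Ca Ca0 HCa] := error_source_bound m1 m2 Padm kap.
have [C1f C1f0 HCf] := error_source_bound m1 m2 Padm 1.
pose del := 2 + 2 * C2 + 2 * Ca.
have del0 : 0 <= del by rewrite !addr_ge0// mulr_ge0.
have [wRd [hi [hi0 [kapL wLd] nR nL]]] := HW del del0.
have [Cg Cg0 HCg] := gain_error_bound P m1 m2.
have [C5' C5'0 HC5] := inflow_bound P k1 k2.
have [Ce Ce0 HCe] := state_energy_equiv.
have w1 := @weight1 R.
pose Q := expR (del * Ht (lam P)) * q P ^+ 2.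
have Q0 : 0 <= Q by rewrite mulr_ge0 ?expR_ge0 ?sqr_ge0.
pose H2 := expR (2 * Ht (mu P)); have H20 : 0 <= H2 := expR_ge0 _.
pose Cd := hi / lo; have Cd0 : 0 <= Cd by rewrite divr_ge0 ?(ltW lo0).
pose Cf := hi * C1f / lo; have Cf0 : 0 <= Cf by rewrite divr_ge0 ?(ltW lo0)// mulr_ge0.
pose Cb := hi * Cg; have Cb0 : 0 <= Cb by rewrite mulr_ge0.
pose C5 := C5' * (1 + Ce / lo); have C50 : 0 <= C5 by rewrite mulr_ge0// addr_ge0// divr_ge0// ltW.
pose Cw := Ce / lo; have Cw0 : 0 <= Cw by rewrite divr_ge0// ltW.
pose B := 2 * Cf + 1; have B1 : 1 <= B by rewrite lerDr mulr_ge0.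
pose A1 := 2 * (C2 * Cd) + 1 + Q.
have A11 : 1 <= A1.
  by rewrite /A1 -addrA [1 + Q]addrC addrA lerDr addr_ge0// mulr_ge0// mulr_ge0.
have B0 := le_trans ler01 B1; have A10 := le_trans ler01 A11.
pose G := A1 * (H2 * C5); have G0 : 0 <= G := mulr_ge0 A10 (mulr_ge0 H20 C50).
pose A2 := G + 1; have A21 : 1 <= A2 by rewrite /A2 lerDr.
have A20 := le_trans ler01 A21.
pose X := 2 * Cb * (1 + B) + 2 * (G * Cw).
have two0 : 0 <= 2 :> R by [].
have X10 : 0 <= 2 * Cb * (1 + B) := mulr_ge0 (mulr_ge0 two0 Cb0) (addr_ge0 ler01 B0).
have X20 : 0 <= 2 * (G * Cw) := mulr_ge0 two0 (mulr_ge0 G0 Cw0).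
have X0 : 0 <= X := addr_ge0 X10 X20.
have X1 : 0 < 1 + X := ltr_wpDr X0 ltr01.
pose M := 1 + A1 + A2 * (1 + B).
have M0 : 0 < M := ltr_wpDr (mulr_ge0 A20 (addr_ge0 ler01 B0)) (ltr_wpDr A10 ltr01).
pose c := (2 * M)^-1; have c0 : 0 < c by rewrite invr_gt0 mulr_gt0.
have hC0 : 0 <= M * (hi * Ce) := mulr_ge0 (ltW M0) (mulr_ge0 hi0 Ce0).
exists (1 + X)^-1, c, (1 + Cw * (M * (hi * Ce))), (Cw * (G / c)).
split.
  split; [by rewrite invr_gt0|by []| |].
    by rewrite lerDl; exact: mulr_ge0 Cw0 hC0.
  exact: (mulr_ge0 Cw0 (divr_ge0 G0 (ltW c0))).
move=> eps k1h k2h m1h m2h U u v uh vh T eps0 epsle T0 k1e k2e m1e m2e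
  [[uC vC uhC vhC] [y [yh [[yL yhL UL] [Wu Wv Wuh Wvh]]]]] cerr.
have eps0' := ltW eps0; have e20 : 0 <= eps ^+ 2 by exact: sqr_ge0.
have [Hs HG] : 2 * (Cb * eps ^+ 2) * (1 + B) <= 1 /\ G * eps ^+ 2 * Cw <= 2^-1.
  have eX : eps ^+ 2 * (1 + X) <= 1.
    have h1 : eps * (1 + X) <= 1 by rewrite -ler_pdivlMr ?div1r.
    have h2 : eps <= 1 by rewrite (le_trans epsle)// invf_le1// lerDl.
    by rewrite expr2 -mulrA (le_trans _ h2)// ler_piMr.
  have h3 := mulr_ge0 e20 X10; have h4 := mulr_ge0 e20 X20.
  exact: (small_gain eX h3 h4 e20).
have y2 : tl2 y by move=> t t0; exact: (L2_sqi 0 t y).1 (yL t t0).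
have yh2 : tl2 yh by move=> t t0; exact: (L2_sqi 0 t yh).1 (yhL t t0).
have U2 : tl2 (fun t => control P U (uh t) (vh t)) by move=> t t0; exact: (L2_sqi 0 t _).1 (UL t t0).
have uc := CL2_cl2 uC; have vc := CL2_cl2 vC; have uhc := CL2_cl2 uhC; have vhc := CL2_cl2 vhC.
have [Wut Wvt] := closed_loop_error Padm uc vc uhc vhc U2 y2 yh2 Wu Wv Wuh Wvh.
have [J [JE Jcl Jc]] := resolvent (@cTk R m2).
pose ut t x := u t x - uh t x; pose vt t x := v t x - vh t x; pose yt t := y t - yh t.
have utc : cl2 ut by exact: cl2B. have vtc : cl2 vt by exact: cl2B. have yt2 : tl2 yt by exact: tl2B.
pose be t := J (vt t); have bec : cl2 be by exact: Jcl.
pose al t x := ut t x - V m1 (be t) x.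
have alc : cl2 al by apply: cl2B => //; apply: cl2_V => //; exact: cTk.
have thalc : cl2 (fun t x => th P x * al t x) by exact: cl2_cM.
pose fb t := J (fun x => th P x * al t x); have fbc : cl2 fb by exact: (Jcl _ thalc).
pose d1 x := m1 x 0 - m1h x 0; pose d2 x := m2 x 0 - m2h x 0.
have cd (k k' : C1T R) := withinB (cT_row0 (@cTk R k)) (cT_row0 (@cTk R k')).
have cd1 : {within `[0, 1], continuous d1} := cd m1 m1h.
have cd2 : {within `[0, 1], continuous (fun x => mu P 0 * d2 x)}.
  by apply: withinM; [exact: within_cst|exact: cd].
pose b2 := J (fun x => mu P 0 * d2 x).
have b2c : {within `[0, 1], continuous b2} by exact: Jc.
have beE t x : 0 <= t -> 0 <= x <= 1 -> be t x + V m2 (be t) x = vt t x.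
  by move=> t0; apply: JE; exact: cl2_sqi.
have alE t x : 0 <= t -> 0 <= x <= 1 -> al t x = ut t x - V m1 (be t) x by [].
have fbE t x : 0 <= t -> 0 <= x <= 1 -> fb t x + V m2 (fb t) x = th P x * al t x.
  by move=> t0; apply: JE; exact: (cl2_sqi thalc t0).
have b2E x : 0 <= x <= 1 -> b2 x + V m2 b2 x = mu P 0 * (m2 x 0 - m2h x 0).
  by apply: JE; exact: sqi_cont cd2.
have Wbe := beta_weak Padm Ko utc vtc alc bec fbc b2c yt2 beE alE fbE b2E Wvt.
have Wal := alpha_weak Padm Ko utc vtc alc bec fbc b2c yt2 beE alE Wut Wbe.
pose z := target k1 k2 u v; have zc : cl2 z by exact: target_cl2.
pose g := target_inflow k1 k2 u v (fun t => control P U (uh t) (vh t)).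
have g2 : tl2 g by exact: target_inflow_tl2.
have Wz := target_weak Padm Kc uc vc U2 y2 Wv Wu.
have c00 : {within `[0, 1], continuous (fun _ : R => 0 : R)}.
  exact: within_cst.
have zz2 : tl2 (fun=> 0 : R) by move=> t t0; exact: sqi_cont (@within_cst R 0 t 0).
have z0c : cl2 (fun _ _ => 0 : R) by apply: cl2_cst; exact: sqi_cont.
have qy2 : tl2 (fun t => q P * y t) by move=> t t0; apply: sqiZ; exact: y2.
have suc : cl2 (fun t x => sig P x * u t x + om P x * v t x) by apply: cl2D; exact: cl2_cM.
have sac : cl2 (fun t x => sig P x * al t x - V m1 (fb t) x).
  by apply: cl2B; [exact: cl2_cM|apply: cl2_V => //; exact: cTk].
have bbc : {within `[0, 1], continuous (fun x : R => mu P 0 * (m1 x 0 - m1h x 0) - V m1 b2 x)}.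
  apply: withinB; last by apply: V_cont; [exact: cTk|exact: sqi_cont].
  by apply: withinM; [exact: within_cst|exact: cd].
rewrite (source_pad (fun t x => sig P x * u t x + om P x * v t x)) in Wu.
rewrite (source_pad (fun _ _ => 0)) in Wz.
have [Fu [Fu2 FuE Iu]] := rightward_energy l0 lP del0 wRd uc suc c00 zz2 qy2 Wu.
have [Fz [Fz2 FzE Iz]] := leftward_energy n0 nP wLd zc z0c c00 zz2 g2 y2 Wz.
have [Fb [Fb2 FbE Ib]] := leftward_energy n0 nP wLd bec fbc b2c yt2 zz2 yt2 Wbe.
have [Fa [Fa2 FaE Ia]] := rightward_energy l0 lP del0 wRd alc sac bbc yt2 zz2 Wal.
clear Wu Wv Wuh Wvh Wut Wvt Wbe Wal Wz.
have sqs (w : R -> R -> R) (t : R) : cl2 w -> 0 <= t -> sqi 0 1 (w t) by move=> wc; exact: cl2_sqi.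
pose W t := Wn (wR (lam P) del) (u t) + Wn (wL (mu P) 2) (z t) + Wn (wL (mu P) 2) (be t) + Wn (wR (lam P) del) (al t).
pose VV t := Wn (wR (lam P) del) (u t) + A1 * Wn (wL (mu P) 2) (z t) +
  A2 * (Wn (wL (mu P) 2) (be t) + B * Wn (wR (lam P) del) (al t)).
have pos t : [/\ 0 <= Wn (wR (lam P) del) (u t), 0 <= Wn (wL (mu P) 2) (z t),
    0 <= Wn (wL (mu P) 2) (be t) & 0 <= Wn (wR (lam P) del) (al t)].
  by split; [exact: Wn_ge0 wRd _|exact: Wn_ge0 wLd _|exact: Wn_ge0 wLd _|exact: Wn_ge0 wRd _].
have equiv t : 0 <= t -> Phi2 u v uh vh t <= Cw * W t /\ W t <= hi * Ce * Phi2 u v uh vh t /\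
    nn (ut t) + nn (vt t) <= Cw * (Wn (wL (mu P) 2) (be t) + Wn (wR (lam P) del) (al t)).
  move=> t0; have us := sqs _ _ uc t0; have zs := sqs _ _ zc t0; have bs := sqs _ _ bec t0; have as_ := sqs _ _ alc t0.
  have [e1 [e2 e3]] := HCe (u t) (v t) (uh t) (vh t) (z t) (al t) (be t) us (sqs _ _ vc t0)
    (sqs _ _ uhc t0) (sqs _ _ vhc t0) as_ bs (fun x _ => erefl) (fun x => beE t x t0) (fun x _ => erefl).
  have [u1 u2] := nR _ us; have [z1 z2] := nL _ zs; have [b1 b2'] := nL _ bs; have [a1 a2] := nR _ as_.
  rewrite Phi2E; exact: (energy_equiv_algebra lo0 hi0 Ce0 e1 e2 e3 u1 z1 b1 a1 u2 z2 b2' a2).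
have VW t : W t <= VV t /\ VV t <= M * W t.
  have [p1 p2 p3 p4] := pos t; exact: (lyapunov_equiv_algebra A11 A21 B1 p1 p2 p3 p4).
have key : VV T <= expR (- c * T) * VV 0 + G * eps ^+ 2 / c.
  apply: (@lyapunov_decay R del Q H2 B A1 A2 c (G * eps ^+ 2) T
    (fun t => Wn (wR (lam P) del) (u t)) (fun t => Wn (wL (mu P) 2) (z t))
    (fun t => Wn (wL (mu P) 2) (be t)) (fun t => Wn (wR (lam P) del) (al t)) Fu Fb Fa g y yt) => //.
  - exact: mulr_ge0.
  - exact: Wn_cont0 wRd uc.
  - exact: Wn_cont0 wLd zc.
  - exact: Wn_cont0 wLd bec.
  - exact: Wn_cont0 wRd alc.
  - move=> s t s0 st; apply: le_trans (Iu s t s0 st) _.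
    by rewrite le_eqVlt; apply/orP; left; apply/eqP; apply: eq_Int => r _; rewrite /Q exprMn mulrA.
  - move=> s t s0 st; apply: le_trans (Iz s t s0 st) _.
    rewrite le_eqVlt; apply/orP; left; apply/eqP; apply: eq_Int => r /andP[sr _].
    by rewrite FzE ?(le_trans s0)// !Wn0 mulr0 mul0r !addr0.
  - move=> s t s0 st; apply: le_trans (Ib s t s0 st) _.
    by rewrite le_eqVlt; apply/orP; left; apply/eqP; apply: eq_Int => r _; rewrite expr0n mulr0 addr0.
  - move=> s t s0 st; apply: le_trans (Ia s t s0 st) _.
    by rewrite le_eqVlt; apply/orP; left; apply/eqP; apply: eq_Int => r _; rewrite expr0n mulr0 addr0.
  move=> r r0 rT; have [p1 p2 p3 p4] := pos r.
  have us := sqs _ _ uc r0; have zs := sqs _ _ zc r0; have bs := sqs _ _ bec r0; have as_ := sqs _ _ alc r0.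
  have vs := sqs _ _ vc r0; have fbs := sqs _ _ fbc r0.
  have [eq1 [_ eq3]] := equiv r r0; have [_ VM] := VW r.
  have [f1 _] := HCf _ (al r) (fb r) w1 as_ fbs (fun x => fbE r x r0).
  have [_ f2] := HCa _ (al r) (fb r) wRd as_ fbs (fun x => fbE r x r0).
  have [g1 g2'] := HCg eps d1 d2 b2 (sqi_cont cd1) (sqi_cont (cd m2 m2h)) (sqi_cont b2c) m1e m2e b2E.
  have su := HC2 _ (u r) (v r) (z r) wRd us vs zs (fun x _ => erefl).
  have [_ zR] := nR _ zs; have [zL _] := nL _ zs; have [_ fL] := nL _ fbs; have [aR _] := nR _ as_.
  have [_ bL] := nL _ (sqi_cont b2c); have [_ bR] := nR _ (sqi_cont bbc).
  have gr : g r ^+ 2 <= C5 * (eps ^+ 2 + eps ^+ 2 * Phi2 u v uh vh r + Wn (wL (mu P) 2) (be r) + Wn (wR (lam P) del) (al r)).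
    have := HC5 eps k1h k2h U (u r) (v r) (uh r) (vh r) us vs (sqs _ _ uhc r0) (sqs _ _ vhc r0) k1e k2e (cerr r r0 rT).
    move/le_trans; apply; rewrite Phi2E.
    exact: (inflow_energy_algebra C5'0 (divr_ge0 Ce0 (ltW lo0)) e20 (Wn_ge0 w1 (u r)) (Wn_ge0 w1 (v r))
      (Wn_ge0 w1 (uh r)) (Wn_ge0 w1 (vh r)) p3 p4 eq3).
  have hFu : Fu r ^+ 2 <= 2 * (C2 * (Wn (wR (lam P) del) (u r) + Cd * Wn (wL (mu P) 2) (z r))).
    exact: (plant_term C20 (FuE r r0) (Wn0 _) su (ratio_algebra lo0 hi0 zR zL)).
  have hFb : Fb r ^+ 2 <= 2 * (Cf * Wn (wR (lam P) del) (al r)) + 2 * (Cb * eps ^+ 2) * yt r ^+ 2.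
    exact: (gain_term hi0 (sqr_ge0 _) (FbE r r0) (ratio_algebra2 lo0 hi0 C1f0 fL f1 aR) bL g1).
  have hFa : Fa r ^+ 2 <= 2 * (Ca * Wn (wR (lam P) del) (al r)) + 2 * (Cb * eps ^+ 2) * yt r ^+ 2.
    exact: (gain_term hi0 (sqr_ge0 _) (FaE r r0) f2 bR g2').
  apply: (@le_trans _ _ (G * eps ^+ 2 - 2^-1 * W r)); last first.
    exact: (half_rate (G * eps ^+ 2) M0 VM).
  exact: (lyapunov_rate C20 Ca0 Cd0 Cf0 C50 Q0 H20 e20 p1 p2 p3 p4 (sqr_ge0 (y r)) (sqr_ge0 (yt r))
    erefl erefl erefl erefl erefl hFu hFb hFa gr eq1 Hs HG).
have [eT _] := equiv T T0; have [_ [e0 _]] := equiv 0 (lexx 0).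
have [WV _] := VW T; have [_ V0] := VW 0.
have P0 : 0 <= Phi2 u v uh vh 0.
  by rewrite Phi2E !addr_ge0//; exact: (Wn_ge0 w1).
rewrite /decay_estimate.
exact: (decay_algebra Cw0 (ltW M0) (expR_ge0 _) P0 eT WV key V0 e0).
Qed.

End decay.

(** * The closed loop stays in range *)

Section conclusion.
Variable R : realType.

(** A strict bound that is available as long as the weak bound holds propagates
    to all times, by continuity. *)
Lemma stays_below (f : R -> R) (r : R) : cont0 f -> f 0 <= r ->
  (forall T, 0 <= T -> (forall t, 0 <= t -> t <= T -> f t <= r) -> f T < r) ->
  forall t, 0 <= t -> f t <= r.
Proof.
move=> cf f0 H T T0.
pose S := [set s | 0 <= s <= T /\ forall t, 0 <= t -> t <= s -> f t <= r].
have S0 : S 0.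
  split; first by rewrite lexx.
  by move=> t t0 t0'; rewrite (_ : t = 0)//; apply/eqP; rewrite eq_le t0 t0'.
have hS : has_sup S by split; [exists 0|exists T => s [/andP[]]].
set m := sup S.
have m0 : 0 <= m by exact: (sup_upper_bound hS).
have mT : m <= T by apply: ge_sup; [exists 0|move=> s [/andP[]]].
have below t : 0 <= t -> t < m -> f t <= r.
  move=> t0 tm; have [|s [_ sS] ts] := @sup_adherent _ S (m - t) _ hS; first by rewrite subr_gt0.
  by apply: sS => //; apply: ltW; move: ts; rewrite opprB addrC subrK.
have fm : f m <= r.
  rewrite leNgt; apply/negP => rf.
  have [d d0 dP] := cf m m0 (f m - r) (ltac:(by rewrite subr_gt0)).
  have [m00|mpos] := leP m 0.
    by move: rf; rewrite (_ : m = 0) ?ltNge ?f0//; apply/eqP; rewrite eq_le m00.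
  pose t := Num.max 0 (m - d / 2).
  have t0 : 0 <= t by rewrite le_max lexx.
  have tm : t < m by rewrite gt_max mpos ltrBlDr ltrDl divr_gt0.
  have td : `|t - m| < d.
    rewrite ltr0_norm ?subr_lt0// opprB ltrBlDr -ltrBlDl /t lt_max; apply/orP; right.
    by rewrite ltrD2l ltrN2 ltr_pdivrMr// ltr_pMr// ltr1n.
  have := dP t t0 td; have := below t t0 tm; rewrite ltr_norml => h1 /andP[h2 _].
  by move: h1 h2; lra.
have Sm : S m.
  split=> [|t t0]; first by rewrite m0.
  by rewrite le_eqVlt => /predU1P[->//|]; exact: below.
have {}H := H m m0 Sm.2.
have [d d0 dP] := cf m m0 (r - f m) (ltac:(by rewrite subr_gt0)).
have [Tm|mltT] := leP T m; first exact: Sm.2.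
exfalso; pose s := Num.min T (m + d / 2).
have ms : m < s by rewrite lt_min mltT ltrDl divr_gt0.
have : S s.
  split=> [|t t0 ts]; first by rewrite (le_trans m0 (ltW ms)) ge_min lexx.
  have [tm|mt] := leP t m; first exact: Sm.2.
  have td : `|t - m| < d.
    rewrite gtr0_norm ?subr_gt0// ltrBlDl (le_lt_trans ts)// gt_min; apply/orP; right.
    by rewrite ltrD2l ltr_pdivrMr// ltr_pMr// ltr1n.
  by have := dP t t0 td; rewrite ltr_norml => /andP[_]; rewrite ltrD2r => /ltW.
by move=> /(sup_upper_bound hS); rewrite leNgt ms.
Qed.

Lemma supnorm2_le (k k' : C1T R) (x xi : R) : @triangle R (x, xi) ->
  `|k x xi - k' x xi| <= supnorm2 (fun x xi => k x xi - k' x xi).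
Proof.
move=> t; have [C C0 CP] := kb_bounded (@cTk R k); have [D D0 DP] := kb_bounded (@cTk R k').
apply: sup_upper_bound; last by exists (x, xi).
split; first by exists `|k x xi - k' x xi|; exists (x, xi).
exists (C + D) => _ [[a b] [/= b0 [ba a1]] <-].
by rewrite (le_trans (ler_normB _ _))// lerD// -kb_id.
Qed.

(** The accuracy at the zero observer state suffices to extract the kernel
    errors, which do not depend on the state. *)
Lemma zero_sample (B : bounds R) : bounds_pos B -> state_sample B (fun=> 0) (fun=> 0).
Proof.
move=> [_ _ [_ _ uh0 vh0]].
have s0 : supnorm (fun _ : R => 0 : R) = 0.
  rewrite /supnorm (_ : [set _ | _ in _] = [set 0]) ?sup1//.
  apply/seteqP; split=> [_ [x _ <-]|_ ->]; first by rewrite /= normr0.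
  by exists 0; [rewrite /I01/= in_itv/= lexx ler01|rewrite normr0].
have l0 : lip01 (fun _ : R => 0 : R).
  rewrite /lip01 /lipschitz_on; near=> M; move=> [x y] _ /=.
  by rewrite subrr normr0 mulr_ge0.
split=> //; by rewrite s0 ltW.
Unshelve. all: by end_near. Qed.

Section accuracy.
Variables (B : bounds R) (P : plant R) (k1 k2 m1 m2 : C1T R) (kap : R -> R -> R)
  (k1h k2h m1h m2h : C1T R) (kaph : R -> R -> R) (U : control_operator R) (eps : R).
Hypothesis Bpos : bounds_pos B.
Hypothesis acc : accuracy B P k1 k2 m1 m2 kap k1h k2h m1h m2h kaph U eps.

Lemma accuracy_gains x : 0 <= x <= 1 -> `|m1 x 0 - m1h x 0| <= eps /\ `|m2 x 0 - m2h x 0| <= eps.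
Proof.
move=> /andP[x0 x1]; have [a1 a2 _] := acc.
have t : @triangle R (x, 0) by split; rewrite /=.
by split; [exact: le_trans (supnorm2_le m1 m1h t) (ltW a1)|exact: le_trans (supnorm2_le m2 m2h t) (ltW a2)].
Qed.

Lemma accuracy_kernels x : 0 <= x <= 1 -> `|k1 1 x - k1h 1 x| <= eps /\ `|k2 1 x - k2h 1 x| <= eps.
Proof.
move=> /andP[x0 x1]; have [_ _ a] := acc.
have t : @triangle R (1, x) by split.
have := a _ _ _ _ t (zero_sample Bpos).
have ce : 0 <= control_error P k1h k2h U (fun=> 0) (fun=> 0) by exact: normr_ge0.
move=> /ltW; rewrite /kernel_error -!addrA => h.
split; apply: le_trans h; first by rewrite lerDl !addr_ge0.
by rewrite -[leLHS]add0r lerD// lerDl !addr_ge0.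
Qed.

End accuracy.

Lemma Phi2_cont0 (u v uh vh : R -> R -> R) : CL2 u -> CL2 v -> CL2 uh -> CL2 vh ->
  cont0 (Phi2 u v uh vh).
Proof.
move=> uC vC uhC vhC.
have c (w : R -> R -> R) : CL2 w -> cont0 (fun t => nn (w t)).
  by move=> /CL2_cl2; exact: Wn_cont0 (@weight1 R).
have -> : Phi2 u v uh vh = (fun t => nn (u t) + nn (v t) + nn (uh t) + nn (vh t)).
  by apply/funext => t; exact: Phi2E.
by apply: cont0D; [apply: cont0D; [apply: cont0D|]|]; exact: c.
Qed.

End conclusion.

Theorem theorem4 (R : realType) (P : plant R) (lam_lo mu_lo : R)
    (B : bounds R) (N1 N2 M1 M2 : R)
    (k1 k2 m1 m2 : C1T R) (kap : R -> R -> R) :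
  admissible P lam_lo mu_lo ->
  bounds_pos B ->
  coef_sample B P ->
  [/\ 0 < N1, 0 < N2, 0 < M1 & 0 < M2] ->
  control_kernels P k1 k2 ->
  observer_kernels P m1 m2 ->
  is_kappa P k2 kap ->
  [/\ kernel_bound N1 M1 k1, kernel_bound N2 M2 k2,
      kernel_bound N1 M1 m1 & kernel_bound N2 M2 m2] ->
  exists (theta3 theta4 : R -> R) (theta5 : R),
    (forall eps, 0 < eps -> 0 < theta3 eps /\ 0 < theta4 eps) /\
    0 < theta5 /\
    forall eps, 0 < eps ->
      let s1 := S1 N1 N2 M1 M2 eps in
      let s2 := S2 N1 N2 M1 M2 eps in
      0 < eps_star B s2 theta5 /\
      (eps < eps_star B s2 theta5 ->
       0 < zeta B s1 s2 (theta4 eps) theta5 eps /\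
       forall (k1h k2h m1h m2h : C1T R) (kaph : R -> R -> R)
              (U : control_operator R) (u v uh vh : R -> R -> R),
         is_kappa P k2h kaph ->
         accuracy B P k1 k2 m1 m2 kap k1h k2h m1h m2h kaph U eps ->
         closed_loop P m1h m2h U u v uh vh ->
         accurate_in_range B P k1h k2h U eps u v uh vh ->
         Phi2 u v uh vh 0 <= zeta B s1 s2 (theta4 eps) theta5 eps ->
         forall t, 0 <= t ->
           Phi2 u v uh vh t
           <= s2 / s1 * theta4 eps * expR (- theta3 eps * t) * Phi2 u v uh vh 0
              + s2 * theta5 * eps ^+ 2).
Proof.
move=> Padm Bpos _ [N10 N20 _ _] Kc Ko _ _.
have [eps0 [c [K [D [[e00 c0 K1 D0] dec]]]]] := decay Padm Kc Ko.
have K0 : 0 < K by exact: lt_le_trans K1.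
pose s1 eps := S1 N1 N2 M1 M2 eps; pose s2 eps := S2 N1 N2 M1 M2 eps.
have s1_gt0 eps : 0 < eps -> 0 < s1 eps.
  by move=> e0; rewrite /s1 /S1 /=; do !(apply: addr_gt0 || apply: mulr_gt0 || apply: expR_gt0).
have s2_ge eps : 0 < eps -> 20 <= s2 eps.
  have sum4 (a b d e : R) : 0 <= a -> 0 <= b -> 0 <= d -> 0 <= e -> 20 <= 20 + a + b + d + e.
    by move=> *; lra.
  move=> e0; rewrite /s2 /S2 /=; apply: sum4;
    by do !(apply: addr_ge0 || apply: mulr_ge0 || apply: expR_ge0 || exact: ltW).
have s2_gt0 eps : 0 < eps -> 0 < s2 eps by move=> /s2_ge; apply: lt_le_trans.
pose r := range2 B.
have r0 : 0 < r.
  by have [_ _ [h1 h2 h3 h4]] := Bpos; rewrite /r /range2; do !(apply: addr_gt0); exact: exprn_gt0.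
(* D bounds the residual, r / eps0 ^+ 2 forces eps <= eps0. *)
pose th5 := 1 + D + r / eps0 ^+ 2.
have e020 : 0 < eps0 ^+ 2 by exact: exprn_gt0.
have th50 : 0 < th5 by rewrite /th5 ltr_wpDr ?divr_ge0 ?ltW// ltr_wpDr.
exists (fun=> c), (fun eps => 2 * K * s1 eps / s2 eps), th5; split=> [eps e0|].
  by split=> //; rewrite divr_gt0 ?s2_gt0// !mulr_gt0// s1_gt0.
split=> // eps e0 /=; rewrite -/(s1 eps) -/(s2 eps).
have s10 := s1_gt0 _ e0; have s20 := s2_gt0 _ e0; have s220 := s2_ge _ e0.
have st0 : 0 < s2 eps * th5 by exact: mulr_gt0.
split; first by rewrite /eps_star divr_gt0 ?sqrtr_gt0.
rewrite /eps_star -/r ltr_pdivlMr ?sqrtr_gt0// => eps_lt.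
have small : s2 eps * th5 * eps ^+ 2 < r.
  have : (eps * Num.sqrt (s2 eps * th5)) ^+ 2 < Num.sqrt r ^+ 2.
    by rewrite ltr_pXn2r ?nnegrE ?sqrtr_ge0 ?mulr_ge0 ?sqrtr_ge0 ?(ltW e0).
  by rewrite exprMn !sqr_sqrtr ?ltW// mulrC.
have e20 : 0 <= eps ^+ 2 by exact: sqr_ge0.
have D_le : D * eps ^+ 2 <= s2 eps * th5 * eps ^+ 2.
  rewrite ler_wpM2r//; apply: (@le_trans _ _ th5); last first.
    by rewrite ler_peMl ?(ltW th50)//; apply: le_trans s220; rewrite ler1n.
  by rewrite /th5 [1 + D]addrC -addrA lerDl addr_ge0// divr_ge0// ltW.
have eps_le : eps <= eps0.
  rewrite leNgt; apply/negP => lt0.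
  have : r < s2 eps * th5 * eps ^+ 2; last by rewrite ltNge (ltW small).
  apply: (@le_lt_trans _ _ (r / eps0 ^+ 2 * eps0 ^+ 2)); first by rewrite divfK// gt_eqF.
  apply: (@lt_le_trans _ _ (th5 * eps0 ^+ 2)).
    by rewrite ltr_pM2r// /th5 ltrDr ltr_wpDr.
  apply: ler_pM; [exact: ltW|exact: ltW| |].
    by rewrite ler_peMl ?(ltW th50)//; apply: le_trans s220; rewrite ler1n.
  by rewrite ler_pXn2r ?nnegrE ?ltW// (lt_trans e00).
have s1n := lt0r_neq0 s10; have s2n := lt0r_neq0 s20; have Kn := lt0r_neq0 K0.
have zE : zeta B (s1 eps) (s2 eps) (2 * K * s1 eps / s2 eps) th5 eps = (r - s2 eps * th5 * eps ^+ 2) / (2 * K).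
  by rewrite /zeta -/r; field; rewrite s1n s2n Kn.
rewrite zE; split; first by rewrite divr_gt0 ?subr_gt0// mulr_gt0.
move=> k1h k2h m1h m2h kaph U u v uh vh _ acc cl rng init.
have [[uC vC uhC vhC] _] := cl.
have P0 t : 0 <= Phi2 u v uh vh t by rewrite /Phi2 !addr_ge0// sqr_ge0.
have est T : 0 <= T -> (forall t, 0 <= t -> t <= T -> Phi2 u v uh vh t <= r) ->
    decay_estimate eps c K D u v uh vh T.
  move=> T0 below; apply: (dec eps k1h k2h m1h m2h U) => //.
  - by move=> x x01; have [] := accuracy_kernels Bpos acc x01.
  - by move=> x x01; have [] := accuracy_kernels Bpos acc x01.
  - by move=> x x01; have [] := accuracy_gains acc x01.
  - by move=> x x01; have [] := accuracy_gains acc x01.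
  - by move=> t t0 tT; apply: ltW; apply: rng => //; exact: below.
have ex1 T : 0 <= T -> expR (- c * T) <= 1.
  by move=> T0; rewrite -expR0 ler_expR mulNr oppr_le0 mulr_ge0// ltW.
have KP0 : K * Phi2 u v uh vh 0 <= (r - s2 eps * th5 * eps ^+ 2) / 2.
  rewrite (_ : _ / 2 = K * ((r - s2 eps * th5 * eps ^+ 2) / (2 * K))); last by field.
  by rewrite ler_wpM2l// ltW.
(* K Phi2 0 is at most half of the margin that the residual leaves in the range. *)
have below T : 0 <= T -> Phi2 u v uh vh T <= r.
  apply: stays_below; first exact: Phi2_cont0.
    apply: (@le_trans _ _ (K * Phi2 u v uh vh 0)); first by rewrite ler_peMl.
    by rewrite (le_trans KP0)//; have := mulr_ge0 (ltW st0) e20; lra.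
  move=> T' T0 /(est T' T0); rewrite /decay_estimate => h.
  have h1 : K * expR (- c * T') * Phi2 u v uh vh 0 <= K * Phi2 u v uh vh 0.
    by rewrite ler_wpM2r// ler_piMr ?(ltW K0)// ex1.
  by lra.
move=> t t0.
have := est t t0 (fun s s0 _ => below s s0); rewrite /decay_estimate => h.
apply: (le_trans h); apply: lerD => //.
rewrite ler_wpM2r// ler_wpM2r ?expR_ge0//.
have -> : s2 eps / s1 eps * (2 * K * s1 eps / s2 eps) = 2 * K by field; rewrite s1n s2n.
by rewrite ler_peMl ?(ltW K0)// ler1n.
Qed.
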